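(* Consider the 3D incompressible Euler equations on $\mathbf T^3$, $\partial_t\mathbf u+(\mathbf u\cdot\nabla)\mathbf u+\nabla p=\mathbf g+\mathbf h$, $\nabla\cdot\mathbf u=0$, with a fixed $\mathbf g\in\mathcal X$ and controls $\mathbf h$ taking values in $X_0$. Let $\pi:\mathcal X\to\mathcal X$ be any continuous linear projection onto a finite-dimensional subspace. Suppose either (i) $\mathcal Z$ is a determining set of modes, or (ii) $\{(1,0,0),(0,1,0),(0,0,1)\}\subseteq\mathcal Z$. Then for all $\mathbf u_0,\mathbf v\in\mathcal X$ and $t,\varepsilon>0$ there exist $\mathbf h_1,\dots,\mathbf h_n\in X_0$ and $t_1,\dots,t_n>0$ with $\sum t_i=t$ such that the composition $\mathbf w=\Phi^{\mathbf h_n}_{t_n}\cdots\Phi^{\mathbf h_1}_{t_1}\mathbf u_0$ is defined (every partial composition lies in $\mathcal X$, i.e. no blow-up occurs on $[0,t]$) and satisfies $d_\infty(\mathbf w,\mathbf v)<\varepsilon$ and $\pi(\mathbf w)=\pi(\mathbf v)$.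
   Context: $H^m=\{\mathbf u\in H^m(\mathbf T^3)^3:\nabla\cdot\mathbf u=0,\int\mathbf u=0\}$, $\mathcal X=\bigcap_{m\ge0}H^m$ (smooth divergence-free mean-free fields) with metric $d_\infty(\mathbf v,\bar{\mathbf v})=\sum_{m\ge0}2^{-m}(1\wedge\|\mathbf v-\bar{\mathbf v}\|_{H^m})$. For $\mathbf u_0\in\mathcal X$ and constant $\mathbf h\in X_0$, there is a unique maximal smooth solution $\mathbf u(\cdot,\mathbf u_0,\mathbf h)\in C([0,T_{\mathbf u_0,\mathbf h});\mathcal X)$ of the Euler equations with forcing $\mathbf g+\mathbf h$; $\Phi^{\mathbf h}_t\mathbf u_0$ denotes $\mathbf u(t,\mathbf u_0,\mathbf h)$ for $t<T_{\mathbf u_0,\mathbf h}$ (and is undefined/''exploded'' afterwards). For each $\mathbf k\in\mathbf Z^3\setminus\{0\}$ choose $\mathbf a^{(0)}_{\mathbf k},\mathbf a^{(1)}_{\mathbf k}\in\mathbb R^3$ with $\mathbf a^{(0)}_{\mathbf k}\cdot\mathbf k=\mathbf a^{(1)}_{\mathbf k}\cdot\mathbf k=\mathbf a^{(0)}_{\mathbf k}\cdot\mathbf a^{(1)}_{\mathbf k}=0$, $|\mathbf a^{(l)}_{\mathbf k}|^2=1/(4\pi)$; set $\mathbf e_{\mathbf k,l,0}=2\mathbf a^{(l)}_{\mathbf k}\cos(\mathbf k\cdot x)$, $\mathbf e_{\mathbf k,l,1}=2\mathbf a^{(l)}_{\mathbf k}\sin(\mathbf k\cdot x)$, $F_{\mathbf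 k}=\operatorname{span}\{\mathbf e_{\mathbf k,l,m}:l,m\in\{0,1\}\}$. For $\mathcal Z\subseteq\mathbf Z^3\setminus\{0\}$, $X_0=\operatorname{span}\{F_{\mathbf k}:\mathbf k\in\mathcal Z\}$. $\mathbf j+\mathbf k$ is an admissible move from $\mathbf j,\mathbf k$ if $\mathbf j,\mathbf k$ are linearly independent and $|\mathbf j|\ne|\mathbf k|$. $\mathcal Z_0=\mathcal Z$, $\mathcal Z_n=\mathcal Z_{n-1}\cup\{\mathbf l\in\mathbf Z^3\setminus\{0\}:\mathbf l=\mathbf j+\mathbf k$ admissible from some $\mathbf j,\mathbf k\in\mathcal Z_{n-1}\}$; $\mathcal Z$ is a determining set of modes if $\bigcup_n\mathcal Z_n=\mathbf Z^3\setminus\{0\}$. *)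

(* Defs.v *)
From Stdlib Require Import Reals ZArith List Classical ClassicalEpsilon.
Import ListNotations.
Open Scope R_scope.

(** Points of R^3 (lifts of points of T^3 = (R/2piZ)^3) and vectors of R^3. *)
Definition R3 : Type := (R * R * R)%type.

Definition comp (i : nat) (x : R3) : R :=
  match x with (a, b, c) =>
    match i with 0%nat => a | 1%nat => b | 2%nat => c | _ => 0 end end.

Definition v3add (x y : R3) : R3 :=
  match x, y with (a,b,c), (a',b',c') => (a+a', b+b', c+c') end.
Definition v3scal (r : R) (x : R3) : R3 :=
  match x with (a,b,c) => (r*a, r*b, r*c) end.
Definition v3zero : R3 := (0,0,0).

Definition shift (j : nat) (x : R3) (s : R) : R3 :=
  match x with (a,b,c) =>
    match j with 0%nat => (a+s,b,c) | 1%nat => (a,b+s,c) | 2%nat => (a,b,c+s)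
               | _ => (a,b,c) end end.

(** Vector fields on T^3, seen as maps R^3 -> R^3 (periodicity imposed below). *)
Definition field : Type := R3 -> R3.
Definition fadd (u v : field) : field := fun x => v3add (u x) (v x).
Definition fscal (r : R) (u : field) : field := fun x => v3scal r (u x).
Definition fsub (u v : field) : field := fadd u (fscal (-1) v).
Definition fcomp (i : nat) (u : field) : R3 -> R := fun x => comp i (u x).

(** partial derivative in direction j (a total function, meaningful where it exists) *)
Definition partial (j : nat) (f : R3 -> R) : R3 -> R :=
  fun x => epsilon (inhabits 0) (fun d => derivable_pt_lim (fun s => f (shift j x s)) 0 d).

Fixpoint dl (l : list nat) (f : R3 -> R) : R3 -> R :=
  match l with nil => f | j :: l' => dl l' (partial j f) end.

Definition dist3 (x y : R3) : R :=
  Rabs (comp 0 x - comp 0 y) + Rabs (comp 1 x - comp 1 y) + Rabs (comp 2 x - comp 2 y).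

Definition continuous3 (f : R3 -> R) : Prop :=
  forall x eps, 0 < eps -> exists delta, 0 < delta /\
    forall y, dist3 x y < delta -> Rabs (f y - f x) < eps.

Definition smooth3 (f : R3 -> R) : Prop :=
  forall l : list nat, (forall j, In j l -> (j < 3)%nat) ->
    continuous3 (dl l f) /\
    forall j x, (j < 3)%nat -> exists d, derivable_pt_lim (fun s => dl l f (shift j x s)) 0 d.

Definition periodic_s (f : R3 -> R) : Prop :=
  forall j x, (j < 3)%nat -> f (shift j x (2*PI)) = f x.
Definition periodic (u : field) : Prop :=
  forall j x, (j < 3)%nat -> u (shift j x (2*PI)) = u x.

(** Integral over the fundamental cell [0,2pi)^3 (limit of Riemann sums;
    for continuous functions this is the usual integral). *)
Definition rsum (f : R3 -> R) (N : nat) : R :=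
  let h := 2 * PI / INR (S N) in
  h ^ 3 * sum_f_R0 (fun a => sum_f_R0 (fun b => sum_f_R0 (fun c =>
     f (h * INR a, h * INR b, h * INR c)) N) N) N.
Definition integral (f : R3 -> R) : R :=
  epsilon (inhabits 0) (fun I => Un_cv (rsum f) I).

Definition inX (u : field) : Prop :=
  periodic u /\
  (forall i, (i < 3)%nat -> smooth3 (fcomp i u)) /\
  (forall x, partial 0 (fcomp 0 u) x + partial 1 (fcomp 1 u) x
             + partial 2 (fcomp 2 u) x = 0) /\
  (forall i, (i < 3)%nat -> integral (fcomp i u) = 0).

Fixpoint words (n : nat) : list (list nat) :=
  match n with
  | 0%nat => [nil]
  | S n' => flat_map (fun w => map (fun j => j :: w) [0%nat; 1%nat; 2%nat]) (words n')
  end.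
Definition allwords (m : nat) : list (list nat) := flat_map words (seq 0 (S m)).

Definition Hm_sq (m : nat) (u : field) : R :=
  fold_right Rplus 0
    (map (fun w => fold_right Rplus 0
        (map (fun i => integral (fun x => (dl w (fcomp i u) x) ^ 2)) [0%nat; 1%nat; 2%nat]))
      (allwords m)).
Definition Hnorm (m : nat) (u : field) : R := sqrt (Hm_sq m u).

Definition dinf (u v : field) : R :=
  epsilon (inhabits 0)
    (fun s => infinite_sum (fun m => (/2) ^ m * Rmin 1 (Hnorm m (fsub u v))) s).

Definition Z3 : Type := (Z * Z * Z)%type.
Definition zc (i : nat) (k : Z3) : Z :=
  match k with (a,b,c) => match i with 0%nat => a | 1%nat => b | 2%nat => c | _ => 0%Z end end.
Definition z3add (j k : Z3) : Z3 :=
  match j, k with (a,b,c), (a',b',c') => ((a+a')%Z, (b+b')%Z, (c+c')%Z) end.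
Definition z3zero : Z3 := (0%Z, 0%Z, 0%Z).
Definition zdot (k : Z3) (x : R3) : R :=
  IZR (zc 0 k) * comp 0 x + IZR (zc 1 k) * comp 1 x + IZR (zc 2 k) * comp 2 x.
Definition z3normsq (k : Z3) : Z :=
  (zc 0 k * zc 0 k + zc 1 k * zc 1 k + zc 2 k * zc 2 k)%Z.

(** X_0 = span{F_k : k in Zs}.  F_k = span{ a cos(k.x), b sin(k.x) : a,b in {a^(0)_k, a^(1)_k} }
    where a^(0)_k, a^(1)_k is an orthogonal basis of k^perp; hence
    F_k = { a cos(k.x) + b sin(k.x) : a.k = b.k = 0 } (independent of the choice). *)
Definition in_X0 (Zs : Z3 -> Prop) (h : field) : Prop :=
  exists modes : list (Z3 * R3 * R3),
    (forall k a b, In (k, a, b) modes ->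
       Zs k /\ zdot k a = 0 /\ zdot k b = 0) /\
    forall x, h x = fold_right v3add v3zero
      (map (fun '(k, a, b) => v3add (v3scal (cos (zdot k x)) a) (v3scal (sin (zdot k x)) b))
           modes).

Definition lin_indep (j k : Z3) : Prop :=
  forall a b : R,
    (forall i, (i < 3)%nat -> a * IZR (zc i j) + b * IZR (zc i k) = 0) -> a = 0 /\ b = 0.
Definition admissible (j k : Z3) : Prop :=
  lin_indep j k /\ z3normsq j <> z3normsq k.
Fixpoint Zn (Zs : Z3 -> Prop) (n : nat) : Z3 -> Prop :=
  match n with
  | 0%nat => Zs
  | S n' => fun l => Zn Zs n' l \/
      (l <> z3zero /\ exists j k, Zn Zs n' j /\ Zn Zs n' k /\ admissible j k /\ l = z3add j k)
  end.
Definition determining (Zs : Z3 -> Prop) : Prop :=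
  forall l, l <> z3zero -> exists n, Zn Zs n l.

Definition fd_cont_proj (pi : field -> field) : Prop :=
  (forall u, inX u -> inX (pi u)) /\
  (forall a b u v, inX u -> inX v ->
     forall x, pi (fadd (fscal a u) (fscal b v)) x = v3add (v3scal a (pi u x)) (v3scal b (pi v x))) /\
  (forall u, inX u -> forall x, pi (pi u) x = pi u x) /\
  (exists (N : nat) (e : nat -> field), (forall i, inX (e i)) /\
     forall u, inX u -> exists c : nat -> R,
       forall x, pi u x = fold_right v3add v3zero (map (fun i => v3scal (c i) (e i x)) (seq 0 N))) /\
  (forall u eps, inX u -> 0 < eps -> exists delta, 0 < delta /\
     forall v, inX v -> dinf u v < delta -> dinf (pi u) (pi v) < eps).

Definition euler_sol (T : R) (f : field) (u : R -> field) : Prop :=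
  (forall s, 0 <= s <= T -> inX (u s)) /\
  (forall s eps, 0 <= s <= T -> 0 < eps -> exists delta, 0 < delta /\
     forall s', 0 <= s' <= T -> Rabs (s' - s) < delta -> dinf (u s') (u s) < eps) /\
  exists p : R -> R3 -> R,
    (forall s, 0 < s < T -> smooth3 (p s) /\ periodic_s (p s)) /\
    forall s x i, 0 < s < T -> (i < 3)%nat ->
      derivable_pt_lim (fun r => comp i (u r x)) s
        (comp i (f x)
         - (comp 0 (u s x) * partial 0 (fcomp i (u s)) x
            + comp 1 (u s x) * partial 1 (fcomp i (u s)) x
            + comp 2 (u s x) * partial 2 (fcomp i (u s)) x)
         - partial i (p s) x).

(* Main.v *)
(** The state is encoded by its Fourier coefficients.  For a datum [c0], a forcing [F] and a small [mu] the
    equation [c' = mu B(c,c) + F] has a smooth solution on [0,1] (energy estimates on Galerkin truncations,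
    uniform in the truncation), and [c(1) = c0 + F + mu B(h,h) + small] whenever [c0] is near a fixed [h].
    Since [s |-> a c(b s)], [b mu = a], solves the Euler equations with forcing [a b F], this gives two moves of
    arbitrarily short duration: a strong constant control [lam h] for time [1/lam] translates the state by [h],
    and jumping by [lam h], [B(h,h) <> 0], drifting for time [1/lam^2] and jumping back translates it by [B(h,h)].
    With [h = h1 + c h2] and [B(hi,hi) = 0] for single modes [hi], the second move yields the bracket
    [c (B(h1,h2) + B(h2,h1))] for every real [c], hence new modes [j + k]; admissibility of the move is what makes
    these brackets span all polarisations at [j + k].  All modes are thus reachable translations, and finite sums
    of modes are dense.  Every estimate holds Lipschitz-uniformly along families of states, so one can steer to
    [v + sum p_i b_i] up to an error that is a small Lipschitz function of [p], with [b_i] a basis of the range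
    of [pi]; a contraction argument then finds [p] for which the projection is exact.  The prescribed total time
    is met by repeating the manoeuvre and letting the free flow act for the time left. *)

From Stdlib Require Import Reals ZArith List Classical ClassicalEpsilon.
From Stdlib Require Import Lra Lia Psatz FunctionalExtensionality Permutation.
From Coquelicot Require Import Coquelicot.
Require Import Defs.
Import ListNotations.
Open Scope R_scope.

(** ** Finite sums *)

Tactic Notation "rtrans" uconstr(h) := eapply Rle_trans; [apply h|].

(** The convection term costs one derivative and large data may blow up, so a small [mu] always
    stands for a short time or a dominant control. Transport cancels against symmetric weights, so
    the growth of every Sobolev norm is governed by the [H^4] norm alone: the admissible [mu]
    depends only on an [H^4] bound, and smooth data stay smooth on the same interval. Comparing and
    expanding solutions does lose derivatives, but a fixed number per move; states are smooth, so
    the loss is paid in advance, and a move asks for more derivatives ([m']) than it returns ([m]).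
    Case (ii) is not an instance of (i): the unit vectors have equal lengths, so no move among them
    is admissible. Two axes give a single polarisation at their sum; bracketed with the third axis
    it gives every polarisation at a corner [(s1, s2, s3)], from which admissible unit steps reach
    all other modes. *)

Fixpoint lsum {A : Type} (l : list A) (f : A -> R) : R :=
  match l with nil => 0 | a :: l' => f a + lsum l' f end.
Definition csum {A : Type} (l : list A) (f : A -> C) : C :=
  (lsum l (fun a => Re (f a)), lsum l (fun a => Im (f a))).

Section ListSums.
Context {A : Type}.
Implicit Types (l : list A) (f g : A -> R).

Lemma lsum_ext l f g : (forall a, In a l -> f a = g a) -> lsum l f = lsum l g.
Proof.
  induction l as [|a l IH]; intros H; simpl; auto.
  rewrite (H a), IH; simpl; auto. intros; apply H; simpl; auto.
Qed.

Lemma lsum_plus l f g : lsum l (fun a => f a + g a) = lsum l f + lsum l g.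
Proof. induction l; simpl; [lra|rewrite IHl; lra]. Qed.

Lemma lsum_minus l f g : lsum l (fun a => f a - g a) = lsum l f - lsum l g.
Proof. induction l; simpl; [lra|rewrite IHl; lra]. Qed.

Lemma lsum_scal l c f : lsum l (fun a => c * f a) = c * lsum l f.
Proof. induction l; simpl; [lra|rewrite IHl; lra]. Qed.

Lemma lsum_scal_r l c f : lsum l (fun a => f a * c) = lsum l f * c.
Proof. induction l; simpl; [lra|rewrite IHl; lra]. Qed.

Lemma lsum_zero l f : (forall a, In a l -> f a = 0) -> lsum l f = 0.
Proof.
  intros H. rewrite (lsum_ext l f (fun _ => 0)) by auto. clear H.
  induction l; simpl; lra.
Qed.

Lemma lsum_const l c : lsum l (fun _ => c) = INR (length l) * c.
Proof. induction l; [simpl; lra|]. cbn [lsum length]. rewrite IHl, S_INR. lra. Qed.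

Lemma lsum_le l f g : (forall a, In a l -> f a <= g a) -> lsum l f <= lsum l g.
Proof.
  induction l as [|a l IH]; intros H; simpl; [lra|].
  apply Rplus_le_compat; [apply H; simpl; auto|apply IH; intros; apply H; simpl; auto].
Qed.

Lemma lsum_nonneg l f : (forall a, In a l -> 0 <= f a) -> 0 <= lsum l f.
Proof.
  intros H. rewrite <- (lsum_zero l (fun _ => 0)) by auto. now apply lsum_le.
Qed.

Lemma lsum_abs l f : Rabs (lsum l f) <= lsum l (fun a => Rabs (f a)).
Proof.
  induction l as [|a l IH]; simpl; [rewrite Rabs_R0; lra|].
  rtrans Rabs_triang. lra.
Qed.

Lemma lsum_app l1 l2 f : lsum (l1 ++ l2) f = lsum l1 f + lsum l2 f.
Proof. induction l1; simpl; [lra|rewrite IHl1; lra]. Qed.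

Lemma lsum_term_le l f a :
  In a l -> (forall b, In b l -> 0 <= f b) -> f a <= lsum l f.
Proof.
  induction l as [|b l IH]; simpl; [tauto|]. intros [->|Ha] H.
  - assert (0 <= lsum l f) by (apply lsum_nonneg; auto). lra.
  - assert (0 <= f b) by auto. specialize (IH Ha (fun c Hc => H c (or_intror Hc))).
    lra.
Qed.

Lemma lsum_perm l1 l2 f : Permutation l1 l2 -> lsum l1 f = lsum l2 f.
Proof. induction 1; simpl; lra. Qed.

Lemma lsum_filter l (p : A -> bool) f :
  lsum l f = lsum (filter p l) f + lsum (filter (fun a => negb (p a)) l) f.
Proof.
  induction l as [|a l IH]; simpl; [lra|]. destruct (p a); simpl; rewrite IH; lra.
Qed.

Definition inb (l : list A) (a : A) : bool :=
  if excluded_middle_informative (In a l) then true else false.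

Lemma inb_true l a : inb l a = true <-> In a l.
Proof. unfold inb. destruct excluded_middle_informative; split; auto; discriminate. Qed.

(** Each sum reduces to the common part of the two lists, and there the lists are permutations of
    each other. *)
Lemma lsum_support l1 l2 f : NoDup l1 -> NoDup l2 ->
  (forall a, In a l1 -> ~ In a l2 -> f a = 0) ->
  (forall a, In a l2 -> ~ In a l1 -> f a = 0) -> lsum l1 f = lsum l2 f.
Proof.
  intros N1 N2 H1 H2.
  rewrite (lsum_filter l1 (inb l2)), (lsum_filter l2 (inb l1)).
  rewrite (lsum_zero (filter (fun a => negb (inb l2 a)) l1)).
  rewrite (lsum_zero (filter (fun a => negb (inb l1 a)) l2)).
  - f_equal. apply lsum_perm, NoDup_Permutation; try (now apply NoDup_filter).
    intros x. rewrite !filter_In, !inb_true. tauto.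
  - intros a Ha. apply filter_In in Ha. destruct Ha as [Ha Hb].
    apply H2; auto. rewrite <- inb_true. destruct (inb l1 a); simpl in Hb; congruence.
  - intros a Ha. apply filter_In in Ha. destruct Ha as [Ha Hb].
    apply H1; auto. rewrite <- inb_true. destruct (inb l2 a); simpl in Hb; congruence.
Qed.

Lemma lsum_incl l1 l2 f : NoDup l1 -> NoDup l2 -> incl l1 l2 ->
  (forall a, In a l2 -> 0 <= f a) -> lsum l1 f <= lsum l2 f.
Proof.
  intros N1 N2 H Hf. rewrite (lsum_filter l2 (inb l1)).
  assert (E : lsum l1 f = lsum (filter (inb l1) l2) f).
  { apply lsum_perm, NoDup_Permutation; auto; [now apply NoDup_filter|].
    intros x. rewrite filter_In, inb_true. split; intuition. }
  rewrite E. assert (0 <= lsum (filter (fun a => negb (inb l1 a)) l2) f); [|lra].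
  apply lsum_nonneg. intros a Ha. apply filter_In in Ha. apply Hf; tauto.
Qed.

Lemma lsum_diff_le l1 l2 f g : NoDup l1 -> NoDup l2 -> incl l1 l2 ->
  (forall a, In a l2 -> Rabs (f a) <= g a) ->
  Rabs (lsum l2 f - lsum l1 f) <= lsum l2 g - lsum l1 g.
Proof.
  intros N1 N2 H Hf.
  assert (E : forall h : A -> R, lsum l1 h = lsum (filter (inb l1) l2) h).
  { intros h. apply lsum_perm, NoDup_Permutation; auto; [now apply NoDup_filter|].
    intros x. rewrite filter_In, inb_true. split; intuition. }
  rewrite !E, (lsum_filter l2 (inb l1) f), (lsum_filter l2 (inb l1) g).
  match goal with |- Rabs ?x <= ?y => ring_simplify x; ring_simplify y end.
  rtrans lsum_abs. apply lsum_le.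
  intros a Ha. apply filter_In in Ha. apply Hf; tauto.
Qed.

(** Cauchy-Schwarz from [2 f g <= t f^2 + g^2 / t], optimised over [t]. It is phrased with upper
    bounds on the norms because only such bounds are carried along later. *)
Lemma lsum_cs l f g A1 B1 : 0 <= A1 -> 0 <= B1 ->
  lsum l (fun a => f a ^ 2) <= A1 ^ 2 -> lsum l (fun a => g a ^ 2) <= B1 ^ 2 ->
  lsum l (fun a => f a * g a) <= A1 * B1.
Proof.
  intros HA HB Hf Hg.
  assert (K : forall t, 0 < t -> 2 * lsum l (fun a => f a * g a) <= t * A1 ^ 2 + / t * B1 ^ 2).
  { intros t Ht. rewrite <- lsum_scal.
    apply Rle_trans with (lsum l (fun a => t * f a ^ 2 + / t * g a ^ 2)).
    - apply lsum_le. intros a _.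
      assert (0 <= / t * (t * f a - g a) ^ 2).
      { apply Rmult_le_pos; [left; now apply Rinv_0_lt_compat|apply pow2_ge_0]. }
      replace (t * f a ^ 2 + / t * g a ^ 2) with (2 * (f a * g a) + / t * (t * f a - g a) ^ 2)
        by (field; lra). lra.
    - rewrite lsum_plus, !lsum_scal. apply Rplus_le_compat; apply Rmult_le_compat_l; auto; try lra.
      left; now apply Rinv_0_lt_compat. }
  apply le_epsilon. intros e He.
  (* The optimal weight is [B1 / A1]; adding [d] to both keeps it defined when a bound is zero, and
     [d] is small enough to cost at most [e]. *)
  set (d := e / (A1 + B1 + 1 + e)).
  assert (Hd : 0 < d) by (apply Rdiv_lt_0_compat; lra).
  assert (Hd1 : d * (A1 + B1 + 1 + e) = e) by (unfold d; field; lra).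
  specialize (K ((B1 + d) / (A1 + d)) ltac:(apply Rdiv_lt_0_compat; lra)).
  replace (/ ((B1 + d) / (A1 + d))) with ((A1 + d) / (B1 + d)) in K by (field; split; lra).
  assert ((B1 + d) / (A1 + d) * A1 ^ 2 <= (B1 + d) * A1).
  { replace ((B1 + d) / (A1 + d) * A1 ^ 2) with ((B1 + d) * A1 - (B1 + d) * A1 * d / (A1 + d)) by (field; lra).
    assert (0 <= (B1 + d) * A1 * d / (A1 + d)); [|lra].
    apply Rdiv_le_0_compat; [|lra]. apply Rmult_le_pos; [apply Rmult_le_pos|]; lra. }
  assert ((A1 + d) / (B1 + d) * B1 ^ 2 <= (A1 + d) * B1).
  { replace ((A1 + d) / (B1 + d) * B1 ^ 2) with ((A1 + d) * B1 - (A1 + d) * B1 * d / (B1 + d)) by (field; lra).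
    assert (0 <= (A1 + d) * B1 * d / (B1 + d)); [|lra].
    apply Rdiv_le_0_compat; [|lra]. apply Rmult_le_pos; [apply Rmult_le_pos|]; lra. }
  nra.
Qed.

Lemma csum_ext l (f g : A -> C) : (forall a, In a l -> f a = g a) -> csum l f = csum l g.
Proof. intros H. unfold csum. f_equal; apply lsum_ext; intros a Ha; now rewrite H. Qed.

Lemma csum_plus l (f g : A -> C) : csum l (fun a => f a + g a)%C = (csum l f + csum l g)%C.
Proof. unfold csum, Cplus; simpl. f_equal; rewrite <- lsum_plus; auto. Qed.

Lemma csum_minus l (f g : A -> C) : csum l (fun a => f a - g a)%C = (csum l f - csum l g)%C.
Proof. unfold csum, Cminus, Cplus, Copp; simpl. f_equal; rewrite <- Rminus_def, <- lsum_minus; auto. Qed.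

Lemma csum_scal l (c : C) (f : A -> C) : csum l (fun a => c * f a)%C = (c * csum l f)%C.
Proof.
  unfold csum, Cmult; simpl. f_equal; rewrite <- !lsum_scal.
  - rewrite <- lsum_minus. auto.
  - rewrite <- lsum_plus. auto.
Qed.

Lemma csum_scal_r l (c : C) (f : A -> C) : csum l (fun a => f a * c)%C = (csum l f * c)%C.
Proof. rewrite Cmult_comm, <- csum_scal. apply csum_ext; intros; apply Cmult_comm. Qed.

Lemma csum_zero l (f : A -> C) : (forall a, In a l -> f a = 0%C) -> csum l f = 0%C.
Proof. intros H. unfold csum. rewrite !lsum_zero; auto; intros a Ha; now rewrite H. Qed.

Lemma csum_conj l (f : A -> C) : Cconj (csum l f) = csum l (fun a => Cconj (f a)).
Proof.
  unfold csum, Cconj; simpl. f_equal.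
  induction l as [|a l IH]; simpl; [lra|]. rewrite <- IH. unfold Im; lra.
Qed.

Lemma csum_cons a l (f : A -> C) : csum (a :: l) f = (f a + csum l f)%C.
Proof. reflexivity. Qed.

Lemma Cmod_csum l (f : A -> C) : Cmod (csum l f) <= lsum l (fun a => Cmod (f a)).
Proof.
  induction l as [|a l IH].
  - change (csum [] f) with (RtoC 0). rewrite Cmod_0. simpl; lra.
  - rewrite csum_cons. rtrans Cmod_triangle. simpl. lra.
Qed.

Lemma csum_support l1 l2 (f : A -> C) : NoDup l1 -> NoDup l2 ->
  (forall a, In a l1 -> ~ In a l2 -> f a = 0%C) ->
  (forall a, In a l2 -> ~ In a l1 -> f a = 0%C) -> csum l1 f = csum l2 f.
Proof.
  intros. unfold csum. f_equal; apply lsum_support; auto; intros a Ha Hb;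
    ((rewrite H1 by auto) || (rewrite H2 by auto)); reflexivity.
Qed.

End ListSums.

Lemma lsum_map {A B} (l : list A) (s : A -> B) (f : B -> R) :
  lsum (map s l) f = lsum l (fun a => f (s a)).
Proof. induction l; simpl; auto. now rewrite IHl. Qed.

Lemma lsum_swap {A B} (l : list A) (l' : list B) (f : A -> B -> R) :
  lsum l (fun a => lsum l' (fun b => f a b)) = lsum l' (fun b => lsum l (fun a => f a b)).
Proof.
  induction l as [|a l IH]; simpl.
  - symmetry. now apply lsum_zero.
  - rewrite IH. symmetry. apply (@lsum_plus _ l').
Qed.

Lemma csum_swap {A B} (l : list A) (l' : list B) (f : A -> B -> C) :
  csum l (fun a => csum l' (fun b => f a b)) = csum l' (fun b => csum l (fun a => f a b)).
Proof. unfold csum; simpl. f_equal; apply lsum_swap. Qed.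

Lemma lsum_list_prod {A B} (l : list A) (l' : list B) (f : A * B -> R) :
  lsum (list_prod l l') f = lsum l (fun a => lsum l' (fun b => f (a, b))).
Proof.
  induction l as [|a l IH]; simpl; auto.
  rewrite lsum_app, IH, lsum_map. reflexivity.
Qed.

Lemma NoDup_map_inv_fun {A B} (l : list A) (s : A -> B) (s' : B -> A) :
  (forall a, s' (s a) = a) -> NoDup l -> NoDup (map s l).
Proof.
  intros Hs H. apply FinFun.Injective_map_NoDup; auto.
  intros x y E. rewrite <- (Hs x), <- (Hs y), E. auto.
Qed.

Lemma lsum_reindex {A} (l : list A) (s s' : A -> A) (f : A -> R) :
  NoDup l -> (forall a, s' (s a) = a) -> (forall a, s (s' a) = a) ->
  (forall a, In a l -> ~ In (s a) l -> f (s a) = 0) ->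
  (forall a, In a l -> ~ In (s' a) l -> f a = 0) ->
  lsum l (fun a => f (s a)) = lsum l f.
Proof.
  intros N H1 H2 H3 H4. rewrite <- (lsum_map l s f). apply lsum_support; auto.
  - eapply NoDup_map_inv_fun; eauto.
  - intros a Ha Hb. apply in_map_iff in Ha. destruct Ha as (b & <- & Hb'). auto.
  - intros a Ha Hb. apply H4; auto. intros Hc. apply Hb. rewrite <- (H2 a). now apply in_map.
Qed.

Lemma csum_reindex {A} (l : list A) (s s' : A -> A) (f : A -> C) :
  NoDup l -> (forall a, s' (s a) = a) -> (forall a, s (s' a) = a) ->
  (forall a, In a l -> ~ In (s a) l -> f (s a) = 0%C) ->
  (forall a, In a l -> ~ In (s' a) l -> f a = 0%C) ->
  csum l (fun a => f (s a)) = csum l f.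
Proof.
  intros N H1 H2 H3 H4. unfold csum. f_equal.
  - apply (lsum_reindex l s s' (fun a => Re (f a))); auto; intros a Ha Hb; [rewrite H3|rewrite H4]; auto.
  - apply (lsum_reindex l s s' (fun a => Im (f a))); auto; intros a Ha Hb; [rewrite H3|rewrite H4]; auto.
Qed.

(** ** Lattice sums *)

Definition z3opp (k : Z3) : Z3 := match k with (a, b, c) => ((-a)%Z, (-b)%Z, (-c)%Z) end.
Definition z3sub (j k : Z3) : Z3 := z3add j (z3opp k).
Definition kc (i : nat) (k : Z3) : R := IZR (zc i k).

Ltac z3 := intros; repeat match goal with k : Z3 |- _ => destruct k as [[? ?] ?] end;
  unfold z3sub, z3add, z3opp, z3zero in *; simpl in *; try (apply f_equal2; [apply f_equal2|]; lia).

Lemma z3add_comm j k : z3add j k = z3add k j. Proof. z3. Qed.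
Lemma z3oppK k : z3opp (z3opp k) = k. Proof. z3. Qed.
Lemma z3sub_sub k j : z3sub k (z3sub k j) = j. Proof. z3. Qed.
Lemma z3subK k j : z3add (z3sub k j) j = k. Proof. z3. Qed.
Lemma z3addK k j : z3sub (z3add k j) j = k. Proof. z3. Qed.
Lemma z3add_sub k j : z3add j (z3sub k j) = k. Proof. z3. Qed.
Lemma z3sub_opp k j : z3sub (z3opp k) (z3opp j) = z3opp (z3sub k j). Proof. z3. Qed.

Lemma kc_add i j k : kc i (z3add j k) = kc i j + kc i k.
Proof. unfold kc. z3. destruct i as [|[|[|i]]]; rewrite <- plus_IZR; auto. Qed.
Lemma kc_opp i k : kc i (z3opp k) = - kc i k.
Proof. unfold kc. z3. destruct i as [|[|[|i]]]; rewrite <- opp_IZR; auto. Qed.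
Lemma kc_sub i j k : kc i (z3sub j k) = kc i j - kc i k.
Proof. unfold z3sub. rewrite kc_add, kc_opp. lra. Qed.

Definition zrange (N : nat) : list Z :=
  map (fun i => (Z.of_nat i - Z.of_nat N)%Z) (seq 0 (2 * N + 1)).
Definition box (N : nat) : list Z3 := list_prod (list_prod (zrange N) (zrange N)) (zrange N).

Lemma in_zrange N a : In a (zrange N) <-> (Z.abs a <= Z.of_nat N)%Z.
Proof.
  unfold zrange. rewrite in_map_iff. split.
  - intros (i & <- & Hi). apply in_seq in Hi. lia.
  - intros H. exists (Z.to_nat (a + Z.of_nat N)). rewrite in_seq. lia.
Qed.

Lemma in_box N k : In k (box N) <->
  (Z.abs (zc 0 k) <= Z.of_nat N /\ Z.abs (zc 1 k) <= Z.of_nat N /\ Z.abs (zc 2 k) <= Z.of_nat N)%Z.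
Proof.
  destruct k as [[a b] c]. unfold box, Z3. rewrite !in_prod_iff, !in_zrange. simpl. tauto.
Qed.

Lemma NoDup_list_prod {A B} (l : list A) (l' : list B) :
  NoDup l -> NoDup l' -> NoDup (list_prod l l').
Proof.
  intros H H'. induction H as [|a l Ha H IH]; simpl; [constructor|].
  apply NoDup_app; auto.
  - apply FinFun.Injective_map_NoDup; auto. intros x y E; congruence.
  - intros [x y] Hx Hy. apply in_map_iff in Hx. destruct Hx as (z & E & Hz).
    apply in_prod_iff in Hy. inversion E; subst. tauto.
Qed.

Lemma NoDup_box N : NoDup (box N).
Proof.
  assert (NoDup (zrange N)).
  { apply FinFun.Injective_map_NoDup; [|apply seq_NoDup]. intros x y E; lia. }
  unfold box, Z3. repeat apply NoDup_list_prod; auto.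
Qed.
#[export] Hint Resolve NoDup_box : core.

Lemma box_mono N M : (N <= M)%nat -> incl (box N) (box M).
Proof. intros H k. rewrite !in_box. lia. Qed.

Lemma box_opp N k : In k (box N) -> In (z3opp k) (box N).
Proof. rewrite !in_box. z3. lia. Qed.

Lemma box_opp_iff N k : In (z3opp k) (box N) <-> In k (box N).
Proof. rewrite !in_box. z3. lia. Qed.

Lemma box_add N M j k : In j (box N) -> In k (box M) -> In (z3add j k) (box (N + M)).
Proof. rewrite !in_box. z3. lia. Qed.

Lemma box_sub N M j k : In j (box N) -> In k (box M) -> In (z3sub j k) (box (N + M)).
Proof. intros. unfold z3sub. auto using box_add, box_opp. Qed.

Lemma box_ex (k : Z3) : exists N, In k (box N).
Proof. exists (Z.to_nat (Z.abs (zc 0 k) + Z.abs (zc 1 k) + Z.abs (zc 2 k))). rewrite in_box. lia. Qed.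

Lemma box_ex_list (L : list Z3) : exists N, incl L (box N).
Proof.
  induction L as [|k L [N HN]]; [exists 0%nat; intros ? []|].
  destruct (box_ex k) as [M HM]. exists (N + M)%nat. intros j [<-|Hj].
  - eapply box_mono; [|eauto]; lia.
  - eapply box_mono; [|apply HN; auto]; lia.
Qed.

(** * Weights on the lattice *)

Definition wt (k : Z3) : R := 1 + IZR (Z.abs (zc 0 k) + Z.abs (zc 1 k) + Z.abs (zc 2 k)).

Lemma wt_abs k : wt k = 1 + (Rabs (kc 0 k) + Rabs (kc 1 k) + Rabs (kc 2 k)).
Proof. unfold wt, kc. rewrite !plus_IZR, !abs_IZR. reflexivity. Qed.
Lemma wt_ge1 k : 1 <= wt k.
Proof. unfold wt. assert (0 <= IZR (Z.abs (zc 0 k) + Z.abs (zc 1 k) + Z.abs (zc 2 k))) by (apply IZR_le; lia). lra. Qed.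
Lemma wt_opp k : wt (z3opp k) = wt k.
Proof. rewrite !wt_abs, !kc_opp, !Rabs_Ropp. auto. Qed.
Lemma wt_add j k : wt (z3add j k) <= wt j + wt k - 1.
Proof.
  rewrite !wt_abs, !kc_add. pose proof (Rabs_triang (kc 0 j) (kc 0 k)).
  pose proof (Rabs_triang (kc 1 j) (kc 1 k)). pose proof (Rabs_triang (kc 2 j) (kc 2 k)). lra.
Qed.
Lemma wt_split k j : wt k <= wt j + wt (z3sub k j) - 1.
Proof. rewrite <- (z3add_sub k j) at 1. apply wt_add. Qed.
Lemma wt_diff k j : Rabs (wt k - wt (z3sub k j)) <= wt j.
Proof.
  pose proof (wt_split k j). pose proof (wt_add k (z3opp j)).
  fold (z3sub k j) in *. rewrite wt_opp in H0. apply Rabs_le. lra.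
Qed.
Lemma kc_wt i k : Rabs (kc i k) <= wt k.
Proof.
  rewrite wt_abs. pose proof (Rabs_pos (kc 0 k)). pose proof (Rabs_pos (kc 1 k)). pose proof (Rabs_pos (kc 2 k)).
  destruct i as [|[|[|i]]]; try lra.
  replace (kc (S (S (S i))) k) with 0 by (destruct k as [[? ?] ?]; reflexivity). rewrite Rabs_R0. lra.
Qed.
Lemma wt_notin_box N k : ~ In k (box N) -> INR N <= wt k.
Proof.
  rewrite in_box. intros H. unfold wt. rewrite INR_IZR_INZ.
  assert (IZR (Z.of_nat N) <= IZR (Z.abs (zc 0 k) + Z.abs (zc 1 k) + Z.abs (zc 2 k))); [apply IZR_le; lia|lra].
Qed.

(** The reference majorant of lattice series. It is a product of one-variable factors, so its
    summability and its convolution inequality reduce to dimension one. *)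
Definition om (k : Z3) : R := / (1 + kc 0 k ^ 2) * / (1 + kc 1 k ^ 2) * / (1 + kc 2 k ^ 2).

Lemma om_pos k : 0 < om k.
Proof.
  unfold om. pose proof (pow2_ge_0 (kc 0 k)). pose proof (pow2_ge_0 (kc 1 k)). pose proof (pow2_ge_0 (kc 2 k)).
  repeat apply Rmult_lt_0_compat; apply Rinv_0_lt_compat; lra.
Qed.

Lemma om_inv k : om k = / ((1 + kc 0 k ^ 2) * (1 + kc 1 k ^ 2) * (1 + kc 2 k ^ 2)).
Proof. unfold om. now rewrite !Rinv_mult. Qed.

Lemma om_le1 k : om k <= 1.
Proof.
  rewrite om_inv. rewrite <- Rinv_1.
  apply Rinv_le_contravar; [lra|]. nra.
Qed.

(** Each factor satisfies [1 + k_i^2 <= wt^2]. This is the origin of the exponent 6 throughout: six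
    powers of [wt] buy summability. *)
Lemma om_wt k : 1 <= om k * wt k ^ 6.
Proof.
  rewrite om_inv.
  assert (H : forall i, (i < 3)%nat -> 1 <= 1 + kc i k ^ 2 <= wt k ^ 2).
  { intros i Hi. pose proof (pow2_ge_0 (kc i k)). split; [lra|]. rewrite wt_abs.
    assert (kc i k ^ 2 = Rabs (kc i k) ^ 2) as -> by (symmetry; apply pow2_abs).
    pose proof (Rabs_pos (kc 0 k)). pose proof (Rabs_pos (kc 1 k)). pose proof (Rabs_pos (kc 2 k)).
    destruct i as [|[|[|i]]]; try nra; lia. }
  pose proof (H 0%nat ltac:(lia)) as H0. pose proof (H 1%nat ltac:(lia)) as H1. pose proof (H 2%nat ltac:(lia)) as H2.
  set (a := 1 + kc 0 k ^ 2) in *. set (b := 1 + kc 1 k ^ 2) in *. set (c := 1 + kc 2 k ^ 2) in *.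
  assert (0 < a * b * c) by (repeat apply Rmult_lt_0_compat; lra).
  apply Rmult_le_reg_l with (a * b * c); auto.
  replace (a * b * c * (/ (a * b * c) * wt k ^ 6)) with (wt k ^ 2 * wt k ^ 2 * wt k ^ 2) by (field; lra).
  rewrite Rmult_1_r. repeat apply Rmult_le_compat; try lra. apply Rmult_le_pos; lra.
Qed.

(** Peetre's inequality [1 + b^2 <= 2 (1 + a^2) (1 + (b - a)^2)] in each coordinate; the constant is
    [2^3]. *)
Lemma om_peetre k j : om j * om (z3sub k j) <= 8 * om k.
Proof.
  assert (K : forall a b, / (1 + a ^ 2) * / (1 + (b - a) ^ 2) <= 2 * / (1 + b ^ 2)).
  { intros a b. pose proof (pow2_ge_0 a). pose proof (pow2_ge_0 b). pose proof (pow2_ge_0 (b - a)).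
    apply Rmult_le_reg_l with ((1 + a ^ 2) * (1 + (b - a) ^ 2)); [nra|].
    apply Rmult_le_reg_l with (1 + b ^ 2); [nra|].
    replace ((1 + b ^ 2) * ((1 + a ^ 2) * (1 + (b - a) ^ 2) * (/ (1 + a ^ 2) * / (1 + (b - a) ^ 2))))
      with (1 + b ^ 2) by (field; lra).
    replace ((1 + b ^ 2) * ((1 + a ^ 2) * (1 + (b - a) ^ 2) * (2 * / (1 + b ^ 2)))) with
      (2 * ((1 + a ^ 2) * (1 + (b - a) ^ 2))) by (field; lra).
    nra. }
  unfold om. rewrite !kc_sub.
  assert (P : forall a, 0 < / (1 + a ^ 2)).
  { intros a. apply Rinv_0_lt_compat. pose proof (pow2_ge_0 a). lra. }
  eapply Rle_trans; [|right; instantiate (1 := (2 * / (1 + kc 0 k ^ 2)) * (2 * / (1 + kc 1 k ^ 2)) * (2 * / (1 + kc 2 k ^ 2))); ring].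
  match goal with |- ?a * ?b * ?c * (?d * ?e * ?f) <= _ => replace (a * b * c * (d * e * f)) with ((a * d) * (b * e) * (c * f)) by ring end.
  apply Rmult_le_compat; auto; [apply Rmult_le_pos; apply Rlt_le, Rmult_lt_0_compat; auto|apply Rlt_le, Rmult_lt_0_compat; auto|].
  apply Rmult_le_compat; auto; apply Rlt_le, Rmult_lt_0_compat; auto.
Qed.

Lemma zrange_S N (g : Z -> R) :
  lsum (zrange (S N)) g = g (- Z.of_nat (S N))%Z + lsum (zrange N) g + g (Z.of_nat (S N)).
Proof.
  unfold zrange. replace (2 * S N + 1)%nat with (S (2 * N + 1) + 1)%nat by lia.
  rewrite seq_app, map_app, lsum_app. change (seq 0 (S (2 * N + 1))) with (0%nat :: seq 1 (2 * N + 1)).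
  rewrite <- seq_shift. rewrite map_cons, map_map. cbn [lsum].
  rewrite !lsum_map. simpl seq. cbn [map lsum].
  rewrite (lsum_ext (seq 0 (2 * N + 1)) _ (fun a => g (Z.of_nat a - Z.of_nat N)%Z)).
  - replace (Z.of_nat 0 - Z.of_nat (S N))%Z with (- Z.of_nat (S N))%Z by lia.
    replace (Z.of_nat (S (N + (N + 0) + 1)) - Z.of_nat (S N))%Z with (Z.of_nat (S N)) by lia. simpl. lra.
  - intros a _. f_equal. lia.
Qed.

(** Telescoping from [1 / (1 + n^2) <= 2 / (n (n + 1))], taken twice for the two signs of [n]. *)
Lemma zrange_sum_bound N : lsum (zrange N) (fun a => / (1 + IZR a ^ 2)) <= 5 - 4 / (INR N + 1).
Proof.
  induction N as [|N IH]; [simpl; field_simplify; lra|].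
  rewrite zrange_S, opp_IZR, <- INR_IZR_INZ, S_INR.
  replace ((- (INR N + 1)) ^ 2) with ((INR N + 1) ^ 2) by ring.
  pose proof (pos_INR N). set (x := INR N) in *.
  assert (/ (1 + (x + 1) ^ 2) <= 2 / (x + 1) - 2 / (x + 1 + 1)).
  { replace (2 / (x + 1) - 2 / (x + 1 + 1)) with (/ ((x + 1) * (x + 2) / 2)) by (field; lra).
    apply Rinv_le_contravar; nra. }
  lra.
Qed.

Lemma om_sum_bound N : lsum (box N) om <= 125.
Proof.
  unfold box, Z3. rewrite lsum_list_prod.
  set (g := fun a => / (1 + IZR a ^ 2)). set (s := lsum (zrange N) g).
  rewrite (lsum_ext _ _ (fun ab => g (fst ab) * g (snd ab) * s)).
  - rewrite lsum_scal_r, lsum_list_prod.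
    rewrite (lsum_ext _ _ (fun a => g a * s)).
    + rewrite lsum_scal_r. fold s.
      assert (s <= 5).
      { pose proof (zrange_sum_bound N). pose proof (pos_INR N).
        assert (0 < 4 / (INR N + 1)) by (apply Rdiv_lt_0_compat; lra). unfold s, g; lra. }
      assert (0 <= s).
      { apply lsum_nonneg. intros a _. unfold g. left; apply Rinv_0_lt_compat.
        pose proof (pow2_ge_0 (IZR a)); lra. }
      nra.
    + intros a _. simpl. now rewrite lsum_scal.
  - intros [a b] _. simpl. unfold s. rewrite <- lsum_scal. apply lsum_ext. intros c _. reflexivity.
Qed.

(** The tail estimate covers every finite set containing the cube, not only larger cubes, so that
    lattice sums can later be reindexed. *)
Lemma om_tail eps : 0 < eps -> exists N, forall L, NoDup L -> incl (box N) L ->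
  lsum L om - lsum (box N) om <= eps.
Proof.
  intros He.
  assert (Hg : Un_growing (fun N => lsum (box N) om)).
  { intros N. apply lsum_incl; auto. apply box_mono; lia. intros; left; apply om_pos. }
  assert (Hb : has_ub (fun N => lsum (box N) om)).
  { exists 125. intros x [N ->]. apply om_sum_bound. }
  destruct (growing_cv _ Hg Hb) as [l Hl].
  destruct (Hl eps He) as [N HN]. exists N. intros L HL Hi.
  destruct (box_ex_list L) as [M HM].
  assert (lsum L om <= l).
  { eapply Rle_trans; [|apply (growing_ineq _ _ Hg Hl (N + M)%nat)].
    apply lsum_incl; auto. intros k Hk. eapply box_mono; [|apply HM; auto]; lia.
    intros; left; apply om_pos. }
  specialize (HN N (le_n _)). unfold Rdist in HN.
  pose proof (growing_ineq _ _ Hg Hl N). simpl in H0. rewrite Rabs_left1 in HN by lra. lra.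
Qed.

(** * Dominated series over the lattice *)

Definition zsum (a : Z3 -> R) : R := real (Lim_seq (fun N => lsum (box N) a)).
Definition dom (B : R) (a : Z3 -> R) : Prop := forall k, Rabs (a k) <= B * om k.

Lemma dom_nonneg B a : dom B a -> 0 <= B.
Proof. intros H. specialize (H z3zero). pose proof (Rabs_pos (a z3zero)). pose proof (om_pos z3zero). nra. Qed.

Lemma dom_mono B B' a : dom B a -> B <= B' -> dom B' a.
Proof. intros H Hb k. specialize (H k). pose proof (om_pos k). nra. Qed.

Lemma dom_list_tail B eps : 0 < eps -> exists N, forall a, dom B a -> forall L, NoDup L -> incl (box N) L ->
  Rabs (lsum L a - lsum (box N) a) <= eps.
Proof.
  intros He. destruct (om_tail (eps / (Rabs B + 1))) as [N HN].
  { apply Rdiv_lt_0_compat; auto. pose proof (Rabs_pos B); lra. }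
  exists N. intros a Ha L HL Hi. specialize (HN L HL Hi).
  pose proof (dom_nonneg _ _ Ha) as HB. rewrite Rabs_pos_eq in HN by auto.
  eapply Rle_trans; [apply (lsum_diff_le (box N) L a (fun k => B * om k)); auto|].
  rewrite !lsum_scal. assert (H : 0 <= lsum L om - lsum (box N) om).
  { assert (lsum (box N) om <= lsum L om); [|lra]. apply lsum_incl; auto. intros; left; apply om_pos. }
  assert ((lsum L om - lsum (box N) om) * (B + 1) <= eps).
  { apply Rmult_le_compat_r with (r := B + 1) in HN; [|lra].
    replace (eps / (B + 1) * (B + 1)) with eps in HN by (field; lra). auto. }
  lra.
Qed.

Lemma zsum_cv B a : dom B a -> is_lim_seq (fun N => lsum (box N) a) (zsum a).
Proof.
  intros Ha.
  assert (H : ex_finite_lim_seq (fun N => lsum (box N) a)).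
  { apply ex_lim_seq_cauchy_corr. intros eps.
    assert (He : 0 < eps / 4) by (destruct eps; simpl; lra).
    destruct (dom_list_tail B (eps / 4) He) as [N HN]. exists N. intros n m Hn Hm.
    pose proof (HN a Ha (box n) (NoDup_box n) (box_mono _ _ Hn)) as H1.
    pose proof (HN a Ha (box m) (NoDup_box m) (box_mono _ _ Hm)) as H2.
    replace (lsum (box n) a - lsum (box m) a) with
      ((lsum (box n) a - lsum (box N) a) - (lsum (box m) a - lsum (box N) a)) by ring.
    eapply Rle_lt_trans; [apply Rabs_triang|]. rewrite Rabs_Ropp. lra. }
  apply Lim_seq_correct' in H. exact H.
Qed.

Lemma is_lim_seq_le_eps (u : nat -> R) l x eps N : is_lim_seq u l -> (forall n, (N <= n)%nat -> Rabs (u n - x) <= eps) ->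
  Rabs (real l - x) <= eps.
Proof.
  intros Hu H.
  assert (exists r, l = Finite r) as [r ->].
  { destruct l as [r| |]; [now exists r| |]; exfalso.
    - apply is_lim_seq_spec in Hu. destruct (Hu (x + eps)) as [M HM].
      specialize (HM (N + M)%nat ltac:(lia)). specialize (H (N + M)%nat ltac:(lia)).
      apply Rabs_le_between in H. lra.
    - apply is_lim_seq_spec in Hu. destruct (Hu (x - eps)) as [M HM].
      specialize (HM (N + M)%nat ltac:(lia)). specialize (H (N + M)%nat ltac:(lia)).
      apply Rabs_le_between in H. lra. }
  simpl. apply le_epsilon. intros e He. apply is_lim_seq_spec in Hu.
  destruct (Hu (mkposreal e He)) as [M HM]. simpl in HM.
  specialize (HM (N + M)%nat ltac:(lia)). specialize (H (N + M)%nat ltac:(lia)).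
  replace (r - x) with ((u (N + M)%nat - x) - (u (N + M)%nat - r)) by ring.
  rtrans Rabs_triang. rewrite Rabs_Ropp. lra.
Qed.

(** The cube depends on [B] and [eps] only, so the estimate is uniform over all families dominated
    by [B]; the exchanges of limits below rest on this uniformity. *)
Lemma zsum_list B eps : 0 < eps -> exists N, forall a, dom B a -> forall L, NoDup L -> incl (box N) L ->
  Rabs (lsum L a - zsum a) <= eps.
Proof.
  intros He. destruct (dom_list_tail B (eps / 2)) as [N HN]; [lra|].
  exists N. intros a Ha L HL Hi.
  pose proof (HN a Ha L HL Hi).
  assert (Rabs (zsum a - lsum (box N) a) <= eps / 2).
  { apply (is_lim_seq_le_eps _ (Finite (zsum a)) _ _ N (zsum_cv B a Ha)). intros n Hn.
    apply HN; auto. now apply box_mono. }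
  replace (lsum L a - zsum a) with ((lsum L a - lsum (box N) a) - (zsum a - lsum (box N) a)) by ring.
  rtrans Rabs_triang. rewrite Rabs_Ropp. lra.
Qed.

Lemma zsum_ext a b : (forall k, a k = b k) -> zsum a = zsum b.
Proof. intros H. f_equal. apply functional_extensionality. auto. Qed.

Lemma zsum_unique B a l : dom B a -> is_lim_seq (fun N => lsum (box N) a) (Finite l) -> zsum a = l.
Proof.
  intros Ha H. apply (is_lim_seq_unique) in H. unfold zsum. now rewrite H.
Qed.

Lemma zsum_plus B a b : dom B a -> dom B b -> zsum (fun k => a k + b k) = zsum a + zsum b.
Proof.
  intros Ha Hb. unfold zsum at 1.
  rewrite (is_lim_seq_unique _ (Finite (zsum a + zsum b))); [reflexivity|].
  eapply is_lim_seq_ext; [intros n; symmetry; apply lsum_plus|].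
  apply (is_lim_seq_plus' _ _ _ _ (zsum_cv B a Ha) (zsum_cv B b Hb)).
Qed.

Lemma zsum_scal B c a : dom B a -> zsum (fun k => c * a k) = c * zsum a.
Proof.
  intros Ha. unfold zsum at 1.
  rewrite (is_lim_seq_unique _ (Finite (c * zsum a))); [reflexivity|].
  eapply is_lim_seq_ext; [intros n; symmetry; apply lsum_scal|].
  apply (is_lim_seq_scal_l _ c (Finite (zsum a)) (zsum_cv B a Ha)).
Qed.

Lemma dom_scal B c a : dom B a -> dom (Rabs c * B) (fun k => c * a k).
Proof. intros H k. rewrite Rabs_mult, Rmult_assoc. apply Rmult_le_compat_l; auto. apply Rabs_pos. Qed.

Lemma dom_plus B B' a b : dom B a -> dom B' b -> dom (B + B') (fun k => a k + b k).
Proof. intros H H' k. rtrans Rabs_triang. specialize (H k). specialize (H' k). lra. Qed.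

Lemma zsum_minus B a b : dom B a -> dom B b -> zsum (fun k => a k - b k) = zsum a - zsum b.
Proof.
  intros Ha Hb. rewrite (zsum_ext _ (fun k => a k + (-1) * b k)) by (intros; ring).
  rewrite (zsum_plus B); auto.
  - rewrite (zsum_scal B); auto. ring.
  - intros k. rewrite Rabs_mult, Rabs_left by lra. specialize (Hb k). lra.
Qed.

Lemma zsum_bound B a : dom B a -> Rabs (zsum a) <= 125 * B.
Proof.
  intros Ha. replace (zsum a) with (zsum a - 0) by ring.
  apply (is_lim_seq_le_eps _ (Finite (zsum a)) _ _ 0 (zsum_cv B a Ha)). intros n _.
  rewrite Rminus_0_r. rtrans lsum_abs.
  eapply Rle_trans; [apply lsum_le; intros k _; apply Ha|]. rewrite lsum_scal.
  pose proof (om_sum_bound n). pose proof (dom_nonneg _ _ Ha). nra.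
Qed.

Lemma zsum_finite N a : (forall k, ~ In k (box N) -> a k = 0) -> zsum a = lsum (box N) a.
Proof.
  intros H. unfold zsum. rewrite (is_lim_seq_unique _ (Finite (lsum (box N) a))); [reflexivity|].
  apply is_lim_seq_spec. intros eps. exists N. intros n Hn.
  rewrite (lsum_support (box n) (box N)); auto.
  - rewrite Rminus_diag, Rabs_R0. apply cond_pos.
  - intros k Hk Hk'. exfalso. apply Hk'. eapply box_mono; eauto.
Qed.

Lemma zsum_reindex B a (s s' : Z3 -> Z3) : dom B a -> dom B (fun k => a (s k)) ->
  (forall k, s' (s k) = k) -> (forall k, s (s' k) = k) -> zsum (fun k => a (s k)) = zsum a.
Proof.
  intros Ha Has H1 H2. apply cond_eq. intros eps He.
  destruct (zsum_list B (eps / 3)) as [N HN]; [lra|].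
  (* The cube is so large that both it and its image under [s] contain the cube of [zsum_list]; one
     finite sum then approximates both series. *)
  destruct (box_ex_list (map s' (box N) ++ box N)) as [M HM].
  pose proof (HN _ Has (box M) (NoDup_box M) ltac:(intros k Hk; apply HM, in_or_app; auto)) as HA.
  assert (HB : Rabs (lsum (map s (box M)) a - zsum a) <= eps / 3).
  { apply HN; auto. eapply NoDup_map_inv_fun; eauto. intros k Hk.
    rewrite <- (H2 k). apply in_map. apply HM, in_or_app. left. now apply in_map. }
  rewrite lsum_map in HB.
  apply Rabs_le_between in HA. apply Rabs_le_between in HB. apply Rabs_lt_between. lra.
Qed.

(** Dominated convergence: a fixed cube carries each series up to [eps / 4], and on it convergence
    is termwise. *)
Lemma zsum_limit B (a : nat -> Z3 -> R) (b : Z3 -> R) : (forall n, dom B (a n)) ->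
  (forall k, Un_cv (fun n => a n k) (b k)) -> Un_cv (fun n => zsum (a n)) (zsum b).
Proof.
  intros Ha Hc.
  assert (Hb : dom B b).
  { intros k. replace (b k) with (b k - 0) by ring.
    apply (is_lim_seq_le_eps (fun n => a n k) (Finite (b k)) 0 _ 0).
    - apply is_lim_seq_Reals. auto.
    - intros n _. rewrite Rminus_0_r. apply Ha. }
  intros eps He. destruct (zsum_list B (eps / 4)) as [N HN]; [lra|].
  assert (HL : Un_cv (fun n => lsum (box N) (a n)) (lsum (box N) b)).
  { generalize (box N). induction l as [|k l IH]; simpl.
    - intros e H. exists 0%nat. intros. now rewrite Rdist_eq.
    - apply CV_plus; auto. }
  destruct (HL (eps / 4)) as [M HM]; [lra|]. exists M. intros n Hn. specialize (HM n Hn).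
  pose proof (HN _ (Ha n) (box N) (NoDup_box N) (incl_refl _)) as H1.
  pose proof (HN _ Hb (box N) (NoDup_box N) (incl_refl _)) as H2.
  unfold Rdist in *. apply Rabs_le_between in H1. apply Rabs_le_between in H2.
  apply Rabs_lt_between in HM. apply Rabs_lt_between. lra.
Qed.

Lemma lsum_derive {A} (L : list A) (f f' : A -> R -> R) s :
  (forall k, In k L -> derivable_pt_lim (f k) s (f' k s)) ->
  derivable_pt_lim (fun t => lsum L (fun k => f k t)) s (lsum L (fun k => f' k s)).
Proof.
  induction L as [|k L IH]; intros H; simpl.
  - apply derivable_pt_lim_const.
  - apply (derivable_pt_lim_plus (f k) (fun t => lsum L (fun k => f k t))).
    + apply H; simpl; auto.
    + apply IH. intros; apply H; simpl; auto.
Qed.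

Lemma zsum_derive B (f f' : Z3 -> R -> R) c r : 0 < r ->
  (forall k s, Rabs (s - c) < r -> derivable_pt_lim (f k) s (f' k s)) ->
  (forall s, Rabs (s - c) < r -> dom B (fun k => f k s)) ->
  (forall s, Rabs (s - c) < r -> dom B (fun k => f' k s)) ->
  derivable_pt_lim (fun s => zsum (fun k => f k s)) c (zsum (fun k => f' k c)).
Proof.
  intros Hr Hd Hf Hf'.
  apply (CVU_derivable (fun N s => lsum (box N) (fun k => f k s))
    (fun N s => lsum (box N) (fun k => f' k s)) (fun s => zsum (fun k => f k s))
    (fun s => zsum (fun k => f' k s)) c (mkposreal r Hr)).
  - intros eps He. destruct (zsum_list B (eps / 2)) as [N HN]; [lra|].
    exists N. intros n y Hn Hy. unfold Boule in Hy; simpl in Hy.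
    rewrite Rabs_minus_sym. eapply Rle_lt_trans; [apply HN; auto; now apply box_mono|lra].
  - intros x Hx. apply is_lim_seq_Reals, (zsum_cv B). apply Hf. exact Hx.
  - intros n x Hx. apply lsum_derive. intros k _. apply Hd. exact Hx.
  - unfold Boule; simpl. rewrite Rminus_diag, Rabs_R0. lra.
Qed.

(** Finite sums in [k] pass through the series in [j] by linearity, and their limit passes through
    it by dominated convergence. *)
Lemma zsum_fubini B (F : Z3 -> Z3 -> R) : (forall k j, Rabs (F k j) <= B * om k * om j) ->
  zsum (fun k => zsum (fun j => F k j)) = zsum (fun j => zsum (fun k => F k j)).
Proof.
  intros H.
  assert (Hk : forall k, dom (B * om k) (fun j => F k j)) by (intros k j; auto).
  assert (Hj : forall j, dom (B * om j) (fun k => F k j)).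
  { intros j k. rtrans H. right; ring. }
  assert (HB : 0 <= B).
  { pose proof (Hk z3zero) as Hz. apply dom_nonneg in Hz. pose proof (om_pos z3zero). nra. }
  assert (D1 : dom (125 * B) (fun k => zsum (fun j => F k j))).
  { intros k. rtrans (zsum_bound _ _ (Hk k)). right; ring. }
  apply (zsum_unique _ _ _ D1).
  assert (E : forall L, lsum L (fun k => zsum (fun j => F k j)) = zsum (fun j => lsum L (fun k => F k j))
     /\ dom (B * lsum L om) (fun j => lsum L (fun k => F k j))).
  { induction L as [|k L [IH IHd]]; simpl.
    - split; [rewrite (zsum_finite 0); [symmetry; now apply lsum_zero|auto]|].
      intros j. rewrite Rabs_R0. lra.
    - assert (Q : dom (B * (om k + lsum L om)) (fun j => F k j + lsum L (fun k0 => F k0 j))).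
      { rewrite Rmult_plus_distr_l. apply (dom_plus _ _ (fun j => F k j)); auto. }
      assert (0 <= lsum L om) by (apply lsum_nonneg; intros; left; apply om_pos).
      pose proof (om_pos k). split; auto. rewrite IH. symmetry. apply (zsum_plus (B * (om k + lsum L om))).
      + apply (dom_mono _ _ _ (Hk k)). nra.
      + apply (dom_mono _ _ _ IHd). nra. }
  apply is_lim_seq_ext with (u := fun N => zsum (fun j => lsum (box N) (fun k => F k j))).
  { intros N. symmetry. apply E. }
  apply is_lim_seq_Reals.
  apply (zsum_limit (125 * B)).
  - intros N. destruct (E (box N)) as [_ D]. apply (dom_mono _ _ _ D). pose proof (om_sum_bound N). nra.
  - intros j. apply is_lim_seq_Reals, (zsum_cv _ _ (Hj j)).
Qed.

(** ** The quadratic term and its energy estimates *)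

Definition coef : Type := Z3 -> nat -> C.
Definition s3 (f : nat -> C) : C := (f 0%nat + f 1%nat + f 2%nat)%C.
Definition cdot (z : nat -> C) (k : Z3) : C := s3 (fun a => z a * RtoC (kc a k))%C.
Definition vdot (z w : nat -> C) : C := s3 (fun i => Cconj (z i) * w i)%C.
Definition ksq (k : Z3) : R := kc 0 k ^ 2 + kc 1 k ^ 2 + kc 2 k ^ 2.
(** The Leray projection at frequency [k]. At [k = 0] the quotient vanishes, because [kc i k = 0],
    and [pj] is the identity. *)
Definition pj (k : Z3) (z : nat -> C) (i : nat) : C :=
  (z i - RtoC (kc i k / ksq k) * cdot z k)%C.
(* The field with coefficients [u k i] is [sum_k Re (u k exp (i k.x))]; [Dn N u w] is the convection term
   [-(u.grad) w] with [u] restricted to [box N], and [Bn N u w] its divergence-free part. *)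
Definition Dn (N : nat) (u w : coef) (k : Z3) (i : nat) : C :=
  (- Ci * csum (box N) (fun j => cdot (u j) k * w (z3sub k j) i))%C.
Definition Bn (N : nat) (u w : coef) (k : Z3) (i : nat) : C := pj k (Dn N u w k) i.

(** Hermitian symmetry, the condition under which coefficients are determined by the real field they
    represent. *)
Definition rl (u : coef) : Prop := forall k i, u (z3opp k) i = Cconj (u k i).
Definition dv (u : coef) : Prop := forall k, cdot (u k) k = 0%C.
Definition supp (N : nat) (u : coef) : Prop := forall k i, ~ In k (box N) -> u k i = 0%C.
Definition trunc (N : nat) (u : coef) : coef := fun k i => if inb (box N) k then u k i else 0%C.

Definition cadd (u v : coef) : coef := fun k i => (u k i + v k i)%C.
Definition csb (u v : coef) : coef := fun k i => (u k i - v k i)%C.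
Definition cscl (r : R) (u : coef) : coef := fun k i => (RtoC r * u k i)%C.
Definition czero : coef := fun _ _ => 0%C.

Definition vn (z : nat -> C) : R := sqrt (Cmod (z 0%nat) ^ 2 + Cmod (z 1%nat) ^ 2 + Cmod (z 2%nat) ^ 2).
Definition IP (m N : nat) (u w : coef) : R :=
  lsum (box N) (fun k => wt k ^ (2 * m) * Re (vdot (u k) (w k))).

(** Norm bounds are stated on all cubes, so that no convergence has to be established before using
    them. *)
Definition l2b (a : Z3 -> R) (A : R) : Prop := 0 <= A /\ forall M, lsum (box M) (fun k => a k ^ 2) <= A ^ 2.
Definition l1b (a : Z3 -> R) (A : R) : Prop := forall M, lsum (box M) a <= A.
(* [sob m u A] bounds the [H^m] norm of [u] by [A]. *)
Definition sob (m : nat) (u : coef) (A : R) : Prop := l2b (fun k => wt k ^ m * vn (u k)) A.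

Lemma ceq (a b : C) : Re a = Re b -> Im a = Im b -> a = b.
Proof. destruct a, b; simpl; congruence. Qed.

Lemma Re_plus a b : Re (a + b)%C = Re a + Re b. Proof. reflexivity. Qed.
Lemma Im_plus a b : Im (a + b)%C = Im a + Im b. Proof. reflexivity. Qed.
Lemma Re_minus a b : Re (a - b)%C = Re a - Re b. Proof. reflexivity. Qed.
Lemma Im_minus a b : Im (a - b)%C = Im a - Im b. Proof. reflexivity. Qed.
Lemma Re_scal r a : Re (RtoC r * a)%C = r * Re a. Proof. destruct a; simpl; ring. Qed.
Lemma Im_scal r a : Im (RtoC r * a)%C = r * Im a. Proof. destruct a; simpl; ring. Qed.
Lemma Im_csum {A} (L : list A) f : Im (csum L f) = lsum L (fun a => Im (f a)). Proof. reflexivity. Qed.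
Lemma im_le_Cmod c : Rabs (Im c) <= Cmod c.
Proof. eapply Rle_trans; [apply Rmax_r|apply Rmax_Cmod]. Qed.
Lemma Cmod_RtoC r : Cmod (RtoC r) = Rabs r. Proof. apply Cmod_R. Qed.
Lemma Cmod_sq c : Cmod c ^ 2 = Re c ^ 2 + Im c ^ 2.
Proof. apply Cmod2_alt. Qed.
Lemma Cmod_le_ReIm c : Cmod c <= Rabs (Re c) + Rabs (Im c).
Proof.
  apply Rsqr_incr_0_var; [|pose proof (Rabs_pos (Re c)); pose proof (Rabs_pos (Im c)); lra].
  rewrite !Rsqr_pow2, Cmod_sq, <- (pow2_abs (Re c)), <- (pow2_abs (Im c)).
  pose proof (Rabs_pos (Re c)); pose proof (Rabs_pos (Im c)); nra.
Qed.

Lemma vn_ge0 z : 0 <= vn z. Proof. apply sqrt_pos. Qed.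
Lemma vn_sq z : vn z ^ 2 = Cmod (z 0%nat) ^ 2 + Cmod (z 1%nat) ^ 2 + Cmod (z 2%nat) ^ 2.
Proof.
  unfold vn. rewrite <- Rsqr_pow2, Rsqr_sqrt; auto.
  pose proof (pow2_ge_0 (Cmod (z 0%nat))). pose proof (pow2_ge_0 (Cmod (z 1%nat))). pose proof (pow2_ge_0 (Cmod (z 2%nat))). lra.
Qed.
Lemma le_of_sq x y : 0 <= y -> x ^ 2 <= y ^ 2 -> x <= y.
Proof. intros. apply Rsqr_incr_0_var; auto. now rewrite !Rsqr_pow2. Qed.
Lemma vn_comp z i : (i < 3)%nat -> Cmod (z i) <= vn z.
Proof.
  intros Hi. apply le_of_sq; [apply vn_ge0|]. rewrite vn_sq.
  pose proof (pow2_ge_0 (Cmod (z 0%nat))). pose proof (pow2_ge_0 (Cmod (z 1%nat))). pose proof (pow2_ge_0 (Cmod (z 2%nat))).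
  destruct i as [|[|[|i]]]; try lra. lia.
Qed.
Lemma vn_le_sum z : vn z <= Cmod (z 0%nat) + Cmod (z 1%nat) + Cmod (z 2%nat).
Proof.
  pose proof (Cmod_ge_0 (z 0%nat)). pose proof (Cmod_ge_0 (z 1%nat)). pose proof (Cmod_ge_0 (z 2%nat)).
  apply le_of_sq; [lra|]. rewrite vn_sq. nra.
Qed.
Lemma vn_ext z w : (forall i, (i < 3)%nat -> z i = w i) -> vn z = vn w.
Proof. intros H. unfold vn. rewrite !H by lia. auto. Qed.
Lemma vn_triangle z w : vn (fun i => z i + w i)%C <= vn z + vn w.
Proof.
  pose proof (vn_ge0 z). pose proof (vn_ge0 w).
  apply le_of_sq; [lra|]. rewrite vn_sq.
  pose proof (lsum_cs [0;1;2]%nat (fun i => Cmod (z i)) (fun i => Cmod (w i)) (vn z) (vn w) H H0) as K.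
  rewrite !vn_sq in K. simpl lsum in K.
  assert (T : forall i, Cmod (z i + w i)%C ^ 2 <= Cmod (z i) ^ 2 + 2 * (Cmod (z i) * Cmod (w i)) + Cmod (w i) ^ 2).
  { intros i. pose proof (Cmod_triangle (z i) (w i)). pose proof (Cmod_ge_0 (z i + w i)%C).
    replace (Cmod (z i) ^ 2 + 2 * (Cmod (z i) * Cmod (w i)) + Cmod (w i) ^ 2) with ((Cmod (z i) + Cmod (w i)) ^ 2) by ring.
    apply pow_incr. lra. }
  pose proof (T 0%nat). pose proof (T 1%nat). pose proof (T 2%nat).
  replace ((vn z + vn w) ^ 2) with (vn z ^ 2 + 2 * (vn z * vn w) + vn w ^ 2) by ring. rewrite !vn_sq. lra.
Qed.
Lemma vn_scal r z : vn (fun i => RtoC r * z i)%C = Rabs r * vn z.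
Proof.
  unfold vn. rewrite <- (sqrt_pow2 (Rabs r)) by apply Rabs_pos. rewrite <- sqrt_mult_alt by apply pow2_ge_0.
  f_equal. rewrite !Cmod_mult, !Cmod_RtoC. ring.
Qed.
Lemma vn_zero : vn (fun _ => 0%C) = 0.
Proof. unfold vn. rewrite !Cmod_0. replace (0 ^ 2 + 0 ^ 2 + 0 ^ 2) with 0 by ring. apply sqrt_0. Qed.

Lemma vdot_self z : Re (vdot z z) = vn z ^ 2.
Proof. rewrite vn_sq, !Cmod_sq. unfold vdot, s3. destruct (z 0%nat), (z 1%nat), (z 2%nat); simpl; ring. Qed.

Lemma Cmod_s3 f : Cmod (s3 f) <= Cmod (f 0%nat) + Cmod (f 1%nat) + Cmod (f 2%nat).
Proof.
  unfold s3. rtrans Cmod_triangle.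
  pose proof (Cmod_triangle (f 0%nat) (f 1%nat)). lra.
Qed.

Lemma vdot_bound z w : Cmod (vdot z w) <= 3 * vn z * vn w.
Proof.
  rtrans Cmod_s3.
  assert (T : forall i, (i < 3)%nat -> Cmod (Cconj (z i) * w i)%C <= vn z * vn w).
  { intros i Hi. rewrite Cmod_mult, Cmod_conj. apply Rmult_le_compat; auto using Cmod_ge_0, vn_comp. }
  pose proof (T 0%nat ltac:(lia)). pose proof (T 1%nat ltac:(lia)). pose proof (T 2%nat ltac:(lia)). lra.
Qed.

Lemma cdot_bound z k : Cmod (cdot z k) <= vn z * wt k.
Proof.
  rtrans Cmod_s3. cbv beta. rewrite !Cmod_mult, !Cmod_RtoC, wt_abs.
  pose proof (vn_ge0 z).
  pose proof (vn_comp z 0 ltac:(lia)). pose proof (vn_comp z 1 ltac:(lia)). pose proof (vn_comp z 2 ltac:(lia)).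
  pose proof (Rabs_pos (kc 0 k)). pose proof (Rabs_pos (kc 1 k)). pose proof (Rabs_pos (kc 2 k)). nra.
Qed.

Lemma cdot_sub z k j : cdot z (z3sub k j) = (cdot z k - cdot z j)%C.
Proof. unfold cdot, s3. rewrite !kc_sub, !RtoC_minus. ring. Qed.
Lemma cdot_opp z k : cdot z (z3opp k) = (- cdot z k)%C.
Proof. unfold cdot, s3. rewrite !kc_opp, !RtoC_opp. ring. Qed.
Lemma Cconj_RtoC r : Cconj (RtoC r) = RtoC r.
Proof. unfold Cconj, RtoC. simpl. f_equal. ring. Qed.
Lemma cdot_conj z k : Cconj (cdot z k) = cdot (fun i => Cconj (z i)) k.
Proof. unfold cdot, s3. now rewrite !Cplus_conj, !Cmult_conj, !Cconj_RtoC. Qed.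
Lemma cdot_ext z w k : (forall i, z i = w i) -> cdot z k = cdot w k.
Proof. intros H. unfold cdot, s3. now rewrite !H. Qed.
Lemma cdot_rl u j k : rl u -> cdot (u (z3opp j)) k = Cconj (cdot (u j) k).
Proof. intros H. rewrite cdot_conj. apply cdot_ext. intros; apply H. Qed.
Lemma cdot_dv u j k : dv u -> cdot (u j) k = cdot (u j) (z3sub k j).
Proof. intros H. rewrite cdot_sub, H. ring. Qed.
Lemma vdot_conj z w : Cconj (vdot z w) = vdot w z.
Proof. unfold vdot, s3. rewrite !Cplus_conj, !Cmult_conj, !Cconj_conj. ring. Qed.

(* Young's inequality for convolutions, in the two placements of the summable factor. *)
Lemma young1 a b c A B Cc N : (forall k, 0 <= a k) -> (forall k, 0 <= b k) -> (forall k, 0 <= c k) ->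
  l2b a A -> l1b b B -> l2b c Cc ->
  lsum (box N) (fun k => lsum (box N) (fun j => a k * b j * c (z3sub k j))) <= A * B * Cc.
Proof.
  intros Ha Hb Hc [HA HA'] HB [HC HC']. rewrite lsum_swap.
  apply Rle_trans with (lsum (box N) (fun j => b j * (A * Cc))).
  - apply lsum_le. intros j _.
    rewrite (lsum_ext _ _ (fun k => b j * (a k * c (z3sub k j)))) by (intros; ring).
    rewrite lsum_scal. apply Rmult_le_compat_l; auto.
    apply lsum_cs; auto.
    rewrite <- (lsum_map (box N) (fun k => z3sub k j) (fun l => c l ^ 2)).
    destruct (box_ex_list (map (fun k => z3sub k j) (box N))) as [M HM].
    eapply Rle_trans; [|apply (HC' M)]. apply lsum_incl; auto.
    + eapply (NoDup_map_inv_fun _ _ (fun k => z3add k j)); auto. intros; apply z3subK.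
    + intros; apply pow2_ge_0.
  - rewrite lsum_scal_r. specialize (HB N). assert (0 <= A * Cc) by (apply Rmult_le_pos; auto). nra.
Qed.

Lemma young2 a b c A B Cc N : (forall k, 0 <= a k) -> (forall k, 0 <= b k) -> (forall k, 0 <= c k) ->
  l2b a A -> l2b b B -> l1b c Cc ->
  lsum (box N) (fun k => lsum (box N) (fun j => a k * b j * c (z3sub k j))) <= A * B * Cc.
Proof.
  intros Ha Hb Hc HA HB HC.
  assert (P : forall k l, 0 <= a k * c l * b (z3sub k l)).
  { intros. repeat apply Rmult_le_pos; auto. }
  (* The change of variable [l = k - j] exchanges the two factors and reduces to [young1]; the
     doubled cube contains all the differences. *)
  apply Rle_trans with (lsum (box (N + N)) (fun k => lsum (box (N + N)) (fun l => a k * c l * b (z3sub k l)))).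
  - apply Rle_trans with (lsum (box N) (fun k => lsum (box (N + N)) (fun l => a k * c l * b (z3sub k l)))).
    + apply lsum_le. intros k Hk.
      set (G := fun l => a k * c l * b (z3sub k l)).
      rewrite (lsum_ext _ _ (fun j => G (z3sub k j))).
      * rewrite <- (lsum_map (box N) (fun j => z3sub k j) G). apply lsum_incl; auto.
        2: { intros l Hl. apply in_map_iff in Hl. destruct Hl as (j & <- & Hj). now apply box_sub. }
        eapply (NoDup_map_inv_fun _ _ (fun j => z3sub k j)); auto. intros; apply z3sub_sub.
        intros l _. apply P.
      * intros j _. unfold G. rewrite z3sub_sub. ring.
    + apply lsum_incl; auto.
      * apply box_mono; lia.
      * intros k _. apply lsum_nonneg. auto.
  - eapply Rle_trans; [apply (young1 a c b A Cc B); auto|]. right; ring.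
Qed.

(** Cauchy-Schwarz for the splitting of [wt * vn] into [wt^4 vn] and [wt^(-3)]: hence the condition
    [4 <= m]. Since [wt^(-6) <= om], the second factor has square sum at most [125 <= 12^2]. *)
Lemma sob_l1 m u A : (4 <= m)%nat -> sob m u A -> l1b (fun k => wt k * vn (u k)) (12 * A).
Proof.
  intros Hm [HA H] M.
  apply Rle_trans with (lsum (box M) (fun k => (wt k ^ m * vn (u k)) * / wt k ^ 3)).
  - apply lsum_le. intros k _. pose proof (wt_ge1 k). pose proof (vn_ge0 (u k)).
    apply Rmult_le_reg_r with (wt k ^ 3); [apply pow_lt; lra|].
    replace (wt k ^ m * vn (u k) * / wt k ^ 3 * wt k ^ 3) with (wt k ^ m * vn (u k)) by (field; lra).
    replace (wt k * vn (u k) * wt k ^ 3) with (wt k ^ 4 * vn (u k)) by ring.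
    apply Rmult_le_compat_r; auto. apply Rle_pow; auto.
  - rewrite Rmult_comm. apply lsum_cs; auto; try lra.
    eapply Rle_trans; [|eapply Rle_trans; [apply (om_sum_bound M)|lra]].
    apply lsum_le. intros k _. pose proof (wt_ge1 k). pose proof (om_wt k).
    apply Rmult_le_reg_r with (wt k ^ 6); [apply pow_lt; lra|].
    replace ((/ wt k ^ 3) ^ 2 * wt k ^ 6) with 1 by (field; lra). auto.
Qed.

Lemma l1b_mono a b A : (forall k, a k <= b k) -> l1b b A -> l1b a A.
Proof. intros H HA M. eapply Rle_trans; [apply lsum_le; intros; apply H|auto]. Qed.

Lemma sob_l1' m u A : (4 <= m)%nat -> sob m u A -> l1b (fun k => vn (u k)) (12 * A).
Proof.
  intros Hm H. eapply l1b_mono; [|eapply sob_l1; eauto].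
  intros k. pose proof (wt_ge1 k). pose proof (vn_ge0 (u k)). simpl. nra.
Qed.

Lemma sob_pos m u A : sob m u A -> 0 <= A. Proof. intros [H _]; auto. Qed.

Lemma sob_le m u A B : sob m u A -> A <= B -> sob m u B.
Proof. intros [H H'] Hb. split; [lra|]. intros M. rtrans H'. apply pow_incr; lra. Qed.

Lemma sob_mono m m' u A : (m <= m')%nat -> sob m' u A -> sob m u A.
Proof.
  intros Hm [H H']. split; auto. intros M. eapply Rle_trans; [|apply (H' M)].
  apply lsum_le. intros k _. pose proof (wt_ge1 k). pose proof (vn_ge0 (u k)).
  apply pow_incr. split; [apply Rmult_le_pos; auto; apply pow_le; lra|].
  apply Rmult_le_compat_r; auto. apply Rle_pow; auto.
Qed.

Lemma l2b_triangle a b c A B : (forall k, 0 <= c k <= a k + b k) -> l2b a A -> l2b b B -> l2b c (A + B).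
Proof.
  intros H [HA HA'] [HB HB']. split; [lra|]. intros M.
  apply Rle_trans with (lsum (box M) (fun k => (a k ^ 2 + 2 * (a k * b k)) + b k ^ 2)).
  - apply lsum_le. intros k _. replace (a k ^ 2 + 2 * (a k * b k) + b k ^ 2) with ((a k + b k) ^ 2) by ring.
    apply pow_incr; auto.
  - rewrite !lsum_plus, lsum_scal. pose proof (lsum_cs _ _ _ _ _ HA HB (HA' M) (HB' M)).
    specialize (HA' M). specialize (HB' M). nra.
Qed.

Lemma sob_add m u v A B : sob m u A -> sob m v B -> sob m (cadd u v) (A + B).
Proof.
  intros. eapply l2b_triangle; eauto. intros k. cbv beta. rewrite <- Rmult_plus_distr_l.
  pose proof (wt_ge1 k). assert (0 <= wt k ^ m) by (apply pow_le; lra).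
  split; [apply Rmult_le_pos; auto; apply vn_ge0|]. apply Rmult_le_compat_l; auto. apply vn_triangle.
Qed.

Lemma sob_scl m r u A : sob m u A -> sob m (cscl r u) (Rabs r * A).
Proof.
  intros [HA H]. split; [apply Rmult_le_pos; auto; apply Rabs_pos|]. intros M.
  rewrite (lsum_ext _ _ (fun k => Rabs r ^ 2 * (wt k ^ m * vn (u k)) ^ 2)).
  - rewrite lsum_scal, Rpow_mult_distr. apply Rmult_le_compat_l; auto. apply pow2_ge_0.
  - intros k _. unfold cscl. rewrite vn_scal. ring.
Qed.

Lemma coef_ext (u v : coef) : (forall k i, u k i = v k i) -> u = v.
Proof. intros H. apply functional_extensionality; intros k. apply functional_extensionality; intros i. auto. Qed.

Ltac coef_ring := apply coef_ext; intros; unfold cadd, csb, cscl, czero; try change (RtoC (-1)) with (RtoC (Ropp 1));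
  rewrite ?RtoC_opp, ?RtoC_plus, ?RtoC_minus, ?RtoC_mult, ?RtoC_opp; ring.

Lemma csb_scl u v : csb u v = cadd u (cscl (-1) v).
Proof. coef_ring. Qed.

Lemma sob_zero m : sob m czero 0.
Proof.
  split; [lra|]. intros M. rewrite lsum_zero; [lra|]. intros k _. unfold czero. rewrite vn_zero. ring.
Qed.

Lemma sob_vn m u A k : sob m u A -> wt k ^ m * vn (u k) <= A.
Proof.
  intros [HA H]. destruct (box_ex k) as [N HN]. apply le_of_sq; auto. eapply Rle_trans; [|apply (H N)].
  apply (lsum_term_le (box N) (fun k => (wt k ^ m * vn (u k)) ^ 2)); auto. intros; apply pow2_ge_0.
Qed.
Lemma sob_comp m u A k i : (i < 3)%nat -> sob m u A -> wt k ^ m * Cmod (u k i) <= A.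
Proof.
  intros Hi H. apply Rle_trans with (wt k ^ m * vn (u k)); [|now apply sob_vn].
  apply Rmult_le_compat_l; [apply pow_le; pose proof (wt_ge1 k); lra|]. now apply vn_comp.
Qed.

Lemma IP_self m N u : IP m N u u = lsum (box N) (fun k => (wt k ^ m * vn (u k)) ^ 2).
Proof.
  apply lsum_ext. intros k _. rewrite vdot_self, pow_mult. replace ((wt k ^ 2) ^ m) with ((wt k ^ m) ^ 2); [ring|].
  now rewrite <- !pow_mult, Nat.mul_comm.
Qed.

Lemma IP_self_ge0 m N u : 0 <= IP m N u u.
Proof. rewrite IP_self. apply lsum_nonneg. intros; apply pow2_ge_0. Qed.

Lemma sob_IP m N u A : sob m u A -> IP m N u u <= A ^ 2.
Proof. intros [_ H]. rewrite IP_self. apply H. Qed.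

Lemma supp_sob m N u A : 0 <= A -> supp N u -> IP m N u u <= A ^ 2 -> sob m u A.
Proof.
  intros HA Hs H. split; auto. intros M. eapply Rle_trans; [|apply H]. rewrite IP_self.
  assert (Z : forall k, ~ In k (box N) -> (wt k ^ m * vn (u k)) ^ 2 = 0).
  { intros k Hk. rewrite (vn_ext (u k) (fun _ => 0%C)) by auto. rewrite vn_zero. ring. }
  destruct (le_lt_dec M N).
  - apply lsum_incl; auto. now apply box_mono. intros; apply pow2_ge_0.
  - right. apply lsum_support; auto.
    intros k Hk Hk'. exfalso. apply Hk'. eapply box_mono; [|eauto]. lia.
Qed.

Lemma supp_sob_sqrt m N u : supp N u -> sob m u (sqrt (IP m N u u)).
Proof.
  intros H. apply (supp_sob m N); auto; [apply sqrt_pos|].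
  rewrite <- Rsqr_pow2, Rsqr_sqrt; [lra|]. apply IP_self_ge0.
Qed.

Lemma IP_cs m N u w A B : sob m u A -> sob m w B -> Rabs (IP m N u w) <= 3 * A * B.
Proof.
  intros [HA Hu] [HB Hw]. unfold IP. rtrans lsum_abs.
  apply Rle_trans with (lsum (box N) (fun k => 3 * ((wt k ^ m * vn (u k)) * (wt k ^ m * vn (w k))))).
  - apply lsum_le. intros k _. rewrite Rabs_mult.
    assert (0 <= wt k ^ m) by (apply pow_le; pose proof (wt_ge1 k); lra).
    replace (wt k ^ (2 * m)) with (wt k ^ m * wt k ^ m) by (rewrite <- pow_add; f_equal; lia).
    rewrite (Rabs_pos_eq (wt k ^ m * wt k ^ m)) by (apply Rmult_le_pos; auto).
    replace (3 * (wt k ^ m * vn (u k) * (wt k ^ m * vn (w k)))) with (wt k ^ m * wt k ^ m * (3 * vn (u k) * vn (w k))) by ring.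
    apply Rmult_le_compat_l; [apply Rmult_le_pos; auto|].
    eapply Rle_trans; [apply re_le_Cmod|apply vdot_bound].
  - rewrite lsum_scal, Rmult_assoc. apply Rmult_le_compat_l; [lra|]. apply lsum_cs; auto.
Qed.

(** * Cancellation and energy estimates for the convection term *)

Definition Tri (N : nat) (g : Z3 -> Z3 -> R) (u w v : coef) : C :=
  csum (box N) (fun k => csum (box N) (fun j =>
    RtoC (g k (z3sub k j)) * (cdot (u j) k * vdot (w k) (v (z3sub k j)))))%C.

Lemma vdot_Dn N u w v k :
  vdot (w k) (Dn N u v k) = (- Ci * csum (box N) (fun j => cdot (u j) k * vdot (w k) (v (z3sub k j))))%C.
Proof.
  unfold vdot at 1, s3, Dn.
  transitivity (- Ci * (Cconj (w k 0%nat) * csum (box N) (fun j => cdot (u j) k * v (z3sub k j) 0%nat)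
    + Cconj (w k 1%nat) * csum (box N) (fun j => cdot (u j) k * v (z3sub k j) 1%nat)
    + Cconj (w k 2%nat) * csum (box N) (fun j => cdot (u j) k * v (z3sub k j) 2%nat)))%C; [ring|].
  f_equal. rewrite <- !csum_scal, <- !csum_plus. apply csum_ext. intros j _. unfold vdot, s3. ring.
Qed.

Lemma IP_Dn m N u w v : IP m N w (Dn N u v) = Im (Tri N (fun k _ => wt k ^ (2 * m)) u w v).
Proof.
  unfold IP, Tri. rewrite Im_csum. apply lsum_ext. intros k _. rewrite vdot_Dn.
  rewrite csum_scal. set (z := csum _ _). rewrite Im_scal. simpl. ring.
Qed.

(** Antisymmetry of transport on the Fourier side. The substitution of [(k - j, - j)] for [(k, j)]
    conjugates the form: Hermitian symmetry conjugates [u_j], incompressibility gives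
    [u_j . k = u_j . (k - j)], and [g] is symmetric. The support of [w] discards the indices that
    leave the cube. A form equal to its own conjugate is real. *)
Lemma Tri_sym_real N g u w : rl u -> dv u -> supp N w -> (forall k l, g k l = g l k) ->
  Im (Tri N g u w w) = 0.
Proof.
  intros Hr Hd Hs Hg.
  assert (E : Cconj (Tri N g u w w) = Tri N g u w w).
  { unfold Tri at 1. rewrite csum_conj.
    rewrite (csum_ext _ _ (fun k => csum (box N) (fun j =>
      RtoC (g (z3sub k j) k) * (cdot (u (z3opp j)) (z3sub k j) * vdot (w (z3sub k j)) (w k)))%C)).
    2:{ intros k _. rewrite csum_conj. apply csum_ext. intros j _.
        rewrite !Cmult_conj, Cconj_RtoC, vdot_conj, (cdot_rl u j); auto.
        rewrite (cdot_dv u j k) by auto. rewrite Hg. reflexivity. }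
    rewrite csum_swap.
    set (Phi := fun j => csum (box N) (fun k => RtoC (g k (z3sub k j)) * (cdot (u j) k * vdot (w k) (w (z3sub k j))))%C).
    transitivity (csum (box N) Phi); [|unfold Tri, Phi; apply csum_swap].
    rewrite (csum_ext _ _ (fun j => Phi (z3opp j))).
    - apply (csum_reindex (box N) z3opp z3opp Phi); auto using z3oppK.
      + intros j Hj Hn. exfalso; apply Hn, box_opp; auto.
      + intros j Hj Hn. exfalso; apply Hn, box_opp; auto.
    - intros j _. unfold Phi.
      set (G := fun k => (RtoC (g k (z3sub k (z3opp j))) * (cdot (u (z3opp j)) k * vdot (w k) (w (z3sub k (z3opp j)))))%C).
      assert (E : forall k, z3sub (z3sub k j) (z3opp j) = k) by z3.
      rewrite (csum_ext _ _ (fun k => G (z3sub k j))) by (intros k _; unfold G; now rewrite E).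
      apply (csum_reindex (box N) (fun k => z3sub k j) (fun k => z3add k j) G); auto.
      + intros; apply z3subK.
      + intros; apply z3addK.
      + intros k Hk Hn. unfold G, vdot, s3. rewrite !(Hs (z3sub k j)) by auto.
        rewrite Cconj_RtoC. ring.
      + intros k Hk Hn. unfold G, vdot, s3. replace (z3sub k (z3opp j)) with (z3add k j) by z3.
        rewrite !(Hs (z3add k j)) by auto. ring. }
  assert (Im (Cconj (Tri N g u w w)) = Im (Tri N g u w w)) by now rewrite E.
  rewrite im_conj in H. lra.
Qed.

Lemma Tri_bound N g u w v (h : Z3 -> Z3 -> R) : dv u ->
  (forall k j, Rabs (g k (z3sub k j)) * (3 * vn (u j) * wt (z3sub k j) * vn (w k) * vn (v (z3sub k j))) <= h k j) ->
  Cmod (Tri N g u w v) <= lsum (box N) (fun k => lsum (box N) (fun j => h k j)).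
Proof.
  intros Hd H. unfold Tri. rtrans Cmod_csum. apply lsum_le. intros k _.
  rtrans Cmod_csum. apply lsum_le. intros j _.
  eapply Rle_trans; [|apply H]. rewrite !Cmod_mult, Cmod_RtoC. apply Rmult_le_compat_l; [apply Rabs_pos|].
  rewrite (cdot_dv u) by auto.
  replace (3 * vn (u j) * wt (z3sub k j) * vn (w k) * vn (v (z3sub k j))) with
    ((vn (u j) * wt (z3sub k j)) * (3 * vn (w k) * vn (v (z3sub k j)))) by ring.
  apply Rmult_le_compat; auto using Cmod_ge_0, cdot_bound, vdot_bound.
Qed.

Lemma pow_sum_bound x y m : 0 <= x -> 0 <= y -> (x + y) ^ m <= 2 ^ m * (x ^ m + y ^ m).
Proof.
  intros Hx Hy. apply Rle_trans with ((2 * Rmax x y) ^ m).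
  - apply pow_incr. pose proof (Rmax_l x y). pose proof (Rmax_r x y). lra.
  - rewrite Rpow_mult_distr. apply Rmult_le_compat_l; [apply pow_le; lra|].
    pose proof (pow_le x m Hx). pose proof (pow_le y m Hy).
    unfold Rmax; destruct Rle_dec; lra.
Qed.

(** The difference of powers is of first order in [z]; this is the derivative gained by the
    commutator below. *)
Lemma pow_diff_bound x y z p : 0 <= x -> 0 <= y -> 0 <= z -> Rabs (x - y) <= z ->
  Rabs (x ^ S p - y ^ S p) <= INR (S p) * z * (y + z) ^ p.
Proof.
  intros Hx Hy Hz H. induction p as [|p IH].
  - simpl. rewrite !Rmult_1_r. lra.
  - replace (x ^ S (S p) - y ^ S (S p)) with (x * (x ^ S p - y ^ S p) + (x - y) * y ^ S p) by (simpl; ring).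
    rtrans Rabs_triang. rewrite !Rabs_mult.
    rewrite (Rabs_pos_eq x), (Rabs_pos_eq (y ^ S p)); auto using pow_le.
    assert (x <= y + z) by (apply Rabs_le_between in H; lra).
    assert (y ^ S p <= (y + z) ^ S p) by (apply pow_incr; lra).
    assert (x * Rabs (x ^ S p - y ^ S p) <= (y + z) * (INR (S p) * z * (y + z) ^ p)).
    { apply Rmult_le_compat; auto. apply Rabs_pos. }
    assert (Rabs (x - y) * y ^ S p <= z * (y + z) ^ S p).
    { apply Rmult_le_compat; auto. apply Rabs_pos. apply pow_le; auto. }
    rewrite (S_INR (S p)). simpl pow in *. lra.
Qed.

Definition KI (m : nat) : R := 3 * INR m * 2 ^ m.
Definition KII (m : nat) : R := 72 * 2 ^ m.

Lemma lsum2_split N (F : Z3 -> Z3 -> R) G1 G2 c :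
  (forall k j, F k j = c * (G1 k j + G2 k j)) ->
  lsum (box N) (fun k => lsum (box N) (fun j => F k j)) =
  c * (lsum (box N) (fun k => lsum (box N) (fun j => G1 k j)) + lsum (box N) (fun k => lsum (box N) (fun j => G2 k j))).
Proof.
  intros H. rewrite <- lsum_plus, <- lsum_scal. apply lsum_ext; intros k _.
  rewrite <- lsum_plus, <- lsum_scal. apply lsum_ext; intros j _. apply H.
Qed.

(** Commutator estimate. With [l = k - j], the weight [wt k^m wt l^m] is symmetric and contributes
    nothing, so [wt k^(2m)] may be replaced by [wt k^m (wt k^m - wt l^m)]. The bracket carries a
    factor [wt j], a derivative of [u], in place of the one that would fall on [w] at top order. *)
Lemma transport_estimate m N u w A U1 Cw W1 : (1 <= m)%nat ->
  rl u -> dv u -> supp N w -> sob m u A -> sob m w Cw ->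
  l1b (fun k => wt k * vn (u k)) U1 -> l1b (fun k => wt k * vn (w k)) W1 ->
  Rabs (IP m N w (Dn N u w)) <= KI m * (Cw * U1 * Cw + Cw * A * W1).
Proof.
  intros Hm Hr Hd Hs HA HC HU HW. destruct m as [|p]; [lia|]. set (m := S p) in *.
  rewrite IP_Dn.
  assert (E : Im (Tri N (fun k _ => wt k ^ (2 * m)) u w w) =
    Im (Tri N (fun k l => wt k ^ m * (wt k ^ m - wt l ^ m)) u w w)).
  { assert (Z : Im (Tri N (fun k l => wt k ^ m * wt l ^ m) u w w) = 0).
    { apply Tri_sym_real; auto. intros; ring. }
    rewrite <- (Rminus_0_r (Im (Tri N (fun k _ => wt k ^ (2 * m)) u w w))), <- Z. rewrite <- Im_minus. f_equal. unfold Tri. rewrite <- csum_minus.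
    apply csum_ext. intros k _. rewrite <- csum_minus. apply csum_ext. intros j _.
    rewrite Rmult_minus_distr_l, RtoC_minus. replace (wt k ^ (2 * m)) with (wt k ^ m * wt k ^ m) by (rewrite <- pow_add; f_equal; lia). ring. }
  rewrite E. rtrans im_le_Cmod.
  set (a := fun k => wt k ^ m * vn (w k)).
  assert (W : forall k, 0 < wt k) by (intros k; pose proof (wt_ge1 k); lra).
  assert (V : forall (x : coef) k, 0 <= vn (x k)) by (intros; apply vn_ge0).
  assert (Wm : forall k q, 0 <= wt k ^ q) by (intros; apply pow_le; auto; left; auto).
  eapply Rle_trans; [apply (Tri_bound _ _ _ _ _ (fun k j => KI m * (a k * (wt j * vn (u j)) * (wt (z3sub k j) ^ m * vn (w (z3sub k j)))
     + a k * (wt j ^ m * vn (u j)) * (wt (z3sub k j) * vn (w (z3sub k j)))))); auto|].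
  - intros k j. set (l := z3sub k j).
    rewrite Rabs_mult, (Rabs_pos_eq (wt k ^ m)) by auto.
    assert (Rabs (wt k ^ m - wt l ^ m) <= INR m * wt j * (2 ^ m * (wt l ^ p + wt j ^ p))).
    { eapply Rle_trans; [apply (pow_diff_bound (wt k) (wt l) (wt j)); auto; try (left; auto; fail); apply wt_diff|].
      apply Rmult_le_compat_l; [apply Rmult_le_pos; [apply pos_INR|left; auto]|].
      eapply Rle_trans; [apply pow_sum_bound; left; auto|].
      apply Rmult_le_compat_r; [pose proof (Wm l p); pose proof (Wm j p); lra|].
      apply Rle_pow; [lra|unfold m; lia]. }
    unfold KI, a. fold m.
    transitivity ((wt k ^ m * (INR m * wt j * (2 ^ m * (wt l ^ p + wt j ^ p)))) * (3 * vn (u j) * wt l * vn (w k) * vn (w l))).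
    + apply Rmult_le_compat_r.
      * repeat apply Rmult_le_pos; auto; try lra; left; auto.
      * apply Rmult_le_compat_l; auto.
    + right. unfold m. simpl pow. ring.
  - rewrite (lsum2_split _ _ (fun k j => a k * (wt j * vn (u j)) * (wt (z3sub k j) ^ m * vn (w (z3sub k j))))
      (fun k j => a k * (wt j ^ m * vn (u j)) * (wt (z3sub k j) * vn (w (z3sub k j)))) (KI m)) by reflexivity.
    apply Rmult_le_compat_l.
    { unfold KI. apply Rmult_le_pos; [|apply pow_le; lra]. apply Rmult_le_pos; [lra|apply pos_INR]. }
    apply Rplus_le_compat.
    + apply (young1 a (fun j => wt j * vn (u j)) (fun l => wt l ^ m * vn (w l))); auto;
        intros; unfold a; apply Rmult_le_pos; auto; left; auto.
    + apply (young2 a (fun j => wt j ^ m * vn (u j)) (fun l => wt l * vn (w l))); auto;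
        intros; unfold a; apply Rmult_le_pos; auto; left; auto.
Qed.

(** Here nothing cancels: the weight is split by [wt k <= wt j + wt l], and the derivative falls on
    [v], which is therefore measured in [H^(m+1)]. *)
Lemma product_estimate m N u v w A B Cw : (4 <= m)%nat -> dv u ->
  sob m u A -> sob (S m) v B -> sob m w Cw ->
  Rabs (IP m N w (Dn N u v)) <= KII m * Cw * A * B.
Proof.
  intros Hm Hd HA HB HC. rewrite IP_Dn. rtrans im_le_Cmod.
  set (a := fun k => wt k ^ m * vn (w k)).
  assert (W : forall k, 0 < wt k) by (intros k; pose proof (wt_ge1 k); lra).
  assert (V : forall (x : coef) k, 0 <= vn (x k)) by (intros; apply vn_ge0).
  assert (Wm : forall k q, 0 <= wt k ^ q) by (intros; apply pow_le; auto; left; auto).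
  eapply Rle_trans; [apply (Tri_bound _ _ _ _ _ (fun k j => (3 * 2 ^ m) * (a k * (wt j ^ m * vn (u j)) * (wt (z3sub k j) * vn (v (z3sub k j)))
     + a k * vn (u j) * (wt (z3sub k j) ^ (S m) * vn (v (z3sub k j)))))); auto|].
  - intros k j. set (l := z3sub k j). rewrite Rabs_pos_eq by auto.
    assert (wt k ^ m <= 2 ^ m * (wt j ^ m + wt l ^ m)).
    { eapply Rle_trans; [|apply pow_sum_bound; left; auto]. apply pow_incr. split; [left; auto|].
      unfold l. pose proof (wt_split k j). lra. }
    unfold a.
    transitivity ((wt k ^ m * (2 ^ m * (wt j ^ m + wt l ^ m))) * (3 * vn (u j) * wt l * vn (w k) * vn (v l))).
    + apply Rmult_le_compat_r.
      * repeat apply Rmult_le_pos; auto; try lra; left; auto.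
      * replace (wt k ^ (2 * m)) with (wt k ^ m * wt k ^ m) by (rewrite <- pow_add; f_equal; lia).
        apply Rmult_le_compat_l; auto.
    + right. simpl pow. ring.
  - rewrite (lsum2_split _ _ (fun k j => a k * (wt j ^ m * vn (u j)) * (wt (z3sub k j) * vn (v (z3sub k j))))
      (fun k j => a k * vn (u j) * (wt (z3sub k j) ^ (S m) * vn (v (z3sub k j)))) (3 * 2 ^ m)) by reflexivity.
    assert (H1 : lsum (box N) (fun k => lsum (box N) (fun j => a k * (wt j ^ m * vn (u j)) * (wt (z3sub k j) * vn (v (z3sub k j))))) <= Cw * A * (12 * B)).
    { apply (young2 a (fun j => wt j ^ m * vn (u j)) (fun l => wt l * vn (v l))); auto;
        try (intros; unfold a; apply Rmult_le_pos; auto; left; auto; fail).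
      eapply sob_l1; [|eauto]. lia. }
    assert (H2 : lsum (box N) (fun k => lsum (box N) (fun j => a k * vn (u j) * (wt (z3sub k j) ^ S m * vn (v (z3sub k j))))) <= Cw * (12 * A) * B).
    { apply (young1 a (fun j => vn (u j)) (fun l => wt l ^ S m * vn (v l))); auto;
        try (intros; unfold a; apply Rmult_le_pos; auto; left; auto; fail).
      eapply sob_l1'; [|eauto]. lia. }
    unfold KII. assert (0 < 2 ^ m) by (apply pow_lt; lra). nra.
Qed.

(** * The projected quadratic term and its truncation *)

Lemma vdot_pj z k w : cdot z k = 0%C -> vdot z (pj k w) = vdot z w.
Proof.
  intros H. unfold vdot, pj, s3. set (d := cdot w k).
  transitivity (Cconj (z 0%nat) * w 0%nat + Cconj (z 1%nat) * w 1%nat + Cconj (z 2%nat) * w 2%nat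
    - RtoC (/ ksq k) * d * Cconj (cdot z k))%C.
  - rewrite cdot_conj. unfold cdot, s3, Rdiv. rewrite !RtoC_mult. ring.
  - rewrite H, Cconj_RtoC. ring.
Qed.

Lemma IP_Bn m N w u v : dv w -> IP m N w (Bn N u v) = IP m N w (Dn N u v).
Proof. intros H. apply lsum_ext. intros k _. unfold Bn. now rewrite vdot_pj. Qed.

Lemma cdot_pj k z : cdot (pj k z) k = 0%C.
Proof.
  unfold pj. set (d := cdot z k).
  transitivity (cdot z k - RtoC ((kc 0 k * kc 0 k + kc 1 k * kc 1 k + kc 2 k * kc 2 k) / ksq k) * d)%C.
  - clearbody d. unfold cdot, s3, Rdiv. rewrite !RtoC_mult, !RtoC_plus, !RtoC_mult. ring.
  - fold d. destruct (Req_dec (ksq k) 0) as [E|E].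
    + assert (K : kc 0 k = 0 /\ kc 1 k = 0 /\ kc 2 k = 0).
      { unfold ksq in E. pose proof (pow2_ge_0 (kc 0 k)). pose proof (pow2_ge_0 (kc 1 k)). pose proof (pow2_ge_0 (kc 2 k)).
        repeat split; nra. }
      destruct K as (K0 & K1 & K2).
      assert (d = 0%C) as ->. { unfold d, cdot, s3. rewrite K0, K1, K2. ring. } ring.
    + replace ((kc 0 k * kc 0 k + kc 1 k * kc 1 k + kc 2 k * kc 2 k) / ksq k) with 1 by (unfold ksq in *; field; auto). ring.
Qed.

Lemma dv_Bn N u v : dv (Bn N u v).
Proof. intros k. apply cdot_pj. Qed.

Lemma rl_pj (z : coef) : rl z -> rl (fun k => pj k (z k)).
Proof.
  intros H k i. unfold pj. rewrite Cminus_conj, Cmult_conj, Cconj_RtoC, H. f_equal.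
  rewrite cdot_opp, (cdot_rl z) by auto. rewrite kc_opp. unfold ksq. rewrite !kc_opp.
  replace (- kc i k / ((- kc 0 k) ^ 2 + (- kc 1 k) ^ 2 + (- kc 2 k) ^ 2)) with (- (kc i k / (kc 0 k ^ 2 + kc 1 k ^ 2 + kc 2 k ^ 2))).
  - rewrite RtoC_opp. ring.
  - unfold Rdiv. replace ((- kc 0 k) ^ 2 + (- kc 1 k) ^ 2 + (- kc 2 k) ^ 2) with (kc 0 k ^ 2 + kc 1 k ^ 2 + kc 2 k ^ 2) by ring. ring.
Qed.

Lemma rl_Dn N u v : rl u -> rl v -> rl (Dn N u v).
Proof.
  intros Hu Hv k i. unfold Dn. rewrite Cmult_conj, csum_conj, Copp_conj.
  rewrite <- (csum_reindex (box N) z3opp z3opp (fun j => cdot (u j) (z3opp k) * v (z3sub (z3opp k) j) i)%C); auto using z3oppK.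
  - rewrite (csum_ext _ (fun a => cdot (u (z3opp a)) (z3opp k) * v (z3sub (z3opp k) (z3opp a)) i)%C
     (fun j => (-1) * Cconj (cdot (u j) k * v (z3sub k j) i))%C).
    + rewrite csum_scal. replace (Cconj Ci) with (-Ci)%C; [ring|]. apply ceq; simpl; ring.
    + intros j _. rewrite cdot_opp, (cdot_rl u) by auto. rewrite z3sub_opp, Hv, Cmult_conj.
      ring.
  - intros j Hj Hn. exfalso; apply Hn, box_opp; auto.
  - intros j Hj Hn. exfalso; apply Hn, box_opp; auto.
Qed.

Lemma rl_Bn N u v : rl u -> rl v -> rl (Bn N u v).
Proof. intros. apply (rl_pj (Dn N u v)). now apply rl_Dn. Qed.

Lemma cdot_csb (z w : nat -> C) k : cdot (fun i => z i - w i)%C k = (cdot z k - cdot w k)%C.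
Proof. unfold cdot, s3. ring. Qed.
Lemma cdot_cadd (z w : nat -> C) k : cdot (fun i => z i + w i)%C k = (cdot z k + cdot w k)%C.
Proof. unfold cdot, s3. ring. Qed.
Lemma cdot_cscl (c : C) (w : nat -> C) k : cdot (fun i => c * w i)%C k = (c * cdot w k)%C.
Proof. unfold cdot, s3. ring. Qed.

Lemma pj_add k (z w : nat -> C) i : pj k (fun i => z i + w i)%C i = (pj k z i + pj k w i)%C.
Proof. unfold pj. rewrite cdot_cadd. ring. Qed.
Lemma pj_scal k (c : C) (w : nat -> C) i : pj k (fun i => c * w i)%C i = (c * pj k w i)%C.
Proof. unfold pj. rewrite cdot_cscl. ring. Qed.
Lemma pj_ext k (z w : nat -> C) i : (forall i, z i = w i) -> pj k z i = pj k w i.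
Proof. intros H. unfold pj. rewrite H. now rewrite (cdot_ext z w). Qed.

Lemma Dn_addl N u u' v k i : Dn N (cadd u u') v k i = (Dn N u v k i + Dn N u' v k i)%C.
Proof.
  unfold Dn. rewrite <- Cmult_plus_distr_l, <- csum_plus. f_equal. apply csum_ext. intros j _.
  unfold cadd. rewrite cdot_cadd. ring.
Qed.
Lemma Dn_addr N u v v' k i : Dn N u (cadd v v') k i = (Dn N u v k i + Dn N u v' k i)%C.
Proof.
  unfold Dn. rewrite <- Cmult_plus_distr_l, <- csum_plus. f_equal. apply csum_ext. intros j _.
  unfold cadd. ring.
Qed.
Lemma Dn_scall N r u v k i : Dn N (cscl r u) v k i = (RtoC r * Dn N u v k i)%C.
Proof.
  unfold Dn.
  transitivity (- Ci * (csum (box N) (fun j => cdot (u j) k * v (z3sub k j) i) * RtoC r))%C; [|ring].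
  f_equal. rewrite <- csum_scal_r. apply csum_ext. intros j _. unfold cscl. rewrite cdot_cscl. ring.
Qed.
Lemma Dn_scalr N r u v k i : Dn N u (cscl r v) k i = (RtoC r * Dn N u v k i)%C.
Proof.
  unfold Dn.
  transitivity (- Ci * (csum (box N) (fun j => cdot (u j) k * v (z3sub k j) i) * RtoC r))%C; [|ring].
  f_equal. rewrite <- csum_scal_r. apply csum_ext. intros j _. unfold cscl. ring.
Qed.

Lemma Bn_addl N u u' v : Bn N (cadd u u') v = cadd (Bn N u v) (Bn N u' v).
Proof. apply coef_ext; intros. unfold Bn, cadd at 2. rewrite <- pj_add. apply pj_ext. intros; apply Dn_addl. Qed.
Lemma Bn_addr N u v v' : Bn N u (cadd v v') = cadd (Bn N u v) (Bn N u v').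
Proof. apply coef_ext; intros. unfold Bn, cadd at 2. rewrite <- pj_add. apply pj_ext. intros; apply Dn_addr. Qed.
Lemma Bn_scall N r u v : Bn N (cscl r u) v = cscl r (Bn N u v).
Proof. apply coef_ext; intros. unfold Bn, cscl at 2. rewrite <- pj_scal. apply pj_ext. intros; apply Dn_scall. Qed.
Lemma Bn_scalr N r u v : Bn N u (cscl r v) = cscl r (Bn N u v).
Proof. apply coef_ext; intros. unfold Bn, cscl at 2. rewrite <- pj_scal. apply pj_ext. intros; apply Dn_scalr. Qed.

(** This splitting puts the difference once in the transporting slot, at the price of a derivative
    of [u] only, and once in the transported slot, where the commutator estimate applies. *)
Lemma Bn_diff N u v : csb (Bn N u u) (Bn N v v) = cadd (Bn N (csb u v) u) (Bn N v (csb u v)).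
Proof.
  rewrite !csb_scl, Bn_addl, Bn_addr, Bn_scall, Bn_scalr. coef_ring.
Qed.

Lemma supp_trunc N u : supp N (trunc N u).
Proof.
  intros k i Hk. unfold trunc. destruct (inb (box N) k) eqn:E; auto.
  apply inb_true in E. tauto.
Qed.
Lemma trunc_in N u k i : In k (box N) -> trunc N u k i = u k i.
Proof. intros H. unfold trunc. apply inb_true in H. now rewrite H. Qed.
Lemma trunc_out N u k i : ~ In k (box N) -> trunc N u k i = 0%C.
Proof. intros H. now apply supp_trunc. Qed.
Lemma dv_trunc N u : dv u -> dv (trunc N u).
Proof.
  intros H k. unfold trunc. destruct (inb (box N) k); [apply H|]. unfold cdot, s3. ring.
Qed.
Lemma rl_trunc N u : rl u -> rl (trunc N u).
Proof.
  intros H k i. destruct (classic (In k (box N))) as [Hk|Hk].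
  - rewrite !trunc_in; auto. now apply box_opp.
  - rewrite !trunc_out; auto. now rewrite Cconj_RtoC. now rewrite box_opp_iff.
Qed.
Lemma IP_trunc_r m N u w : IP m N u (trunc N w) = IP m N u w.
Proof.
  apply lsum_ext. intros k Hk. unfold vdot, s3. now rewrite !trunc_in.
Qed.
Lemma sob_dom m u v A : (forall k, vn (v k) <= vn (u k)) -> sob m u A -> sob m v A.
Proof.
  intros H [HA HM]. split; auto. intros M. eapply Rle_trans; [|apply (HM M)].
  apply lsum_le. intros k _. assert (0 <= wt k ^ m) by (apply pow_le; pose proof (wt_ge1 k); lra).
  apply pow_incr. split; [apply Rmult_le_pos; auto; apply vn_ge0|]. apply Rmult_le_compat_l; auto.
Qed.
Lemma sob_trunc m N u A : sob m u A -> sob m (trunc N u) A.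
Proof.
  apply sob_dom. intros k. destruct (classic (In k (box N))) as [Hk|Hk].
  - right. apply vn_ext. intros; now apply trunc_in.
  - rewrite (vn_ext (trunc N u k) (fun _ => 0%C)) by (intros; now apply trunc_out). rewrite vn_zero. apply vn_ge0.
Qed.

(** By duality: the energy pairing of the truncated term with itself is at most its norm times
    [KII m * A * B], and one factor is divided out. *)
Lemma sob_Bn m N u v A B : (4 <= m)%nat -> dv u -> sob m u A -> sob (S m) v B ->
  sob m (trunc N (Bn N u v)) (KII m * A * B).
Proof.
  intros Hm Hd HA HB. set (z := trunc N (Bn N u v)).
  assert (Hz : supp N z) by apply supp_trunc.
  assert (Dz : dv z) by (apply dv_trunc, dv_Bn).
  pose proof (supp_sob_sqrt m N z Hz) as Sz. set (E := IP m N z z) in *.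
  assert (HE : E <= KII m * sqrt E * A * B).
  { unfold E at 1. unfold z at 2. rewrite IP_trunc_r, IP_Bn by auto.
    rtrans Rle_abs. now apply product_estimate. }
  assert (K0 : 0 <= KII m * A * B).
  { pose proof (sob_pos _ _ _ HA). pose proof (sob_pos _ _ _ HB). unfold KII. assert (0 < 2 ^ m) by (apply pow_lt; lra).
    repeat apply Rmult_le_pos; lra. }
  apply (sob_le _ _ _ _ Sz).
  pose proof (sqrt_pos E). pose proof (sqrt_sqrt E (IP_self_ge0 m N z)).
  destruct (Req_dec (sqrt E) 0) as [->|Hn]; auto.
  apply Rmult_le_reg_l with (sqrt E); lra.
Qed.

Lemma Dn_supp N M u v k i : (N <= M)%nat -> supp N u -> Dn M u v k i = Dn N u v k i.
Proof.
  intros H Hs. unfold Dn. f_equal. apply csum_support; auto.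
  - intros j _ Hn. unfold cdot, s3. rewrite !Hs by auto. ring.
  - intros j Hj Hn. exfalso. apply Hn. eapply box_mono; eauto.
Qed.
Lemma Bn_supp N M u v : (N <= M)%nat -> supp N u -> Bn M u v = Bn N u v.
Proof. intros. apply coef_ext; intros. apply pj_ext. intros. now apply Dn_supp. Qed.

(** ** Globally Lipschitz differential equations *)

Lemma deriv_mono h h' a b : a <= b -> (forall s, a <= s <= b -> derivable_pt_lim h s (h' s)) ->
  (forall s, a <= s <= b -> 0 <= h' s) -> h a <= h b.
Proof.
  intros Hab Hd Hp. destruct Hab as [Hab| ->]; [|lra].
  destruct (MVT_cor2 h h' a b Hab Hd) as (c & E & Hc). specialize (Hp c ltac:(lra)).
  assert (0 <= h' c * (b - a)) by (apply Rmult_le_pos; lra). lra.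
Qed.

Lemma deriv_exp a c s : derivable_pt_lim (fun t => c * exp (a * t)) s (c * a * exp (a * s)).
Proof. apply is_derive_Reals. auto_derive; auto. ring. Qed.

Lemma lsum_close_continuity {I} (L : list I) (f : R -> I -> R) (s : R) eps : 0 < eps ->
  (forall i, In i L -> continuity_pt (fun t => f t i) s) ->
  exists d, 0 < d /\ forall t, Rabs (t - s) < d -> lsum L (fun i => Rabs (f t i - f s i)) < eps.
Proof.
  revert eps. induction L as [|i l IH]; intros eps He Hc; simpl.
  - exists 1. split; [lra|]. auto.
  - destruct (IH (eps / 2)) as (d & Hd & H); [lra|intros; apply Hc; simpl; auto|].
    destruct (Hc i (or_introl eq_refl) (eps / 2)) as (d' & Hd' & H'); [lra|].
    exists (Rmin d d'). split; [apply Rmin_pos; auto|]. intros t Ht.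
    pose proof (Rmin_l d d'). pose proof (Rmin_r d d').
    assert (Rabs (f t i - f s i) < eps / 2).
    { destruct (Req_dec t s) as [->|Hn]; [rewrite Rminus_diag, Rabs_R0; lra|].
      apply (H' t). split; [split; [exact Logic.I|auto]|]. simpl. unfold Rdist. lra. }
    specialize (H t ltac:(lra)). lra.
Qed.

Lemma is_lim_seq_lsum {I} (L : list I) (u : nat -> I -> R) (l : I -> R) :
  (forall i, In i L -> is_lim_seq (fun n => u n i) (l i)) -> is_lim_seq (fun n => lsum L (u n)) (lsum L l).
Proof.
  induction L as [|i L IH]; intros H; simpl; [apply is_lim_seq_const|].
  apply (is_lim_seq_plus' (fun n => u n i)); [apply H; simpl; auto|apply IH; intros; apply H; simpl; auto].
Qed.

Section Picard.
Context {I : Type} (L : list I) (G : (I -> R) -> I -> R) (Lam : R).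
Hypothesis Lam_pos : 0 < Lam.
Hypothesis G_lip : forall y z, lsum L (fun i => Rabs (G y i - G z i)) <= Lam * lsum L (fun i => Rabs (y i - z i)).
Hypothesis G_out : forall y i, ~ In i L -> G y i = 0.
Variable y0 : I -> R.

(** Picard iterates. Time runs over the whole line because [derivable_pt_lim] is two-sided also at
    the initial time. *)
Fixpoint pic (n : nat) (t : R) (i : I) : R :=
  match n with
  | 0%nat => y0 i
  | S n' => y0 i + RInt (fun s => G (pic n' s) i) 0 t
  end.

Lemma G_lip1 y z i : Rabs (G y i - G z i) <= Lam * lsum L (fun i => Rabs (y i - z i)).
Proof.
  destruct (classic (In i L)) as [Hi|Hi].
  - eapply Rle_trans; [|apply G_lip]. apply (lsum_term_le L (fun i => Rabs (G y i - G z i))); auto.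
    intros; apply Rabs_pos.
  - rewrite !G_out by auto. rewrite Rminus_diag, Rabs_R0. apply Rmult_le_pos; [lra|].
    apply lsum_nonneg. intros; apply Rabs_pos.
Qed.

Lemma G_continuity (f : R -> I -> R) s i : (forall j, In j L -> continuity_pt (fun t => f t j) s) ->
  continuity_pt (fun t => G (f t) i) s.
Proof.
  intros Hc eps He.
  destruct (lsum_close_continuity L f s (eps / Lam)) as (d & Hd & H); auto.
  { apply Rdiv_lt_0_compat; auto. }
  exists d. split; auto. intros t [_ Ht]. simpl in *. unfold Rdist in *.
  eapply Rle_lt_trans; [apply G_lip1|]. specialize (H t Ht).
  apply Rmult_lt_compat_l with (r := Lam) in H; auto.
  replace (Lam * (eps / Lam)) with eps in H by (field; lra). auto.
Qed.

Lemma pic_cont n i s : continuity_pt (fun t => pic n t i) s.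
Proof.
  revert i s. induction n as [|n IH]; intros i s; simpl.
  - apply continuity_pt_const. intros x y; auto.
  - apply derivable_continuous_pt. exists (0 + G (pic n s) i).
    apply (derivable_pt_lim_plus (fun _ => y0 i)); [apply derivable_pt_lim_const|].
    apply is_derive_Reals. apply (is_derive_RInt (fun r => G (pic n r) i) _ 0).
    + apply filter_forall. intros b. apply (@RInt_correct R_CompleteNormedModule), ex_RInt_continuous.
      intros z _. apply continuity_pt_filterlim. apply G_continuity. auto.
    + apply continuity_pt_filterlim. apply G_continuity. auto.
Qed.

Lemma pic_deriv n i s : derivable_pt_lim (fun t => pic (S n) t i) s (G (pic n s) i).
Proof.
  simpl. replace (G (pic n s) i) with (0 + G (pic n s) i) by ring.
  apply (derivable_pt_lim_plus (fun _ => y0 i)); [apply derivable_pt_lim_const|].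
  apply is_derive_Reals. apply (is_derive_RInt (fun r => G (pic n r) i) _ 0).
  - apply filter_forall. intros b. apply (@RInt_correct R_CompleteNormedModule), ex_RInt_continuous.
    intros z _. apply continuity_pt_filterlim, G_continuity. intros; apply pic_cont.
  - apply continuity_pt_filterlim, G_continuity. intros; apply pic_cont.
Qed.

Lemma pic_0 n i : pic n 0 i = y0 i.
Proof. destruct n; simpl; auto. rewrite RInt_point. unfold zero; simpl. ring. Qed.

(* Summing against the signs of [z t] reduces to a scalar comparison. *)
Lemma vector_comparison (z z' : R -> I -> R) K t : 0 <= K ->
  (forall i, z 0 i = 0) -> (forall i s, derivable_pt_lim (fun r => z r i) s (z' s i)) ->
  (forall s, lsum L (fun i => Rabs (z' s i)) <= K * (2 * Lam) * exp (2 * Lam * Rabs s)) ->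
  lsum L (fun i => Rabs (z t i)) <= K * exp (2 * Lam * Rabs t).
Proof.
  intros HK H0 Hd Hb.
  set (sg := fun i => if Rle_dec 0 (z t i) then 1 else -1).
  set (g := fun s => lsum L (fun i => sg i * z s i)).
  set (g' := fun s => lsum L (fun i => sg i * z' s i)).
  assert (Eg : lsum L (fun i => Rabs (z t i)) = g t).
  { apply lsum_ext. intros i _. unfold sg. destruct Rle_dec; [rewrite Rabs_pos_eq by auto|rewrite Rabs_left by lra]; ring. }
  assert (Hg0 : g 0 = 0). { apply lsum_zero. intros i _. rewrite H0. ring. }
  assert (Hgd : forall s, derivable_pt_lim g s (g' s)).
  { intros s. apply (lsum_derive L (fun i r => sg i * z r i) (fun i r => sg i * z' r i)).
    intros i _. apply (derivable_pt_lim_scal (fun r => z r i)). auto. }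
  assert (Hgb : forall s, Rabs (g' s) <= K * (2 * Lam) * exp (2 * Lam * Rabs s)).
  { intros s. rtrans lsum_abs. eapply Rle_trans; [|apply Hb].
    apply lsum_le. intros i _. rewrite Rabs_mult. right.
    unfold sg. destruct Rle_dec; [rewrite Rabs_R1|rewrite Rabs_left by lra]; ring. }
  rewrite Eg. destruct (Rle_dec 0 t) as [Ht|Ht].
  - assert (K * exp (2 * Lam * 0) - g 0 <= K * exp (2 * Lam * t) - g t).
    { apply (deriv_mono (fun s => K * exp (2 * Lam * s) - g s) (fun s => K * (2 * Lam) * exp (2 * Lam * s) - g' s)); auto.
      - intros s _. apply (derivable_pt_lim_minus (fun s => K * exp (2 * Lam * s)) g); auto. apply deriv_exp.
      - intros s Hs. specialize (Hgb s). rewrite (Rabs_pos_eq s) in Hgb by lra.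
        pose proof (Rle_abs (g' s)). lra. }
    rewrite Rmult_0_r, exp_0 in H. rewrite (Rabs_pos_eq t) by auto. lra.
  - assert (- K * exp (- 2 * Lam * t) + g t <= - K * exp (- 2 * Lam * 0) + g 0).
    { apply (deriv_mono (fun s => - K * exp (- 2 * Lam * s) + g s) (fun s => - K * (- 2 * Lam) * exp (- 2 * Lam * s) + g' s)); [lra| |].
      - intros s _. apply (derivable_pt_lim_plus (fun s => - K * exp (- 2 * Lam * s)) g); auto. apply deriv_exp.
      - intros s Hs. specialize (Hgb s). rewrite (Rabs_left1 s) in Hgb by lra.
        apply Rabs_le_between in Hgb. replace (2 * Lam * - s) with (- 2 * Lam * s) in Hgb by ring. lra. }
    rewrite Rmult_0_r, exp_0 in H. rewrite (Rabs_left t) by lra.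
    replace (2 * Lam * - t) with (- 2 * Lam * t) by ring. lra.
Qed.

Let K0 : R := lsum L (fun i => Rabs (G y0 i)) / (2 * Lam).

Lemma K0_pos : 0 <= K0.
Proof. apply Rdiv_le_0_compat; [apply lsum_nonneg; intros; apply Rabs_pos|lra]. Qed.

(** The weight [exp (2 * Lam * Rabs t)] turns Picard's map into a contraction of ratio [1/2] on all
    of R at once, so the time interval is never subdivided. *)
Lemma pic_step n t : lsum L (fun i => Rabs (pic (S n) t i - pic n t i)) <= K0 * / 2 ^ n * exp (2 * Lam * Rabs t).
Proof.
  revert t. induction n as [|n IH]; intros t.
  - apply (vector_comparison (fun t i => pic 1 t i - pic 0 t i) (fun _ i => G y0 i - 0)).
    + simpl. rewrite Rinv_1, Rmult_1_r. apply K0_pos.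
    + intros i. rewrite !pic_0. ring.
    + intros i s. apply (derivable_pt_lim_minus (fun r => pic 1 r i)).
      apply (pic_deriv 0). apply derivable_pt_lim_const.
    + intros s. rewrite (lsum_ext _ _ (fun i => Rabs (G y0 i))) by (intros; now rewrite Rminus_0_r).
      simpl pow. rewrite Rinv_1, Rmult_1_r.
      replace (K0 * (2 * Lam)) with (lsum L (fun i => Rabs (G y0 i))) by (unfold K0; field; lra).
      assert (1 <= exp (2 * Lam * Rabs s)).
      { rewrite <- exp_0 at 1. destruct (Req_dec (2 * Lam * Rabs s) 0) as [->|Hn]; [lra|].
        left. apply exp_increasing. pose proof (Rabs_pos s). assert (0 <= 2 * Lam * Rabs s) by (apply Rmult_le_pos; lra). lra. }
      assert (0 <= lsum L (fun i => Rabs (G y0 i))) by (apply lsum_nonneg; intros; apply Rabs_pos). nra.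
  - apply (vector_comparison (fun t i => pic (S (S n)) t i - pic (S n) t i) (fun t i => G (pic (S n) t) i - G (pic n t) i)).
    + apply Rmult_le_pos; [apply K0_pos|]. left. apply Rinv_0_lt_compat, pow_lt; lra.
    + intros i. rewrite !pic_0. ring.
    + intros i s. apply (derivable_pt_lim_minus (fun r => pic (S (S n)) r i)); apply pic_deriv.
    + intros s. rtrans G_lip.
      eapply Rle_trans; [apply Rmult_le_compat_l; [lra|apply IH]|].
      right. simpl pow. field. apply pow_nonzero; lra.
Qed.

Lemma pic_diff n p t : lsum L (fun i => Rabs (pic (n + p) t i - pic n t i)) <= 2 * K0 * / 2 ^ n * exp (2 * Lam * Rabs t) * (1 - / 2 ^ p).
Proof.
  induction p as [|p IH].
  - rewrite Nat.add_0_r. rewrite lsum_zero; [simpl; rewrite Rinv_1; lra|].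
    intros; rewrite Rminus_diag; apply Rabs_R0.
  - rewrite Nat.add_succ_r.
    apply Rle_trans with (lsum L (fun i => Rabs (pic (S (n + p)) t i - pic (n + p) t i) + Rabs (pic (n + p) t i - pic n t i))).
    + apply lsum_le. intros i _. replace (pic (S (n + p)) t i - pic n t i) with ((pic (S (n + p)) t i - pic (n + p) t i) + (pic (n + p) t i - pic n t i)) by ring.
      apply Rabs_triang.
    + rewrite lsum_plus. pose proof (pic_step (n + p) t).
      eapply Rle_trans; [apply Rplus_le_compat; [apply H|apply IH]|]. right.
      rewrite pow_add. simpl pow. field. split; apply pow_nonzero; lra.
Qed.

Definition picl (t : R) (i : I) : R := real (Lim_seq (fun n => pic n t i)).

Lemma pic_out n t i : ~ In i L -> pic n t i = y0 i.
Proof.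
  intros Hi. destruct n; simpl; auto.
  rewrite (RInt_ext _ (fun _ => 0)) by (intros; now apply G_out). rewrite RInt_const. unfold scal; simpl. unfold mult; simpl. ring.
Qed.

Lemma half_pow_small B eps : 0 < eps -> exists n, B * / 2 ^ n < eps.
Proof.
  intros He. destruct (Rle_dec B 0) as [Hb|Hb].
  - exists 0%nat. simpl. rewrite Rinv_1. lra.
  - assert (H1 : Rabs (/ 2) < 1) by (rewrite Rabs_pos_eq; lra).
    destruct (pow_lt_1_zero (/ 2) H1 (eps / B)) as [n Hn]; [apply Rdiv_lt_0_compat; lra|].
    exists n. specialize (Hn n (le_n _)). rewrite pow_inv in Hn.
    rewrite Rabs_pos_eq in Hn by (left; apply Rinv_0_lt_compat, pow_lt; lra).
    apply Rmult_lt_compat_l with (r := B) in Hn; [|lra].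
    replace (B * (eps / B)) with eps in Hn by (field; lra). auto.
Qed.

Lemma pic_diff1 n p t i : Rabs (pic (n + p) t i - pic n t i) <= 2 * K0 * / 2 ^ n * exp (2 * Lam * Rabs t).
Proof.
  assert (Q : 0 <= 2 * K0 * / 2 ^ n * exp (2 * Lam * Rabs t)).
  { pose proof K0_pos. apply Rmult_le_pos; [apply Rmult_le_pos; [lra|]|left; apply exp_pos].
    left. apply Rinv_0_lt_compat, pow_lt; lra. }
  destruct (classic (In i L)) as [Hi|Hi].
  - eapply Rle_trans; [apply (lsum_term_le L (fun i => Rabs (pic (n + p) t i - pic n t i))); auto; intros; apply Rabs_pos|].
    rtrans pic_diff.
    assert (0 < / 2 ^ p) by (apply Rinv_0_lt_compat, pow_lt; lra). nra.
  - rewrite !pic_out by auto. rewrite Rminus_diag, Rabs_R0. auto.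
Qed.

Lemma pic_cv t i : is_lim_seq (fun n => pic n t i) (picl t i).
Proof.
  assert (H : ex_finite_lim_seq (fun n => pic n t i)).
  { apply ex_lim_seq_cauchy_corr. intros eps.
    destruct (half_pow_small (2 * K0 * exp (2 * Lam * Rabs t)) (eps / 2)) as [n Hn].
    { destruct eps; simpl; lra. }
    exists n. intros p q Hp Hq.
    pose proof (pic_diff1 n (p - n) t i) as H1. pose proof (pic_diff1 n (q - n) t i) as H2.
    replace (n + (p - n))%nat with p in H1 by lia. replace (n + (q - n))%nat with q in H2 by lia.
    replace (pic p t i - pic q t i) with ((pic p t i - pic n t i) - (pic q t i - pic n t i)) by ring.
    eapply Rle_lt_trans; [apply Rabs_triang|]. rewrite Rabs_Ropp. lra. }
  apply Lim_seq_correct' in H. exact H.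
Qed.

Lemma pic_close n t : lsum L (fun i => Rabs (picl t i - pic n t i)) <= 2 * K0 * / 2 ^ n * exp (2 * Lam * Rabs t).
Proof.
  assert (H : is_lim_seq (fun p => lsum L (fun i => Rabs (pic (n + p) t i - pic n t i))) (lsum L (fun i => Rabs (picl t i - pic n t i)))).
  { apply is_lim_seq_lsum. intros i _.
    apply (is_lim_seq_abs _ (Finite (picl t i - pic n t i))).
    apply is_lim_seq_minus'; [|apply is_lim_seq_const].
    apply is_lim_seq_ext with (u := fun p => pic (p + n) t i); [intros; f_equal; lia|].
    apply (is_lim_seq_incr_n (fun n => pic n t i)). apply pic_cv. }
  apply (is_lim_seq_le _ (fun _ => 2 * K0 * / 2 ^ n * exp (2 * Lam * Rabs t)) _ (Finite (2 * K0 * / 2 ^ n * exp (2 * Lam * Rabs t)))) in H; [exact H| |apply is_lim_seq_const].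
  intros p. rtrans pic_diff.
  assert (Q : 0 <= 2 * K0 * / 2 ^ n * exp (2 * Lam * Rabs t)).
  { pose proof K0_pos. apply Rmult_le_pos; [apply Rmult_le_pos; [lra|]|left; apply exp_pos].
    left. apply Rinv_0_lt_compat, pow_lt; lra. }
  assert (0 < / 2 ^ p) by (apply Rinv_0_lt_compat, pow_lt; lra). nra.
Qed.

(** The derivatives [G (pic n)] converge uniformly near each time, so the limit of the iterates may
    be differentiated. *)
Theorem global_lipschitz_ode : exists y : R -> I -> R,
  (forall i, y 0 i = y0 i) /\ forall t i, derivable_pt_lim (fun s => y s i) t (G (y t) i).
Proof.
  exists picl. split.
  - intros i. unfold picl. rewrite (is_lim_seq_unique _ (Finite (y0 i))); auto.
    apply is_lim_seq_ext with (u := fun _ => y0 i); [intros; now rewrite pic_0|apply is_lim_seq_const].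
  - intros t i.
    apply (CVU_derivable (fun n s => pic (S n) s i) (fun n s => G (pic n s) i) (fun s => picl s i) (fun s => G (picl s) i) t (mkposreal 1 Rlt_0_1)).
    + intros eps He.
      destruct (half_pow_small (Lam * (2 * K0 * exp (2 * Lam * (Rabs t + 1)))) eps He) as [n Hn].
      exists n. intros m s Hm Hs. unfold Boule in Hs. simpl in Hs.
      eapply Rle_lt_trans; [apply G_lip1|].
      eapply Rle_lt_trans; [apply Rmult_le_compat_l; [lra|apply pic_close]|].
      eapply Rle_lt_trans; [|apply Hn]. rewrite !Rmult_assoc.
      assert (E : exp (2 * (Lam * Rabs s)) <= exp (2 * (Lam * (Rabs t + 1)))).
      { assert (Rabs s <= Rabs t + 1).
        { replace s with (t + (s - t)) by ring. rtrans Rabs_triang. lra. }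
        assert (D : 2 * (Lam * Rabs s) <= 2 * (Lam * (Rabs t + 1))) by nra.
        destruct D as [D| ->]; [left; now apply exp_increasing|lra]. }
      assert (F : / 2 ^ m <= / 2 ^ n).
      { apply Rinv_le_contravar; [apply pow_lt; lra|apply Rle_pow; auto; lra]. }
      pose proof K0_pos. pose proof (exp_pos (2 * (Lam * Rabs s))).
      assert (0 < / 2 ^ m) by (apply Rinv_0_lt_compat, pow_lt; lra).
      assert (/ 2 ^ m * exp (2 * (Lam * Rabs s)) <= exp (2 * (Lam * (Rabs t + 1))) * / 2 ^ n).
      { rewrite (Rmult_comm (exp _)). apply Rmult_le_compat; lra. }
      assert (0 <= Lam * (2 * K0)) by nra.
      rewrite <- !Rmult_assoc. rewrite <- !Rmult_assoc in H2.
      assert (T := Rmult_le_compat_l _ _ _ H3 H2). rewrite <- !Rmult_assoc in *. lra.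
    + intros s _. apply is_lim_seq_Reals.
      apply (is_lim_seq_incr_1 (fun n => pic n s i)). apply pic_cv.
    + intros n s _. apply pic_deriv.
    + unfold Boule; simpl. rewrite Rminus_diag, Rabs_R0. lra.
Qed.
End Picard.

(** ** Galerkin approximations *)

(** Components are indexed by all of [nat]; forcing those beyond the third to vanish makes equality
    of fields plain equality of coefficients. *)
Definition n3 (u : coef) : Prop := forall k i, (3 <= i)%nat -> u k i = 0%C.
Definition cder (u : R -> coef) (s : R) (d : coef) : Prop := forall k i,
  derivable_pt_lim (fun r => Re (u r k i)) s (Re (d k i)) /\
  derivable_pt_lim (fun r => Im (u r k i)) s (Im (d k i)).

Lemma kc_ge3 i k : (3 <= i)%nat -> kc i k = 0.
Proof. intros H. unfold kc. destruct k as [[a b] c]. destruct i as [|[|[|i]]]; try lia. reflexivity. Qed.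

Lemma n3_pj k (z : nat -> C) i : (3 <= i)%nat -> z i = 0%C -> pj k z i = 0%C.
Proof. intros H Hz. unfold pj. rewrite Hz, kc_ge3 by auto. unfold Rdiv. rewrite Rmult_0_l. ring. Qed.

Lemma n3_Bn N u v : n3 v -> n3 (Bn N u v).
Proof.
  intros H k i Hi. unfold Bn. apply n3_pj; auto. unfold Dn. rewrite csum_zero; [ring|].
  intros j _. rewrite H by auto. ring.
Qed.
Lemma n3_trunc N u : n3 u -> n3 (trunc N u).
Proof. intros H k i Hi. unfold trunc. destruct (inb _ _); auto. Qed.

Lemma deriv_zero_const f s : (forall t, derivable_pt_lim f t 0) -> f s = f 0.
Proof.
  intros H. destruct (Rle_dec 0 s).
  - apply Rle_antisym.
    + assert (- f 0 <= - f s); [|lra]. apply (deriv_mono (fun t => - f t) (fun _ => - 0)); auto; intros; [|lra].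
      apply (derivable_pt_lim_opp f); auto.
    + apply (deriv_mono f (fun _ => 0)); auto; intros; lra.
  - apply Rle_antisym.
    + apply (deriv_mono f (fun _ => 0)); auto; intros; lra.
    + assert (- f s <= - f 0); [|lra]. apply (deriv_mono (fun t => - f t) (fun _ => - 0)); auto; try lra; intros; [|lra].
      apply (derivable_pt_lim_opp f); auto.
Qed.
Lemma C_zero_const (z : R -> C) s : (forall t, derivable_pt_lim (fun r => Re (z r)) t 0 /\ derivable_pt_lim (fun r => Im (z r)) t 0) ->
  z 0 = 0%C -> z s = 0%C.
Proof.
  intros H H0. rewrite <- H0. apply ceq; [apply (deriv_zero_const (fun r => Re (z r)))|apply (deriv_zero_const (fun r => Im (z r)))]; apply H.
Qed.

Lemma deriv_ext f g s l : (forall t, f t = g t) -> derivable_pt_lim f s l -> derivable_pt_lim g s l.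
Proof. intros H. replace g with f; auto. apply functional_extensionality; auto. Qed.

Lemma deriv_val f s l l' : l = l' -> derivable_pt_lim f s l -> derivable_pt_lim f s l'.
Proof. now intros ->. Qed.

(** * Cut-off functions and bounded Lipschitz maps *)

Definition clip (M x : R) : R := Rmax (- M) (Rmin M x).
Definition clamp01 (x : R) : R := Rmax 0 (Rmin 1 x).

Ltac mm := unfold clip, clamp01, Rmax, Rmin in *; repeat destruct Rle_dec; try lra.

Lemma clip_bound M x : 0 <= M -> Rabs (clip M x) <= M.
Proof. intros. apply Rabs_le. mm. Qed.
Lemma clip_lip M x y : Rabs (clip M x - clip M y) <= Rabs (x - y).
Proof. unfold Rabs at 2. destruct Rcase_abs; apply Rabs_le; mm. Qed.
Lemma clip_opp M x : 0 <= M -> clip M (- x) = - clip M x.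
Proof. intros. mm. Qed.
Lemma clip_id M x : Rabs x <= M -> clip M x = x.
Proof. intros H. apply Rabs_le_between in H. mm. Qed.
Lemma clip_inactive M x : 0 < M -> Rabs (clip M x) < M -> clip M x = x.
Proof. intros HM H. apply Rabs_lt_between in H. mm. Qed.
Lemma clamp01_lip x y : Rabs (clamp01 x - clamp01 y) <= Rabs (x - y).
Proof. unfold Rabs at 2. destruct Rcase_abs; apply Rabs_le; mm. Qed.
Lemma clamp01_bound x : 0 <= clamp01 x <= 1.
Proof. mm. Qed.

Section BoundedLipschitz.
Context {I : Type} (L : list I).
Definition dist1 (y z : I -> R) : R := lsum L (fun i => Rabs (y i - z i)).
(** Boundedness is part of the class because products of Lipschitz functions are Lipschitz only when
    the factors are bounded. *)
Definition BL (f : (I -> R) -> R) : Prop := exists B, forall y z, Rabs (f y) <= B /\ Rabs (f y - f z) <= B * dist1 y z.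
Definition BLC (f : (I -> R) -> C) : Prop := BL (fun y => Re (f y)) /\ BL (fun y => Im (f y)).

Lemma dist1_pos y z : 0 <= dist1 y z.
Proof. apply lsum_nonneg. intros; apply Rabs_pos. Qed.

Lemma BL_const c : BL (fun _ => c).
Proof.
  exists (Rabs c). intros y z. split; [lra|]. rewrite Rminus_diag, Rabs_R0.
  apply Rmult_le_pos; [apply Rabs_pos|apply dist1_pos].
Qed.
Lemma BL_plus f g : BL f -> BL g -> BL (fun y => f y + g y).
Proof.
  intros [B H] [B' H']. exists (B + B'). intros y z. destruct (H y z), (H' y z). split.
  - rtrans Rabs_triang. lra.
  - replace (f y + g y - (f z + g z)) with ((f y - f z) + (g y - g z)) by ring.
    rtrans Rabs_triang. lra.
Qed.
Lemma BL_mult f g : BL f -> BL g -> BL (fun y => f y * g y).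
Proof.
  intros [B H] [B' H']. exists (2 * (B * B') + B * B'). intros y z. destruct (H y z), (H' y z).
  destruct (H z z), (H' z z).
  pose proof (Rabs_pos (f y)). pose proof (Rabs_pos (g y)). pose proof (dist1_pos y z).
  assert (0 <= B * B') by (apply Rmult_le_pos; lra).
  split.
  - rewrite Rabs_mult. assert (Rabs (f y) * Rabs (g y) <= B * B') by (apply Rmult_le_compat; lra). lra.
  - replace (f y * g y - f z * g z) with ((f y - f z) * g y + f z * (g y - g z)) by ring.
    rtrans Rabs_triang. rewrite !Rabs_mult.
    assert (Rabs (f y - f z) * Rabs (g y) <= (B * dist1 y z) * B') by (apply Rmult_le_compat; auto; apply Rabs_pos).
    assert (Rabs (f z) * Rabs (g y - g z) <= B * (B' * dist1 y z)) by (apply Rmult_le_compat; auto; apply Rabs_pos).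
    assert (0 <= B * B' * dist1 y z) by (apply Rmult_le_pos; auto). lra.
Qed.
Lemma BL_ext f g : (forall y, f y = g y) -> BL f -> BL g.
Proof. intros H. replace g with f; auto. apply functional_extensionality; auto. Qed.
Lemma BL_lsum {A} (l : list A) (f : A -> (I -> R) -> R) : (forall a, In a l -> BL (f a)) -> BL (fun y => lsum l (fun a => f a y)).
Proof.
  induction l as [|a l IH]; intros H; simpl; [apply BL_const|].
  apply BL_plus; [apply H; simpl; auto|apply IH; intros; apply H; simpl; auto].
Qed.
Lemma BL_clip M i : 0 <= M -> In i L -> BL (fun y => clip M (y i)).
Proof.
  intros HM Hi. exists (M + 1). intros y z. split.
  - pose proof (clip_bound M (y i) HM). lra.
  - rtrans clip_lip.
    assert (Rabs (y i - z i) <= dist1 y z).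
    { apply (lsum_term_le L (fun i => Rabs (y i - z i))); auto. intros; apply Rabs_pos. }
    pose proof (dist1_pos y z). nra.
Qed.
Lemma BL_clamp01 f : BL f -> BL (fun y => clamp01 (f y)).
Proof.
  intros [B H]. exists (B + 1). intros y z. destruct (H y z). pose proof (Rabs_pos (f y)). pose proof (dist1_pos y z). split.
  - pose proof (clamp01_bound (f y)). rewrite Rabs_pos_eq by lra. lra.
  - rtrans clamp01_lip. lra.
Qed.
Lemma BLC_const c : BLC (fun _ => c).
Proof. split; apply BL_const. Qed.
Lemma BLC_plus f g : BLC f -> BLC g -> BLC (fun y => f y + g y)%C.
Proof. intros [] []. split; simpl; apply BL_plus; auto. Qed.
Lemma BLC_mult f g : BLC f -> BLC g -> BLC (fun y => f y * g y)%C.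
Proof.
  intros [] []. split; simpl.
  - apply BL_ext with (fun y => Re (f y) * Re (g y) + (-1) * (Im (f y) * Im (g y))); [intros; unfold Re, Im; ring|].
    apply BL_plus; [|apply BL_mult; [apply BL_const|]]; apply BL_mult; auto.
  - apply BL_plus; apply BL_mult; auto.
Qed.
Lemma BLC_RtoC f : BL f -> BLC (fun y => RtoC (f y)).
Proof. intros. split; simpl; auto. apply BL_const. Qed.
Lemma BLC_conj f : BLC f -> BLC (fun y => Cconj (f y)).
Proof.
  intros []. split; simpl; auto. apply BL_ext with (fun y => (-1) * Im (f y)); [intros; unfold Im; ring|].
  apply BL_mult; auto. apply BL_const.
Qed.
Lemma BLC_minus f g : BLC f -> BLC g -> BLC (fun y => f y - g y)%C.
Proof.
  intros Hf Hg. assert (H : BLC (fun y => f y + RtoC (-1) * g y)%C).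
  { apply BLC_plus; auto. apply BLC_mult; auto. apply BLC_const. }
  destruct H as [H1 H2]. split; [eapply BL_ext; [|exact H1]|eapply BL_ext; [|exact H2]]; intros; simpl; unfold Re, Im; simpl; ring.
Qed.
Lemma BLC_csum {A} (l : list A) (f : A -> (I -> R) -> C) : (forall a, In a l -> BLC (f a)) -> BLC (fun y => csum l (fun a => f a y)).
Proof. intros H. split; simpl; apply BL_lsum; apply H. Qed.
Lemma BLC_s3 (f : nat -> (I -> R) -> C) : (forall i, BLC (f i)) -> BLC (fun y => s3 (fun i => f i y)).
Proof. intros H. unfold s3. repeat apply BLC_plus; auto. Qed.
Lemma BLC_cdot (f : nat -> (I -> R) -> C) k : (forall i, BLC (f i)) -> BLC (fun y => cdot (fun i => f i y) k).
Proof. intros H. apply (BLC_s3 (fun i y => f i y * RtoC (kc i k))%C). intros; apply BLC_mult; auto. apply BLC_const. Qed.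

Lemma BL_field_lip (G : (I -> R) -> I -> R) (L' : list I) : (forall i, In i L' -> BL (fun y => G y i)) ->
  exists Lam, 0 < Lam /\ forall y z, lsum L' (fun i => Rabs (G y i - G z i)) <= Lam * dist1 y z.
Proof.
  induction L' as [|i l IH]; intros H.
  - exists 1. split; [lra|]. intros. simpl. pose proof (dist1_pos y z). lra.
  - destruct IH as (Lam & HL & Hl); [intros; apply H; simpl; auto|].
    destruct (H i (or_introl eq_refl)) as [B HB]. exists (Lam + B).
    assert (0 <= B). { destruct (HB (fun _ => 0) (fun _ => 0)). eapply Rle_trans; [apply Rabs_pos|eauto]. }
    split; [lra|]. intros y z. simpl. destruct (HB y z). specialize (Hl y z). lra.
Qed.
End BoundedLipschitz.

Section CutoffGalerkin.
Variables (N : nat) (mu K : R) (c0 F : coef).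
Hypotheses (K_pos : 0 <= K) (c0_rl : rl c0) (c0_dv : dv c0) (c0_n3 : n3 c0)
  (F_rl : rl F) (F_dv : dv F) (F_n3 : n3 F).

Let Idx : Type := (Z3 * nat * bool)%type.
Let L : list Idx := list_prod (list_prod (box N) [0;1;2]%nat) [true; false].
(** Energy at most [K + 1] bounds every coefficient by [sqrt (K + 1)], strictly below [K + 2], so
    clipping at this level is then inactive. *)
Let M : R := K + 2.

Lemma in_L k i b : In (k, i, b) L <-> In k (box N) /\ (i < 3)%nat.
Proof.
  unfold L. rewrite !in_prod_iff. simpl. split.
  - intros [[H1 H2] _]. split; auto. lia.
  - intros [H1 H2]. split; [split; auto; lia|destruct b; auto].
Qed.

(** Clipping makes the quadratic field globally Lipschitz. Averaging over [k] and [- k] enforces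
    Hermitian symmetry for arbitrary [y], so that the right-hand side has it by construction. *)
Definition uc (y : Idx -> R) : coef := fun k i =>
  if inb L (k, i, true) then
    ((clip M (y (k, i, true)) + clip M (y (z3opp k, i, true))) / 2,
     (clip M (y (k, i, false)) - clip M (y (z3opp k, i, false))) / 2)
  else 0%C.
(** The nonlinearity is switched off gradually between the energies [K] and [K + 1]. *)
Definition th (y : Idx -> R) : R := clamp01 (K + 1 - IP 4 N (uc y) (uc y)).
Definition Vf (y : Idx -> R) : coef := cadd (cscl (mu * th y) (Bn N (uc y) (uc y))) F.
Definition Gf (y : Idx -> R) (i : Idx) : R :=
  if inb L i then match i with (k, a, b) => if b then Re (Vf y k a) else Im (Vf y k a) end else 0.

Lemma BL_uc k i : BLC L (fun y => uc y k i).
Proof.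
  unfold uc. destruct (inb L (k, i, true)) eqn:E; [|apply BLC_const].
  apply inb_true, in_L in E. destruct E as [E1 E2].
  assert (HM : 0 <= M) by (unfold M; lra).
  assert (H : forall b, BL L (fun y => clip M (y (k, i, b)))) by (intros; apply BL_clip; auto; apply in_L; auto).
  assert (H' : forall b, BL L (fun y => clip M (y (z3opp k, i, b)))).
  { intros; apply BL_clip; auto; apply in_L; auto using box_opp. }
  split; simpl.
  - apply BL_mult; [apply BL_plus|apply BL_const]; auto.
  - apply BL_mult; [|apply BL_const]. apply BL_ext with (fun y => clip M (y (k, i, false)) + (-1) * clip M (y (z3opp k, i, false))); [intros; ring|].
    apply BL_plus; auto. apply BL_mult; auto. apply BL_const.
Qed.

Lemma BL_Dn k i : BLC L (fun y => Dn N (uc y) (uc y) k i).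
Proof.
  unfold Dn. apply BLC_mult; [apply BLC_const|]. apply (BLC_csum L (box N) (fun j y => cdot (uc y j) k * uc y (z3sub k j) i)%C).
  intros j _. apply BLC_mult; [|apply BL_uc]. apply (BLC_cdot L (fun a y => uc y j a)). intros; apply BL_uc.
Qed.

Lemma BL_Vf k i : BLC L (fun y => Vf y k i).
Proof.
  unfold Vf, cadd, cscl. apply BLC_plus; [|apply BLC_const]. apply BLC_mult.
  - apply BLC_RtoC. apply BL_mult; [apply BL_const|]. apply BL_clamp01.
    apply BL_ext with (fun y => (K + 1) + (-1) * IP 4 N (uc y) (uc y)); [intros; ring|].
    apply BL_plus; [apply BL_const|]. apply BL_mult; [apply BL_const|].
    unfold IP. apply (BL_lsum L (box N) (fun k y => wt k ^ (2 * 4) * Re (vdot (uc y k) (uc y k)))).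
    intros j _. apply BL_mult; [apply BL_const|].
    apply (BLC_s3 L (fun i y => Cconj (uc y j i) * uc y j i)%C).
    intros a. apply BLC_mult; [apply BLC_conj|]; apply BL_uc.
  - unfold Bn, pj. apply BLC_minus; [apply BL_Dn|]. apply BLC_mult; [apply BLC_const|].
    apply (BLC_cdot L (fun a y => Dn N (uc y) (uc y) k a)). intros; apply BL_Dn.
Qed.

Lemma uc_rl y : rl (uc y).
Proof.
  intros k i. unfold uc.
  destruct (inb L (k, i, true)) eqn:E.
  - assert (E' : inb L (z3opp k, i, true) = true).
    { apply inb_true, in_L. apply inb_true, in_L in E. destruct E; auto using box_opp. }
    rewrite E', z3oppK. apply ceq; simpl; field.
  - assert (E' : inb L (z3opp k, i, true) = false).
    { apply Bool.not_true_iff_false. intros E'. apply Bool.not_true_iff_false in E. apply E.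
      apply inb_true, in_L. apply inb_true, in_L in E'. rewrite box_opp_iff in E'. auto. }
    rewrite E'. now rewrite Cconj_RtoC.
Qed.

Lemma uc_n3 y : n3 (uc y).
Proof.
  intros k i Hi. unfold uc. destruct (inb L (k, i, true)) eqn:E; auto.
  apply inb_true, in_L in E. lia.
Qed.

(** Clipping leaves no trace in the conclusion: where [theta] is nonzero the energy is at most
    [K + 1] and clipping is inactive, and where it is zero the quadratic term is absent. *)
Theorem cutoff_galerkin : exists (c : R -> coef) (theta : R -> R),
  c 0 = trunc N c0 /\ forall s,
  supp N (c s) /\ rl (c s) /\ dv (c s) /\ n3 (c s) /\ 0 <= theta s <= 1 /\
  (theta s <> 0 -> IP 4 N (c s) (c s) <= K + 1) /\
  (IP 4 N (c s) (c s) <= K -> theta s = 1) /\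
  cder c s (cadd (cscl (mu * theta s) (trunc N (Bn N (c s) (c s)))) (trunc N F)).
Proof.
  destruct (BL_field_lip L Gf L) as (Lam & HLam & Hlip).
  { intros [[k a] b] Hi. unfold Gf. apply inb_true in Hi. rewrite Hi. destruct b; apply BL_Vf. }
  destruct (global_lipschitz_ode L Gf Lam HLam Hlip) with
    (y0 := fun j : Idx => match j with (k, i, b) => if b then Re (trunc N c0 k i) else Im (trunc N c0 k i) end)
    as (y & Hy0 & Hy).
  { intros y i Hi. unfold Gf. destruct (inb L i) eqn:E; auto. apply inb_true in E. tauto. }
  set (c := fun s => (fun k i => (y s (k, i, true), y s (k, i, false))) : coef).
  assert (V_rl : forall s, rl (Vf (y s))).
  { intros s k i. unfold Vf, cadd, cscl. rewrite (rl_Bn N _ _ (uc_rl _) (uc_rl _)), F_rl.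
    now rewrite Cplus_conj, Cmult_conj, Cconj_RtoC. }
  assert (V_dv : forall s, dv (Vf (y s))).
  { intros s k. unfold Vf, cadd, cscl. rewrite cdot_cadd, cdot_cscl, F_dv, (dv_Bn N _ _ k). ring. }
  assert (V_n3 : forall s, n3 (Vf (y s))).
  { intros s k i Hi. unfold Vf, cadd, cscl. rewrite F_n3, (n3_Bn N _ _ (uc_n3 (y s))) by auto. ring. }
  assert (c_init : c 0 = trunc N c0).
  { apply coef_ext; intros k i. unfold c. rewrite !Hy0. now destruct (trunc N c0 k i). }
  assert (c_der : forall s, cder c s (trunc N (Vf (y s)))).
  { intros s k i. unfold c. simpl. split.
    - eapply deriv_val; [|apply (Hy s (k, i, true))].
      unfold Gf. destruct (inb L (k, i, true)) eqn:E.
      + apply inb_true, in_L in E. rewrite trunc_in; tauto.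
      + destruct (classic (In k (box N))) as [Hk|Hk]; [|now rewrite trunc_out].
        rewrite trunc_in, V_n3; auto. destruct (le_lt_dec 3 i); auto.
        assert (inb L (k, i, true) = true) by (apply inb_true, in_L; auto). congruence.
    - eapply deriv_val; [|apply (Hy s (k, i, false))].
      unfold Gf. destruct (inb L (k, i, false)) eqn:E.
      + apply inb_true, in_L in E. rewrite trunc_in; tauto.
      + destruct (classic (In k (box N))) as [Hk|Hk]; [|now rewrite trunc_out].
        rewrite trunc_in, V_n3; auto. destruct (le_lt_dec 3 i); auto.
        assert (inb L (k, i, false) = true) by (apply inb_true, in_L; auto). congruence. }
  (* Support, symmetry and incompressibility are linear constraints; each is preserved because its
     defect starts at zero and has zero derivative. *)
  assert (c_zero : forall k i, (forall t, trunc N (Vf (y t)) k i = 0%C) -> c 0 k i = 0%C -> forall s, c s k i = 0%C).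
  { intros k i Z H0 s. apply (C_zero_const (fun r => c r k i)); auto. intros t. destruct (c_der t k i) as [D1 D2]. rewrite Z in D1, D2. auto. }
  assert (c_supp : forall s, supp N (c s)) by (intros s k i Hk; apply c_zero; [intros|rewrite c_init]; now apply trunc_out).
  assert (c_n3 : forall s, n3 (c s)) by (intros s k i Hi; apply c_zero; [intros t|rewrite c_init]; now apply (n3_trunc N)).
  assert (c_rl : forall s, rl (c s)).
  { intros s k i. replace (c s (z3opp k) i) with (c s (z3opp k) i - Cconj (c s k i) + Cconj (c s k i))%C by ring.
    rewrite (C_zero_const (fun r => c r (z3opp k) i - Cconj (c r k i))%C); [ring| |rewrite c_init, (rl_trunc N _ c0_rl); ring].
    intros t. destruct (c_der t k i) as [D1 D2]. destruct (c_der t (z3opp k) i) as [D3 D4]. rewrite (rl_trunc N _ (V_rl t)) in D3, D4. split.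
    - apply deriv_ext with (fun r => Re (c r (z3opp k) i) - Re (c r k i)); [intros; simpl; ring|].
      eapply deriv_val; [|apply derivable_pt_lim_minus; [exact D3|exact D1]]. rewrite re_conj. ring.
    - apply deriv_ext with (fun r => Im (c r (z3opp k) i) + Im (c r k i)); [intros; simpl; ring|].
      eapply deriv_val; [|apply derivable_pt_lim_plus; [exact D4|exact D2]]. rewrite im_conj. ring. }
  assert (c_dv : forall s, dv (c s)).
  { intros s k. apply (C_zero_const (fun r => cdot (c r k) k)); [|rewrite c_init; apply (dv_trunc N _ c0_dv)]. intros t.
    assert (ER : forall z : nat -> C, Re (cdot z k) = kc 0 k * Re (z 0%nat) + kc 1 k * Re (z 1%nat) + kc 2 k * Re (z 2%nat)).
    { intros z. unfold cdot, s3. destruct (z 0%nat), (z 1%nat), (z 2%nat). simpl. ring. }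
    assert (EI : forall z : nat -> C, Im (cdot z k) = kc 0 k * Im (z 0%nat) + kc 1 k * Im (z 1%nat) + kc 2 k * Im (z 2%nat)).
    { intros z. unfold cdot, s3. destruct (z 0%nat), (z 1%nat), (z 2%nat). simpl. ring. }
    pose proof (dv_trunc N _ (V_dv t) k) as Z. split.
    - eapply deriv_ext; [intros; symmetry; apply ER|].
      eapply deriv_val; [|repeat apply derivable_pt_lim_plus; apply derivable_pt_lim_scal; apply c_der]. rewrite <- ER, Z. auto.
    - eapply deriv_ext; [intros; symmetry; apply EI|].
      eapply deriv_val; [|repeat apply derivable_pt_lim_plus; apply derivable_pt_lim_scal; apply c_der]. rewrite <- EI, Z. auto. }
  assert (HM : 0 < M) by (unfold M; lra).
  (* Along the trajectory symmetry holds, so the average in [uc] is just clipping. *)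
  assert (uc_c : forall s k i, uc (y s) k i = (clip M (Re (c s k i)), clip M (Im (c s k i)))).
  { intros s k i. unfold uc. destruct (inb L (k, i, true)) eqn:E.
    - pose proof (c_rl s k i) as Hr. unfold c in Hr. apply (f_equal Re) in Hr as Hr1. apply (f_equal Im) in Hr as Hr2.
      rewrite re_conj in Hr1. rewrite im_conj in Hr2. simpl in Hr1, Hr2.
      rewrite Hr1, Hr2, clip_opp by lra. unfold c. simpl. f_equal; field.
    - assert (c s k i = 0%C) as ->.
      { destruct (classic (In k (box N))) as [Hk|Hk]; [|now apply c_supp].
        destruct (le_lt_dec 3 i); [now apply c_n3|].
        assert (inb L (k, i, true) = true) by (apply inb_true, in_L; auto). congruence. }
      simpl. rewrite clip_id by (rewrite Rabs_R0; lra). reflexivity. }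
  assert (small : forall u k i, IP 4 N u u <= K + 1 -> In k (box N) -> (i < 3)%nat -> Cmod (u k i) < M).
  { intros u k i Hu Hk Hi. rewrite IP_self in Hu.
    pose proof (lsum_term_le (box N) (fun k => (wt k ^ 4 * vn (u k)) ^ 2) k Hk ltac:(intros; apply pow2_ge_0)) as H1.
    cbv beta in H1. pose proof (vn_comp (u k) i Hi) as H2. pose proof (Cmod_ge_0 (u k i)) as H3.
    assert (1 <= wt k ^ 4) by (apply pow_R1_Rle, wt_ge1).
    assert (Cmod (u k i) <= wt k ^ 4 * vn (u k)) by nra.
    unfold M. nra. }
  assert (uc_eq : forall s, IP 4 N (uc (y s)) (uc (y s)) <= K + 1 -> uc (y s) = c s).
  { intros s H. apply coef_ext; intros k i.
    destruct (classic (In k (box N))) as [Hk|Hk].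
    2:{ rewrite uc_c, (c_supp s k i) by auto. simpl. now rewrite clip_id by (rewrite Rabs_R0; lra). }
    destruct (le_lt_dec 3 i) as [Hi|Hi]; [rewrite (uc_n3 (y s) k i), (c_n3 s k i); auto|].
    pose proof (small _ k i H Hk Hi) as Hs. rewrite uc_c in Hs |- *.
    assert (H1 : Rabs (clip M (Re (c s k i))) < M) by (eapply Rle_lt_trans; [apply (re_le_Cmod (clip M (Re (c s k i)), clip M (Im (c s k i))))|exact Hs]).
    assert (H2 : Rabs (clip M (Im (c s k i))) < M) by (eapply Rle_lt_trans; [apply (im_le_Cmod (clip M (Re (c s k i)), clip M (Im (c s k i))))|exact Hs]).
    rewrite (clip_inactive _ _ HM H1), (clip_inactive _ _ HM H2). now destruct (c s k i). }
  exists c, (fun s => th (y s)). split; auto. intros s. repeat match goal with |- _ /\ _ => split; auto end.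
  - apply clamp01_bound.
  - apply clamp01_bound.
  - intros Ht. unfold th in Ht. assert (Hu : IP 4 N (uc (y s)) (uc (y s)) <= K + 1).
    { destruct (Rle_dec (IP 4 N (uc (y s)) (uc (y s))) (K + 1)) as [H|H]; auto. exfalso. apply Ht. mm. }
    rewrite (uc_eq s Hu) in Hu. auto.
  - intros HK. unfold th.
    assert (E : uc (y s) = c s).
    { apply coef_ext; intros k i. rewrite uc_c.
      assert (HH : Cmod (c s k i) <= M).
      { destruct (classic (In k (box N))) as [Hk|Hk]; [|rewrite c_supp, Cmod_0 by auto; lra].
        destruct (le_lt_dec 3 i) as [Hi|Hi]; [rewrite c_n3, Cmod_0 by auto; lra|].
        left. apply small; auto. lra. }
      pose proof (re_le_Cmod (c s k i)). pose proof (im_le_Cmod (c s k i)).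
      rewrite !clip_id by lra. now destruct (c s k i). }
    rewrite E. mm.
  - assert (E : trunc N (Vf (y s)) = cadd (cscl (mu * th (y s)) (trunc N (Bn N (c s) (c s)))) (trunc N F)).
    { apply coef_ext; intros k i. unfold cadd, cscl. destruct (classic (In k (box N))) as [Hk|Hk].
      - rewrite !trunc_in by auto. unfold Vf, cadd, cscl. f_equal.
        destruct (Req_dec (th (y s)) 0) as [Hz|Hz].
        + rewrite Hz, Rmult_0_r. ring.
        + rewrite uc_eq; auto. unfold th in Hz.
          destruct (Rle_dec (IP 4 N (uc (y s)) (uc (y s))) (K + 1)) as [H|H]; auto. exfalso. apply Hz. mm.
      - rewrite !trunc_out by auto. ring. }
    rewrite <- E. apply c_der.
Qed.
End CutoffGalerkin.

(** * Energy inequalities and existence for the truncated systems *)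

Lemma IP_derive m N u s d : cder u s d ->
  derivable_pt_lim (fun r => IP m N (u r) (u r)) s (2 * IP m N (u s) d).
Proof.
  intros H.
  assert (E : forall z w : nat -> C, Re (vdot z w) = Re (z 0%nat) * Re (w 0%nat) + Im (z 0%nat) * Im (w 0%nat)
     + (Re (z 1%nat) * Re (w 1%nat) + Im (z 1%nat) * Im (w 1%nat)) + (Re (z 2%nat) * Re (w 2%nat) + Im (z 2%nat) * Im (w 2%nat))).
  { intros z w. unfold vdot, s3. destruct (z 0%nat), (z 1%nat), (z 2%nat), (w 0%nat), (w 1%nat), (w 2%nat). simpl. ring. }
  apply deriv_ext with (fun r => lsum (box N) (fun k => wt k ^ (2 * m) * Re (vdot (u r k) (u r k)))); [reflexivity|].
  eapply deriv_val; [|apply (lsum_derive (box N) (fun k r => wt k ^ (2 * m) * Re (vdot (u r k) (u r k)))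
    (fun k r => wt k ^ (2 * m) * (2 * Re (vdot (u s k) (d k)))))].
  - unfold IP. rewrite <- lsum_scal. apply lsum_ext. intros; ring.
  - intros k _. apply (derivable_pt_lim_scal (fun r => Re (vdot (u r k) (u r k)))).
    eapply deriv_ext; [intros; symmetry; apply E|].
    eapply deriv_val; [|repeat apply derivable_pt_lim_plus; apply derivable_pt_lim_mult; apply H].
    rewrite E. ring.
Qed.

Lemma IP_lin_derive m N z u s d : cder u s d ->
  derivable_pt_lim (fun r => IP m N z (u r)) s (IP m N z d).
Proof.
  intros H.
  assert (E : forall z w : nat -> C, Re (vdot z w) = Re (z 0%nat) * Re (w 0%nat) + Im (z 0%nat) * Im (w 0%nat)
     + (Re (z 1%nat) * Re (w 1%nat) + Im (z 1%nat) * Im (w 1%nat)) + (Re (z 2%nat) * Re (w 2%nat) + Im (z 2%nat) * Im (w 2%nat))).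
  { intros x w. unfold vdot, s3. destruct (x 0%nat), (x 1%nat), (x 2%nat), (w 0%nat), (w 1%nat), (w 2%nat). simpl. ring. }
  apply deriv_ext with (fun r => lsum (box N) (fun k => wt k ^ (2 * m) * Re (vdot (z k) (u r k)))); [reflexivity|].
  apply (lsum_derive (box N) (fun k r => wt k ^ (2 * m) * Re (vdot (z k) (u r k)))
    (fun k r => wt k ^ (2 * m) * Re (vdot (z k) (d k)))).
  intros k _. apply (derivable_pt_lim_scal (fun r => Re (vdot (z k) (u r k)))).
  eapply deriv_ext; [intros; symmetry; apply E|].
  rewrite E. repeat apply derivable_pt_lim_plus; apply derivable_pt_lim_scal; apply H.
Qed.

Lemma IP_add_r m N z u v : IP m N z (cadd u v) = IP m N z u + IP m N z v.
Proof.
  unfold IP. rewrite <- lsum_plus. apply lsum_ext. intros k _. unfold vdot, s3, cadd.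
  rewrite <- Rmult_plus_distr_l, <- Re_plus. f_equal. f_equal. ring.
Qed.
Lemma IP_scl_r m N z r v : IP m N z (cscl r v) = r * IP m N z v.
Proof.
  unfold IP. rewrite <- lsum_scal. apply lsum_ext. intros k _. unfold vdot, s3, cscl.
  transitivity (wt k ^ (2 * m) * Re (RtoC r * (Cconj (z k 0%nat) * v k 0%nat + Cconj (z k 1%nat) * v k 1%nat + Cconj (z k 2%nat) * v k 2%nat))%C).
  - f_equal. f_equal. ring.
  - rewrite Re_scal. ring.
Qed.
Lemma IP_sub_r m N z u v : IP m N z (csb u v) = IP m N z u - IP m N z v.
Proof. rewrite csb_scl, IP_add_r, IP_scl_r. ring. Qed.

(** Both time directions are covered, so the derivative is bounded in absolute value. The natural
    term [b / a] is weakened to [b] by [1 <= a]. *)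
Lemma gronwall f f' a b : 1 <= a -> 0 <= b -> (forall s, 0 <= f s) ->
  (forall s, Rabs s <= 2 -> derivable_pt_lim f s (f' s)) ->
  (forall s, Rabs s <= 2 -> Rabs (f' s) <= a * f s + b) ->
  forall t, Rabs t <= 2 -> f t <= exp (2 * a) * (f 0 + b).
Proof.
  intros Ha Hb Hp Hd HB t Ht.
  assert (Q : f t + b / a <= exp (a * Rabs t) * (f 0 + b / a)).
  { destruct (Rle_dec 0 t) as [H0|H0].
    - rewrite (Rabs_pos_eq t) in * by auto.
      assert (M : - ((f 0 + b / a) * exp (- a * 0)) <= - ((f t + b / a) * exp (- a * t))).
      { apply (deriv_mono (fun s => - ((f s + b / a) * exp (- a * s)))
          (fun s => - ((f' s + 0) * exp (- a * s) + (f s + b / a) * (1 * - a * exp (- a * s))))); auto.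
        - intros s Hs. apply (derivable_pt_lim_opp (fun s => (f s + b / a) * exp (- a * s))).
          apply (derivable_pt_lim_mult (fun s => f s + b / a) (fun s => exp (- a * s))).
          + apply (derivable_pt_lim_plus f); [apply Hd, Rabs_le; lra|apply derivable_pt_lim_const].
          + apply deriv_ext with (fun s => 1 * exp (- a * s)); [intros; ring|apply deriv_exp].
        - intros s Hs. specialize (HB s ltac:(apply Rabs_le; lra)). apply Rabs_le_between in HB.
          pose proof (exp_pos (- a * s)).
          replace (- ((f' s + 0) * exp (- a * s) + (f s + b / a) * (1 * - a * exp (- a * s)))) with
            ((a * f s + b - f' s) * exp (- a * s)) by (field; lra).
          apply Rmult_le_pos; lra. }
      rewrite Rmult_0_r, exp_0 in M.
      replace (- a * t) with (- (a * t)) in M by ring. rewrite exp_Ropp in M. pose proof (exp_pos (a * t)).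
      apply Rmult_le_reg_r with (/ exp (a * t)); [now apply Rinv_0_lt_compat|].
      replace (exp (a * t) * (f 0 + b / a) * / exp (a * t)) with (f 0 + b / a) by (field; split; lra). lra.
    - rewrite (Rabs_left t) in * by lra.
      assert (M : (f t + b / a) * exp (a * t) <= (f 0 + b / a) * exp (a * 0)).
      { apply (deriv_mono (fun s => (f s + b / a) * exp (a * s))
          (fun s => (f' s + 0) * exp (a * s) + (f s + b / a) * (1 * a * exp (a * s)))); [lra| |].
        - intros s Hs.
          apply (derivable_pt_lim_mult (fun s => f s + b / a) (fun s => exp (a * s))).
          + apply (derivable_pt_lim_plus f); [apply Hd, Rabs_le; lra|apply derivable_pt_lim_const].
          + apply deriv_ext with (fun s => 1 * exp (a * s)); [intros; ring|apply deriv_exp].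
        - intros s Hs. specialize (HB s ltac:(apply Rabs_le; lra)). apply Rabs_le_between in HB.
          pose proof (exp_pos (a * s)).
          replace ((f' s + 0) * exp (a * s) + (f s + b / a) * (1 * a * exp (a * s))) with
            ((a * f s + b + f' s) * exp (a * s)) by (field; lra).
          apply Rmult_le_pos; lra. }
      rewrite Rmult_0_r, exp_0 in M.
      replace (a * - t) with (- (a * t)) by ring. rewrite exp_Ropp. pose proof (exp_pos (a * t)).
      apply Rmult_le_reg_r with (exp (a * t)); auto.
      replace (/ exp (a * t) * (f 0 + b / a) * exp (a * t)) with (f 0 + b / a) by (field; split; lra). lra. }
  assert (B1 : 0 <= b / a <= b).
  { split; [apply Rdiv_le_0_compat; lra|]. apply Rmult_le_reg_r with a; [lra|]. unfold Rdiv. rewrite Rmult_assoc, Rinv_l by lra. nra. }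
  assert (E : exp (a * Rabs t) <= exp (2 * a)).
  { assert (D : a * Rabs t <= 2 * a) by nra. destruct D as [D| ->]; [left; now apply exp_increasing|lra]. }
  specialize (Hp 0). pose proof (exp_pos (a * Rabs t)). nra.
Qed.

Lemma KI_pos m : 0 <= KI m.
Proof. unfold KI. pose proof (pos_INR m). assert (0 < 2 ^ m) by (apply pow_lt; lra). repeat apply Rmult_le_pos; lra. Qed.
Lemma KII_pos m : 0 <= KII m.
Proof. unfold KII. assert (0 < 2 ^ m) by (apply pow_lt; lra). lra. Qed.

Definition field_ok (u : coef) : Prop := rl u /\ dv u /\ n3 u.

(** The interval [[-2, 2]] leaves a margin around [[0, 1]], where solutions are used, so that
    two-sided derivatives exist at both ends. *)
Definition gsol (N : nat) (mu : R) (F : coef) (c : R -> coef) : Prop :=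
  (forall s, supp N (c s) /\ field_ok (c s)) /\
  forall s, Rabs s <= 2 -> cder c s (cadd (cscl mu (trunc N (Bn N (c s) (c s)))) (trunc N F)).

Lemma self_transport m N c U : (1 <= m)%nat -> supp N c -> rl c -> dv c -> 0 <= U ->
  l1b (fun k => wt k * vn (c k)) U -> Rabs (IP m N c (Bn N c c)) <= 2 * KI m * U * IP m N c c.
Proof.
  intros Hm Hs Hr Hd HU H. pose proof (supp_sob_sqrt m N c Hs) as S.
  rewrite IP_Bn by auto. set (E := IP m N c c) in *. assert (SE : sqrt E * sqrt E = E) by apply sqrt_sqrt, IP_self_ge0.
  eapply Rle_trans; [apply (transport_estimate m N c c (sqrt E) U (sqrt E) U); auto|]. right.
  transitivity (2 * KI m * U * (sqrt E * sqrt E)); [ring|now rewrite SE].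
Qed.

Lemma trunc_init_IP m N c0 A : sob m c0 A -> IP m N (trunc N c0) (trunc N c0) <= A ^ 2.
Proof. intros H. apply sob_IP. now apply sob_trunc. Qed.

Lemma forcing_IP m N c F A E : supp N c -> IP m N c c = E -> sob m F A -> 2 * Rabs (IP m N c (trunc N F)) <= 3 * E + 3 * A ^ 2.
Proof.
  intros Hs <- HF. rewrite IP_trunc_r. pose proof (supp_sob_sqrt m N c Hs) as S.
  pose proof (IP_cs m N c F _ _ S HF). pose proof (sqrt_sqrt _ (IP_self_ge0 m N c)).
  pose proof (pow2_ge_0 (sqrt (IP m N c c) - A)). nra.
Qed.

(** The cut-off replaces a continuation argument: the energy inequality for the cut-off system keeps
    the energy below [K] on the whole interval, so the cut-off never acts. In higher norms the
    transport estimate is linear with a coefficient controlled by [H^4]; hence [mu0] does not depend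
    on [m], and the bound is proportional to [B]. *)
Lemma galerkin_exists M : 0 <= M -> exists mu0, 0 < mu0 <= 1 /\ exists Rb : nat -> R, (forall m, 0 <= Rb m) /\
  forall mu c0 F N, 0 < mu <= mu0 -> field_ok c0 -> field_ok F -> sob 4 c0 M -> sob 4 F M ->
  exists c, gsol N mu F c /\ c 0 = trunc N c0 /\
    forall m B, (4 <= m)%nat -> sob m c0 B -> sob m F B -> forall s, Rabs s <= 2 -> sob m (c s) (Rb m * B).
Proof.
  (* [K] is the Gronwall bound for rate 4 on [[-2, 2]]: the forcing accounts for 3 and the
     nonlinearity is allowed 1. *)
  intros HM. set (K := exp 8 * (M ^ 2 + 3 * M ^ 2)).
  assert (HK : 0 <= K). { pose proof (exp_pos 8). pose proof (pow2_ge_0 M). unfold K. apply Rmult_le_pos; lra. }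
  (* With [mu <= / X] the nonlinear part of the energy derivative is at most the energy itself; 48
     is [2 * 2 * 12], from the derivative of a square, [self_transport] and [sob_l1]. *)
  set (X := 48 * KI 4 * sqrt (K + 1) + 1).
  assert (HX : 1 <= X). { pose proof (KI_pos 4). pose proof (sqrt_pos (K + 1)). unfold X. assert (0 <= KI 4 * sqrt (K + 1)) by (apply Rmult_le_pos; auto). lra. }
  exists (/ X). split.
  { split; [apply Rinv_0_lt_compat; lra|]. rewrite <- Rinv_1. apply Rinv_le_contravar; lra. }
  set (a := fun m => 48 * KI m * sqrt K + 3).
  assert (Ha : forall m, 3 <= a m). { intros m. unfold a. pose proof (KI_pos m). pose proof (sqrt_pos K). assert (0 <= KI m * sqrt K) by (apply Rmult_le_pos; auto). lra. }
  exists (fun m => 2 * exp (a m)). split; [intros; pose proof (exp_pos (a m)); lra|].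
  intros mu c0 F N [Hmu Hmu0] (R0 & D0 & N0) (RF & DF & NF) S0 SF.
  assert (Hmu1 : mu <= 1).
  { rtrans Hmu0. rewrite <- Rinv_1. apply Rinv_le_contravar; lra. }
  destruct (cutoff_galerkin N mu K c0 F HK R0 D0 N0 RF DF NF) as (c & th & Hc0 & Hc).
  assert (E4 : forall s, Rabs s <= 2 -> IP 4 N (c s) (c s) <= K).
  { intros s Hs. unfold K.
    replace 8 with (2 * 4) by ring.
    eapply Rle_trans; [apply (gronwall (fun r => IP 4 N (c r) (c r)) (fun r => 2 * IP 4 N (c r) (cadd (cscl (mu * th r) (trunc N (Bn N (c r) (c r)))) (trunc N F))) 4 (3 * M ^ 2)); auto; try lra|].
    - pose proof (pow2_ge_0 M). lra.
    - intros; apply IP_self_ge0.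
    - intros r _. apply IP_derive. apply Hc.
    - intros r _. destruct (Hc r) as (Hs' & Hr & Hd & Hn & Hth & Hth1 & _ & _).
      rewrite IP_add_r, IP_scl_r, IP_trunc_r, Rabs_mult, (Rabs_pos_eq 2) by lra.
      eapply Rle_trans; [apply Rmult_le_compat_l; [lra|apply Rabs_triang]|].
      pose proof (forcing_IP 4 N (c r) F M _ Hs' eq_refl SF).
      set (E := IP 4 N (c r) (c r)) in *. pose proof (IP_self_ge0 4 N (c r)) as HE. fold E in HE.
      assert (2 * Rabs (mu * th r * IP 4 N (c r) (Bn N (c r) (c r))) <= E).
      { destruct (Req_dec (th r) 0) as [Hz|Hz]; [rewrite Hz, Rmult_0_r, Rmult_0_l, Rabs_R0; lra|].
        fold E in Hth1.
        assert (SS : sob 4 (c r) (sqrt (K + 1))).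
        { apply (supp_sob 4 N); auto; [apply sqrt_pos|]. rewrite <- Rsqr_pow2, Rsqr_sqrt by lra. auto. }
        assert (U0 : 0 <= 12 * sqrt (K + 1)) by (apply Rmult_le_pos; [lra|apply sqrt_pos]).
        pose proof (self_transport 4 N (c r) (12 * sqrt (K + 1)) ltac:(lia) Hs' Hr Hd
          U0 (sob_l1 4 _ _ (le_n 4) SS)) as T. fold E in T.
        rewrite Rabs_mult, (Rabs_pos_eq (mu * th r)) by (apply Rmult_le_pos; lra).
        set (q := Rabs (IP 4 N (c r) (Bn N (c r) (c r)))) in *.
        assert (T' : 2 * q <= (X - 1) * E) by (unfold X; lra).
        assert (0 <= q) by apply Rabs_pos.
        assert (mu * X <= 1). { apply Rmult_le_reg_r with (/ X); [apply Rinv_0_lt_compat; lra|]. rewrite Rmult_assoc, Rinv_r by lra. lra. }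
        assert (mu * th r <= mu) by nra.
        assert (mu * th r * q <= mu * q) by (apply Rmult_le_compat_r; auto).
        assert (mu * (2 * q) <= mu * ((X - 1) * E)) by (apply Rmult_le_compat_l; lra).
        assert (mu * X * E <= 1 * E) by (apply Rmult_le_compat_r; auto).
        assert (0 <= mu * E) by (apply Rmult_le_pos; lra). lra. }
      lra.
    - apply Rmult_le_compat_l; [left; apply exp_pos|]. apply Rplus_le_compat_r.
      rewrite Hc0. now apply trunc_init_IP. }
  assert (T1 : forall s, Rabs s <= 2 -> th s = 1) by (intros s Hs; apply Hc; auto).
  exists c. split; [split|split; auto].
  - intros s. destruct (Hc s) as (? & ? & ? & ? & _). repeat split; auto.
  - intros s Hs. destruct (Hc s) as (_ & _ & _ & _ & _ & _ & _ & H). rewrite T1, Rmult_1_r in H by auto. auto.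
  - intros m B Hm SB SFB s Hs. destruct (Hc s) as (Hss & _).
    pose proof (sob_pos _ _ _ SB) as HB.
    apply (supp_sob m N); auto. { pose proof (exp_pos (a m)). apply Rmult_le_pos; lra. }
    assert (G : IP m N (c s) (c s) <= exp (2 * a m) * (B ^ 2 + 3 * B ^ 2)).
    { eapply Rle_trans; [apply (gronwall (fun r => IP m N (c r) (c r)) (fun r => 2 * IP m N (c r) (cadd (cscl mu (trunc N (Bn N (c r) (c r)))) (trunc N F))) (a m) (3 * B ^ 2)); auto; try lra|].
      - specialize (Ha m). lra.
      - pose proof (pow2_ge_0 B). lra.
      - intros; apply IP_self_ge0.
      - intros r Hr. apply IP_derive. destruct (Hc r) as (_ & _ & _ & _ & _ & _ & _ & H). rewrite T1, Rmult_1_r in H by auto. auto.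
      - intros r Hr'. destruct (Hc r) as (Hs' & Hr & Hd & Hn & _).
        rewrite IP_add_r, IP_scl_r, IP_trunc_r, Rabs_mult, (Rabs_pos_eq 2) by lra.
        eapply Rle_trans; [apply Rmult_le_compat_l; [lra|apply Rabs_triang]|].
        pose proof (forcing_IP m N (c r) F B _ Hs' eq_refl SFB).
        assert (SS : sob 4 (c r) (sqrt K)).
        { apply (supp_sob 4 N); auto; [apply sqrt_pos|]. rewrite <- Rsqr_pow2, Rsqr_sqrt by lra. auto. }
        assert (U0 : 0 <= 12 * sqrt K) by (apply Rmult_le_pos; [lra|apply sqrt_pos]).
        pose proof (self_transport m N (c r) (12 * sqrt K) ltac:(lia) Hs' Hr Hd
          U0 (sob_l1 4 _ _ (le_n 4) SS)) as T.
        rewrite Rabs_mult, (Rabs_pos_eq mu) by lra.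
        set (q := Rabs (IP m N (c r) (Bn N (c r) (c r)))) in *.
        assert (0 <= q) by apply Rabs_pos.
        assert (mu * q <= 1 * q) by (apply Rmult_le_compat_r; lra). unfold a. lra.
      - apply Rmult_le_compat_l; [left; apply exp_pos|]. apply Rplus_le_compat_r.
        rewrite Hc0. now apply trunc_init_IP. }
    replace (2 * a m) with (a m + a m) in G by ring. rewrite exp_plus in G.
    replace ((2 * exp (a m) * B) ^ 2) with (exp (a m) * exp (a m) * (B ^ 2 + 3 * B ^ 2)) by ring. auto.
Qed.

(** Gronwall bounds the energy with factor [exp (2 * a)], hence the norm with [exp a]; the 2 absorbs
    [del^2 + 3 eps^2 <= 4 (del + eps)^2]. *)
Definition Kdiff (m : nat) (A : R) : R := 2 * exp (2 * KII m * A + 48 * KI m * A + 3).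

Lemma cder_sub u v s d e : cder u s d -> cder v s e -> cder (fun r => csb (u r) (v r)) s (csb d e).
Proof.
  intros Hu Hv k i. destruct (Hu k i), (Hv k i). split.
  - apply (derivable_pt_lim_minus (fun r => Re (u r k i)) (fun r => Re (v r k i))); auto.
  - apply (derivable_pt_lim_minus (fun r => Im (u r k i)) (fun r => Im (v r k i))); auto.
Qed.

Lemma supp_csb N u v : supp N u -> supp N v -> supp N (csb u v).
Proof. intros Hu Hv k i Hk. unfold csb. rewrite Hu, Hv by auto. ring. Qed.
Lemma dv_csb u v : dv u -> dv v -> dv (csb u v).
Proof. intros Hu Hv k. unfold csb. rewrite cdot_csb, Hu, Hv. ring. Qed.

(** The forcings may depend on time, so that truncation errors can be counted as forcing. By
    [Bn_diff] only [u] needs the additional derivative. *)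
Lemma diff_estimate m N mu u v Fu Fv A del eps : (4 <= m)%nat -> 0 <= mu <= 1 -> 0 <= eps ->
  (forall s, supp N (u s) /\ field_ok (u s)) -> (forall s, supp N (v s) /\ field_ok (v s)) ->
  (forall s, Rabs s <= 2 -> cder u s (cadd (cscl mu (trunc N (Bn N (u s) (u s)))) (Fu s))) ->
  (forall s, Rabs s <= 2 -> cder v s (cadd (cscl mu (trunc N (Bn N (v s) (v s)))) (Fv s))) ->
  (forall s, Rabs s <= 2 -> sob (S m) (u s) A) -> (forall s, Rabs s <= 2 -> sob m (v s) A) ->
  (forall s, Rabs s <= 2 -> sob m (csb (Fu s) (Fv s)) eps) ->
  sob m (csb (u 0) (v 0)) del ->
  forall s, Rabs s <= 2 -> sob m (csb (u s) (v s)) (Kdiff m A * (del + eps)).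
Proof.
  intros Hm Hmu Heps Hu Hv Du Dv Su Sv SF S0 s Hs.
  set (a := 2 * KII m * A + 48 * KI m * A + 3).
  assert (HA : 0 <= A) by (apply (sob_pos m (v s)); auto).
  assert (Hd : 0 <= del) by (eapply sob_pos; eauto).
  assert (Ha : 3 <= a). { pose proof (KI_pos m). pose proof (KII_pos m). assert (0 <= KI m * A) by (apply Rmult_le_pos; auto). assert (0 <= KII m * A) by (apply Rmult_le_pos; auto). unfold a. lra. }
  set (w := fun r => csb (u r) (v r)).
  assert (Hw : forall r, supp N (w r)) by (intros; apply supp_csb; [apply Hu|apply Hv]).
  apply (supp_sob m N); [|apply Hw|].
  { unfold Kdiff. apply Rmult_le_pos; [|lra]. pose proof (exp_pos a). unfold a in H. lra. }
  assert (G : IP m N (w s) (w s) <= exp (2 * a) * (del ^ 2 + 3 * eps ^ 2)).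
  { eapply Rle_trans; [apply (gronwall (fun r => IP m N (w r) (w r)) (fun r => 2 * IP m N (w r) (csb (cadd (cscl mu (trunc N (Bn N (u r) (u r)))) (Fu r)) (cadd (cscl mu (trunc N (Bn N (v r) (v r)))) (Fv r)))) a (3 * eps ^ 2)); auto; try lra|].
    - pose proof (pow2_ge_0 eps). lra.
    - intros; apply IP_self_ge0.
    - intros r Hr. apply (IP_derive m N w). apply cder_sub; auto.
    - intros r Hr. set (E := IP m N (w r) (w r)).
      destruct (Hu r) as (_ & Ru & Du' & _). destruct (Hv r) as (_ & Rv & Dv' & _).
      assert (Dw : dv (w r)) by (apply dv_csb; auto).
      assert (Q : IP m N (w r) (csb (cadd (cscl mu (trunc N (Bn N (u r) (u r)))) (Fu r)) (cadd (cscl mu (trunc N (Bn N (v r) (v r)))) (Fv r)))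
        = mu * (IP m N (w r) (Dn N (w r) (u r)) + IP m N (w r) (Dn N (v r) (w r))) + IP m N (w r) (csb (Fu r) (Fv r))).
      { rewrite !IP_sub_r, !IP_add_r, !IP_scl_r, !IP_trunc_r.
        rewrite <- (IP_Bn m N (w r) (w r) (u r)), <- (IP_Bn m N (w r) (v r) (w r)), <- IP_add_r by auto.
        unfold w at 5 6. rewrite <- Bn_diff, IP_sub_r. fold (w r). ring. }
      rewrite Q. pose proof (supp_sob_sqrt m N (w r) (Hw r)) as Sw. fold E in Sw.
      pose proof (IP_self_ge0 m N (w r)) as HE. fold E in HE. pose proof (sqrt_sqrt E HE) as SE.
      pose proof (product_estimate m N (w r) (u r) (w r) _ _ _ Hm Dw Sw (Su r Hr) Sw) as P1.
      pose proof (transport_estimate m N (v r) (w r) A (12 * A) (sqrt E) (12 * sqrt E) ltac:(lia) Rv Dv' (Hw r) (Sv r Hr) Sw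
        (sob_l1 _ _ _ Hm (Sv r Hr)) (sob_l1 _ _ _ Hm Sw)) as P2.
      pose proof (IP_cs m N (w r) _ _ _ Sw (SF r Hr)) as P3.
      rewrite Rabs_mult, (Rabs_pos_eq 2) by lra.
      eapply Rle_trans; [apply Rmult_le_compat_l; [lra|apply Rabs_triang]|].
      rewrite Rabs_mult, (Rabs_pos_eq mu) by lra.
      assert (P4 : mu * Rabs (IP m N (w r) (Dn N (w r) (u r)) + IP m N (w r) (Dn N (v r) (w r))) <=
        1 * (KII m * A * E + KI m * 24 * A * E)).
      { apply Rmult_le_compat; try lra. apply Rabs_pos. rtrans Rabs_triang.
        replace (KII m * sqrt E * sqrt E * A) with (KII m * A * E) in P1 by (rewrite <- SE at 1; ring).
        replace (KI m * (sqrt E * (12 * A) * sqrt E + sqrt E * A * (12 * sqrt E))) with (KI m * 24 * A * E) in P2 by (rewrite <- SE at 1; ring). lra. }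
      assert (P5 : 6 * sqrt E * eps <= 3 * E + 3 * eps ^ 2) by (pose proof (pow2_ge_0 (sqrt E - eps)); nra).
      unfold a. lra.
    - apply Rmult_le_compat_l; [left; apply exp_pos|]. apply Rplus_le_compat_r. now apply sob_IP. }
  replace (2 * a) with (a + a) in G by ring. rewrite exp_plus in G.
  rtrans G. unfold Kdiff. fold a.
  replace ((2 * exp a * (del + eps)) ^ 2) with (exp a * exp a * (4 * (del + eps) ^ 2)) by ring.
  apply Rmult_le_compat_l; [pose proof (exp_pos a); apply Rmult_le_pos; lra|]. nra.
Qed.

(** Pairing the curve with its own increment [z] reduces the claim to the scalar mean value theorem;
    the factor 3 is that of [IP_cs]. *)
Lemma mean_value m N y phi B s t : s <= t -> (forall r, supp N (y r)) ->
  (forall r, s <= r <= t -> cder y r (phi r)) -> (forall r, s <= r <= t -> sob m (phi r) B) ->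
  sob m (csb (y t) (y s)) (3 * B * (t - s)).
Proof.
  intros Hst Hs Hd Hb. set (z := csb (y t) (y s)).
  assert (Hz : supp N z) by (apply supp_csb; auto).
  assert (HB : 0 <= B) by (apply (sob_pos m (phi s)), Hb; lra).
  destruct Hst as [Hst|Hst].
  2:{ subst t. replace (3 * B * (s - s)) with 0 by ring.
      replace z with czero; [apply sob_zero|]. apply coef_ext; intros. unfold z, csb, czero. ring. }
  pose proof (supp_sob_sqrt m N z Hz) as Sz. set (E := IP m N z z) in *.
  apply (sob_le _ _ _ _ Sz).
  destruct (MVT_cor2 (fun r => IP m N z (y r)) (fun r => IP m N z (phi r)) s t Hst) as (x & Hx & Hx').
  { intros r Hr. apply IP_lin_derive. auto. }
  assert (HE : E = IP m N z (phi x) * (t - s)).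
  { rewrite <- Hx, <- IP_sub_r. reflexivity. }
  pose proof (IP_cs m N z (phi x) _ _ Sz (Hb x ltac:(lra))) as H1.
  pose proof (sqrt_pos E). pose proof (sqrt_sqrt E (IP_self_ge0 m N z)).
  apply Rabs_le_between in H1.
  assert (0 <= 3 * B * (t - s)) by (apply Rmult_le_pos; lra).
  destruct (Req_dec (sqrt E) 0) as [->|Hn]; auto.
  apply Rmult_le_reg_l with (sqrt E); [lra|]. rewrite H0, HE at 1.
  apply Rle_trans with (3 * sqrt E * B * (t - s)); [|right; ring]. apply Rmult_le_compat_r; lra.
Qed.

(** ** Smooth solutions on the Fourier side *)

Definition mz (u : coef) : Prop := forall i, u z3zero i = 0%C.
Definition adm (u : coef) : Prop := field_ok u /\ mz u /\ forall m, exists B, sob m u B.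

Definition clim (u : nat -> coef) (v : coef) : Prop := forall k i,
  Un_cv (fun n => Re (u n k i)) (Re (v k i)) /\ Un_cv (fun n => Im (u n k i)) (Im (v k i)).

Lemma Un_cv_ev u v l : (exists N, forall n, (N <= n)%nat -> u n = v n) -> Un_cv u l -> Un_cv v l.
Proof.
  intros [N H] Hu eps He. destruct (Hu eps He) as [M HM]. exists (N + M)%nat.
  intros n Hn. rewrite <- H by lia. apply HM. lia.
Qed.
Lemma Un_cv_const c : Un_cv (fun _ => c) c.
Proof. intros eps He. exists 0%nat. intros. now rewrite Rdist_eq. Qed.

Lemma clim_const u : clim (fun _ => u) u.
Proof. intros k i. split; apply Un_cv_const. Qed.
Lemma clim_csb u u' v v' : clim u v -> clim u' v' -> clim (fun n => csb (u n) (u' n)) (csb v v').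
Proof.
  intros H H' k i. destruct (H k i), (H' k i). split.
  - apply (CV_minus (fun n => Re (u n k i)) (fun n => Re (u' n k i))); auto.
  - apply (CV_minus (fun n => Im (u n k i)) (fun n => Im (u' n k i))); auto.
Qed.
Lemma clim_trunc u : clim (fun n => trunc n u) u.
Proof.
  intros k i. destruct (box_ex k) as [N HN].
  split; (eapply Un_cv_ev; [|apply Un_cv_const]); exists N; intros n Hn; rewrite trunc_in; auto; eapply box_mono; eauto.
Qed.
Lemma clim_ev u u' v : (exists N, forall n, (N <= n)%nat -> u n = u' n) -> clim u v -> clim u' v.
Proof.
  intros [N HN] H k i. destruct (H k i). split; (eapply Un_cv_ev; [|eassumption]); exists N; intros n Hn; now rewrite HN.
Qed.

Lemma Un_cv_lsum {A} (L : list A) (u : nat -> A -> R) l :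
  (forall a, In a L -> Un_cv (fun n => u n a) (l a)) -> Un_cv (fun n => lsum L (u n)) (lsum L l).
Proof.
  intros H. apply is_lim_seq_Reals. apply is_lim_seq_lsum. intros. now apply is_lim_seq_Reals, H.
Qed.

Lemma Un_cv_le u l B : Un_cv u l -> (exists N, forall n, (N <= n)%nat -> u n <= B) -> l <= B.
Proof.
  intros H [N HN]. apply le_epsilon. intros eps He. destruct (H eps He) as [M HM].
  specialize (HM (N + M)%nat ltac:(lia)). specialize (HN (N + M)%nat ltac:(lia)).
  unfold Rdist in HM. apply Rabs_lt_between in HM. lra.
Qed.

Lemma sob_lim m u v B : (exists N, forall n, (N <= n)%nat -> sob m (u n) B) -> clim u v -> sob m v B.
Proof.
  intros [N HN] H. split; [apply (sob_pos m (u N)), HN; lia|]. intros M.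
  apply (Un_cv_le (fun n => lsum (box M) (fun k => (wt k ^ m * vn (u n k)) ^ 2))).
  - apply (Un_cv_lsum (box M) (fun n k => (wt k ^ m * vn (u n k)) ^ 2)). intros k _.
    apply Un_cv_ev with (fun n => (wt k ^ m) ^ 2 * ((Re (u n k 0%nat) ^ 2 + Im (u n k 0%nat) ^ 2) + (Re (u n k 1%nat) ^ 2 + Im (u n k 1%nat) ^ 2) + (Re (u n k 2%nat) ^ 2 + Im (u n k 2%nat) ^ 2))).
    { exists 0%nat. intros n _. rewrite Rpow_mult_distr, vn_sq, !Cmod_sq. reflexivity. }
    rewrite Rpow_mult_distr, vn_sq, !Cmod_sq.
    apply CV_mult; [apply Un_cv_const|].
    assert (Sq : forall a l, Un_cv a l -> Un_cv (fun n => a n ^ 2) (l ^ 2)).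
    { intros a l Ha. simpl. apply CV_mult; auto. apply CV_mult; auto. apply Un_cv_const. }
    repeat apply CV_plus; apply Sq; apply H.
  - exists N. intros n Hn. apply HN; auto.
Qed.

Lemma Un_cv_unique u l l' : Un_cv u l -> Un_cv u l' -> l = l'.
Proof. apply UL_sequence. Qed.

Lemma field_ok_lim u v : (forall n, field_ok (u n)) -> clim u v -> field_ok v.
Proof.
  intros H Hc. split; [|split].
  - intros k i. destruct (Hc k i) as [A1 A2], (Hc (z3opp k) i) as [B1 B2]. apply ceq.
    + rewrite re_conj. eapply Un_cv_unique; [apply B1|]. eapply Un_cv_ev; [|apply A1].
      exists 0%nat. intros n _. destruct (H n) as (Hr & _). now rewrite Hr, re_conj.
    + rewrite im_conj. eapply Un_cv_unique; [apply B2|]. eapply Un_cv_ev; [|apply CV_opp, A2].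
      exists 0%nat. intros n _. destruct (H n) as (Hr & _). unfold opp_seq. now rewrite Hr, im_conj.
  - intros k.
    assert (ER : forall z : nat -> C, Re (cdot z k) = kc 0 k * Re (z 0%nat) + kc 1 k * Re (z 1%nat) + kc 2 k * Re (z 2%nat)).
    { intros z. unfold cdot, s3. destruct (z 0%nat), (z 1%nat), (z 2%nat). simpl. ring. }
    assert (EI : forall z : nat -> C, Im (cdot z k) = kc 0 k * Im (z 0%nat) + kc 1 k * Im (z 1%nat) + kc 2 k * Im (z 2%nat)).
    { intros z. unfold cdot, s3. destruct (z 0%nat), (z 1%nat), (z 2%nat). simpl. ring. }
    apply ceq.
    + rewrite ER. symmetry. eapply Un_cv_unique; [|repeat apply CV_plus; (apply CV_mult; [apply Un_cv_const|apply Hc])].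
      eapply Un_cv_ev; [|apply Un_cv_const]. exists 0%nat. intros n _. cbv beta. rewrite <- ER.
      destruct (H n) as (_ & Hd & _). now rewrite Hd.
    + rewrite EI. symmetry. eapply Un_cv_unique; [|repeat apply CV_plus; (apply CV_mult; [apply Un_cv_const|apply Hc])].
      eapply Un_cv_ev; [|apply Un_cv_const]. exists 0%nat. intros n _. cbv beta. rewrite <- EI.
      destruct (H n) as (_ & Hd & _). now rewrite Hd.
  - intros k i Hi. destruct (Hc k i) as [A1 A2]. apply ceq; symmetry.
    + eapply Un_cv_unique; [|apply A1]. eapply Un_cv_ev; [|apply Un_cv_const]. exists 0%nat. intros n _.
      destruct (H n) as (_ & _ & Hn). now rewrite Hn.
    + eapply Un_cv_unique; [|apply A2]. eapply Un_cv_ev; [|apply Un_cv_const]. exists 0%nat. intros n _.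
      destruct (H n) as (_ & _ & Hn). now rewrite Hn.
Qed.

(** Outside the cube [wt] is at least [N], so one more derivative buys a factor [1 / N]. *)
Lemma tail_norm m N N' z B : (1 <= N)%nat -> (N <= N')%nat -> sob (S m) (trunc N' z) B ->
  sob m (csb (trunc N' z) (trunc N z)) (B / INR N).
Proof.
  intros HN HNN [HB H]. assert (HI : 1 <= INR N) by (apply (le_INR 1); auto).
  split; [apply Rdiv_le_0_compat; lra|]. intros M.
  apply Rle_trans with (lsum (box M) (fun k => / INR N ^ 2 * (wt k ^ S m * vn (trunc N' z k)) ^ 2)).
  - apply lsum_le. intros k _. rewrite <- pow_inv, <- Rpow_mult_distr. pose proof (wt_ge1 k).
    assert (0 <= wt k ^ m) by (apply pow_le; lra). pose proof (vn_ge0 (trunc N' z k)).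
    apply pow_incr. split; [apply Rmult_le_pos; auto; apply vn_ge0|].
    destruct (classic (In k (box N))) as [Hk|Hk].
    + rewrite (vn_ext (csb (trunc N' z) (trunc N z) k) (fun _ => 0%C)).
      * rewrite vn_zero, Rmult_0_r. apply Rmult_le_pos; [left; apply Rinv_0_lt_compat; lra|].
        apply Rmult_le_pos; auto. apply pow_le; lra.
      * intros i _. unfold csb. rewrite !trunc_in; auto. ring. eapply box_mono; eauto.
    + rewrite (vn_ext (csb (trunc N' z) (trunc N z) k) (trunc N' z k)).
      * pose proof (wt_notin_box N k Hk). simpl pow.
        apply Rmult_le_reg_l with (INR N); [lra|].
        replace (INR N * (/ INR N * (wt k * wt k ^ m * vn (trunc N' z k)))) with (wt k * (wt k ^ m * vn (trunc N' z k))) by (field; lra).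
        apply Rmult_le_compat_r; auto. apply Rmult_le_pos; auto.
      * intros i _. unfold csb. rewrite (trunc_out N) by auto. ring.
  - rewrite lsum_scal. unfold Rdiv. rewrite Rpow_mult_distr, Rmult_comm, pow_inv.
    apply Rmult_le_compat_r; auto. left. apply Rinv_0_lt_compat, pow_lt; lra.
Qed.

(** The approximations are kept together with the limit, since quantitative estimates are proved on
    the finite systems and then passed to the limit. The rate [1 / N] serves to differentiate the
    limit in time. *)
Record esol (mu : R) (F c0 : coef) (cN : nat -> R -> coef) (c : R -> coef) : Prop := {
  es_gal : forall N, gsol N mu F (cN N) /\ cN N 0 = trunc N c0;
  es_bd : forall m, exists B, forall N s, Rabs s <= 2 -> sob m (cN N s) B;
  es_lim : forall s, Rabs s <= 2 -> clim (fun N => cN N s) (c s);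
  es_rate : forall m, exists B, forall N s, (1 <= N)%nat -> Rabs s <= 2 -> sob m (csb (cN N s) (c s)) (B / INR N) }.

Lemma csb_trunc_cadd N u v : trunc N (cadd u v) = cadd (trunc N u) (trunc N v).
Proof. apply coef_ext; intros k i. unfold trunc, cadd. destruct (inb (box N) k); auto. ring. Qed.
Lemma trunc_cscl N r v : trunc N (cscl r v) = cscl r (trunc N v).
Proof. apply coef_ext; intros k i. unfold trunc, cscl. destruct (inb (box N) k); auto. ring. Qed.

Lemma sob_ge4 : forall (u : nat -> R -> coef) , (forall m, (4 <= m)%nat -> exists B, forall N s, Rabs s <= 2 -> sob m (u N s) B) ->
  forall m, exists B, forall N s, Rabs s <= 2 -> sob m (u N s) B.
Proof.
  intros u H m. destruct (H (m + 4)%nat) as [B HB]; [lia|]. exists B. intros. eapply sob_mono; [|apply HB; auto]. lia.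
Qed.

(** The [N]-th approximation solves the [N']-th system up to a forcing error: the frequencies of [F]
    and of the quadratic term lying between the two cubes. By [tail_norm] this error is of order
    [1 / N]. *)
Lemma galerkin_cauchy mu F c0 (cN : nat -> R -> coef) : 0 <= mu <= 1 ->
  (forall m, exists B, sob m F B) -> (forall m, exists B, sob m c0 B) ->
  (forall N, gsol N mu F (cN N) /\ cN N 0 = trunc N c0) ->
  (forall m, exists B, forall N s, Rabs s <= 2 -> sob m (cN N s) B) ->
  forall m, (4 <= m)%nat -> exists B, forall N N' s, (1 <= N)%nat -> (N <= N')%nat -> Rabs s <= 2 -> sob m (csb (cN N s) (cN N' s)) (B / INR N).
Proof.
  intros Hmu HF H0 Hg Hb m Hm.
  destruct (Hb m) as [B1 HB1]. destruct (Hb (S m)) as [B2 HB2]. destruct (Hb (S (S m))) as [B3 HB3].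
  destruct (HF (S m)) as [BF HBF]. destruct (H0 (S m)) as [B0 HB0].
  assert (0 <= B1) by (apply (sob_pos m (cN 0%nat 0)), HB1; rewrite Rabs_R0; lra).
  assert (P2 : 0 <= B2) by (apply (sob_pos (S m) (cN 0%nat 0)), HB2; rewrite Rabs_R0; lra).
  assert (P3 : 0 <= B3) by (apply (sob_pos (S (S m)) (cN 0%nat 0)), HB3; rewrite Rabs_R0; lra).
  pose proof (sob_pos _ _ _ HBF) as PF.
  set (A := B1 + B2). set (E := BF + Rabs mu * (KII (S m) * B2 * B3)).
  exists (Kdiff m A * (B0 + E)). intros N N' s HN HNN Hs.
  assert (HI : 1 <= INR N) by (apply (le_INR 1); auto).
  destruct (Hg N) as [[Hsup Hder] Hi0]. destruct (Hg N') as [[Hsup' Hder'] Hi0'].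
  set (G := fun r => cadd F (cscl mu (Bn N' (cN N r) (cN N r)))).
  replace (Kdiff m A * (B0 + E) / INR N) with (Kdiff m A * (B0 / INR N + E / INR N)) by (field; lra).
  assert (EB : forall r, Bn N' (cN N r) (cN N r) = Bn N (cN N r) (cN N r)) by (intros r; apply Bn_supp; auto; apply Hsup).
  assert (KP : 0 <= Rabs mu * (KII (S m) * B2 * B3)).
  { apply Rmult_le_pos; [apply Rabs_pos|]. apply Rmult_le_pos; [apply Rmult_le_pos; [apply KII_pos|]|]; auto. }
  apply (diff_estimate m N' mu (cN N) (cN N')
    (fun r => csb (trunc N' F) (csb (trunc N' (G r)) (trunc N (G r)))) (fun _ => trunc N' F) A); auto.
  - apply Rdiv_le_0_compat; [unfold E; lra|lra].
  - intros r. destruct (Hsup r) as [S1 S2]. split; auto.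
    intros k i Hk. apply S1. intros Hk'. apply Hk. eapply box_mono; eauto.
  - intros r Hr.
    match goal with |- cder _ _ ?X => replace X with (cadd (cscl mu (trunc N (Bn N (cN N r) (cN N r)))) (trunc N F)); auto end.
    unfold G. rewrite !csb_trunc_cadd, !trunc_cscl, EB.
    coef_ring.
  - intros r Hr. eapply sob_le; [apply HB2; auto|unfold A; lra].
  - intros r Hr. eapply sob_le; [apply HB1; auto|unfold A; lra].
  - intros r Hr.
    replace (csb (csb (trunc N' F) (csb (trunc N' (G r)) (trunc N (G r)))) (trunc N' F)) with (cscl (-1) (csb (trunc N' (G r)) (trunc N (G r)))).
    2:{ coef_ring. }
    replace (E / INR N) with (Rabs (-1) * (E / INR N)) by (rewrite Rabs_left by lra; ring).
    apply sob_scl. apply tail_norm; auto.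
    unfold G. rewrite csb_trunc_cadd, trunc_cscl. apply sob_add; [now apply sob_trunc|].
    apply sob_scl. apply sob_Bn; auto. apply Hsup.
  - rewrite Hi0, Hi0'.
    replace (csb (trunc N c0) (trunc N' c0)) with (cscl (-1) (csb (trunc N' c0) (trunc N c0))).
    2:{ coef_ring. }
    replace (B0 / INR N) with (Rabs (-1) * (B0 / INR N)) by (rewrite Rabs_left by lra; ring).
    apply sob_scl. apply tail_norm; auto. now apply sob_trunc.
Qed.

Lemma cauchy_rate_limit (a : nat -> R) B : (forall n m, (1 <= n)%nat -> (n <= m)%nat -> Rabs (a n - a m) <= B / INR n) ->
  Un_cv a (real (Lim_seq a)).
Proof.
  intros H. apply is_lim_seq_Reals. apply Lim_seq_correct'. apply ex_lim_seq_cauchy_corr. intros eps.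
  destruct (nfloor_ex (2 * (Rabs B + 1) / eps)) as [n [Hn1 Hn2]].
  { apply Rdiv_le_0_compat; [pose proof (Rabs_pos B); lra|apply cond_pos]. }
  exists (S n). intros p q Hp Hq.
  assert (Q : forall p, (S n <= p)%nat -> Rabs (a (S n) - a p) < eps / 2).
  { intros r Hr. eapply Rle_lt_trans; [apply H; auto; lia|].
    assert (HI : 0 < INR (S n)) by (apply lt_0_INR; lia).
    apply Rmult_lt_reg_r with (INR (S n)); auto. unfold Rdiv at 1. rewrite Rmult_assoc, Rinv_l, Rmult_1_r by lra.
    rewrite S_INR. apply Rmult_lt_compat_r with (r := eps) in Hn2; [|apply cond_pos].
    unfold Rdiv in Hn2. rewrite Rmult_assoc, Rinv_l, Rmult_1_r in Hn2 by (apply Rgt_not_eq, cond_pos).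
    pose proof (Rle_abs B). lra. }
  pose proof (Q p Hp). pose proof (Q q Hq).
  replace (a p - a q) with ((a (S n) - a q) - (a (S n) - a p)) by ring.
  eapply Rle_lt_trans; [apply Rabs_triang|]. rewrite Rabs_Ropp. lra.
Qed.

Lemma sob_comp0 m u A k i : n3 u -> sob m u A -> Cmod (u k i) <= A.
Proof.
  intros Hn H. destruct (le_lt_dec 3 i) as [Hi|Hi].
  - rewrite Hn, Cmod_0 by auto. eapply sob_pos; eauto.
  - pose proof (sob_comp m u A k i Hi H). pose proof (Cmod_ge_0 (u k i)).
    assert (1 <= wt k ^ m) by (apply pow_R1_Rle, wt_ge1). nra.
Qed.

Lemma n3_csb u v : n3 u -> n3 v -> n3 (csb u v).
Proof. intros H H' k i Hi. unfold csb. rewrite H, H' by auto. ring. Qed.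

Lemma galerkin_limit mu F c0 (cN : nat -> R -> coef) : 0 <= mu <= 1 ->
  (forall m, exists B, sob m F B) -> (forall m, exists B, sob m c0 B) ->
  (forall N, gsol N mu F (cN N) /\ cN N 0 = trunc N c0) ->
  (forall m, exists B, forall N s, Rabs s <= 2 -> sob m (cN N s) B) ->
  exists c, esol mu F c0 cN c.
Proof.
  intros Hmu HF H0 Hg Hb.
  pose proof (galerkin_cauchy mu F c0 cN Hmu HF H0 Hg Hb) as HC.
  assert (Hn : forall N s, n3 (cN N s)) by (intros N s; destruct (Hg N) as [[Q _] _]; apply Q).
  set (c := fun s => (fun k i => (real (Lim_seq (fun N => Re (cN N s k i))), real (Lim_seq (fun N => Im (cN N s k i))))) : coef).
  assert (HL : forall s, Rabs s <= 2 -> clim (fun N => cN N s) (c s)).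
  { intros s Hs k i. destruct (HC 4%nat (le_n _)) as [B HB].
    assert (Q : forall N N', (1 <= N)%nat -> (N <= N')%nat -> Cmod (cN N s k i - cN N' s k i) <= B / INR N).
    { intros N N' H1 H2. apply (sob_comp0 4 (csb (cN N s) (cN N' s))); auto. apply n3_csb; auto. }
    split; apply (cauchy_rate_limit _ B); intros n m H1 H2.
    - eapply Rle_trans; [|apply (Q n m H1 H2)]. rewrite <- Re_minus. apply re_le_Cmod.
    - eapply Rle_trans; [|apply (Q n m H1 H2)]. rewrite <- Im_minus. apply im_le_Cmod. }
  exists c. split; auto.
  intros m. destruct (HC (m + 4)%nat) as [B HB]; [lia|]. exists B. intros N s HN Hs.
  apply (sob_lim m (fun N' => csb (cN N s) (cN N' s))).
  - exists N. intros n Hn'. eapply sob_mono; [|apply HB; auto]. lia.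
  - apply clim_csb; [apply clim_const|auto].
Qed.

Theorem euler_exists M : 0 <= M -> exists mu0, 0 < mu0 <= 1 /\ exists Rb : nat -> R, (forall m, 0 <= Rb m) /\
  forall mu c0 F, 0 < mu <= mu0 -> adm c0 -> adm F -> sob 4 c0 M -> sob 4 F M ->
  exists cN c, esol mu F c0 cN c /\
    forall m B, (4 <= m)%nat -> sob m c0 B -> sob m F B -> forall N s, Rabs s <= 2 -> sob m (cN N s) (Rb m * B).
Proof.
  intros HM. destruct (galerkin_exists M HM) as (mu0 & Hmu0 & Rb & HRb & H).
  exists mu0. split; auto. exists Rb. split; auto.
  intros mu c0 F Hmu (A1 & A2 & A3) (B1 & B2 & B3) S0 SF.
  assert (Q : forall N, exists c, gsol N mu F c /\ c 0 = trunc N c0 /\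
    forall m B, (4 <= m)%nat -> sob m c0 B -> sob m F B -> forall s, Rabs s <= 2 -> sob m (c s) (Rb m * B)).
  { intros N. apply H; auto. }
  set (cN := fun N => proj1_sig (constructive_indefinite_description _ (Q N))).
  assert (HcN : forall N, gsol N mu F (cN N) /\ cN N 0 = trunc N c0 /\
    forall m B, (4 <= m)%nat -> sob m c0 B -> sob m F B -> forall s, Rabs s <= 2 -> sob m (cN N s) (Rb m * B)).
  { intros N. exact (proj2_sig (constructive_indefinite_description _ (Q N))). }
  destruct (galerkin_limit mu F c0 cN) as [c Hc]; auto; try lra.
  - intros N. destruct (HcN N) as (? & ? & _). auto.
  - apply sob_ge4. intros m Hm. destruct (A3 m) as [X HX], (B3 m) as [Y HY].
    pose proof (sob_pos _ _ _ HX). pose proof (sob_pos _ _ _ HY).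
    exists (Rb m * (X + Y)). intros N s Hs. destruct (HcN N) as (_ & _ & Q'). apply Q'; auto; eapply sob_le; eauto; lra.
  - exists cN, c. split; auto. intros m B Hm S1 S2 N s Hs. destruct (HcN N) as (_ & _ & Q'). auto.
Qed.

(** * The full quadratic term and the limit equation *)

Definition zsumC (f : Z3 -> C) : C := (zsum (fun k => Re (f k)), zsum (fun k => Im (f k))).
Definition domC (B : R) (f : Z3 -> C) : Prop := forall k, Cmod (f k) <= B * om k.
Definition Dinf (u w : coef) (k : Z3) (i : nat) : C :=
  (- Ci * zsumC (fun j => cdot (u j) k * w (z3sub k j) i))%C.
Definition Binf (u : coef) (k : Z3) (i : nat) : C := pj k (Dinf u u k) i.

Lemma domC_Re B f : domC B f -> dom B (fun k => Re (f k)).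
Proof. intros H k. eapply Rle_trans; [apply re_le_Cmod|apply H]. Qed.
Lemma domC_Im B f : domC B f -> dom B (fun k => Im (f k)).
Proof. intros H k. eapply Rle_trans; [apply im_le_Cmod|apply H]. Qed.
Lemma zsumC_minus B f g : domC B f -> domC B g -> zsumC (fun k => f k - g k)%C = (zsumC f - zsumC g)%C.
Proof.
  intros Hf Hg. apply ceq.
  - exact (zsum_minus B (fun k => Re (f k)) (fun k => Re (g k)) (domC_Re _ _ Hf) (domC_Re _ _ Hg)).
  - exact (zsum_minus B (fun k => Im (f k)) (fun k => Im (g k)) (domC_Im _ _ Hf) (domC_Im _ _ Hg)).
Qed.
Lemma zsumC_bound B f : domC B f -> Cmod (zsumC f) <= 250 * B.
Proof.
  intros H. rtrans Cmod_le_ReIm.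
  pose proof (zsum_bound _ _ (domC_Re _ _ H)). pose proof (zsum_bound _ _ (domC_Im _ _ H)). unfold zsumC. simpl. lra.
Qed.
Lemma zsumC_finite N (f : Z3 -> C) : (forall k, ~ In k (box N) -> f k = 0%C) -> zsumC f = csum (box N) f.
Proof. intros H. apply ceq; apply zsum_finite; intros k Hk; now rewrite H. Qed.

Lemma sob6_vn m u A k : (6 <= m)%nat -> sob m u A -> vn (u k) <= A * om k.
Proof.
  intros Hm H. pose proof (sob_vn _ _ _ k (sob_mono 6 _ _ _ Hm H)) as Q.
  pose proof (om_wt k). pose proof (om_pos k). pose proof (vn_ge0 (u k)).
  apply Rle_trans with (om k * (wt k ^ 6 * vn (u k))); [|rewrite (Rmult_comm A); apply Rmult_le_compat_l; lra].
  rewrite <- Rmult_assoc. rewrite <- (Rmult_1_l (vn (u k))) at 1. apply Rmult_le_compat_r; auto.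
Qed.

Lemma pj_bound k (z : nat -> C) i e : (forall a, Cmod (z a) <= e) ->
  Cmod (pj k z i) <= (1 + Rabs (kc i k / ksq k) * (3 * wt k)) * e.
Proof.
  intros H. unfold pj, Cminus. rtrans Cmod_triangle. rewrite Cmod_opp, Cmod_mult, Cmod_RtoC.
  assert (Cmod (cdot z k) <= 3 * wt k * e).
  { rtrans cdot_bound. pose proof (vn_le_sum z). pose proof (wt_ge1 k).
    pose proof (H 0%nat). pose proof (H 1%nat). pose proof (H 2%nat). nra. }
  specialize (H i). pose proof (Rabs_pos (kc i k / ksq k)).
  assert (Rabs (kc i k / ksq k) * Cmod (cdot z k) <= Rabs (kc i k / ksq k) * (3 * wt k * e)) by (apply Rmult_le_compat_l; auto). lra.
Qed.

Lemma pj_minus k (z w : nat -> C) i : pj k (fun i => z i - w i)%C i = (pj k z i - pj k w i)%C.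
Proof. unfold pj. rewrite cdot_csb. ring. Qed.

Lemma Dinf_dom u v A B k i : n3 v -> sob 6 u A -> sob 0 v B ->
  domC (A * wt k * B) (fun j => cdot (u j) k * v (z3sub k j) i)%C.
Proof.
  intros Hn Hu Hv j. rewrite Cmod_mult.
  pose proof (cdot_bound (u j) k). pose proof (sob6_vn 6 u A j (le_n _) Hu).
  pose proof (sob_comp0 0 v B (z3sub k j) i Hn Hv). pose proof (Cmod_ge_0 (v (z3sub k j) i)). pose proof (Cmod_ge_0 (cdot (u j) k)).
  pose proof (wt_ge1 k).
  apply Rle_trans with ((A * om j * wt k) * B); [|right; ring].
  apply Rmult_le_compat; auto. eapply Rle_trans; [eauto|]. apply Rmult_le_compat_r; lra.
Qed.

(** For a supported [u] the finite sum is already the full series, so only a bilinear difference has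
    to be estimated. *)
Lemma Bn_Binf_close N u v A e k i : supp N u -> n3 u -> n3 v ->
  sob 6 u A -> sob 6 v A -> sob 6 (csb u v) e ->
  Cmod (Bn N u u k i - Binf v k i) <= (1 + Rabs (kc i k / ksq k) * (3 * wt k)) * (500 * (A * wt k * e)).
Proof.
  intros Hs Hnu Hnv Hu Hv He. unfold Bn, Binf. rewrite <- pj_minus. apply pj_bound. intros a.
  assert (S0 : forall x y, sob 6 x y -> sob 0 x y) by (intros x y; apply sob_mono; lia).
  unfold Dn, Dinf.
  set (f := fun j => (cdot (u j) k * u (z3sub k j) a)%C). set (g := fun j => (cdot (v j) k * v (z3sub k j) a)%C).
  rewrite <- (zsumC_finite N f).
  2:{ intros j Hj. unfold f, cdot, s3. rewrite !Hs by auto. ring. }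
  replace (- Ci * zsumC f - - Ci * zsumC g)%C with (- Ci * (zsumC f - zsumC g))%C by ring.
  rewrite Cmod_mult, Cmod_opp, Cmod_Ci, Rmult_1_l.
  rewrite <- (zsumC_minus (A * wt k * A)); try (apply Dinf_dom; auto).
  replace (500 * (A * wt k * e)) with (250 * (e * wt k * A + A * wt k * e)) by ring. apply zsumC_bound.
  intros j. unfold f, g.
  replace (cdot (u j) k * u (z3sub k j) a - cdot (v j) k * v (z3sub k j) a)%C with
    (cdot (csb u v j) k * u (z3sub k j) a + cdot (v j) k * csb u v (z3sub k j) a)%C.
  2:{ unfold csb. rewrite (cdot_csb (u j) (v j)). ring. }
  rtrans Cmod_triangle. rewrite Rmult_plus_distr_r. apply Rplus_le_compat.
  - apply (Dinf_dom (csb u v) u e A k a); auto.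
  - apply (Dinf_dom v (csb u v) A e k a); auto. now apply n3_csb.
Qed.

Lemma esol_ok mu F c0 cN c s : esol mu F c0 cN c -> Rabs s <= 2 -> field_ok (c s).
Proof.
  intros H Hs. apply (field_ok_lim (fun N => cN N s)); [|now apply (es_lim _ _ _ _ _ H)].
  intros N. destruct (es_gal _ _ _ _ _ H N) as [[Q _] _]. apply Q.
Qed.

Lemma esol_bd mu F c0 cN c : esol mu F c0 cN c -> forall m, exists B, forall s, Rabs s <= 2 -> sob m (c s) B.
Proof.
  intros H m. destruct (es_bd _ _ _ _ _ H m) as [B HB]. exists B. intros s Hs.
  apply (sob_lim m (fun N => cN N s)); [exists 0%nat; auto|now apply (es_lim _ _ _ _ _ H)].
Qed.

(** For each fixed coefficient the derivatives of the approximations converge uniformly near [s],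
    thanks to the rate recorded in [esol]. *)
Lemma esol_derive mu F c0 cN c : 0 <= mu <= 1 -> esol mu F c0 cN c -> forall s, Rabs s < 2 ->
  cder c s (cadd (cscl mu (Binf (c s))) F).
Proof.
  intros Hmu H s Hs k i.
  destruct (es_bd _ _ _ _ _ H 6) as [A HA]. destruct (es_rate _ _ _ _ _ H 6) as [B HB].
  assert (Hr : 0 < 2 - Rabs s) by lra.
  set (Q := (1 + Rabs (kc i k / ksq k) * (3 * wt k)) * (500 * (A * wt k))).
  assert (A0 : 0 <= A) by (apply (sob_pos 6 (cN 0%nat 0)), HA; rewrite Rabs_R0; lra).
  assert (HQ : 0 <= Q).
  { unfold Q. pose proof (wt_ge1 k). pose proof (Rabs_pos (kc i k / ksq k)).
    assert (0 <= Rabs (kc i k / ksq k) * (3 * wt k)) by (apply Rmult_le_pos; lra).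
    apply Rmult_le_pos; [lra|]. apply Rmult_le_pos; [lra|]. apply Rmult_le_pos; lra. }
  destruct (box_ex k) as [N0 HN0].
  assert (HU : forall eps, 0 < eps -> exists N, forall n, (N <= n)%nat -> forall y, Boule s (mkposreal _ Hr) y ->
    Cmod (cadd (cscl mu (Binf (c y))) F k i - cadd (cscl mu (trunc n (Bn n (cN n y) (cN n y)))) (trunc n F) k i) < eps).
  { intros eps He. destruct (nfloor_ex (Q * (Rabs B) / eps)) as [n0 [_ Hn0]].
    { apply Rdiv_le_0_compat; auto. apply Rmult_le_pos; auto; apply Rabs_pos. }
    exists (N0 + S n0)%nat. intros n Hn y Hy. unfold Boule in Hy; simpl in Hy.
    assert (Hy2 : Rabs y <= 2).
    { replace y with (s + (y - s)) by ring. rtrans Rabs_triang. lra. }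
    unfold cadd, cscl. rewrite !trunc_in by (eapply box_mono; [|eauto]; lia).
    replace (mu * Binf (c y) k i + F k i - (mu * Bn n (cN n y) (cN n y) k i + F k i))%C with
      (- (mu * (Bn n (cN n y) (cN n y) k i - Binf (c y) k i)))%C by ring.
    rewrite Cmod_opp, Cmod_mult, Cmod_RtoC, Rabs_pos_eq by lra.
    destruct (es_gal _ _ _ _ _ H n) as [[G _] _]. destruct (G y) as [G1 (G2 & G3 & G4)].
    assert (Hn1 : INR n0 + 1 <= INR n) by (rewrite <- S_INR; apply le_INR; lia). pose proof (pos_INR n0).
    assert (C1 : Cmod (Bn n (cN n y) (cN n y) k i - Binf (c y) k i) <= Q * (B / INR n)).
    { eapply Rle_trans; [apply (Bn_Binf_close n (cN n y) (c y) A (B / INR n)); auto|].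
      - apply (esol_ok _ _ _ _ _ y H Hy2).
      - apply (sob_lim 6 (fun N => cN N y)); [exists 0%nat; auto|now apply (es_lim _ _ _ _ _ H)].
      - apply HB; auto; lia.
      - right. unfold Q. ring. }
    pose proof (Cmod_ge_0 (Bn n (cN n y) (cN n y) k i - Binf (c y) k i)).
    apply Rle_lt_trans with (Q * (B / INR n)); [nra|].
    apply Rmult_lt_reg_r with (INR n); [lra|]. replace (Q * (B / INR n) * INR n) with (Q * B) by (field; lra).
    apply Rmult_lt_compat_r with (r := eps) in Hn0; auto. unfold Rdiv in Hn0. rewrite Rmult_assoc, Rinv_l, Rmult_1_r in Hn0 by lra.
    pose proof (Rle_abs B). nra. }
  assert (HB2 : forall y, Boule s (mkposreal _ Hr) y -> Rabs y <= 2).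
  { intros y Hy. unfold Boule in Hy; simpl in Hy. replace y with (s + (y - s)) by ring. rtrans Rabs_triang. lra. }
  split.
  - apply (CVU_derivable (fun n y => Re (cN n y k i)) (fun n y => Re (cadd (cscl mu (trunc n (Bn n (cN n y) (cN n y)))) (trunc n F) k i))
      (fun y => Re (c y k i)) (fun y => Re (cadd (cscl mu (Binf (c y))) F k i)) s (mkposreal _ Hr)).
    + intros eps He. destruct (HU eps He) as [N HN]. exists N. intros n y Hn Hy.
      rewrite <- Re_minus. eapply Rle_lt_trans; [apply re_le_Cmod|]. auto.
    + intros y Hy. apply (es_lim _ _ _ _ _ H); auto.
    + intros n y Hy. destruct (es_gal _ _ _ _ _ H n) as [[_ G] _]. apply G; auto.
    + unfold Boule; simpl. rewrite Rminus_diag, Rabs_R0. auto.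
  - apply (CVU_derivable (fun n y => Im (cN n y k i)) (fun n y => Im (cadd (cscl mu (trunc n (Bn n (cN n y) (cN n y)))) (trunc n F) k i))
      (fun y => Im (c y k i)) (fun y => Im (cadd (cscl mu (Binf (c y))) F k i)) s (mkposreal _ Hr)).
    + intros eps He. destruct (HU eps He) as [N HN]. exists N. intros n y Hn Hy.
      rewrite <- Im_minus. eapply Rle_lt_trans; [apply im_le_Cmod|]. auto.
    + intros y Hy. apply (es_lim _ _ _ _ _ H); auto.
    + intros n y Hy. destruct (es_gal _ _ _ _ _ H n) as [[_ G] _]. apply G; auto.
    + unfold Boule; simpl. rewrite Rminus_diag, Rabs_R0. auto.
Qed.

(** ** Jumps of families of solutions *)

Lemma cder_const u s : cder (fun _ => u) s czero.
Proof. intros k i. split; apply derivable_pt_lim_const. Qed.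
Lemma cder_lin u s : cder (fun r => cscl r u) s u.
Proof.
  intros k i. unfold cscl. split.
  - eapply deriv_ext; [intros; symmetry; apply Re_scal|]. eapply deriv_val; [|apply (derivable_pt_lim_mult (fun r => r) (fun _ => Re (u k i)));
     [apply derivable_pt_lim_id|apply derivable_pt_lim_const]]. ring.
  - eapply deriv_ext; [intros; symmetry; apply Im_scal|]. eapply deriv_val; [|apply (derivable_pt_lim_mult (fun r => r) (fun _ => Im (u k i)));
     [apply derivable_pt_lim_id|apply derivable_pt_lim_const]]. ring.
Qed.

Lemma supp_cadd N u v : supp N u -> supp N v -> supp N (cadd u v).
Proof. intros Hu Hv k i Hk. unfold cadd. rewrite Hu, Hv by auto. ring. Qed.
Lemma supp_cscl N r v : supp N v -> supp N (cscl r v).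
Proof. intros Hv k i Hk. unfold cscl. rewrite Hv by auto. ring. Qed.
Lemma supp_mono N N' u : (N <= N')%nat -> supp N u -> supp N' u.
Proof. intros H Hu k i Hk. apply Hu. intros Hk'. apply Hk. eapply box_mono; eauto. Qed.
Lemma csb_trunc N u v : trunc N (csb u v) = csb (trunc N u) (trunc N v).
Proof. apply coef_ext; intros k i. unfold trunc, csb. destruct (inb (box N) k); auto. ring. Qed.
Lemma trunc_supp_id N u : supp N u -> trunc N u = u.
Proof.
  intros H. apply coef_ext; intros k i. destruct (classic (In k (box N))) as [Hk|Hk].
  - now apply trunc_in.
  - rewrite trunc_out, H; auto.
Qed.

Definition rem (mu : R) (c0 F h : coef) (N : nat) (c1 : coef) : coef :=
  csb (csb (csb c1 c0) F) (cscl mu (Bn N h h)).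

Section JumpPair.
Variables (m N0 : nat) (mu R0 X BF eta : R) (F c0 h F' c0' h' : coef)
  (cN cN' : nat -> R -> coef) (c c' : R -> coef).
Hypotheses (Hm : (4 <= m)%nat) (Hmu : 0 <= mu <= 1) (HX : 0 <= X) (HBF : 0 <= BF <= R0) (Heta : 0 <= eta)
  (E : esol mu F c0 cN c) (E' : esol mu F' c0' cN' c')
  (Sh : supp N0 h) (Oh : field_ok h) (Sh' : supp N0 h') (Oh' : field_ok h')
  (Bc : forall N s, Rabs s <= 2 -> sob (S (S (S m))) (cN N s) R0)
  (Bc' : forall N s, Rabs s <= 2 -> sob (S (S (S m))) (cN' N s) R0)
  (Bh : sob (S m) h R0) (Bh' : sob (S m) h' R0) (Dh : sob (S m) (csb h h') (R0 * eta))
  (D0 : sob (S (S m)) (csb c0 c0') (R0 * eta))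
  (BF1 : sob (S (S m)) F BF) (BF2 : sob (S (S m)) F' BF) (DF : sob (S (S m)) (csb F F') (BF * eta))
  (X1 : sob (S m) (csb c0 h) X) (X2 : sob (S m) (csb c0' h') X)
  (DX : sob (S m) (csb (csb c0 h) (csb c0' h')) (X * eta)).

(** Two solutions with data at distance of order [eta] are followed together. [Lc * eta] bounds
    their distance, [rho] the deviation of one solution from its reference [h], and [R1] the sizes
    and Lipschitz constants that occur. Three derivatives are spent: one in the stability estimate
    and one in each of two applications of [sob_Bn]. *)
Let Lc : R := Kdiff (S (S m)) R0 * (2 * R0).
Let R1 : R := R0 + Lc.
Let rho : R := X + 3 * (mu * (2 * KII (S m) * R1 * R1) + BF).

Lemma jp_Lc_pos : 0 <= Lc.
Proof.
  unfold Lc. apply Rmult_le_pos; [|lra]. unfold Kdiff.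
  pose proof (exp_pos (2 * KII (S (S m)) * R0 + 48 * KI (S (S m)) * R0 + 3)). lra.
Qed.

Lemma jp_diff N s : Rabs s <= 2 -> sob (S (S m)) (csb (cN N s) (cN' N s)) (Lc * eta).
Proof.
  intros Hs. destruct (es_gal _ _ _ _ _ E N) as [[G1 G2] G3]. destruct (es_gal _ _ _ _ _ E' N) as [[G1' G2'] G3'].
  replace (Lc * eta) with (Kdiff (S (S m)) R0 * (R0 * eta + R0 * eta)) by (unfold Lc; ring).
  apply (diff_estimate (S (S m)) N mu (cN N) (cN' N) (fun _ => trunc N F) (fun _ => trunc N F') R0); auto; try lia.
  - apply Rmult_le_pos; lra.
  - intros r Hr. eapply sob_mono; [|apply Bc'; auto]. lia.
  - intros r Hr. rewrite <- csb_trunc. apply sob_trunc. eapply sob_le; [apply DF|]. apply Rmult_le_compat_r; lra.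
  - rewrite G3, G3', <- csb_trunc. now apply sob_trunc.
Qed.

Lemma jp_incr_bound (F1 c01 : coef) cM c1 N s : esol mu F1 c01 cM c1 ->
  (forall N s, Rabs s <= 2 -> sob (S (S (S m))) (cM N s) R0) -> sob (S (S m)) F1 BF -> 0 <= s <= 1 ->
  sob (S m) (csb (cM N s) (cM N 0)) (3 * (mu * (KII (S m) * R0 * R0) + BF)).
Proof.
  intros E1 B1 BF0 Hs. destruct (es_gal _ _ _ _ _ E1 N) as [[G1 G2] G3].
  assert (K0 : 0 <= mu * (KII (S m) * R0 * R0) + BF).
  { pose proof (KII_pos (S m)). assert (0 <= mu * (KII (S m) * R0 * R0)); [|lra].
    apply Rmult_le_pos; [lra|]. apply Rmult_le_pos; [apply Rmult_le_pos|]; lra. }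
  apply (sob_le _ _ (3 * (mu * (KII (S m) * R0 * R0) + BF) * (s - 0))).
  2:{ rewrite Rminus_0_r. nra. }
  apply (mean_value (S m) N (cM N) (fun r => cadd (cscl mu (trunc N (Bn N (cM N r) (cM N r)))) (trunc N F1))); try lra.
  - intros; apply G1.
  - intros r Hr. apply G2. apply Rabs_le; lra.
  - intros r Hr. assert (Hr2 : Rabs r <= 2) by (apply Rabs_le; lra). apply sob_add.
    + replace (mu * (KII (S m) * R0 * R0)) with (Rabs mu * (KII (S m) * R0 * R0)) by (rewrite Rabs_pos_eq; lra).
      apply sob_scl. apply sob_Bn; [lia|apply G1| |]; eapply sob_mono; try (apply B1; auto); lia.
    + apply sob_trunc. eapply sob_mono; [|apply BF0]. lia.
Qed.

Lemma jp_d_bound (F1 c01 h1 : coef) cM c1 N s : esol mu F1 c01 cM c1 ->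
  (forall N s, Rabs s <= 2 -> sob (S (S (S m))) (cM N s) R0) -> sob (S (S m)) F1 BF -> supp N0 h1 ->
  sob (S m) (csb c01 h1) X -> (N0 <= N)%nat -> 0 <= s <= 1 ->
  sob (S m) (csb (cM N s) h1) rho.
Proof.
  intros E1 B1 BF0 S1 SX HN Hs. destruct (es_gal _ _ _ _ _ E1 N) as [_ G3].
  replace (csb (cM N s) h1) with (cadd (trunc N (csb c01 h1)) (csb (cM N s) (cM N 0))).
  2:{ rewrite G3, csb_trunc, (trunc_supp_id N h1) by (eapply supp_mono; eauto).
      coef_ring. }
  eapply sob_le; [apply sob_add; [apply sob_trunc; eauto|apply (jp_incr_bound F1 c01 cM c1); auto]|].
  unfold rho. pose proof jp_Lc_pos. pose proof (KII_pos (S m)).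
  assert (R0 * R0 <= R1 * R1) by (unfold R1; apply Rmult_le_compat; lra).
  assert (mu * (KII (S m) * R0 * R0) <= mu * (2 * KII (S m) * R1 * R1)); [|lra].
  apply Rmult_le_compat_l; [lra|]. nra.
Qed.

(** Comparing the deviations from [h] and [h'], rather than the solutions, retains the small factor
    [rho] that [jp_diff] does not provide. *)
Lemma jp_dd_bound N s : (N0 <= N)%nat -> 0 <= s <= 1 ->
  sob (S m) (csb (csb (cN N s) h) (csb (cN' N s) h')) (rho * eta).
Proof.
  intros HN Hs. destruct (es_gal _ _ _ _ _ E N) as [[G1 G2] G3]. destruct (es_gal _ _ _ _ _ E' N) as [[G1' G2'] G3'].
  set (y := fun r => csb (cN N r) (cN' N r)).
  replace (csb (csb (cN N s) h) (csb (cN' N s) h')) with (cadd (trunc N (csb (csb c0 h) (csb c0' h'))) (csb (y s) (y 0))).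
  2:{ unfold y. rewrite G3, G3', !csb_trunc, (trunc_supp_id N h), (trunc_supp_id N h') by (eapply supp_mono; eauto).
      coef_ring. }
  pose proof jp_Lc_pos. pose proof (KII_pos (S m)).
  set (B := mu * (2 * KII (S m) * R1 * R1) * eta + BF * eta).
  assert (HB : 0 <= B).
  { unfold B. assert (0 <= mu * (2 * KII (S m) * R1 * R1)).
    { apply Rmult_le_pos; [lra|]. apply Rmult_le_pos; [apply Rmult_le_pos|]; unfold R1; lra. }
    apply Rplus_le_le_0_compat; apply Rmult_le_pos; lra. }
  eapply sob_le; [apply sob_add; [apply sob_trunc; apply DX|]|].
  - apply (mean_value (S m) N y (fun r => csb (cadd (cscl mu (trunc N (Bn N (cN N r) (cN N r)))) (trunc N F)) (cadd (cscl mu (trunc N (Bn N (cN' N r) (cN' N r)))) (trunc N F'))) B 0 s); try lra.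
    + intros r. apply supp_csb; [apply G1|apply G1'].
    + intros r Hr. apply cder_sub; [apply G2|apply G2']; apply Rabs_le; lra.
    + intros r Hr. assert (Hr2 : Rabs r <= 2) by (apply Rabs_le; lra).
      match goal with |- sob _ ?Z _ => replace Z with (cadd (cscl mu (cadd (trunc N (Bn N (y r) (cN N r))) (trunc N (Bn N (cN' N r) (y r))))) (trunc N (csb F F'))) end.
      2:{ rewrite <- csb_trunc_cadd. unfold y. rewrite <- Bn_diff, !csb_trunc. coef_ring. }
      unfold B. apply sob_add; [|apply sob_trunc; eapply sob_mono; [|apply DF]; lia].
      replace (mu * (2 * KII (S m) * R1 * R1) * eta) with (Rabs mu * (KII (S m) * (R1 * eta) * R1 + KII (S m) * R1 * (R1 * eta))) by (rewrite Rabs_pos_eq by lra; ring).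
      assert (Yr : sob (S (S m)) (y r) (R1 * eta)).
      { eapply sob_le; [apply jp_diff; auto|]. apply Rmult_le_compat_r; auto. unfold R1; lra. }
      apply sob_scl, sob_add; apply sob_Bn; try lia.
      * apply dv_csb; [apply G1|apply G1'].
      * eapply sob_mono; [|apply Yr]; lia.
      * eapply sob_le; [eapply sob_mono; [|apply Bc; auto]; lia|unfold R1; lra].
      * apply G1'.
      * eapply sob_le; [eapply sob_mono; [|apply Bc'; auto]; lia|unfold R1; lra].
      * exact Yr.
  - unfold rho. replace ((X + 3 * (mu * (2 * KII (S m) * R1 * R1) + BF)) * eta) with (X * eta + 3 * B * 1) by (unfold B; ring).
    rewrite Rminus_0_r. nra.
Qed.

(** The expected drift is subtracted linearly in time: the velocity that is left is
    [mu (B(c, c) - B(h, h))], and the increment over [[0, 1]] tends to [rem]. *)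
Let ycurve (h1 F1 : coef) (cM : nat -> R -> coef) N (r : R) : coef :=
  csb (csb (csb (cM N r) (cM N 0)) (cscl r (trunc N F1))) (cscl r (cscl mu (trunc N (Bn N h1 h1)))).

Lemma jp_ycurve_supp h1 F1 c01 cM c1 N r : esol mu F1 c01 cM c1 -> supp N (ycurve h1 F1 cM N r).
Proof.
  intros E1. destruct (es_gal _ _ _ _ _ E1 N) as [[G1 G2] G3].
  unfold ycurve. repeat apply supp_csb; try apply supp_cscl; try apply supp_cscl; try apply supp_trunc; apply G1.
Qed.

Lemma jp_ycurve_der h1 F1 c01 cM c1 N r : esol mu F1 c01 cM c1 -> Rabs r <= 2 ->
  cder (ycurve h1 F1 cM N) r (cscl mu (trunc N (csb (Bn N (cM N r) (cM N r)) (Bn N h1 h1)))).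
Proof.
  intros E1 Hr. destruct (es_gal _ _ _ _ _ E1 N) as [[G1 G2] G3].
  unfold ycurve.
  match goal with |- cder _ _ ?Z => replace Z with (csb (csb (csb (cadd (cscl mu (trunc N (Bn N (cM N r) (cM N r)))) (trunc N F1)) czero) (trunc N F1)) (cscl mu (trunc N (Bn N h1 h1)))) end.
  - apply (cder_sub (fun r => csb (csb (cM N r) (cM N 0)) (cscl r (trunc N F1)))); [|apply cder_lin].
    apply (cder_sub (fun r => csb (cM N r) (cM N 0))); [|apply cder_lin].
    apply (cder_sub (fun r => cM N r)); [now apply G2|apply cder_const].
  - rewrite csb_trunc. coef_ring.
Qed.

Lemma jp_ycurve_lim h1 F1 c01 cM c1 : esol mu F1 c01 cM c1 -> supp N0 h1 ->
  clim (fun N => csb (ycurve h1 F1 cM N 1) (ycurve h1 F1 cM N 0)) (rem mu c01 F1 h1 N0 (c1 1)).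
Proof.
  intros E1 S1.
  apply clim_ev with (fun N => rem mu (trunc N c01) (trunc N F1) h1 N0 (cM N 1)).
  2:{ unfold rem. repeat apply clim_csb; try apply clim_trunc; try apply clim_const.
      apply (es_lim _ _ _ _ _ E1). rewrite Rabs_R1; lra. }
  exists (N0 + N0)%nat. intros N HN. destruct (es_gal _ _ _ _ _ E1 N) as [[G1 G2] G3].
  assert (EB : trunc N (Bn N h1 h1) = Bn N0 h1 h1).
  { rewrite (Bn_supp N0 N) by (auto; lia). apply trunc_supp_id.
    intros k i Hk. unfold Bn, pj.
    assert (Z : forall a, Dn N0 h1 h1 k a = 0%C).
    { intros a. unfold Dn. rewrite csum_zero; [ring|]. intros j Hj.
      rewrite (S1 (z3sub k j) a); [ring|]. intros Hkj. apply Hk.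
      rewrite <- (z3subK k j). eapply box_mono; [|apply box_add; eauto]. lia. }
    unfold cdot, s3. rewrite !Z. ring. }
  unfold ycurve, rem. rewrite EB, G3. coef_ring.
Qed.

(** [B(c, c) - B(h, h) = B(c - h, c) + B(h, c - h)] and [c - h] stays of size [rho], so the error
    has the small factor [mu * rho]. *)
Lemma jump_bound : sob m (rem mu c0 F h N0 (c 1)) (12 * KII m * R1 * mu * rho).
Proof.
  assert (LP := jp_Lc_pos). assert (KP := KII_pos m).
  apply (sob_lim m (fun N => csb (ycurve h F cN N 1) (ycurve h F cN N 0))); [|apply (jp_ycurve_lim h F c0 cN c); auto].
  exists N0. intros N HN. destruct (es_gal _ _ _ _ _ E N) as [[G1 G2] G3].
  assert (RP : 0 <= rho). { eapply sob_pos. apply (jp_d_bound F c0 h cN c N 0); auto. lra. }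
  apply (sob_le _ _ (3 * (mu * (KII m * rho * R1 + KII m * R1 * rho)) * (1 - 0))).
  2:{ assert (0 <= KII m * R1 * mu * rho) by (apply Rmult_le_pos; [apply Rmult_le_pos; [apply Rmult_le_pos|]|]; auto; unfold R1; lra). lra. }
  apply (mean_value m N (ycurve h F cN N) (fun r => cscl mu (trunc N (csb (Bn N (cN N r) (cN N r)) (Bn N h h))))); try lra.
  - intros r. apply (jp_ycurve_supp h F c0 cN c); auto.
  - intros r Hr. apply (jp_ycurve_der h F c0 cN c); auto. apply Rabs_le; lra.
  - intros r Hr. assert (Hr2 : Rabs r <= 2) by (apply Rabs_le; lra).
    replace mu with (Rabs mu) at 2 by (rewrite Rabs_pos_eq; lra).
    apply sob_scl. rewrite Bn_diff, csb_trunc_cadd.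
    assert (Dr : sob (S m) (csb (cN N r) h) rho) by (apply (jp_d_bound F c0 h cN c); auto; lra).
    apply sob_add; apply sob_Bn; auto.
    + apply dv_csb; [apply G1|apply Oh].
    + eapply sob_mono; [|apply Dr]; lia.
    + eapply sob_le; [eapply sob_mono; [|apply Bc; auto]; lia|unfold R1; lra].
    + apply Oh.
    + eapply sob_le; [eapply sob_mono; [|apply Bh]; lia|unfold R1; lra].
Qed.

Lemma jump_lip : sob m (csb (rem mu c0 F h N0 (c 1)) (rem mu c0' F' h' N0 (c' 1))) (12 * KII m * R1 * mu * rho * eta).
Proof.
  assert (LP := jp_Lc_pos).
  set (y := fun N r => csb (ycurve h F cN N r) (ycurve h' F' cN' N r)).
  apply (sob_lim m (fun N => csb (y N 1) (y N 0))).
  2:{ apply clim_ev with (fun N => csb (csb (ycurve h F cN N 1) (ycurve h F cN N 0)) (csb (ycurve h' F' cN' N 1) (ycurve h' F' cN' N 0))).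
      { exists 0%nat. intros n _. unfold y. coef_ring. }
      apply clim_csb; [apply (jp_ycurve_lim h F c0 cN c)|apply (jp_ycurve_lim h' F' c0' cN' c')]; auto. }
  exists N0. intros N HN. destruct (es_gal _ _ _ _ _ E N) as [[G1 G2] G3]. destruct (es_gal _ _ _ _ _ E' N) as [[G1' G2'] G3'].
  replace (12 * KII m * R1 * mu * rho * eta) with (3 * (mu * (((KII m * (rho * eta) * R1 + KII m * rho * (R1 * eta)) + KII m * (R1 * eta) * rho) + KII m * R1 * (rho * eta))) * (1 - 0)) by ring.
  apply (mean_value m N (y N) (fun r => csb (cscl mu (trunc N (csb (Bn N (cN N r) (cN N r)) (Bn N h h)))) (cscl mu (trunc N (csb (Bn N (cN' N r) (cN' N r)) (Bn N h' h'))))) _ 0 1); try lra.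
  - intros r. apply supp_csb; [apply (jp_ycurve_supp h F c0 cN c)|apply (jp_ycurve_supp h' F' c0' cN' c')]; auto.
  - intros r Hr. apply cder_sub; [apply (jp_ycurve_der h F c0 cN c)|apply (jp_ycurve_der h' F' c0' cN' c')]; auto; apply Rabs_le; lra.
  - intros r Hr. assert (Hr2 : Rabs r <= 2) by (apply Rabs_le; lra).
    set (d := csb (cN N r) h). set (d' := csb (cN' N r) h').
    (* Four bilinear terms, each of order [rho * eta]: either [d - d'] occurs, or one deviation
       meets one difference. *)
    match goal with |- sob _ ?Z _ => replace Z with (cscl mu (cadd (cadd (cadd (trunc N (Bn N (csb d d') (cN N r))) (trunc N (Bn N d' (csb (cN N r) (cN' N r))))) (trunc N (Bn N (csb h h') d))) (trunc N (Bn N h' (csb d d'))))) end.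
    2:{ rewrite !Bn_diff. fold d d'. rewrite <- !csb_trunc_cadd.
        replace (csb d d') with (cadd d (cscl (-1) d')) by (now rewrite <- csb_scl).
        replace (csb (cN N r) (cN' N r)) with (cadd (cN N r) (cscl (-1) (cN' N r))) by (now rewrite <- csb_scl).
        replace (csb h h') with (cadd h (cscl (-1) h')) by (now rewrite <- csb_scl).
        rewrite !Bn_addl, !Bn_addr, !Bn_scall, !Bn_scalr, !csb_trunc_cadd, !trunc_cscl.
        coef_ring. }
    replace mu with (Rabs mu) at 2 by (rewrite Rabs_pos_eq; lra).
    assert (Dr : sob (S m) d rho) by (apply (jp_d_bound F c0 h cN c); auto; lra).
    assert (Dr' : sob (S m) d' rho) by (apply (jp_d_bound F' c0' h' cN' c'); auto; lra).
    assert (DD : sob (S m) (csb d d') (rho * eta)) by (apply jp_dd_bound; auto; lra).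
    assert (Od : dv d) by (apply dv_csb; [apply G1|apply Oh]).
    assert (Od' : dv d') by (apply dv_csb; [apply G1'|apply Oh']).
    assert (Cd : sob (S (S m)) (csb (cN N r) (cN' N r)) (R1 * eta)).
    { eapply sob_le; [apply jp_diff; auto|]. apply Rmult_le_compat_r; auto. unfold R1; lra. }
    apply sob_scl. repeat apply sob_add; apply sob_Bn; auto.
    + apply dv_csb; auto.
    + eapply sob_mono; [|apply DD]; lia.
    + eapply sob_le; [eapply sob_mono; [|apply Bc; auto]; lia|unfold R1; lra].
    + eapply sob_mono; [|apply Dr']; lia.
    + eapply sob_mono; [|apply Cd]; lia.
    + apply dv_csb; [apply Oh|apply Oh'].
    + eapply sob_le; [eapply sob_mono; [|apply Dh]; lia|]. apply Rmult_le_compat_r; auto. unfold R1; lra.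
    + apply Oh'.
    + eapply sob_le; [eapply sob_mono; [|apply Bh']; lia|unfold R1; lra].
Qed.
End JumpPair.

(** * Families of states that are Lipschitz in a parameter *)

Section Families.
Context {P : Type} (dst : P -> P -> R) (dst_pos : forall p q, 0 <= dst p q).

(** A single constant bounds the size and the Lipschitz modulus, so estimates for single states
    extend to families with the same bookkeeping. *)
Definition fam (m : nat) (w : P -> coef) (M : R) : Prop :=
  (forall p, sob m (w p) M) /\ forall p q, sob m (csb (w p) (w q)) (M * dst p q).
Definition cfam (c : P -> R) (M : R) : Prop :=
  0 <= M /\ (forall p, Rabs (c p) <= M) /\ forall p q, Rabs (c p - c q) <= M * dst p q.

Lemma fam_le m w A B : fam m w A -> A <= B -> fam m w B.
Proof.
  intros [H1 H2] HAB. split; intros; [eapply sob_le; eauto|]. eapply sob_le; [apply H2|].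
  apply Rmult_le_compat_r; auto.
Qed.
Lemma fam_mono m m' w A : (m <= m')%nat -> fam m' w A -> fam m w A.
Proof. intros H [H1 H2]. split; intros; eapply sob_mono; eauto. Qed.
Lemma fam_ext m w w' A : (forall p, w p = w' p) -> fam m w A -> fam m w' A.
Proof. intros H. replace w' with w; auto. now apply functional_extensionality. Qed.
Lemma fam_add m w v A B : fam m w A -> fam m v B -> fam m (fun p => cadd (w p) (v p)) (A + B).
Proof.
  intros [H1 H2] [H3 H4]. split; intros; [now apply sob_add|].
  replace (csb (cadd (w p) (v p)) (cadd (w q) (v q))) with (cadd (csb (w p) (w q)) (csb (v p) (v q))).
  - rewrite Rmult_plus_distr_r. now apply sob_add.
  - coef_ring.
Qed.
Lemma fam_scl m r w A : fam m w A -> fam m (fun p => cscl r (w p)) (Rabs r * A).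
Proof.
  intros [H1 H2]. split; intros; [now apply sob_scl|].
  replace (csb (cscl r (w p)) (cscl r (w q))) with (cscl r (csb (w p) (w q))).
  - rewrite Rmult_assoc. now apply sob_scl.
  - coef_ring.
Qed.
Lemma csb_self u : csb u u = czero.
Proof. coef_ring. Qed.
Lemma fam_const m u A : sob m u A -> fam m (fun _ => u) A.
Proof.
  intros H. split; auto. intros p q. rewrite csb_self. eapply sob_le; [apply sob_zero|].
  apply Rmult_le_pos; auto. eapply sob_pos; eauto.
Qed.
Lemma fam_cmul m c u A B : cfam c A -> sob m u B -> fam m (fun p => cscl (c p) u) (A * B).
Proof.
  intros (H0 & H1 & H2) Hu. pose proof (sob_pos _ _ _ Hu). split; intros.
  - eapply sob_le; [apply sob_scl; eauto|]. now apply Rmult_le_compat_r.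
  - replace (csb (cscl (c p) u) (cscl (c q) u)) with (cscl (c p - c q) u).
    + eapply sob_le; [apply sob_scl; eauto|].
      replace (A * B * dst p q) with ((A * dst p q) * B) by ring. now apply Rmult_le_compat_r.
    + coef_ring.
Qed.
Lemma fam_pos m w A : fam m w A -> inhabited P -> 0 <= A.
Proof. intros [H _] [p]. apply (sob_pos m (w p)), H. Qed.

(** [mu0] and [Cj] depend only on [m] and the radius [R0]. When [X] and [BF] are of order [mu] the
    error is of order [mu^2]; it then survives the division by [mu] in the bracket manoeuvre. *)
Theorem family_jump m R0 : (4 <= m)%nat -> 0 <= R0 -> exists mu0 Cj, 0 < mu0 <= 1 /\ 0 <= Cj /\
  forall mu (c0 F h : P -> coef) N0 X BF, 0 < mu <= mu0 -> 0 <= X -> 0 <= BF <= R0 ->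
  (forall p, adm (c0 p)) -> (forall p, adm (F p)) -> (forall p, supp N0 (h p) /\ field_ok (h p)) ->
  fam (m + 3) c0 R0 -> fam (m + 3) F BF -> fam (S m) h R0 -> fam (S m) (fun p => csb (c0 p) (h p)) X ->
  exists c : P -> R -> coef, (forall p, exists cN, esol mu (F p) (c0 p) cN (c p)) /\
    fam m (fun p => rem mu (c0 p) (F p) (h p) N0 (c p 1)) (Cj * mu * (X + mu + BF)).
Proof.
  intros Hm HR. destruct (euler_exists R0 HR) as (mu0 & Hmu0 & Rb & HRb & H).
  (* [R1] bounds the solutions in order [m + 3]; [R2] is the constant called [R1] in the comparison
     of two solutions, computed with this bound. *)
  set (R1 := R0 + Rb (m + 3)%nat * R0).
  assert (HR1 : R0 <= R1). { unfold R1. assert (0 <= Rb (m + 3)%nat * R0) by (apply Rmult_le_pos; auto). lra. }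
  set (R2 := R1 + Kdiff (S (S m)) R1 * (2 * R1)).
  assert (HR2 : 0 <= R2).
  { assert (0 <= Kdiff (S (S m)) R1).
    { unfold Kdiff. pose proof (exp_pos (2 * KII (S (S m)) * R1 + 48 * KI (S (S m)) * R1 + 3)). lra. }
    assert (0 <= Kdiff (S (S m)) R1 * (2 * R1)) by (apply Rmult_le_pos; lra). unfold R2. lra. }
  pose proof (KII_pos m) as KP. pose proof (KII_pos (S m)) as KP'.
  set (Cj := 12 * KII m * R2 * (1 + 3 + 6 * KII (S m) * R2 * R2)).
  assert (HCj : 0 <= 12 * KII m * R2) by (apply Rmult_le_pos; lra).
  assert (HC2 : 0 <= 6 * KII (S m) * R2 * R2) by (apply Rmult_le_pos; [apply Rmult_le_pos|]; lra).
  exists mu0, Cj. split; auto. split; [apply Rmult_le_pos; lra|].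
  intros mu c0 F h N0 X BF Hmu HX HBF Ac AF Ah Fc FF Fh FX.
  assert (Q : forall p, exists c : R -> coef, exists cN, esol mu (F p) (c0 p) cN c /\
     forall N s, Rabs s <= 2 -> sob (S (S (S m))) (cN N s) R1).
  { intros p. destruct (H mu (c0 p) (F p)) as (cN & c & E & B); auto.
    - eapply sob_mono; [|apply Fc]. lia.
    - eapply sob_le; [eapply sob_mono; [|apply FF]; lia|lra].
    - exists c, cN. split; auto. intros N s Hs. replace (S (S (S m))) with (m + 3)%nat by lia.
      eapply sob_le; [apply (B (m + 3)%nat R0); auto; try lia; [apply Fc|]|unfold R1; lra].
      eapply sob_le; [apply FF|lra]. }
  set (c := fun p => proj1_sig (constructive_indefinite_description _ (Q p))).
  assert (Hc : forall p, exists cN, esol mu (F p) (c0 p) cN (c p) /\ forall N s, Rabs s <= 2 -> sob (S (S (S m))) (cN N s) R1).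
  { intros p. exact (proj2_sig (constructive_indefinite_description _ (Q p))). }
  assert (Hfin : 12 * KII m * R2 * mu * (X + 3 * (mu * (2 * KII (S m) * R2 * R2) + BF)) <= Cj * mu * (X + mu + BF)).
  { unfold Cj. replace (12 * KII m * R2 * (1 + 3 + 6 * KII (S m) * R2 * R2) * mu * (X + mu + BF)) with
      (12 * KII m * R2 * mu * ((1 + 3 + 6 * KII (S m) * R2 * R2) * (X + mu + BF))) by ring.
    apply Rmult_le_compat_l; [apply Rmult_le_pos; lra|]. set (K := 6 * KII (S m) * R2 * R2) in *.
    replace (X + 3 * (mu * (2 * KII (S m) * R2 * R2) + BF)) with (X + mu * K + 3 * BF) by (unfold K; ring).
    assert (0 <= K * X) by (apply Rmult_le_pos; lra). assert (0 <= K * BF) by (apply Rmult_le_pos; lra). lra. }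
  exists c. split; [intros p; destruct (Hc p) as (cN & E & _); eauto|].
  split.
  - intros p. destruct (Hc p) as (cN & E & B). eapply sob_le; [|apply Hfin].
    apply (jump_bound m N0 mu R1 X BF (F p) (c0 p) (h p) cN (c p)); auto; try lra; try apply Ah.
    + eapply sob_le; [apply Fh|lra].
    + eapply sob_mono; [|apply FF]; lia.
    + apply FX.
  - intros p q. destruct (Hc p) as (cN & E & B). destruct (Hc q) as (cN' & E' & B').
    eapply sob_le; [|apply Rmult_le_compat_r; [apply dst_pos|apply Hfin]].
    apply (jump_lip m N0 mu R1 X BF (dst p q) (F p) (c0 p) (h p) (F q) (c0 q) (h q) cN cN' (c p) (c q)); auto; try lra; try apply Ah;
      try (eapply sob_le; [apply Fh|lra]); try apply FX.
    + eapply sob_le; [apply Fh|]. apply Rmult_le_compat_r; auto.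
    + eapply sob_le; [eapply sob_mono; [|apply Fc]; lia|]. apply Rmult_le_compat_r; auto.
    + eapply sob_mono; [|apply FF]; lia.
    + eapply sob_mono; [|apply FF]; lia.
    + eapply sob_mono; [|apply FF]; lia.
Qed.
End Families.

(** ** Fourier series *)

(** The real part of [a * exp (i th)]. *)
Definition trm (a : C) (th : R) : R := Re a * cos th - Im a * sin th.
Definition SF (a : Z3 -> C) (x : R3) : R := zsum (fun k => trm (a k) (zdot k x)).
Definition synth (c : coef) : field := fun x =>
  (SF (fun k => c k 0%nat) x, SF (fun k => c k 1%nat) x, SF (fun k => c k 2%nat) x).
(** Rapid decay, the Fourier side of smoothness. *)
Definition RD (a : Z3 -> C) : Prop := forall p, exists B, forall k, wt k ^ p * Cmod (a k) <= B.
Definition dk (j : nat) (a : Z3 -> C) : Z3 -> C := fun k => (Ci * RtoC (kc j k) * a k)%C.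
Fixpoint dks (l : list nat) (a : Z3 -> C) : Z3 -> C :=
  match l with nil => a | j :: l' => dks l' (dk j a) end.

Lemma fcomp_synth c i : (i < 3)%nat -> fcomp i (synth c) = SF (fun k => c k i).
Proof. intros H. apply functional_extensionality. intros x. destruct i as [|[|[|i]]]; try reflexivity. lia. Qed.

Lemma trm_bound a th : Rabs (trm a th) <= 2 * Cmod a.
Proof.
  unfold trm, Rminus. rtrans Rabs_triang. rewrite Rabs_Ropp, !Rabs_mult.
  pose proof (re_le_Cmod a). pose proof (im_le_Cmod a). pose proof (COS_bound th). pose proof (SIN_bound th).
  assert (Rabs (cos th) <= 1) by (apply Rabs_le; lra). assert (Rabs (sin th) <= 1) by (apply Rabs_le; lra).
  pose proof (Rabs_pos (Im a)). pose proof (Rabs_pos (cos th)). nra.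
Qed.

Lemma trm_dom B a x : domC B a -> dom (2 * B) (fun k => trm (a k) (zdot k x)).
Proof. intros H k. rtrans trm_bound. specialize (H k). lra. Qed.

Lemma domC_of_decay a B : (forall k, wt k ^ 6 * Cmod (a k) <= B) -> domC B a.
Proof.
  intros H k. pose proof (om_wt k). pose proof (om_pos k). pose proof (Cmod_ge_0 (a k)).
  apply Rle_trans with (om k * (wt k ^ 6 * Cmod (a k))).
  - rewrite <- Rmult_assoc. rewrite <- (Rmult_1_l (Cmod (a k))) at 1. apply Rmult_le_compat_r; auto.
  - rewrite (Rmult_comm B). apply Rmult_le_compat_l; auto. lra.
Qed.

Lemma RD_domC a : RD a -> exists B, domC B a.
Proof. intros H. destruct (H 6%nat) as [B HB]. exists B. now apply domC_of_decay. Qed.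

Lemma dk_bound j a k p : wt k ^ p * Cmod (dk j a k) <= wt k ^ S p * Cmod (a k).
Proof.
  unfold dk. rewrite !Cmod_mult, Cmod_Ci, Cmod_RtoC, Rmult_1_l.
  pose proof (kc_wt j k). pose proof (Cmod_ge_0 (a k)). pose proof (wt_ge1 k).
  assert (0 <= wt k ^ p) by (apply pow_le; lra). simpl pow.
  replace (wt k * wt k ^ p * Cmod (a k)) with (wt k ^ p * (wt k * Cmod (a k))) by ring.
  apply Rmult_le_compat_l; auto. now apply Rmult_le_compat_r.
Qed.

Lemma RD_dk j a : RD a -> RD (dk j a).
Proof. intros H p. destruct (H (S p)) as [B HB]. exists B. intros k. eapply Rle_trans; [apply dk_bound|auto]. Qed.

Lemma RD_plus a b : RD a -> RD b -> RD (fun k => a k + b k)%C.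
Proof.
  intros Ha Hb p. destruct (Ha p) as [A HA]. destruct (Hb p) as [B HB]. exists (A + B). intros k.
  pose proof (Cmod_triangle (a k) (b k)). specialize (HA k). specialize (HB k).
  assert (0 <= wt k ^ p) by (apply pow_le; pose proof (wt_ge1 k); lra). nra.
Qed.
Lemma RD_scal z a : RD a -> RD (fun k => z * a k)%C.
Proof.
  intros Ha p. destruct (Ha p) as [A HA]. exists (Cmod z * A). intros k. rewrite Cmod_mult.
  replace (wt k ^ p * (Cmod z * Cmod (a k))) with (Cmod z * (wt k ^ p * Cmod (a k))) by ring.
  apply Rmult_le_compat_l; auto. apply Cmod_ge_0.
Qed.
Lemma RD_ext a b : (forall k, a k = b k) -> RD a -> RD b.
Proof. intros H. replace b with a; auto. now apply functional_extensionality. Qed.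

Lemma SF_plus a b x : RD a -> RD b -> SF (fun k => a k + b k)%C x = SF a x + SF b x.
Proof.
  intros Ha Hb. destruct (RD_domC _ Ha) as [A HA]. destruct (RD_domC _ Hb) as [B HB].
  unfold SF. rewrite <- (zsum_plus (2 * A + 2 * B)).
  - apply zsum_ext. intros k. unfold trm. simpl. unfold Re, Im. ring.
  - apply (dom_mono (2 * A)); [now apply trm_dom|]. pose proof (dom_nonneg _ _ (trm_dom _ _ x HB)). lra.
  - apply (dom_mono (2 * B)); [now apply trm_dom|]. pose proof (dom_nonneg _ _ (trm_dom _ _ x HA)). lra.
Qed.
Lemma SF_scal r a x : RD a -> SF (fun k => RtoC r * a k)%C x = r * SF a x.
Proof.
  intros Ha. destruct (RD_domC _ Ha) as [A HA]. unfold SF. rewrite <- (zsum_scal (2 * A)) by now apply trm_dom.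
  apply zsum_ext. intros k. unfold trm. rewrite Re_scal, Im_scal. ring.
Qed.
Lemma SF_ext a b x : (forall k, a k = b k) -> SF a x = SF b x.
Proof. intros H. unfold SF. apply zsum_ext. intros k. now rewrite H. Qed.
Lemma SF_zero x : SF (fun _ => 0%C) x = 0.
Proof. unfold SF. rewrite (zsum_finite 0). apply lsum_zero. all: intros; unfold trm; simpl; ring. Qed.

Lemma SF_bound a B x : (forall k, wt k ^ 6 * Cmod (a k) <= B) -> Rabs (SF a x) <= 250 * B.
Proof.
  intros H. apply domC_of_decay in H. rtrans (zsum_bound _ _ (trm_dom _ _ x H)). lra.
Qed.

Lemma zdot_kc k x : zdot k x = kc 0 k * comp 0 x + kc 1 k * comp 1 x + kc 2 k * comp 2 x.
Proof. reflexivity. Qed.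
Lemma zdot_shift k j x s : (j < 3)%nat -> zdot k (shift j x s) = zdot k x + kc j k * s.
Proof.
  intros Hj. rewrite !zdot_kc. destruct x as [[a b] c]. destruct j as [|[|[|j]]]; try lia; simpl; ring.
Qed.
Lemma zdot_opp k x : zdot (z3opp k) x = - zdot k x.
Proof. rewrite !zdot_kc, !kc_opp. ring. Qed.
Lemma zdot_add j k x : zdot (z3add j k) x = zdot j x + zdot k x.
Proof. rewrite !zdot_kc, !kc_add. ring. Qed.

Lemma shift_shift j x s t : shift j (shift j x s) t = shift j x (s + t).
Proof. destruct x as [[a b] c]. destruct j as [|[|[|j]]]; simpl; auto; (apply f_equal2; [apply f_equal2|]; ring). Qed.
Lemma shift_0 j x : shift j x 0 = x.
Proof. destruct x as [[a b] c]. destruct j as [|[|[|j]]]; simpl; auto; (apply f_equal2; [apply f_equal2|]; ring). Qed.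

Lemma trm_derive a w th s : derivable_pt_lim (fun s => trm a (th + w * s)) s (trm (Ci * RtoC w * a)%C (th + w * s)).
Proof.
  replace (trm (Ci * RtoC w * a)%C (th + w * s)) with (- w * Im a * cos (th + w * s) - w * Re a * sin (th + w * s)).
  - apply is_derive_Reals. unfold trm. auto_derive; auto. ring.
  - unfold trm. destruct a as [p q]. simpl. ring.
Qed.

Lemma SF_derive a j x : (j < 3)%nat -> RD a ->
  derivable_pt_lim (fun s => SF a (shift j x s)) 0 (SF (dk j a) x).
Proof.
  intros Hj Ha. destruct (RD_domC _ Ha) as [A HA]. destruct (RD_domC _ (RD_dk j _ Ha)) as [B HB].
  unfold SF.
  eapply deriv_val; [|apply (zsum_derive (2 * A + 2 * B) (fun k s => trm (a k) (zdot k (shift j x s)))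
    (fun k s => trm (dk j a k) (zdot k (shift j x s))) 0 1); [lra| | |]].
  - apply zsum_ext. intros k. now rewrite shift_0.
  - intros k s _. rewrite zdot_shift by auto.
    eapply deriv_ext; [|apply trm_derive]. intros t. simpl. now rewrite zdot_shift.
  - intros s _. apply (dom_mono (2 * A)); [now apply trm_dom|]. pose proof (dom_nonneg _ _ (trm_dom _ _ x HB)). lra.
  - intros s _. apply (dom_mono (2 * B)); [now apply trm_dom|]. pose proof (dom_nonneg _ _ (trm_dom _ _ x HA)). lra.
Qed.

Lemma partial_eq j f x d : derivable_pt_lim (fun s => f (shift j x s)) 0 d -> partial j f x = d.
Proof.
  intros H. unfold partial. apply (uniqueness_limite (fun s => f (shift j x s)) 0); auto.
  apply epsilon_spec. eauto.
Qed.

Lemma partial_SF j a : (j < 3)%nat -> RD a -> partial j (SF a) = SF (dk j a).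
Proof. intros Hj Ha. apply functional_extensionality. intros x. apply partial_eq. now apply SF_derive. Qed.

Lemma RD_dks l a : RD a -> RD (dks l a).
Proof. revert a. induction l as [|j l IH]; intros a H; simpl; auto. apply IH, RD_dk, H. Qed.

Lemma dl_SF l a : (forall j, In j l -> (j < 3)%nat) -> RD a -> dl l (SF a) = SF (dks l a).
Proof.
  revert a. induction l as [|j l IH]; intros a Hl Ha; simpl; auto.
  rewrite partial_SF by (auto; apply Hl; simpl; auto). apply IH; [intros; apply Hl; simpl; auto|now apply RD_dk].
Qed.

Lemma dks_bound l a k p : wt k ^ p * Cmod (dks l a k) <= wt k ^ (p + length l) * Cmod (a k).
Proof.
  revert a p. induction l as [|j l IH]; intros a p; simpl; [rewrite Nat.add_0_r; lra|].
  rtrans IH. rtrans dk_bound.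
  replace (p + S (length l))%nat with (S (p + length l)) by lia. lra.
Qed.

Lemma cos_lip a b : Rabs (cos a - cos b) <= Rabs (a - b).
Proof.
  destruct (MVT_abs cos (fun x => - sin x) b a) as (c & Hc & _).
  { intros c _. apply derivable_pt_lim_cos. }
  rewrite Hc, Rabs_Ropp. pose proof (SIN_bound c). assert (Rabs (sin c) <= 1) by (apply Rabs_le; lra).
  pose proof (Rabs_pos (a - b)). nra.
Qed.
Lemma sin_lip a b : Rabs (sin a - sin b) <= Rabs (a - b).
Proof.
  destruct (MVT_abs sin cos b a) as (c & Hc & _).
  { intros c _. apply derivable_pt_lim_sin. }
  rewrite Hc. pose proof (COS_bound c). assert (Rabs (cos c) <= 1) by (apply Rabs_le; lra).
  pose proof (Rabs_pos (a - b)). nra.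
Qed.

Lemma zdot_lip k x y : Rabs (zdot k y - zdot k x) <= wt k * dist3 x y.
Proof.
  rewrite !zdot_kc, wt_abs. unfold dist3.
  set (x0 := comp 0 x). set (x1 := comp 1 x). set (x2 := comp 2 x). set (y0 := comp 0 y). set (y1 := comp 1 y). set (y2 := comp 2 y).
  replace (kc 0 k * y0 + kc 1 k * y1 + kc 2 k * y2 - (kc 0 k * x0 + kc 1 k * x1 + kc 2 k * x2)) with
    (kc 0 k * (y0 - x0) + kc 1 k * (y1 - x1) + kc 2 k * (y2 - x2)) by ring.
  rtrans Rabs_triang. eapply Rle_trans; [apply Rplus_le_compat_r, Rabs_triang|].
  rewrite !Rabs_mult, (Rabs_minus_sym y0), (Rabs_minus_sym y1), (Rabs_minus_sym y2).
  pose proof (Rabs_pos (kc 0 k)). pose proof (Rabs_pos (kc 1 k)). pose proof (Rabs_pos (kc 2 k)).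
  pose proof (Rabs_pos (x0 - y0)). pose proof (Rabs_pos (x1 - y1)). pose proof (Rabs_pos (x2 - y2)). nra.
Qed.

Lemma dist3_pos x y : 0 <= dist3 x y.
Proof. unfold dist3. pose proof (Rabs_pos (comp 0 x - comp 0 y)). pose proof (Rabs_pos (comp 1 x - comp 1 y)). pose proof (Rabs_pos (comp 2 x - comp 2 y)). lra. Qed.

Lemma SF_lipschitz a : RD a -> exists B, 0 <= B /\ forall x y, Rabs (SF a y - SF a x) <= B * dist3 x y.
Proof.
  intros Ha. destruct (RD_domC _ Ha) as [A HA]. destruct (Ha 7%nat) as [B HB].
  assert (B0 : 0 <= B). { eapply Rle_trans; [|apply (HB z3zero)]. apply Rmult_le_pos; [apply pow_le; pose proof (wt_ge1 z3zero); lra|apply Cmod_ge_0]. }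
  exists (250 * B). split; [lra|]. intros x y. unfold SF.
  rewrite <- (zsum_minus (2 * A)) by now apply trm_dom.
  replace (250 * B * dist3 x y) with (125 * (2 * B * dist3 x y)) by ring. apply zsum_bound. intros k.
  assert (T : Rabs (trm (a k) (zdot k y) - trm (a k) (zdot k x)) <= 2 * Cmod (a k) * (wt k * dist3 x y)).
  { pose proof (zdot_lip k x y). unfold trm.
    replace (Re (a k) * cos (zdot k y) - Im (a k) * sin (zdot k y) - (Re (a k) * cos (zdot k x) - Im (a k) * sin (zdot k x)))
      with (Re (a k) * (cos (zdot k y) - cos (zdot k x)) + - (Im (a k) * (sin (zdot k y) - sin (zdot k x)))) by ring.
    rtrans Rabs_triang. rewrite Rabs_Ropp, !Rabs_mult.
    pose proof (cos_lip (zdot k y) (zdot k x)). pose proof (sin_lip (zdot k y) (zdot k x)).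
    pose proof (re_le_Cmod (a k)). pose proof (im_le_Cmod (a k)).
    assert (Rabs (Re (a k)) * Rabs (cos (zdot k y) - cos (zdot k x)) <= Cmod (a k) * (wt k * dist3 x y)).
    { apply Rmult_le_compat; try apply Rabs_pos; lra. }
    assert (Rabs (Im (a k)) * Rabs (sin (zdot k y) - sin (zdot k x)) <= Cmod (a k) * (wt k * dist3 x y)).
    { apply Rmult_le_compat; try apply Rabs_pos; lra. }
    lra. }
  rtrans T. specialize (HB k). pose proof (dist3_pos x y). pose proof (om_wt k). pose proof (om_pos k).
  pose proof (Cmod_ge_0 (a k)). pose proof (wt_ge1 k).
  assert (wt k * Cmod (a k) <= B * om k).
  { apply Rle_trans with (om k * (wt k ^ 7 * Cmod (a k))); [|rewrite (Rmult_comm B); apply Rmult_le_compat_l; lra].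
    replace (om k * (wt k ^ 7 * Cmod (a k))) with (om k * wt k ^ 6 * (wt k * Cmod (a k))) by ring.
    assert (0 <= wt k * Cmod (a k)) by (apply Rmult_le_pos; lra). nra. }
  replace (2 * Cmod (a k) * (wt k * dist3 x y)) with (2 * dist3 x y * (wt k * Cmod (a k))) by ring.
  replace (2 * B * dist3 x y * om k) with (2 * dist3 x y * (B * om k)) by ring.
  apply Rmult_le_compat_l; lra.
Qed.

Lemma lip_continuous (g : R3 -> R) B : 0 <= B -> (forall x y, Rabs (g y - g x) <= B * dist3 x y) -> continuous3 g.
Proof.
  intros HB H x eps He. exists (eps / (B + 1)). split; [apply Rdiv_lt_0_compat; lra|]. intros y Hy.
  eapply Rle_lt_trans; [apply H|]. pose proof (dist3_pos x y). apply Rle_lt_trans with ((B + 1) * dist3 x y); [lra|].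
  apply Rmult_lt_compat_l with (r := B + 1) in Hy; [|lra]. replace ((B + 1) * (eps / (B + 1))) with eps in Hy by (field; lra). auto.
Qed.

Lemma SF_continuous a : RD a -> continuous3 (SF a).
Proof. intros Ha. destruct (SF_lipschitz a Ha) as (B & HB & H). now apply (lip_continuous _ B). Qed.

Lemma SF_smooth a : RD a -> smooth3 (SF a).
Proof.
  intros Ha l Hl. rewrite dl_SF by auto. split.
  - apply SF_continuous, RD_dks, Ha.
  - intros j x Hj. eexists. apply SF_derive; auto. now apply RD_dks.
Qed.

Lemma cos_2pi_Z x n : cos (x + IZR n * (2 * PI)) = cos x.
Proof.
  destruct (Z_le_dec 0 n) as [H|H].
  - rewrite <- (Z2Nat.id n) by auto. rewrite <- INR_IZR_INZ.
    replace (x + INR (Z.to_nat n) * (2 * PI)) with (x + 2 * INR (Z.to_nat n) * PI) by ring. apply cos_period.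
  - rewrite <- (cos_period (x + IZR n * (2 * PI)) (Z.to_nat (- n))). f_equal.
    rewrite INR_IZR_INZ, Z2Nat.id, opp_IZR by lia. ring.
Qed.
Lemma sin_2pi_Z x n : sin (x + IZR n * (2 * PI)) = sin x.
Proof.
  destruct (Z_le_dec 0 n) as [H|H].
  - rewrite <- (Z2Nat.id n) by auto. rewrite <- INR_IZR_INZ.
    replace (x + INR (Z.to_nat n) * (2 * PI)) with (x + 2 * INR (Z.to_nat n) * PI) by ring. apply sin_period.
  - rewrite <- (sin_period (x + IZR n * (2 * PI)) (Z.to_nat (- n))). f_equal.
    rewrite INR_IZR_INZ, Z2Nat.id, opp_IZR by lia. ring.
Qed.

Lemma SF_periodic a : periodic_s (SF a).
Proof.
  intros j x Hj. unfold SF. apply zsum_ext. intros k. unfold trm.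
  rewrite zdot_shift by auto. unfold kc. now rewrite cos_2pi_Z, sin_2pi_Z.
Qed.

Lemma adm_RD u i : adm u -> RD (fun k => u k i).
Proof.
  intros ((_ & _ & Hn) & _ & H) p. destruct (H p) as [B HB]. exists B. intros k.
  destruct (le_lt_dec 3 i) as [Hi|Hi].
  - rewrite Hn, Cmod_0, Rmult_0_r by auto. eapply sob_pos; eauto.
  - now apply sob_comp.
Qed.

(** ** Products of Fourier series *)

Definition cis (th : R) : C := (cos th, sin th).
Definition rls (a : Z3 -> C) : Prop := forall k, a (z3opp k) = Cconj (a k).
Definition conv (a b : Z3 -> C) (k : Z3) : C := zsumC (fun j => a j * b (z3sub k j))%C.

Lemma Cmod_cis th : Cmod (cis th) = 1.
Proof.
  unfold Cmod, cis. simpl fst; simpl snd. rewrite <- sqrt_1. f_equal.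
  pose proof (sin2_cos2 th) as H. unfold Rsqr in H. lra.
Qed.
Lemma cis_plus a b : cis (a + b) = (cis a * cis b)%C.
Proof. unfold cis, Cmult. simpl. rewrite cos_plus, sin_plus. f_equal. ring. Qed.

Lemma SF_Re a x : SF a x = zsum (fun k => Re (a k * cis (zdot k x))%C).
Proof. apply zsum_ext. intros k. unfold trm. reflexivity. Qed.

(** The terms at [k] and [- k] cancel. [SF] keeps real parts only, whereas the convolution theorem
    multiplies complex sums; this closes the gap. *)
Lemma SF_Im a B x : rls a -> domC B a -> zsum (fun k => Im (a k * cis (zdot k x))%C) = 0.
Proof.
  intros Hr Hd. set (f := fun k => Im (a k * cis (zdot k x))%C).
  assert (Df : dom B f).
  { intros k. unfold f. rtrans im_le_Cmod. rewrite Cmod_mult, Cmod_cis, Rmult_1_r. apply Hd. }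
  assert (Ef : forall k, f (z3opp k) = -1 * f k).
  { intros k. unfold f. rewrite Hr, zdot_opp. unfold cis. rewrite cos_neg, sin_neg. destruct (a k). simpl. ring. }
  assert (E : zsum (fun k => f (z3opp k)) = zsum f).
  { apply (zsum_reindex B f z3opp z3opp); auto using z3oppK. intros k. rewrite Ef, Rabs_mult, Rabs_left by lra. specialize (Df k). lra. }
  rewrite (zsum_ext _ (fun k => -1 * f k)) in E by auto. rewrite (zsum_scal B) in E by auto. lra.
Qed.

Lemma domC_mono B B' a : domC B a -> B <= B' -> domC B' a.
Proof. intros H Hb k. specialize (H k). pose proof (om_pos k). nra. Qed.

(** Peetre's inequality trades one power of [om j] for [om k] and yields the double domination
    required by [zsum_fubini]; hence the decay [om^2] asked of [a]. *)
Lemma conv_dom a b A B k : (forall j, Cmod (a j) <= A * om j ^ 2) -> domC B b -> 0 <= A -> 0 <= B ->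
  domC (8 * A * B * om k) (fun j => a j * b (z3sub k j))%C.
Proof.
  intros Ha Hb HA HB j. rewrite Cmod_mult.
  pose proof (om_peetre k j). pose proof (om_pos j).
  apply Rle_trans with ((A * om j ^ 2) * (B * om (z3sub k j))).
  - apply Rmult_le_compat; auto using Cmod_ge_0.
  - replace (A * om j ^ 2 * (B * om (z3sub k j))) with ((A * B * om j) * (om j * om (z3sub k j))) by ring.
    replace (8 * A * B * om k * om j) with ((A * B * om j) * (8 * om k)) by ring.
    apply Rmult_le_compat_l; auto. apply Rmult_le_pos; [apply Rmult_le_pos|]; lra.
Qed.

Lemma RD_om2 a : RD a -> exists A, 0 <= A /\ forall j, Cmod (a j) <= A * om j ^ 2.
Proof.
  intros H. destruct (H 12%nat) as [A HA]. exists A.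
  assert (0 <= A). { eapply Rle_trans; [|apply (HA z3zero)]. apply Rmult_le_pos; [apply pow_le; pose proof (wt_ge1 z3zero); lra|apply Cmod_ge_0]. }
  split; auto. intros j. pose proof (om_wt j). pose proof (om_pos j). pose proof (Cmod_ge_0 (a j)).
  apply Rle_trans with (om j ^ 2 * (wt j ^ 12 * Cmod (a j))).
  - replace (om j ^ 2 * (wt j ^ 12 * Cmod (a j))) with ((om j * wt j ^ 6) ^ 2 * Cmod (a j)) by ring.
    rewrite <- (Rmult_1_l (Cmod (a j))) at 1. apply Rmult_le_compat_r; auto.
    assert (1 ^ 2 <= (om j * wt j ^ 6) ^ 2) by (apply pow_incr; lra). lra.
  - rewrite (Rmult_comm A). apply Rmult_le_compat_l; auto. apply pow_le; lra.
Qed.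

Theorem SF_mult a b x : RD a -> RD b -> rls a -> rls b -> SF a x * SF b x = SF (conv a b) x.
Proof.
  intros Ha Hb Ra Rb.
  destruct (RD_om2 a Ha) as (A & HA0 & HA). destruct (RD_domC _ Ha) as [A' HA'].
  destruct (RD_domC _ Hb) as [B HB].
  assert (HB0 : 0 <= B) by (apply (dom_nonneg _ _ (domC_Re _ _ HB))).
  set (F := fun k j => Re (a j * b (z3sub k j) * cis (zdot k x))%C).
  assert (EF : forall k, Re (conv a b k * cis (zdot k x))%C = zsum (F k)).
  { intros k. set (D := conv_dom a b A B k HA HB HA0 HB0).
    unfold conv. set (f := fun j => (a j * b (z3sub k j))%C) in *.
    replace (Re (zsumC f * cis (zdot k x))%C) with (cos (zdot k x) * zsum (fun j => Re (f j)) + (- sin (zdot k x)) * zsum (fun j => Im (f j)))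
      by (unfold zsumC, cis; simpl; ring).
    pose proof (domC_Re _ _ D) as DR. pose proof (domC_Im _ _ D) as DI.
    rewrite <- (zsum_scal _ _ _ DR), <- (zsum_scal _ _ _ DI).
    rewrite <- (zsum_plus (8 * A * B * om k)).
    - apply zsum_ext. intros j. unfold F. fold (f j). destruct (f j). simpl. ring.
    - intros j. rewrite Rabs_mult. specialize (DR j). pose proof (COS_bound (zdot k x)). assert (Rabs (cos (zdot k x)) <= 1) by (apply Rabs_le; lra).
      pose proof (Rabs_pos (Re (f j))). nra.
    - intros j. rewrite Rabs_mult, Rabs_Ropp. specialize (DI j). pose proof (SIN_bound (zdot k x)). assert (Rabs (sin (zdot k x)) <= 1) by (apply Rabs_le; lra).
      pose proof (Rabs_pos (Im (f j))). nra. }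
  rewrite (SF_Re (conv a b)).
  rewrite (zsum_ext _ (fun k => zsum (fun j => F k j))) by (intros k; apply (EF k)).
  rewrite (zsum_fubini (8 * A * B)).
  2:{ intros k j. unfold F. rtrans re_le_Cmod. rewrite Cmod_mult, Cmod_cis, Rmult_1_r.
      apply (conv_dom a b A B k); auto. }
  (* For fixed [j] the shift of [k] by [j] factors the exponential; the real part of the product
     then splits because the second sum is real. *)
  assert (EJ : forall j, zsum (fun k => F k j) = SF b x * Re (a j * cis (zdot j x))%C).
  { intros j. set (z := (a j * cis (zdot j x))%C).
    set (G := fun l => Re (z * (b l * cis (zdot l x)))%C).
    assert (DG : dom (Cmod z * B) G).
    { intros l. unfold G. rtrans re_le_Cmod. rewrite !Cmod_mult, Cmod_cis, Rmult_1_r, Rmult_assoc.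
      apply Rmult_le_compat_l; [apply Cmod_ge_0|apply HB]. }
    assert (EG : forall k, F k j = G (z3sub k j)).
    { intros k. unfold F, G, z. rewrite <- (z3add_sub k j) at 2. rewrite zdot_add, cis_plus. f_equal. ring. }
    rewrite (zsum_ext _ (fun k => G (z3sub k j))) by auto.
    assert (DF : dom (8 * A * B * om j) (fun k => F k j)).
    { intros k. unfold F. rtrans re_le_Cmod. rewrite Cmod_mult, Cmod_cis, Rmult_1_r.
      rtrans (conv_dom a b A B k HA HB HA0 HB0). right; ring. }
    assert (P1 : 0 <= 8 * A * B * om j) by apply (dom_nonneg _ _ DF).
    assert (P2 : 0 <= Cmod z * B) by apply (dom_nonneg _ _ DG).
    rewrite (zsum_reindex (Cmod z * B + 8 * A * B * om j) G (fun k => z3sub k j) (fun k => z3add k j)).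
    - unfold G.
      assert (DB : domC B (fun l => b l * cis (zdot l x))%C).
      { intros l. rewrite Cmod_mult, Cmod_cis, Rmult_1_r. apply HB. }
      rewrite (zsum_ext _ (fun l => Re z * Re (b l * cis (zdot l x))%C + (- Im z) * Im (b l * cis (zdot l x))%C)).
      2:{ intros l. destruct z. simpl. ring. }
      rewrite (zsum_plus (Cmod z * B)).
      + rewrite (zsum_scal B), (zsum_scal B) by (apply domC_Re || apply domC_Im; auto).
        rewrite (SF_Im b B x Rb HB), <- SF_Re. ring.
      + intros l. rewrite Rabs_mult, Rmult_assoc. apply Rmult_le_compat; try apply Rabs_pos. apply re_le_Cmod. apply (domC_Re _ _ DB).
      + intros l. rewrite Rabs_mult, Rabs_Ropp, Rmult_assoc. apply Rmult_le_compat; try apply Rabs_pos. apply im_le_Cmod. apply (domC_Im _ _ DB).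
    - apply (dom_mono _ _ _ DG). lra.
    - apply (dom_mono (8 * A * B * om j)); [|lra]. intros k. rewrite <- EG. apply DF.
    - intros; apply z3subK.
    - intros; apply z3addK. }
  rewrite (zsum_ext _ (fun j => SF b x * Re (a j * cis (zdot j x))%C)) by auto.
  rewrite (zsum_scal A').
  - rewrite <- SF_Re. ring.
  - intros j. rtrans re_le_Cmod. rewrite Cmod_mult, Cmod_cis, Rmult_1_r. apply HA'.
Qed.

(** ** The Euler equation in physical space *)

Lemma ksq_cases k : ksq k = 0 /\ (forall i, kc i k = 0) \/ 1 <= ksq k.
Proof.
  unfold ksq, kc. destruct k as [[a b] c]. simpl zc.
  destruct (Z.eq_dec (a * a + b * b + c * c) 0) as [H|H].
  - assert (a = 0%Z /\ b = 0%Z /\ c = 0%Z) as (-> & -> & ->) by nia. left. split; [simpl; ring|].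
    intros [|[|[|i]]]; reflexivity.
  - right. assert (1 <= a * a + b * b + c * c)%Z by nia. apply IZR_le in H0. rewrite !plus_IZR, !mult_IZR in H0. simpl. lra.
Qed.
Lemma inv_ksq_bound k : Rabs (/ ksq k) <= 1.
Proof.
  destruct (ksq_cases k) as [[H _]|H].
  - rewrite H, Rinv_0, Rabs_R0. lra.
  - rewrite Rabs_pos_eq by (left; apply Rinv_0_lt_compat; lra). rewrite <- Rinv_1. apply Rinv_le_contravar; lra.
Qed.
Lemma kc_div_ksq_bound i k : Rabs (kc i k / ksq k) <= wt k.
Proof.
  unfold Rdiv. rewrite Rabs_mult. pose proof (inv_ksq_bound k). pose proof (kc_wt i k).
  pose proof (Rabs_pos (kc i k)). nra.
Qed.

Lemma wt_sub_mul k j : wt k <= wt j * wt (z3sub k j).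
Proof. pose proof (wt_split k j). pose proof (wt_ge1 j). pose proof (wt_ge1 (z3sub k j)). nra. Qed.

(* [wt k <= wt j wt (k - j)] distributes the weight over the two factors of a convolution. *)
Lemma zsumC_decay p k A B (h : Z3 -> C) (f g : Z3 -> R) : (forall j, 0 <= f j /\ wt j ^ (p + 6) * f j <= A) ->
  (forall j, 0 <= g j /\ wt j ^ p * g j <= B) -> (forall j, Cmod (h j) <= f j * g (z3sub k j)) ->
  domC (A * B / wt k ^ p) h /\ wt k ^ p * Cmod (zsumC h) <= 250 * (A * B).
Proof.
  intros Hf Hg Hh. assert (W : forall l q, 0 < wt l ^ q) by (intros; apply pow_lt; pose proof (wt_ge1 l); lra).
  assert (D : domC (A * B / wt k ^ p) h).
  { intros j. apply Rmult_le_reg_l with (wt k ^ p); auto. pose proof (W k p).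
    replace (wt k ^ p * (A * B / wt k ^ p * om j)) with ((om j * A) * B) by (field; lra).
    destruct (Hf j) as [F0 F1]. destruct (Hg (z3sub k j)) as [G0 G1]. pose proof (W j p). pose proof (W (z3sub k j) p).
    pose proof (om_wt j). pose proof (om_pos j).
    apply Rle_trans with ((wt j ^ p * f j) * (wt (z3sub k j) ^ p * g (z3sub k j))).
    - apply Rle_trans with ((wt j ^ p * wt (z3sub k j) ^ p) * (f j * g (z3sub k j))); [|right; ring].
      apply Rmult_le_compat; auto; [lra|apply Cmod_ge_0|]. rewrite <- Rpow_mult_distr. apply pow_incr. pose proof (wt_ge1 k). split; [lra|apply wt_sub_mul].
    - apply Rmult_le_compat; auto; try (apply Rmult_le_pos; lra). rewrite pow_add in F1.
      apply Rle_trans with (om j * (wt j ^ p * wt j ^ 6 * f j)); [|apply Rmult_le_compat_l; lra].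
      assert (0 <= wt j ^ p * f j) by (apply Rmult_le_pos; lra). nra. }
  split; auto. apply Rle_trans with (wt k ^ p * (250 * (A * B / wt k ^ p))).
  - apply Rmult_le_compat_l; [left; auto|]. now apply zsumC_bound.
  - right. field. pose proof (W k p). lra.
Qed.

Lemma Dinf_decay p u v A B k i : n3 v -> sob (p + 7) u A -> sob (p + 1) v B ->
  wt k ^ p * Cmod (Dinf u v k i) <= 250 * (A * B).
Proof.
  intros Hn Hu Hv. unfold Dinf. rewrite Cmod_mult, Cmod_opp, Cmod_Ci, Rmult_1_l.
  assert (W : forall j (x : R), 0 <= x -> 0 <= wt j * x) by (intros; apply Rmult_le_pos; auto; pose proof (wt_ge1 j); lra).
  apply (zsumC_decay p k A B _ (fun j => wt j * vn (u j)) (fun j => wt j * Cmod (v j i))).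
  - intros j. split; [apply W, vn_ge0|]. rewrite <- Rmult_assoc, Rmult_comm, (Rmult_comm (wt j ^ _)), <- (Rmult_comm (wt j * _)).
    change (wt j * wt j ^ (p + 6)) with (wt j ^ S (p + 6)). replace (S (p + 6)) with (p + 7)%nat by lia. now apply sob_vn.
  - intros j. split; [apply W, Cmod_ge_0|]. replace (wt j ^ p * (wt j * Cmod (v j i))) with (wt j ^ (p + 1) * Cmod (v j i)) by (rewrite pow_add; ring).
    destruct (le_lt_dec 3 i) as [Hi|Hi]; [rewrite Hn, Cmod_0, Rmult_0_r by auto; eapply sob_pos; eauto|now apply sob_comp].
  - intros j. rewrite Cmod_mult. replace (wt j * vn (u j) * (wt (z3sub k j) * Cmod (v (z3sub k j) i))) with (vn (u j) * (wt j * wt (z3sub k j)) * Cmod (v (z3sub k j) i)) by ring.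
    apply Rmult_le_compat_r; [apply Cmod_ge_0|]. rtrans cdot_bound. apply Rmult_le_compat_l; [apply vn_ge0|apply wt_sub_mul].
Qed.

Lemma Binf_decay p u A k i : n3 u -> sob (p + 9) u A -> wt k ^ p * Cmod (Binf u k i) <= 4 * (250 * (A * A)).
Proof.
  intros Hn Hu. unfold Binf. pose proof (wt_ge1 k) as W.
  assert (WP : 0 < wt k ^ p) by (apply pow_lt; lra). assert (WP2 : 0 < wt k ^ (p + 2)) by (apply pow_lt; lra).
  set (e := 250 * (A * A) / wt k ^ (p + 2)).
  assert (He : forall a, Cmod (Dinf u u k a) <= e).
  { intros a. apply Rmult_le_reg_l with (wt k ^ (p + 2)); auto. unfold e.
    replace (wt k ^ (p + 2) * (250 * (A * A) / wt k ^ (p + 2))) with (250 * (A * A)) by (field; lra).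
    apply (Dinf_decay (p + 2)); auto; eapply sob_mono; [|eauto| |eauto]; lia. }
  pose proof (pj_bound k (Dinf u u k) i e He). pose proof (kc_div_ksq_bound i k).
  assert (0 <= e) by (eapply Rle_trans; [apply Cmod_ge_0|apply (He 0%nat)]).
  assert (Cmod (pj k (Dinf u u k) i) <= 4 * wt k ^ 2 * e).
  { eapply Rle_trans; [eauto|]. apply Rmult_le_compat_r; auto. nra. }
  apply Rle_trans with (wt k ^ p * (4 * wt k ^ 2 * e)); [apply Rmult_le_compat_l; lra|].
  right. unfold e. rewrite pow_add. field. split; [lra|apply pow_nonzero; lra].
Qed.

(** The pressure: its gradient is the longitudinal part that [pj] removes. The value of [/ 0] makes
    the coefficient at [k = 0] zero. *)
Definition phat (u : coef) (k : Z3) : C := (- Ci * RtoC (/ ksq k) * cdot (Dinf u u k) k)%C.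

Lemma RD_Dinf u i : adm u -> RD (fun k => Dinf u u k i).
Proof.
  intros ((_ & _ & Hn) & _ & H) p. destruct (H (p + 7)%nat) as [A HA].
  exists (250 * (A * A)). intros k. apply Dinf_decay; auto. eapply sob_mono; [|eauto]. lia.
Qed.

Lemma RD_mul_wt a b q B : RD a -> (forall k, Cmod (b k) <= B * wt k ^ q * Cmod (a k)) -> 0 <= B -> RD b.
Proof.
  intros Ha H HB p. destruct (Ha (p + q)%nat) as [A HA]. exists (B * A). intros k.
  assert (0 <= wt k ^ p) by (apply pow_le; pose proof (wt_ge1 k); lra).
  apply Rle_trans with (B * (wt k ^ (p + q) * Cmod (a k))).
  - rewrite pow_add. replace (B * (wt k ^ p * wt k ^ q * Cmod (a k))) with (wt k ^ p * (B * wt k ^ q * Cmod (a k))) by ring.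
    now apply Rmult_le_compat_l.
  - now apply Rmult_le_compat_l.
Qed.

Lemma RD_cdot (z : coef) : (forall i, RD (fun k => z k i)) -> RD (fun k => cdot (z k) k).
Proof.
  intros H. unfold cdot, s3.
  assert (T : forall i, RD (fun k => z k i * RtoC (kc i k))%C).
  { intros i. apply (RD_mul_wt _ _ 1 1 (H i)); [|lra]. intros k. rewrite Cmod_mult, Cmod_RtoC.
    pose proof (kc_wt i k). pose proof (Cmod_ge_0 (z k i)). simpl. nra. }
  apply RD_plus; auto. apply RD_plus; auto.
Qed.

Lemma RD_phat u : adm u -> RD (phat u).
Proof.
  intros H. apply (RD_mul_wt (fun k => cdot (Dinf u u k) k) _ 0 1); [apply RD_cdot; intros; now apply RD_Dinf| |lra].
  intros k. unfold phat. rewrite !Cmod_mult, Cmod_opp, Cmod_Ci, Cmod_RtoC. pose proof (inv_ksq_bound k).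
  pose proof (Cmod_ge_0 (cdot (Dinf u u k) k)). simpl. nra.
Qed.

Lemma dk_phat u i k : dk i (phat u) k = (RtoC (kc i k / ksq k) * cdot (Dinf u u k) k)%C.
Proof.
  unfold dk, phat, Rdiv. rewrite RtoC_mult.
  transitivity (- (Ci * Ci) * RtoC (kc i k) * RtoC (/ ksq k) * cdot (Dinf u u k) k)%C; [ring|].
  replace (Ci * Ci)%C with (- RtoC 1)%C; [ring|]. apply ceq; simpl; ring.
Qed.

Lemma zsumC_plus B f g : domC B f -> domC B g -> zsumC (fun k => f k + g k)%C = (zsumC f + zsumC g)%C.
Proof.
  intros Hf Hg. apply ceq.
  - exact (zsum_plus B (fun k => Re (f k)) (fun k => Re (g k)) (domC_Re _ _ Hf) (domC_Re _ _ Hg)).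
  - exact (zsum_plus B (fun k => Im (f k)) (fun k => Im (g k)) (domC_Im _ _ Hf) (domC_Im _ _ Hg)).
Qed.
Lemma zsumC_ext (f g : Z3 -> C) : (forall k, f k = g k) -> zsumC f = zsumC g.
Proof. intros H. f_equal. now apply functional_extensionality. Qed.
Lemma zsumC_scal B (z : C) f : domC B f -> zsumC (fun k => z * f k)%C = (z * zsumC f)%C.
Proof.
  intros Hf. pose proof (domC_Re _ _ Hf) as DR. pose proof (domC_Im _ _ Hf) as DI. pose proof (dom_nonneg _ _ DR) as B0.
  assert (D : forall r q a, dom B a -> Rabs r <= q -> dom (q * B) (fun k => r * a k)).
  { intros r q a Ha Hq. apply (dom_mono (Rabs r * B)); [now apply dom_scal|]. now apply Rmult_le_compat_r. }
  set (q := Rabs (Re z) + Rabs (Im z)). pose proof (Rabs_pos (Re z)). pose proof (Rabs_pos (Im z)).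
  assert (Q1 : Rabs (Re z) <= q) by (unfold q; lra). assert (Q2 : Rabs (Im z) <= q) by (unfold q; lra).
  apply ceq; unfold zsumC; simpl.
  - rewrite (zsum_ext _ (fun k => Re z * Re (f k) + (- Im z) * Im (f k))) by (intros; unfold Re, Im; ring).
    rewrite (zsum_plus (q * B)) by (apply D; auto; now rewrite Rabs_Ropp). rewrite !(zsum_scal B) by auto. unfold Re, Im. ring.
  - rewrite (zsum_ext _ (fun k => Re z * Im (f k) + Im z * Re (f k))) by (intros; unfold Re, Im; ring).
    rewrite (zsum_plus (q * B)) by (apply D; auto). rewrite !(zsum_scal B) by auto. unfold Re, Im. ring.
Qed.

(** Incompressibility replaces [u_j . k] by [u_j . (k - j)], which exhibits the series as a sum of
    convolutions of [u] with derivatives of [u]. *)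
Lemma SF_transport u i x : adm u -> (i < 3)%nat ->
  SF (fun k => Dinf u u k i) x =
  - (comp 0 (synth u x) * partial 0 (fcomp i (synth u)) x + comp 1 (synth u x) * partial 1 (fcomp i (synth u)) x
     + comp 2 (synth u x) * partial 2 (fcomp i (synth u)) x).
Proof.
  intros Hu Hi. assert (Rdu : forall a, RD (fun k => u k a)) by (intros; now apply adm_RD).
  destruct Hu as ((Hr & Hd & Hn) & Hz & Hs).
  rewrite fcomp_synth by auto. rewrite !partial_SF by auto. simpl comp.
  assert (Rls : forall a, rls (fun k => u k a)) by (intros a k; apply Hr).
  assert (Rlk : forall a, rls (dk a (fun k => u k i))).
  { intros a k. unfold dk. rewrite Hr, kc_opp, RtoC_opp, !Cmult_conj, Cconj_RtoC.
    replace (Cconj Ci) with (- Ci)%C; [ring|]. apply ceq; simpl; ring. }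
  rewrite !SF_mult; auto; try (now apply RD_dk).
  set (cv := fun a => conv (fun k => u k a) (dk a (fun k => u k i))).
  assert (Dec : forall a p, exists A B, forall k, domC (A * B / wt k ^ p) (fun j => u j a * dk a (fun k => u k i) (z3sub k j))%C /\ wt k ^ p * Cmod (cv a k) <= 250 * (A * B)).
  { intros a p. destruct (Rdu a (p + 6)%nat) as [A HA]. destruct (RD_dk a _ (Rdu i) p) as [B HB]. exists A, B. intros k.
    apply (zsumC_decay p k A B _ (fun j => Cmod (u j a)) (fun j => Cmod (dk a (fun k => u k i) j))); intros j; [split; [apply Cmod_ge_0|auto]..|].
    rewrite Cmod_mult. apply Rle_refl. }
  assert (E : forall k, Dinf u u k i = (-1 * (cv 0%nat k + cv 1%nat k + cv 2%nat k))%C).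
  { intros k. unfold cv, conv.
    assert (Dom : forall a, exists B, domC B (fun j => u j a * dk a (fun k => u k i) (z3sub k j))%C).
    { intros a. destruct (Dec a 0%nat) as (A & B & H). eexists. apply H. }
    assert (Sm : forall f g, (exists B, domC B f) -> (exists B, domC B g) -> (zsumC (fun k => f k + g k) = zsumC f + zsumC g)%C /\ exists B, domC B (fun k => f k + g k)%C).
    { intros f g [B1 H1] [B2 H2]. pose proof (dom_nonneg _ _ (domC_Re _ _ H1)). pose proof (dom_nonneg _ _ (domC_Re _ _ H2)). split.
      - apply (zsumC_plus (B1 + B2)); eapply domC_mono; eauto; lra.
      - exists (B1 + B2). intros j. rtrans Cmod_triangle. specialize (H1 j). specialize (H2 j). lra. }
    destruct (Sm _ _ (Dom 0%nat) (Dom 1%nat)) as [S1 D1]. destruct (Sm _ _ D1 (Dom 2%nat)) as [S2 [B D2]].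
    rewrite <- S1, <- S2, <- (zsumC_scal B) by auto. unfold Dinf. destruct (Hs 6%nat) as [A HA].
    rewrite <- (zsumC_scal (A * wt k * A)); [|apply Dinf_dom; auto; eapply sob_mono; [|apply HA]; lia].
    apply zsumC_ext. intros j. rewrite (cdot_dv u) by auto. unfold dk, cdot, s3. ring. }
  assert (RDC : forall a, RD (cv a)) by (intros a p; destruct (Dec a p) as (A & B & H); eexists; apply H).
  rewrite (SF_ext _ _ x E).
  rewrite SF_scal by (apply RD_plus; auto; apply RD_plus; auto).
  rewrite (SF_plus (fun k => cv 0%nat k + cv 1%nat k)%C (cv 2%nat)), (SF_plus (cv 0%nat) (cv 1%nat)); auto; [|apply RD_plus; auto]. unfold cv. ring.
Qed.

(** ** Integration over the torus *)

Definition cper (f : R3 -> R) : Prop := continuous3 f /\ periodic_s f.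
Definition T3 (n : nat) (g : nat -> nat -> nat -> R) : R :=
  lsum (seq 0 n) (fun a => lsum (seq 0 n) (fun b => lsum (seq 0 n) (fun c => g a b c))).
Definition gpt (n : nat) (a b c : nat) : R3 :=
  let h := 2 * PI / INR n in (h * INR a, h * INR b, h * INR c).
Definition Rs (n : nat) (f : R3 -> R) : R := (2 * PI / INR n) ^ 3 * T3 n (fun a b c => f (gpt n a b c)).
Definition vol : R := (2 * PI) ^ 3.

Lemma vol_pos : 0 < vol.
Proof. unfold vol. apply pow_lt. pose proof PI_RGT_0. lra. Qed.

Lemma sum_f_R0_lsum f N : sum_f_R0 f N = lsum (seq 0 (S N)) f.
Proof.
  induction N as [|N IH]; [simpl; lra|]. rewrite tech5, IH.
  rewrite (seq_S (S N) 0), lsum_app. simpl. lra.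
Qed.

Lemma rsum_Rs f N : rsum f N = Rs (S N) f.
Proof.
  unfold rsum, Rs, T3. f_equal. rewrite sum_f_R0_lsum. apply lsum_ext. intros a _.
  rewrite sum_f_R0_lsum. apply lsum_ext. intros b _. rewrite sum_f_R0_lsum. reflexivity.
Qed.

Lemma T3_ext n g g' : (forall a b c, (a < n)%nat -> (b < n)%nat -> (c < n)%nat -> g a b c = g' a b c) -> T3 n g = T3 n g'.
Proof.
  intros H. apply lsum_ext. intros a Ha. apply lsum_ext. intros b Hb. apply lsum_ext. intros c Hc.
  apply in_seq in Ha, Hb, Hc. apply H; lia.
Qed.
Lemma T3_le n g g' : (forall a b c, (a < n)%nat -> (b < n)%nat -> (c < n)%nat -> g a b c <= g' a b c) -> T3 n g <= T3 n g'.
Proof.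
  intros H. apply lsum_le. intros a Ha. apply lsum_le. intros b Hb. apply lsum_le. intros c Hc.
  apply in_seq in Ha, Hb, Hc. apply H; lia.
Qed.
Lemma T3_plus n g g' : T3 n (fun a b c => g a b c + g' a b c) = T3 n g + T3 n g'.
Proof.
  unfold T3. rewrite <- lsum_plus. apply lsum_ext. intros. rewrite <- lsum_plus. apply lsum_ext. intros. apply lsum_plus.
Qed.
Lemma T3_scal n r g : T3 n (fun a b c => r * g a b c) = r * T3 n g.
Proof.
  unfold T3. rewrite <- lsum_scal. apply lsum_ext. intros. rewrite <- lsum_scal. apply lsum_ext. intros. apply lsum_scal.
Qed.
Lemma T3_const n r : T3 n (fun _ _ _ => r) = INR n ^ 3 * r.
Proof.
  unfold T3. rewrite (lsum_ext _ _ (fun _ => INR n * (INR n * r))).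
  - rewrite lsum_const, length_seq. ring.
  - intros. rewrite (lsum_ext _ _ (fun _ => INR n * r)); [now rewrite lsum_const, length_seq|].
    intros. now rewrite lsum_const, length_seq.
Qed.
Lemma T3_term n g a b c : (a < n)%nat -> (b < n)%nat -> (c < n)%nat -> (forall a b c, 0 <= g a b c) -> g a b c <= T3 n g.
Proof.
  intros Ha Hb Hc Hg. unfold T3.
  eapply Rle_trans; [|apply (lsum_term_le (seq 0 n) (fun a => lsum (seq 0 n) (fun b => lsum (seq 0 n) (fun c => g a b c))) a)].
  - eapply Rle_trans; [|apply (lsum_term_le (seq 0 n) (fun b => lsum (seq 0 n) (fun c => g a b c)) b)].
    + apply (lsum_term_le (seq 0 n) (fun c => g a b c)); auto. apply in_seq; lia.
    + apply in_seq; lia.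
    + intros. apply lsum_nonneg; auto.
  - apply in_seq; lia.
  - intros. apply lsum_nonneg; intros. apply lsum_nonneg; auto.
Qed.

Lemma lsum_seq_refine n m (g : nat -> R) :
  lsum (seq 0 (n * m)) g = lsum (seq 0 n) (fun a => lsum (seq 0 m) (fun r => g (a * m + r)%nat)).
Proof.
  induction n as [|n IH]; [reflexivity|].
  replace (S n * m)%nat with (n * m + m)%nat by lia. rewrite seq_app, lsum_app, IH, seq_S, lsum_app. f_equal.
  simpl. rewrite Rplus_0_r. clear.
  assert (E : seq (n * m) m = map (fun r => (n * m + r)%nat) (seq 0 m)).
  { generalize (n * m)%nat as k. intros k. revert k. induction m as [|m IH]; intros k; auto.
    simpl. rewrite Nat.add_0_r. f_equal. rewrite (IH (S k)), <- seq_shift, map_map. apply map_ext. intros; lia. }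
  rewrite E, lsum_map. reflexivity.
Qed.

Lemma T3_refine n m g : T3 (n * m) g =
  T3 n (fun a b c => T3 m (fun r s t => g (a * m + r)%nat (b * m + s)%nat (c * m + t)%nat)).
Proof.
  unfold T3. rewrite lsum_seq_refine. apply lsum_ext. intros a _.
  transitivity (lsum (seq 0 m) (fun r => lsum (seq 0 n) (fun b => lsum (seq 0 m) (fun s => lsum (seq 0 n) (fun c => lsum (seq 0 m)
     (fun t => g (a * m + r)%nat (b * m + s)%nat (c * m + t)%nat)))))).
  { apply lsum_ext. intros r _. rewrite lsum_seq_refine. apply lsum_ext. intros b _. apply lsum_ext. intros s _.
    apply lsum_seq_refine. }
  rewrite lsum_swap. apply lsum_ext. intros b _.
  transitivity (lsum (seq 0 m) (fun r => lsum (seq 0 n) (fun c => lsum (seq 0 m) (fun s => lsum (seq 0 m)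
     (fun t => g (a * m + r)%nat (b * m + s)%nat (c * m + t)%nat))))).
  { apply lsum_ext. intros r _. apply lsum_swap. }
  apply lsum_swap.
Qed.

(** Any point can be moved this way into the fundamental cell, where compactness is available;
    moving two points together preserves their distance. *)
Definition tv (n : Z3) (x : R3) : R3 :=
  shift 2 (shift 1 (shift 0 x (IZR (zc 0 n) * (2 * PI))) (IZR (zc 1 n) * (2 * PI))) (IZR (zc 2 n) * (2 * PI)).

Lemma per_Z f j x n : periodic_s f -> (j < 3)%nat -> f (shift j x (IZR n * (2 * PI))) = f x.
Proof.
  intros H Hj.
  assert (N : forall m y, f (shift j y (INR m * (2 * PI))) = f y).
  { induction m as [|m IH]; intros y; [simpl; now rewrite Rmult_0_l, shift_0|].
    rewrite S_INR, Rmult_plus_distr_r, Rmult_1_l, <- shift_shift, H, IH; auto. }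
  destruct (Z_le_dec 0 n) as [Hn|Hn].
  - rewrite <- (Z2Nat.id n), <- INR_IZR_INZ by auto. apply N.
  - rewrite <- (N (Z.to_nat (- n)) (shift j x (IZR n * (2 * PI)))), shift_shift, INR_IZR_INZ, Z2Nat.id, opp_IZR by lia.
    replace (IZR n * (2 * PI) + - IZR n * (2 * PI)) with 0 by ring. now rewrite shift_0.
Qed.
Lemma per_tv f n x : periodic_s f -> f (tv n x) = f x.
Proof. intros H. unfold tv. rewrite !per_Z; auto. Qed.
Lemma dist3_tv n x y : dist3 (tv n x) (tv n y) = dist3 x y.
Proof. destruct x as [[a b] c], y as [[a' b'] c']. unfold dist3, tv. simpl. f_equal; [f_equal|]; f_equal; ring. Qed.
Lemma tv_box x : exists n, 0 <= comp 0 (tv n x) < 2 * PI /\ 0 <= comp 1 (tv n x) < 2 * PI /\ 0 <= comp 2 (tv n x) < 2 * PI.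
Proof.
  pose proof PI_RGT_0 as HP.
  assert (Q : forall a, exists n, 0 <= a + IZR n * (2 * PI) < 2 * PI).
  { intros a. exists (- (up (a / (2 * PI)) - 1))%Z. destruct (archimed (a / (2 * PI))) as [H1 H2].
    rewrite opp_IZR, minus_IZR. set (u := IZR (up (a / (2 * PI)))) in *.
    assert (E : a = a / (2 * PI) * (2 * PI)) by (field; lra). set (q := a / (2 * PI)) in *. nra. }
  destruct x as [[a b] c]. destruct (Q a) as [n0 H0], (Q b) as [n1 H1], (Q c) as [n2 H2].
  exists (n0, n1, n2). unfold tv. simpl. auto.
Qed.

Lemma dist3_triangle x y z : dist3 x z <= dist3 x y + dist3 y z.
Proof.
  unfold dist3. pose proof (Rdist_tri (comp 0 x) (comp 0 z) (comp 0 y)). pose proof (Rdist_tri (comp 1 x) (comp 1 z) (comp 1 y)).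
  pose proof (Rdist_tri (comp 2 x) (comp 2 z) (comp 2 y)). unfold Rdist in *. lra.
Qed.
Lemma dist3_sym x y : dist3 x y = dist3 y x.
Proof. unfold dist3. now rewrite (Rabs_minus_sym (comp 0 x)), (Rabs_minus_sym (comp 1 x)), (Rabs_minus_sym (comp 2 x)). Qed.

Lemma cper_unif f eps : cper f -> 0 < eps -> exists d, 0 < d /\ forall x y, dist3 x y < d -> Rabs (f y - f x) < eps.
Proof.
  intros [Hc Hp] He.
  set (del := fun t : R3 => proj1_sig (constructive_indefinite_description _ (Hc t (eps / 2) ltac:(lra)))).
  assert (Hdel : forall t, 0 < del t /\ forall y, dist3 t y < del t -> Rabs (f y - f t) < eps / 2).
  { intros t. exact (proj2_sig (constructive_indefinite_description _ (Hc t (eps / 2) ltac:(lra)))). }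
  set (pt := fun t : Compactness.Tn 3 R => match t with (a, (b, (c, _))) => (a, b, c) : R3 end).
  (* A sixth, because three coordinates each within [del / 6] add up to at most half of [del], and
     the other half is left for the second point. *)
  assert (Hpos : forall t, 0 < del (pt t) / 6) by (intros t; destruct (Hdel (pt t)); lra).
  destruct (compactness_value 3 (0, (0, (0, tt))) (2 * PI, (2 * PI, (2 * PI, tt))) (fun t => mkposreal _ (Hpos t))) as [d Hd].
  exists d. split; [apply cond_pos|]. intros x y Hxy.
  destruct (tv_box x) as [n Hn].
  rewrite <- (per_tv f n x), <- (per_tv f n y) by auto. rewrite <- (dist3_tv n) in Hxy.
  set (x' := tv n x) in *. set (y' := tv n y) in *. clearbody x' y'.
  apply NNPP. intros Hcon. apply (Hd (comp 0 x', (comp 1 x', (comp 2 x', tt)))).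
  - destruct x' as [[a b] c]. simpl in *. repeat split; lra.
  - intros (t & _ & Hcl & Hdt). apply Hcon. destruct t as (a & b & c & []). simpl in Hcl, Hdt.
    destruct (Hdel (a, b, c)) as [D1 D2]. destruct Hcl as (C1 & C2 & C3 & _).
    assert (X1 : dist3 (a, b, c) x' < del (a, b, c) / 2).
    { rewrite dist3_sym. unfold dist3. simpl. simpl in C1, C2, C3. lra. }
    assert (Y1 : dist3 (a, b, c) y' < del (a, b, c)).
    { eapply Rle_lt_trans; [apply (dist3_triangle _ x')|]. lra. }
    pose proof (D2 x' ltac:(lra)). pose proof (D2 y' Y1).
    replace (f y' - f x') with ((f y' - f (a, b, c)) - (f x' - f (a, b, c))) by ring.
    eapply Rle_lt_trans; [apply Rabs_triang|]. rewrite Rabs_Ropp. lra.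
Qed.

(** A point of the cell is joined to the origin by [n] steps shorter than the modulus of continuity
    for 1; each changes [f] by at most 1. *)
Lemma cper_bounded f : cper f -> exists B, 0 <= B /\ forall x, Rabs (f x) <= B.
Proof.
  intros H. destruct (cper_unif f 1 H Rlt_0_1) as (d & Hd & Hu). pose proof PI_RGT_0 as HP.
  destruct (nfloor_ex (6 * PI / d)) as [N [_ HN]]; [apply Rdiv_le_0_compat; lra|].
  set (n := S N). assert (Hn : 6 * PI / d < INR n) by (unfold n; rewrite S_INR; auto).
  assert (Hn0 : 0 < INR n) by (apply lt_0_INR; unfold n; lia).
  exists (Rabs (f (0, 0, 0)) + INR n). split; [pose proof (Rabs_pos (f (0,0,0))); lra|]. intros x.
  destruct (tv_box x) as [k Hk]. rewrite <- (per_tv f k x) by apply H.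
  destruct (tv k x) as [[a b] c] eqn:E. simpl in Hk.
  assert (I : forall i, Rabs (f (INR i / INR n * a, INR i / INR n * b, INR i / INR n * c)) <= Rabs (f (0, 0, 0)) + INR i).
  { induction i as [|i IH].
    - simpl. unfold Rdiv. rewrite !Rmult_0_l. lra.
    - set (p := (INR i / INR n * a, INR i / INR n * b, INR i / INR n * c)) in *.
      set (q := (INR (S i) / INR n * a, INR (S i) / INR n * b, INR (S i) / INR n * c)).
      assert (D : dist3 p q < d).
      { unfold dist3, p, q. cbn [comp]. rewrite S_INR.
        replace (INR i / INR n * a - (INR i + 1) / INR n * a) with (- (a / INR n)) by (field; lra).
        replace (INR i / INR n * b - (INR i + 1) / INR n * b) with (- (b / INR n)) by (field; lra).
        replace (INR i / INR n * c - (INR i + 1) / INR n * c) with (- (c / INR n)) by (field; lra).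
        rewrite !Rabs_Ropp, !Rabs_pos_eq by (apply Rdiv_le_0_compat; lra).
        replace (a / INR n + b / INR n + c / INR n) with ((a + b + c) / INR n) by (field; lra).
        apply Rmult_lt_reg_r with (INR n); auto. unfold Rdiv at 1. rewrite Rmult_assoc, Rinv_l, Rmult_1_r by lra.
        apply Rmult_lt_compat_r with (r := d) in Hn; auto. unfold Rdiv in Hn. rewrite Rmult_assoc, Rinv_l, Rmult_1_r in Hn by lra. lra. }
      pose proof (Hu p q D). rewrite S_INR. replace (f q) with ((f q - f p) + f p) by ring.
      rtrans Rabs_triang. lra. }
  specialize (I n). unfold Rdiv in I. rewrite Rinv_r, !Rmult_1_l in I by lra. auto.
Qed.

Lemma Rs_plus n f g : Rs n (fun x => f x + g x) = Rs n f + Rs n g.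
Proof. unfold Rs. rewrite T3_plus. ring. Qed.
Lemma Rs_scal n r f : Rs n (fun x => r * f x) = r * Rs n f.
Proof. unfold Rs. rewrite T3_scal. ring. Qed.
Lemma Rs_le n f g : (forall x, f x <= g x) -> Rs (S n) f <= Rs (S n) g.
Proof.
  intros H. unfold Rs. apply Rmult_le_compat_l; [|apply T3_le; auto].
  apply pow_le. pose proof PI_RGT_0. apply Rdiv_le_0_compat; [lra|apply lt_0_INR; lia].
Qed.
Lemma Rs_const n r : Rs (S n) (fun _ => r) = vol * r.
Proof. unfold Rs, vol. rewrite T3_const. field. apply not_0_INR; lia. Qed.
Lemma Rs_abs n f B : (forall x, Rabs (f x) <= B) -> Rabs (Rs (S n) f) <= vol * B.
Proof.
  intros H. apply Rabs_le. split.
  - rewrite Ropp_mult_distr_r, <- (Rs_const n). apply Rs_le. intros x. specialize (H x). apply Rabs_le_between in H. lra.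
  - rewrite <- (Rs_const n). apply Rs_le. intros x. specialize (H x). apply Rabs_le_between in H. lra.
Qed.

(** Each point of the refined grid is compared with the corner of its coarse cell; the three
    coordinates account for [6 * PI]. *)
Lemma Rs_refine_le f d eps n m : (forall x y, dist3 x y < d -> Rabs (f y - f x) < eps) ->
  6 * PI / INR (S n) < d -> Rs (S n * S m) f <= Rs (S n) f + vol * eps.
Proof.
  intros Hu Hn. pose proof PI_RGT_0 as HP.
  assert (Hn0 : 0 < INR (S n)) by (apply lt_0_INR; lia). assert (Hm0 : 0 < INR (S m)) by (apply lt_0_INR; lia).
  set (h := 2 * PI / INR (S n * S m)).
  assert (E : Rs (S n) f + vol * eps = h ^ 3 * T3 (S n) (fun a b c => T3 (S m) (fun _ _ _ => f (gpt (S n) a b c) + eps))).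
  { unfold Rs. rewrite (T3_ext (S n) (fun a b c => T3 (S m) (fun _ _ _ => f (gpt (S n) a b c) + eps)) (fun a b c => INR (S m) ^ 3 * (f (gpt (S n) a b c) + eps)))
      by (intros; apply T3_const). rewrite T3_scal, T3_plus, T3_const. unfold h, vol. rewrite mult_INR. field. lra. }
  rewrite E. unfold Rs. fold h. rewrite T3_refine. apply Rmult_le_compat_l; [apply pow_le, Rdiv_le_0_compat; [lra|apply lt_0_INR; lia]|].
  apply T3_le. intros a b c _ _ _. apply T3_le. intros r s t Hr Hs Ht.
  assert (Q : forall a r, (r < S m)%nat -> Rabs (2 * PI / INR (S n) * INR a - h * INR (a * S m + r)) <= 2 * PI / INR (S n)).
  { intros a' r' Hr'. unfold h. rewrite plus_INR, !mult_INR.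
    replace (2 * PI / INR (S n) * INR a' - 2 * PI / (INR (S n) * INR (S m)) * (INR a' * INR (S m) + INR r')) with
      (- (2 * PI / INR (S n) * (INR r' / INR (S m)))) by (field; lra).
    rewrite Rabs_Ropp. assert (0 <= INR r' / INR (S m) <= 1).
    { split; [apply Rdiv_le_0_compat; [apply pos_INR|auto]|]. apply Rmult_le_reg_r with (INR (S m)); auto.
      unfold Rdiv. rewrite Rmult_assoc, Rinv_l, Rmult_1_r, Rmult_1_l by lra. apply le_INR; lia. }
    assert (0 <= 2 * PI / INR (S n)) by (apply Rdiv_le_0_compat; lra).
    rewrite Rabs_pos_eq by (apply Rmult_le_pos; lra). nra. }
  assert (D : dist3 (gpt (S n) a b c) (gpt (S n * S m) (a * S m + r) (b * S m + s) (c * S m + t)) < d).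
  { eapply Rle_lt_trans; [|apply Hn]. pose proof (Q a r Hr). pose proof (Q b s Hs). pose proof (Q c t Ht).
    unfold dist3, gpt, comp. fold h. replace (6 * PI / INR (S n)) with (2 * PI / INR (S n) + 2 * PI / INR (S n) + 2 * PI / INR (S n)) by (field; lra). lra. }
  apply Hu, Rabs_lt_between in D. lra.
Qed.

Lemma Rs_refine f d eps n m : (forall x y, dist3 x y < d -> Rabs (f y - f x) < eps) ->
  6 * PI / INR (S n) < d -> Rabs (Rs (S n * S m) f - Rs (S n) f) <= vol * eps.
Proof.
  intros Hu Hn. pose proof (Rs_refine_le f d eps n m Hu Hn).
  assert (Hu' : forall x y, dist3 x y < d -> Rabs (-1 * f y - -1 * f x) < eps).
  { intros x y D. replace (-1 * f y - -1 * f x) with (- (f y - f x)) by ring. rewrite Rabs_Ropp. auto. }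
  pose proof (Rs_refine_le (fun x => -1 * f x) d eps n m Hu' Hn) as H'. rewrite !Rs_scal in H'. apply Rabs_le. lra.
Qed.

Lemma inv_INR_small B d : 0 < d -> exists N, forall n, (N <= n)%nat -> B / INR (S n) < d.
Proof.
  intros Hd. destruct (nfloor_ex (Rabs B / d)) as [N [_ HN]]; [apply Rdiv_le_0_compat; auto; apply Rabs_pos|].
  exists N. intros n Hn. assert (0 < INR (S n)) by (apply lt_0_INR; lia).
  assert (INR N + 1 <= INR (S n)) by (rewrite <- S_INR; apply le_INR; lia).
  apply Rmult_lt_reg_r with (INR (S n)); auto. unfold Rdiv at 1. rewrite Rmult_assoc, Rinv_l, Rmult_1_r by lra.
  apply Rmult_lt_compat_r with (r := d) in HN; auto. unfold Rdiv in HN. rewrite Rmult_assoc, Rinv_l, Rmult_1_r in HN by lra.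
  pose proof (Rle_abs B). nra.
Qed.

Lemma integral_cv f : cper f -> Un_cv (rsum f) (integral f).
Proof.
  intros H. unfold integral. apply epsilon_spec.
  assert (HC : Cauchy_crit (rsum f)).
  { intros eps He. pose proof vol_pos as HV.
    destruct (cper_unif f (eps / (4 * vol)) H) as (d & Hd & Hu); [apply Rdiv_lt_0_compat; lra|].
    destruct (inv_INR_small (6 * PI) d Hd) as [N HN]. exists N. intros n m Hn Hm. unfold Rdist. rewrite !rsum_Rs.
    (* Two grids are compared through their common refinement. *)
    pose proof (Rs_refine f d _ n m Hu (HN n Hn)) as A1. pose proof (Rs_refine f d _ m n Hu (HN m Hm)) as A2.
    rewrite (Nat.mul_comm (S m)) in A2.
    replace (vol * (eps / (4 * vol))) with (eps / 4) in * by (field; lra).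
    replace (Rs (S n) f - Rs (S m) f) with ((Rs (S n * S m) f - Rs (S m) f) - (Rs (S n * S m) f - Rs (S n) f)) by ring.
    eapply Rle_lt_trans; [apply Rabs_triang|]. rewrite Rabs_Ropp. lra. }
  destruct (Rcomplete.R_complete _ HC) as [l Hl]. eauto.
Qed.

Lemma int_unique f l : Un_cv (rsum f) l -> integral f = l.
Proof. intros H. apply (Un_cv_unique (rsum f)); auto. unfold integral. apply epsilon_spec. eauto. Qed.

Lemma int_plus f g : cper f -> cper g -> integral (fun x => f x + g x) = integral f + integral g.
Proof.
  intros Hf Hg. apply int_unique. eapply Un_cv_ev; [|apply CV_plus; [apply (integral_cv f)|apply (integral_cv g)]; auto].
  exists 0%nat. intros. cbv beta. now rewrite !rsum_Rs, Rs_plus.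
Qed.
Lemma int_scal r f : cper f -> integral (fun x => r * f x) = r * integral f.
Proof.
  intros Hf. apply int_unique. eapply Un_cv_ev; [|apply CV_mult; [apply (Un_cv_const r)|apply (integral_cv f Hf)]].
  exists 0%nat. intros. cbv beta. now rewrite !rsum_Rs, Rs_scal.
Qed.
Lemma int_ext f g : (forall x, f x = g x) -> integral f = integral g.
Proof. intros H. f_equal. now apply functional_extensionality. Qed.
Lemma int_le f g : cper f -> cper g -> (forall x, f x <= g x) -> integral f <= integral g.
Proof.
  intros Hf Hg H.
  pose proof (integral_cv f Hf) as Cf. pose proof (integral_cv g Hg) as Cg.
  assert (C : Un_cv (fun n => rsum f n - rsum g n) (integral f - integral g)) by (apply CV_minus; auto).
  assert (integral f - integral g <= 0); [|lra].
  apply (Un_cv_le _ _ _ C). exists 0%nat. intros n _. rewrite !rsum_Rs. pose proof (Rs_le n f g H). lra.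
Qed.

Lemma cper_const r : cper (fun _ => r).
Proof. split; [|intros j x Hj; auto]. intros x eps He. exists 1. split; [lra|]. intros. rewrite Rminus_diag, Rabs_R0. auto. Qed.
Lemma int_const r : integral (fun _ => r) = vol * r.
Proof. apply int_unique. eapply Un_cv_ev; [|apply Un_cv_const]. exists 0%nat. intros n _. now rewrite rsum_Rs, Rs_const. Qed.
Lemma int_abs f B : cper f -> (forall x, Rabs (f x) <= B) -> Rabs (integral f) <= vol * B.
Proof.
  intros Hf H. apply Rabs_le. rewrite Ropp_mult_distr_r, <- !int_const.
  split; apply int_le; auto using cper_const; intros x; pose proof (proj1 (Rabs_le_between _ _) (H x)); lra.
Qed.
Lemma cper_plus f g : cper f -> cper g -> cper (fun x => f x + g x).
Proof.
  intros [Cf Pf] [Cg Pg]. split; [|intros j x Hj; now rewrite Pf, Pg].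
  intros x eps He. destruct (Cf x (eps / 2)) as (d & Hd & H); [lra|]. destruct (Cg x (eps / 2)) as (d' & Hd' & H'); [lra|].
  exists (Rmin d d'). split; [now apply Rmin_pos|]. intros y Hy. pose proof (Rmin_l d d'). pose proof (Rmin_r d d').
  specialize (H y ltac:(lra)). specialize (H' y ltac:(lra)).
  replace (f y + g y - (f x + g x)) with ((f y - f x) + (g y - g x)) by ring.
  eapply Rle_lt_trans; [apply Rabs_triang|]. lra.
Qed.
Lemma cper_mult f g : cper f -> cper g -> cper (fun x => f x * g x).
Proof.
  intros Hf Hg. destruct (cper_bounded f Hf) as (A & HA0 & HA). destruct (cper_bounded g Hg) as (B & HB0 & HB).
  destruct Hf as [Cf Pf], Hg as [Cg Pg]. split; [|intros j x Hj; now rewrite Pf, Pg].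
  intros x eps He. set (e := eps / (A + B + 1)). assert (He' : 0 < e) by (apply Rdiv_lt_0_compat; lra).
  destruct (Cf x e He') as (d & Hd & H). destruct (Cg x e He') as (d' & Hd' & H').
  exists (Rmin d d'). split; [now apply Rmin_pos|]. intros y Hy. pose proof (Rmin_l d d'). pose proof (Rmin_r d d').
  specialize (H y ltac:(lra)). specialize (H' y ltac:(lra)).
  replace (f y * g y - f x * g x) with ((f y - f x) * g y + f x * (g y - g x)) by ring.
  eapply Rle_lt_trans; [apply Rabs_triang|]. rewrite !Rabs_mult. specialize (HA x). specialize (HB y).
  pose proof (Rabs_pos (f y - f x)). pose proof (Rabs_pos (g y - g x)). pose proof (Rabs_pos (f x)). pose proof (Rabs_pos (g y)).
  assert (Rabs (f y - f x) * Rabs (g y) <= e * B) by (apply Rmult_le_compat; lra).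
  assert (Rabs (f x) * Rabs (g y - g x) <= A * e) by (apply Rmult_le_compat; lra).
  assert (e * (A + B + 1) = eps) by (unfold e; field; lra). lra.
Qed.
Lemma cper_scal r f : cper f -> cper (fun x => r * f x).
Proof. intros H. apply (cper_mult (fun _ => r)); auto. apply cper_const. Qed.
Lemma cper_ext f g : (forall x, f x = g x) -> cper f -> cper g.
Proof. intros H. replace g with f; auto. now apply functional_extensionality. Qed.
Lemma int_minus f g : cper f -> cper g -> integral (fun x => f x - g x) = integral f - integral g.
Proof.
  intros Hf Hg. rewrite (int_ext _ (fun x => f x + -1 * g x)) by (intros; ring).
  rewrite int_plus, int_scal; auto. ring. now apply cper_scal.
Qed.

Lemma lsum_seq_cycle n (g : nat -> R) : g n = g 0%nat -> lsum (seq 0 n) (fun a => g (S a)) = lsum (seq 0 n) g.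
Proof.
  intros H. destruct n as [|n]; auto.
  rewrite (seq_S n 0) at 1. rewrite lsum_app. simpl. rewrite <- seq_shift, lsum_map. simpl in H. rewrite H. lra.
Qed.

Lemma Rs_shift n j f : periodic_s f -> (j < 3)%nat -> Rs (S n) (fun x => f (shift j x (2 * PI / INR (S n)))) = Rs (S n) f.
Proof.
  intros Hp Hj. unfold Rs. f_equal. set (h := 2 * PI / INR (S n)).
  assert (HN : h * INR (S n) = 2 * PI) by (unfold h; field; apply not_0_INR; lia).
  unfold T3. destruct j as [|[|[|j]]]; [| | |lia].
  - rewrite <- (lsum_seq_cycle (S n) (fun a => lsum (seq 0 (S n)) (fun b => lsum (seq 0 (S n)) (fun c => f (gpt (S n) a b c))))).
    + apply lsum_ext; intros a _. apply lsum_ext; intros b _. apply lsum_ext; intros c _.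
      f_equal. unfold gpt. fold h. cbn [shift]. rewrite (S_INR a). repeat apply f_equal2; auto; ring.
    + apply lsum_ext; intros b _. apply lsum_ext; intros c _. rewrite <- (Hp 0%nat (gpt (S n) 0 b c)) by lia. f_equal.
      unfold gpt. fold h. cbn [shift]. rewrite HN. simpl INR. repeat apply f_equal2; auto; ring.
  - apply lsum_ext; intros a _.
    rewrite <- (lsum_seq_cycle (S n) (fun b => lsum (seq 0 (S n)) (fun c => f (gpt (S n) a b c)))).
    + apply lsum_ext; intros b _. apply lsum_ext; intros c _.
      f_equal. unfold gpt. fold h. cbn [shift]. rewrite (S_INR b). repeat apply f_equal2; auto; ring.
    + apply lsum_ext; intros c _. rewrite <- (Hp 1%nat (gpt (S n) a 0 c)) by lia. f_equal.
      unfold gpt. fold h. cbn [shift]. rewrite HN. simpl INR. repeat apply f_equal2; auto; ring.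
  - apply lsum_ext; intros a _. apply lsum_ext; intros b _.
    rewrite <- (lsum_seq_cycle (S n) (fun c => f (gpt (S n) a b c))).
    + apply lsum_ext; intros c _.
      f_equal. unfold gpt. fold h. cbn [shift]. rewrite (S_INR c). repeat apply f_equal2; auto; ring.
    + rewrite <- (Hp 2%nat (gpt (S n) a b 0)) by lia. f_equal.
      unfold gpt. fold h. cbn [shift]. rewrite HN. simpl INR. repeat apply f_equal2; auto; ring.
Qed.

Definition has_partial (j : nat) (f g : R3 -> R) : Prop := forall x, derivable_pt_lim (fun s => f (shift j x s)) 0 (g x).

Lemma has_partial_at j f g x t : has_partial j f g -> derivable_pt_lim (fun s => f (shift j x s)) t (g (shift j x t)).
Proof.
  intros H.
  assert (D := derivable_pt_lim_comp (fun s => s - t) (fun s => f (shift j (shift j x t) s)) t 1 (g (shift j x t))).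
  eapply deriv_ext; [|eapply deriv_val; [|apply D]].
  - intros s. unfold Ranalysis1.comp. rewrite shift_shift. f_equal. f_equal. ring.
  - ring.
  - eapply deriv_val; [|apply derivable_pt_lim_minus; [apply derivable_pt_lim_id|apply derivable_pt_lim_const]]. ring.
  - rewrite Rminus_diag. auto.
Qed.

Lemma dist3_shift j x s : (j < 3)%nat -> dist3 x (shift j x s) = Rabs s.
Proof.
  intros Hj. destruct x as [[a b] c]. unfold dist3. destruct j as [|[|[|j]]]; try lia; simpl;
    rewrite !Rminus_diag, Rabs_R0; rewrite <- (Rabs_Ropp s); match goal with |- context [Rabs (?u - (?u + s))] => replace (u - (u + s)) with (- s) by ring end; lra.
Qed.

(* Grid sums are invariant under a grid shift, so difference quotients at the grid step have zero sum. *)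
Lemma int_partial_zero j f g : (j < 3)%nat -> cper f -> cper g -> has_partial j f g -> integral g = 0.
Proof.
  intros Hj Hf Hg H. apply cond_eq. intros eps He. rewrite Rminus_0_r. pose proof vol_pos as HV. pose proof PI_RGT_0 as HP.
  destruct (cper_unif g (eps / (2 * vol)) Hg) as (d & Hd & Hu); [apply Rdiv_lt_0_compat; lra|].
  destruct (inv_INR_small (2 * PI) d Hd) as [N HN].
  assert (B : Rabs (integral g) <= vol * (eps / (2 * vol))).
  { assert (Q : forall n, (N <= n)%nat -> Rabs (rsum g n) <= vol * (eps / (2 * vol))).
    { intros n Hn. rewrite rsum_Rs. set (h := 2 * PI / INR (S n)). specialize (HN n Hn). fold h in HN.
      assert (Hh : 0 < h) by (apply Rdiv_lt_0_compat; [lra|apply lt_0_INR; lia]).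
      assert (E : Rs (S n) g = Rs (S n) (fun x => g x + -1 * (/ h * (f (shift j x h) + -1 * f x)))).
      { rewrite Rs_plus, !Rs_scal, Rs_plus, Rs_scal, Rs_shift by (auto; apply Hf). ring. }
      rewrite E. apply Rs_abs. intros x.
      destruct (MVT_cor2 (fun s => f (shift j x s)) (fun s => g (shift j x s)) 0 h Hh) as (c & Hc & Hc').
      { intros c _. now apply has_partial_at. }
      rewrite shift_0 in Hc.
      replace (g x + -1 * (/ h * (f (shift j x h) + -1 * f x))) with (- (g (shift j x c) - g x)).
      - rewrite Rabs_Ropp. left. apply Hu. rewrite dist3_shift, Rabs_pos_eq by (auto; lra). lra.
      - replace (f (shift j x h) + -1 * f x) with (f (shift j x h) - f x) by ring. rewrite Hc. field. lra. }
    apply (Un_cv_le (fun n => Rabs (rsum g n))).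
    - apply cv_cvabs. now apply integral_cv.
    - exists N. auto. }
  replace (vol * (eps / (2 * vol))) with (eps / 2) in B by (field; lra). lra.
Qed.

(** Only the coarse cell containing a translate of [x0] is kept; its share in all refined sums is at
    least [h^3 c], whatever the refinement. *)
Lemma int_pos f x0 : cper f -> (forall x, 0 <= f x) -> 0 < f x0 -> 0 < integral f.
Proof.
  intros Hf H0 Hx.
  destruct (tv_box x0) as [k Hk]. rewrite <- (per_tv f k x0) in Hx by apply Hf. set (y := tv k x0) in *. clearbody y.
  set (c := f y / 2). destruct (proj1 Hf y c) as (d & Hd & Hu); [unfold c; lra|].
  destruct (inv_INR_small (6 * PI) d Hd) as [N HN]. specialize (HN N (le_n _)).
  set (h := 2 * PI / INR (S N)). assert (HI : 0 < INR (S N)) by (apply lt_0_INR; lia).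
  assert (Hh : 0 < h) by (apply Rdiv_lt_0_compat; lra).
  assert (Hh2 : h * INR (S N) = 2 * PI) by (unfold h; field; lra).
  assert (Q : forall u, 0 <= u < 2 * PI -> exists a, (a < S N)%nat /\ h * INR a <= u < h * INR a + h).
  { intros u Hu'. destruct (nfloor_ex (u / h)) as [a [Ha1 Ha2]]; [apply Rdiv_le_0_compat; lra|].
    apply Rmult_le_compat_r with (r := h) in Ha1; [|lra]. apply Rmult_lt_compat_r with (r := h) in Ha2; [|lra].
    unfold Rdiv in Ha1, Ha2. rewrite Rmult_assoc, Rinv_l, Rmult_1_r in Ha1, Ha2 by lra.
    exists a. split; [apply INR_lt; nra|lra]. }
  destruct (Q _ (proj1 Hk)) as (a & Ha & Ha'). destruct (Q _ (proj1 (proj2 Hk))) as (b & Hb & Hb'). destruct (Q _ (proj2 (proj2 Hk))) as (e & Hee & He').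
  assert (L : forall m, h ^ 3 * c <= Rs (S N * S m) f).
  { intros m. assert (HM : 0 < INR (S m)) by (apply lt_0_INR; lia). unfold Rs. rewrite T3_refine.
    set (h' := 2 * PI / INR (S N * S m)). assert (E : h = h' * INR (S m)) by (unfold h, h'; rewrite mult_INR; field; lra).
    assert (Hh' : 0 < h') by (apply Rdiv_lt_0_compat; [lra|apply lt_0_INR; lia]).
    replace (h ^ 3 * c) with (h' ^ 3 * (INR (S m) ^ 3 * c)) by (rewrite E; ring).
    apply Rmult_le_compat_l; [apply pow_le; lra|].
    eapply Rle_trans; [|apply (T3_term (S N) (fun a b c => T3 (S m) (fun r s t => f (gpt (S N * S m) (a * S m + r) (b * S m + s) (c * S m + t)))) a b e); auto].
    - rewrite <- T3_const. apply T3_le. intros r s t Hr Hs Ht.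
      assert (D : dist3 y (gpt (S N * S m) (a * S m + r) (b * S m + s) (e * S m + t)) < d).
      { eapply Rle_lt_trans; [|apply HN]. replace (6 * PI / INR (S N)) with (h + h + h) by (unfold h; field; lra).
        assert (W : forall u a r, h * INR a <= u < h * INR a + h -> (r < S m)%nat -> Rabs (u - h' * INR (a * S m + r)) <= h).
        { intros u a' r' Hu' Hr'. rewrite plus_INR, mult_INR.
          assert (0 <= h' * INR r' <= h). { rewrite E. pose proof (pos_INR r'). assert (INR r' <= INR (S m)) by (apply le_INR; lia). nra. }
          replace (h' * (INR a' * INR (S m) + INR r')) with (h * INR a' + h' * INR r') by (rewrite E; ring).
          apply Rabs_le. lra. }
        pose proof (W _ a r Ha' Hr). pose proof (W _ b s Hb' Hs). pose proof (W _ e t He' Ht).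
        unfold dist3, gpt. fold h'. cbn [comp] in *. lra. }
      specialize (Hu _ D). apply Rabs_lt_between in Hu. unfold c in *. lra.
    - intros. apply lsum_nonneg; intros. apply lsum_nonneg; intros. apply lsum_nonneg; auto. }
  assert (P : 0 < h ^ 3 * c) by (apply Rmult_lt_0_compat; [apply pow_lt; auto|unfold c; lra]).
  apply Rlt_le_trans with (h ^ 3 * c); auto.
  apply le_epsilon. intros ee Hee'. destruct (integral_cv f Hf ee Hee') as [M HM].
  specialize (HM (S N * S M - 1)%nat ltac:(nia)). rewrite rsum_Rs in HM.
  replace (S (S N * S M - 1)) with (S N * S M)%nat in HM by nia. specialize (L M).
  unfold Rdist in HM. apply Rabs_lt_between in HM. lra.
Qed.

(** ** Fourier representation of smooth periodic functions *)

Definition classic_dec (Q : Prop) : {Q} + {~ Q} := excluded_middle_informative Q.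
Definition cosk (k : Z3) (x : R3) : R := cos (zdot k x).
Definition sink (k : Z3) (x : R3) : R := sin (zdot k x).
(** The minus sign matches the one in [trm]. No factor 2 occurs in the normalisation, as both [k]
    and [- k] contribute to [SF]. *)
Definition fc (f : R3 -> R) (k : Z3) : C :=
  (integral (fun x => f x * cosk k x) / vol, - (integral (fun x => f x * sink k x) / vol)).

Lemma cper_cosk k : cper (cosk k).
Proof.
  split.
  - apply (lip_continuous _ (wt k)); [pose proof (wt_ge1 k); lra|]. intros x y. eapply Rle_trans; [apply cos_lip|apply zdot_lip].
  - intros j x Hj. unfold cosk. rewrite zdot_shift by auto. apply cos_2pi_Z.
Qed.
Lemma cper_sink k : cper (sink k).
Proof.
  split.
  - apply (lip_continuous _ (wt k)); [pose proof (wt_ge1 k); lra|]. intros x y. eapply Rle_trans; [apply sin_lip|apply zdot_lip].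
  - intros j x Hj. unfold sink. rewrite zdot_shift by auto. apply sin_2pi_Z.
Qed.

Lemma cosk_partial j k : (j < 3)%nat -> has_partial j (cosk k) (fun x => - kc j k * sink k x).
Proof.
  intros Hj x. apply deriv_ext with (fun s => cos (zdot k x + kc j k * s)); [intros; unfold cosk; now rewrite zdot_shift|].
  apply is_derive_Reals. auto_derive; auto. unfold sink. rewrite Rmult_0_r, Rplus_0_r. ring.
Qed.
Lemma sink_partial j k : (j < 3)%nat -> has_partial j (sink k) (fun x => kc j k * cosk k x).
Proof.
  intros Hj x. apply deriv_ext with (fun s => sin (zdot k x + kc j k * s)); [intros; unfold sink; now rewrite zdot_shift|].
  apply is_derive_Reals. auto_derive; auto. unfold cosk. rewrite Rmult_0_r, Rplus_0_r. ring.
Qed.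
Lemma has_partial_mult j f f' g g' : has_partial j f f' -> has_partial j g g' ->
  has_partial j (fun x => f x * g x) (fun x => f' x * g x + f x * g' x).
Proof.
  intros Hf Hg x. eapply deriv_val; [|apply (derivable_pt_lim_mult (fun s => f (shift j x s)) (fun s => g (shift j x s))); auto].
  cbv beta. now rewrite shift_0.
Qed.

Lemma int_by_parts j f f' g g' : (j < 3)%nat -> cper f -> cper f' -> cper g -> cper g' ->
  has_partial j f f' -> has_partial j g g' ->
  integral (fun x => f x * g' x) = - integral (fun x => f' x * g x).
Proof.
  intros Hj Cf Cf' Cg Cg' Hf Hg.
  assert (E : integral (fun x => f' x * g x + f x * g' x) = 0).
  { apply (int_partial_zero j (fun x => f x * g x)); auto.
    - now apply cper_mult.
    - apply cper_plus; now apply cper_mult.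
    - now apply has_partial_mult. }
  rewrite int_plus in E by (apply cper_mult; auto). lra.
Qed.

Lemma shift_comm i j x s t : shift i (shift j x s) t = shift j (shift i x t) s.
Proof.
  destruct x as [[a b] c].
  destruct i as [|[|[|i]]], j as [|[|[|j]]]; simpl; auto; (apply f_equal2; [apply f_equal2|]; ring).
Qed.

Lemma smooth_partial f j : (j < 3)%nat -> smooth3 f -> smooth3 (partial j f).
Proof.
  intros Hj H l Hl. apply (H (j :: l)). intros i [<-|Hi]; auto.
Qed.
Lemma smooth_cper f : smooth3 f -> periodic_s f -> cper f.
Proof. intros H Hp. split; auto. apply (H nil). intros ? []. Qed.
Lemma smooth_has_partial f j : (j < 3)%nat -> smooth3 f -> has_partial j f (partial j f).
Proof.
  intros Hj H x. destruct (H nil ltac:(intros ? [])) as [_ D]. destruct (D j x Hj) as [d Hd]. simpl in Hd.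
  rewrite (partial_eq _ _ _ d Hd). auto.
Qed.
Lemma periodic_partial f j : periodic_s f -> periodic_s (partial j f).
Proof.
  intros H i x Hi. unfold partial. f_equal. apply functional_extensionality. intros d. f_equal.
  apply functional_extensionality. intros s. rewrite shift_comm. now apply H.
Qed.

(** A derivative multiplies by [i k_j] and so exchanges real and imaginary parts; the sum of their
    absolute values is insensitive to this and iterates cleanly. *)
Lemma fc_ibp f j k : (j < 3)%nat -> smooth3 f -> periodic_s f ->
  Rabs (kc j k) * (Rabs (Re (fc f k)) + Rabs (Im (fc f k))) = Rabs (Re (fc (partial j f) k)) + Rabs (Im (fc (partial j f) k)).
Proof.
  intros Hj Hs Hp.
  pose proof (smooth_cper f Hs Hp) as Cf. pose proof (smooth_cper _ (smooth_partial f j Hj Hs) (periodic_partial f j Hp)) as Cf'.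
  pose proof (smooth_has_partial f j Hj Hs) as D.
  assert (E1 : kc j k * integral (fun x => f x * cosk k x) = - integral (fun x => partial j f x * sink k x)).
  { rewrite <- int_scal by (apply cper_mult; auto; apply cper_cosk).
    rewrite <- (int_by_parts j f _ (sink k) (fun x => kc j k * cosk k x)); auto; try apply cper_sink; try (apply sink_partial; auto).
    - apply int_ext. intros; ring.
    - apply cper_scal, cper_cosk. }
  assert (E2 : kc j k * integral (fun x => f x * sink k x) = integral (fun x => partial j f x * cosk k x)).
  { rewrite <- int_scal by (apply cper_mult; auto; apply cper_sink).
    rewrite <- (Ropp_involutive (integral (fun x => partial j f x * cosk k x))).
    rewrite <- (int_by_parts j f _ (cosk k) (fun x => - kc j k * sink k x)); auto; try apply cper_cosk; try (apply cosk_partial; auto).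
    - rewrite (int_ext (fun x => f x * (- kc j k * sink k x)) (fun x => -1 * (kc j k * (f x * sink k x)))) by (intros; ring).
      rewrite (int_scal (-1)); [ring|]. apply cper_scal, cper_mult; auto. apply cper_sink.
    - apply cper_scal, cper_sink. }
  unfold fc, Re, Im, fst, snd. rewrite !Rabs_Ropp, Rmult_plus_distr_l, <- !Rabs_mult.
  unfold Rdiv. rewrite <- !Rmult_assoc, E1, E2, Ropp_mult_distr_l_reverse, Rabs_Ropp. ring.
Qed.

Lemma fc_decay f p : smooth3 f -> periodic_s f ->
  exists B, forall k, wt k ^ p * (Rabs (Re (fc f k)) + Rabs (Im (fc f k))) <= B.
Proof.
  revert f. induction p as [|p IH]; intros f Hs Hp.
  - destruct (cper_bounded f (smooth_cper f Hs Hp)) as (B & HB & H).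
    exists (B + B). intros k. simpl. rewrite Rmult_1_l. unfold fc, Re, Im, fst, snd. rewrite Rabs_Ropp.
    pose proof vol_pos as HV.
    assert (Q : forall g, cper g -> (forall x, Rabs (g x) <= 1) -> Rabs (integral (fun x => f x * g x) / vol) <= B).
    { intros g Cg Hg. unfold Rdiv. rewrite Rabs_mult, (Rabs_pos_eq (/ vol)) by (left; now apply Rinv_0_lt_compat).
      apply Rmult_le_reg_r with vol; auto. rewrite Rmult_assoc, Rinv_l, Rmult_1_r, (Rmult_comm B) by lra. apply int_abs.
      - apply cper_mult; auto. now apply smooth_cper.
      - intros x. rewrite Rabs_mult. specialize (H x). specialize (Hg x). pose proof (Rabs_pos (g x)). nra. }
    pose proof (Q _ (cper_cosk k)) as Q1. pose proof (Q _ (cper_sink k)) as Q2.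
    assert (Rabs (integral (fun x => f x * cosk k x) / vol) <= B).
    { apply Q1. intros x. apply Rabs_le. apply COS_bound. }
    assert (Rabs (integral (fun x => f x * sink k x) / vol) <= B).
    { apply Q2. intros x. apply Rabs_le. apply SIN_bound. }
    lra.
  - destruct (IH f Hs Hp) as [B HB].
    destruct (IH _ (smooth_partial f 0 ltac:(lia) Hs) (periodic_partial f 0 Hp)) as [B0 HB0].
    destruct (IH _ (smooth_partial f 1 ltac:(lia) Hs) (periodic_partial f 1 Hp)) as [B1 HB1].
    destruct (IH _ (smooth_partial f 2 ltac:(lia) Hs) (periodic_partial f 2 Hp)) as [B2 HB2].
    exists (B + B0 + B1 + B2). intros k. specialize (HB k). specialize (HB0 k). specialize (HB1 k). specialize (HB2 k).
    rewrite <- fc_ibp in HB0, HB1, HB2 by (auto; lia).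
    set (q := Rabs (Re (fc f k)) + Rabs (Im (fc f k))) in *. simpl pow. rewrite wt_abs at 1. lra.
Qed.

Lemma RD_fc f : smooth3 f -> periodic_s f -> RD (fc f).
Proof.
  intros Hs Hp p. destruct (fc_decay f p Hs Hp) as [B HB]. exists B. intros k. eapply Rle_trans; [|apply HB].
  apply Rmult_le_compat_l; [apply pow_le; pose proof (wt_ge1 k); lra|apply Cmod_le_ReIm].
Qed.

Lemma rls_fc f : cper f -> rls (fc f).
Proof.
  intros Hf k. unfold fc, Cconj, fst, snd. apply f_equal2.
  - f_equal. apply int_ext. intros x. unfold cosk. now rewrite zdot_opp, cos_neg.
  - rewrite Ropp_involutive. rewrite (int_ext _ (fun x => -1 * (f x * sink k x))).
    + rewrite int_scal by (apply cper_mult; auto; apply cper_sink). unfold Rdiv. ring.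
    + intros x. unfold sink. rewrite zdot_opp, sin_neg. ring.
Qed.

Lemma z3_nonzero q : q <> z3zero -> exists j, (j < 3)%nat /\ kc j q <> 0.
Proof.
  intros H. destruct q as [[a b] c]. unfold kc.
  destruct (Z.eq_dec a 0) as [Ha|Ha]; [|exists 0%nat; split; [lia|now apply not_0_IZR]].
  destruct (Z.eq_dec b 0) as [Hb|Hb]; [|exists 1%nat; split; [lia|now apply not_0_IZR]].
  destruct (Z.eq_dec c 0) as [Hc|Hc]; [|exists 2%nat; split; [lia|now apply not_0_IZR]].
  subst. now elim H.
Qed.

Lemma int_cosk q : q <> z3zero -> integral (cosk q) = 0.
Proof.
  intros H. destruct (z3_nonzero q H) as (j & Hj & Hk).
  assert (E : integral (fun x => kc j q * cosk q x) = 0).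
  { apply (int_partial_zero j (sink q)); auto; [apply cper_sink|apply cper_scal, cper_cosk|now apply sink_partial]. }
  rewrite int_scal in E by apply cper_cosk. apply Rmult_integral in E. destruct E; [contradiction|auto].
Qed.
Lemma int_sink q : integral (sink q) = 0.
Proof.
  destruct (classic (q = z3zero)) as [->|H].
  - rewrite (int_ext _ (fun _ => 0)); [rewrite int_const; ring|]. intros x. unfold sink, zdot, z3zero. simpl.
    rewrite !Rmult_0_l, !Rplus_0_l. apply sin_0.
  - destruct (z3_nonzero q H) as (j & Hj & Hk).
    assert (E : integral (fun x => - kc j q * sink q x) = 0).
    { apply (int_partial_zero j (cosk q)); auto; [apply cper_cosk|apply cper_scal, cper_sink|now apply cosk_partial]. }
    rewrite int_scal in E by apply cper_sink. apply Rmult_integral in E. destruct E; [lra|auto].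
Qed.
Lemma int_cosk_zero : integral (cosk z3zero) = vol.
Proof.
  rewrite (int_ext _ (fun _ => 1)); [rewrite int_const; ring|]. intros x. unfold cosk, zdot, z3zero. simpl.
  rewrite !Rmult_0_l, !Rplus_0_l. apply cos_0.
Qed.

Lemma cper_lsum {A} (L : list A) (F : A -> R3 -> R) : (forall a, In a L -> cper (F a)) -> cper (fun x => lsum L (fun a => F a x)).
Proof.
  induction L as [|a L IH]; intros H; simpl; [apply cper_const|].
  apply cper_plus; [apply H; simpl; auto|apply IH; intros; apply H; simpl; auto].
Qed.
Lemma int_lsum {A} (L : list A) (F : A -> R3 -> R) : (forall a, In a L -> cper (F a)) ->
  integral (fun x => lsum L (fun a => F a x)) = lsum L (fun a => integral (F a)).
Proof.
  induction L as [|a L IH]; intros H; simpl; [rewrite int_const; ring|].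
  rewrite (int_plus (F a)), IH; auto; try (intros; apply H; simpl; auto). apply cper_lsum. intros; apply H; simpl; auto.
Qed.

Lemma int_zsum B (F : Z3 -> R3 -> R) : (forall k, cper (F k)) -> (forall x, dom B (fun k => F k x)) ->
  cper (fun x => zsum (fun k => F k x)) -> integral (fun x => zsum (fun k => F k x)) = zsum (fun k => integral (F k)).
Proof.
  intros HF HD HC. pose proof vol_pos as HV. symmetry.
  apply (zsum_unique (vol * B)).
  - intros k. rewrite Rmult_assoc. apply int_abs; auto. intros x. apply HD.
  - apply is_lim_seq_spec. intros eps.
    destruct (zsum_list B (eps / (2 * vol))) as [N HN]; [apply Rdiv_lt_0_compat; [apply cond_pos|lra]|].
    exists N. intros n Hn. rewrite <- int_lsum by auto. rewrite <- int_minus by (auto; now apply cper_lsum).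
    eapply Rle_lt_trans; [apply (int_abs _ (eps / (2 * vol)))|].
    + apply cper_ext with (fun x => lsum (box n) (fun k => F k x) + -1 * zsum (fun k => F k x)); [intros; ring|].
      apply cper_plus; [now apply cper_lsum|now apply cper_scal].
    + intros x. apply HN; auto. now apply box_mono.
    + replace (vol * (eps / (2 * vol))) with (eps / 2) by (field; lra). destruct eps; simpl; lra.
Qed.

Lemma trm_as_trig a k x : trm a (zdot k x) = Re a * cosk k x + - Im a * sink k x.
Proof. unfold trm, cosk, sink. ring. Qed.

Lemma cper_trm a k : cper (fun x => trm a (zdot k x)).
Proof.
  eapply cper_ext; [intros; symmetry; apply trm_as_trig|].
  apply cper_plus; apply cper_scal; [apply cper_cosk|apply cper_sink].
Qed.

Lemma int_trm a q : integral (fun x => trm a (zdot q x)) = if classic_dec (q = z3zero) then vol * Re a else 0.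
Proof.
  rewrite (int_ext _ _ (trm_as_trig a q)).
  rewrite int_plus, !int_scal, int_sink by (try apply cper_scal; try apply cper_cosk; apply cper_sink).
  destruct (classic_dec (q = z3zero)) as [->|H]; [rewrite int_cosk_zero; ring|rewrite int_cosk by auto; ring].
Qed.

Lemma zsum_single l (v : R) : zsum (fun k => if classic_dec (k = l) then v else 0) = v.
Proof.
  destruct (box_ex l) as [N HN]. rewrite (zsum_finite N).
  - rewrite (lsum_support (box N) [l]); auto.
    + simpl. destruct (classic_dec (l = l)); [lra|tauto].
    + constructor; auto. constructor.
    + intros k _ Hk. destruct (classic_dec (k = l)); auto. elim Hk. simpl; auto.
    + intros k [<-|[]] Hk. tauto.
  - intros k Hk. destruct (classic_dec (k = l)); auto. subst. tauto.
Qed.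

Lemma cper_SF a : RD a -> cper (SF a).
Proof. intros H. split; [now apply SF_continuous|apply SF_periodic]. Qed.

Lemma trm_mult a b k l x : trm a (zdot k x) * trm b (zdot l x) =
  / 2 * trm (a * b)%C (zdot (z3add k l) x) + / 2 * trm (a * Cconj b)%C (zdot (z3sub k l) x).
Proof.
  unfold z3sub, trm. rewrite !zdot_add, zdot_opp. set (u := zdot k x). set (v := zdot l x).
  rewrite !cos_plus, !sin_plus, cos_neg, sin_neg. destruct a, b. simpl. field.
Qed.

(** Orthogonality selects two frequencies, [l] and [- l], because a product of real parts involves
    both the sum and the difference of the phases. *)
Lemma SF_int_trig a b l : RD a ->
  integral (fun x => SF a x * trm b (zdot l x)) =
  / 2 * vol * (Re (a (z3opp l)) * Re b - Im (a (z3opp l)) * Im b) + / 2 * vol * (Re (a l) * Re b + Im (a l) * Im b).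
Proof.
  intros Ha. destruct (RD_domC _ Ha) as [A HA].
  set (F := fun k x => trm (a k) (zdot k x) * trm b (zdot l x)).
  assert (CF : forall k, cper (F k)) by (intros; apply cper_mult; apply cper_trm).
  assert (D : forall x, dom (2 * A * (2 * Cmod b)) (fun k => F k x)).
  { intros x k. unfold F. rewrite Rabs_mult. pose proof (trm_dom _ _ x HA k). pose proof (trm_bound b (zdot l x)).
    replace (2 * A * (2 * Cmod b) * om k) with (2 * A * om k * (2 * Cmod b)) by ring.
    apply Rmult_le_compat; auto; apply Rabs_pos. }
  assert (E : forall x, SF a x * trm b (zdot l x) = zsum (fun k => F k x)).
  { intros x. unfold SF, F. rewrite Rmult_comm, <- (zsum_scal (2 * A)) by now apply trm_dom. apply zsum_ext. intros; ring. }
  rewrite (int_ext _ _ E). rewrite (int_zsum _ F CF D).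
  2:{ eapply cper_ext; [exact E|]. apply cper_mult; [now apply cper_SF|apply cper_trm]. }
  rewrite (zsum_ext _ (fun k => (if classic_dec (k = z3opp l) then / 2 * vol * (Re (a (z3opp l)) * Re b - Im (a (z3opp l)) * Im b) else 0) + (if classic_dec (k = l) then / 2 * vol * (Re (a l) * Re b + Im (a l) * Im b) else 0))).
  - set (v1 := / 2 * vol * _). set (v2 := / 2 * vol * _).
    assert (DD : forall m v, dom (Rabs v * wt m ^ 6) (fun k => if classic_dec (k = m) then v else 0)).
    { intros m v k. pose proof (om_pos k). pose proof (om_wt k). pose proof (wt_ge1 m). pose proof (Rabs_pos v).
      destruct (classic_dec (k = m)) as [->|].
      - rewrite Rmult_assoc, (Rmult_comm (wt m ^ 6)). nra.
      - rewrite Rabs_R0. apply Rmult_le_pos; [|lra]. apply Rmult_le_pos; auto. apply pow_le; lra. }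
    pose proof (DD (z3opp l) v1) as D1. pose proof (DD l v2) as D2.
    rewrite (zsum_plus (Rabs v1 * wt (z3opp l) ^ 6 + Rabs v2 * wt l ^ 6)).
    + now rewrite !zsum_single.
    + apply (dom_mono _ _ _ D1). pose proof (dom_nonneg _ _ D2). lra.
    + apply (dom_mono _ _ _ D2). pose proof (dom_nonneg _ _ D1). lra.
  - intros k. rewrite (int_ext (F k) _ (fun x => trm_mult (a k) b k l x)).
    rewrite int_plus, !int_scal by (try apply cper_scal; apply cper_trm). rewrite !int_trm. f_equal.
    + destruct (classic_dec (z3add k l = z3zero)) as [Q|Q], (classic_dec (k = z3opp l)) as [Q'|Q'].
      * subst k. destruct (a (z3opp l)), b. simpl. ring.
      * elim Q'. rewrite <- (z3addK k l), Q. z3.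
      * elim Q. subst k. z3.
      * ring.
    + destruct (classic_dec (z3sub k l = z3zero)) as [Q|Q], (classic_dec (k = l)) as [Q'|Q'].
      * subst k. destruct (a l), b. simpl. ring.
      * elim Q'. rewrite <- (z3subK k l), Q. z3.
      * elim Q. subst k. z3.
      * ring.
Qed.

Lemma fc_SF a l : RD a -> rls a -> fc (SF a) l = a l.
Proof.
  intros Ha Hr. pose proof vol_pos as HV. unfold fc.
  rewrite (int_ext (fun x => SF a x * cosk l x) (fun x => SF a x * trm 1 (zdot l x))) by (intros; rewrite trm_as_trig; simpl; ring).
  rewrite (int_ext (fun x => SF a x * sink l x) (fun x => SF a x * trm (- Ci)%C (zdot l x))) by (intros; rewrite trm_as_trig; simpl; ring).
  rewrite !SF_int_trig, Hr by auto. destruct (a l) as [p q]. simpl. f_equal; field; lra.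
Qed.

(* Zero Fourier coefficients survive multiplication by [1 - cos] kernels, so a point where [f > 0]
   is detected by powers of the peaked trigonometric polynomial [q]. *)
Definition allzero (f : R3 -> R) : Prop := cper f /\ forall a k, integral (fun x => f x * trm a (zdot k x)) = 0.

Lemma allzero_plus f g : allzero f -> allzero g -> allzero (fun x => f x + g x).
Proof.
  intros [Cf Hf] [Cg Hg]. split; [now apply cper_plus|]. intros a k.
  rewrite (int_ext _ (fun x => f x * trm a (zdot k x) + g x * trm a (zdot k x))) by (intros; ring).
  rewrite int_plus, Hf, Hg by (apply cper_mult; auto; apply cper_trm). ring.
Qed.
Lemma allzero_scal r f : allzero f -> allzero (fun x => r * f x).
Proof.
  intros [Cf Hf]. split; [now apply cper_scal|]. intros a k. rewrite (int_ext _ (fun x => r * (f x * trm a (zdot k x)))) by (intros; ring).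
  rewrite int_scal, Hf by (apply cper_mult; auto; apply cper_trm). ring.
Qed.
Lemma allzero_trm b l f : allzero f -> allzero (fun x => f x * trm b (zdot l x)).
Proof.
  intros [Cf Hf]. split; [apply cper_mult; auto; apply cper_trm|]. intros a k.
  rewrite (int_ext _ (fun x => / 2 * (f x * trm (b * a)%C (zdot (z3add l k) x)) + / 2 * (f x * trm (b * Cconj a)%C (zdot (z3sub l k) x)))).
  - rewrite int_plus, !int_scal, !Hf by (try apply cper_scal; apply cper_mult; auto; apply cper_trm). ring.
  - intros x. rewrite Rmult_assoc, trm_mult. ring.
Qed.
Lemma allzero_ext f g : (forall x, f x = g x) -> allzero f -> allzero g.
Proof. intros H. replace g with f; auto. now apply functional_extensionality. Qed.
Lemma allzero_int f : allzero f -> integral f = 0.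
Proof.
  intros [Cf H]. rewrite <- (H 1%C z3zero). apply int_ext. intros x. unfold trm, zdot, z3zero. simpl.
  rewrite !Rmult_0_l, !Rplus_0_l, cos_0. ring.
Qed.

Definition e3 (i : nat) : Z3 := match i with 0%nat => (1, 0, 0)%Z | 1%nat => (0, 1, 0)%Z | _ => (0, 0, 1)%Z end.

Lemma zdot_e3 i x : (i < 3)%nat -> zdot (e3 i) x = comp i x.
Proof. intros H. unfold zdot. destruct x as [[a b] c]. destruct i as [|[|[|i]]]; try lia; simpl; ring. Qed.

Definition sc (y x : R3) : R := (1 - cos (comp 0 x - comp 0 y)) + (1 - cos (comp 1 x - comp 1 y)) + (1 - cos (comp 2 x - comp 2 y)).

Lemma cos_comp_trm i y x : (i < 3)%nat -> cos (comp i x - comp i y) = trm (cos (comp i y), - sin (comp i y)) (zdot (e3 i) x).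
Proof. intros Hi. unfold trm. rewrite zdot_e3, cos_minus by auto. simpl. ring. Qed.

Lemma cos_comp_allzero i y f : (i < 3)%nat -> allzero f -> allzero (fun x => f x * cos (comp i x - comp i y)).
Proof.
  intros Hi Hf. apply (allzero_ext (fun x => f x * trm (cos (comp i y), - sin (comp i y)) (zdot (e3 i) x))); [|now apply allzero_trm].
  intros x. now rewrite cos_comp_trm.
Qed.

Lemma allzero_q y eta f M : allzero f -> allzero (fun x => f x * (1 + / 6 * (eta - sc y x)) ^ M).
Proof.
  intros Hf. induction M as [|M IH]; [apply allzero_ext with f; auto; intros; simpl; ring|].
  set (g := fun x => f x * (1 + / 6 * (eta - sc y x)) ^ M) in *.
  apply allzero_ext with (fun x => (1 + / 6 * (eta - 3)) * g x + / 6 * (g x * cos (comp 0 x - comp 0 y)) + / 6 * (g x * cos (comp 1 x - comp 1 y)) + / 6 * (g x * cos (comp 2 x - comp 2 y))).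
  - intros x. unfold g, sc. simpl. ring.
  - repeat apply allzero_plus; apply allzero_scal; auto; apply cos_comp_allzero; auto.
Qed.

Lemma cper_sc y : cper (sc y).
Proof.
  assert (T : forall i, (i < 3)%nat -> cper (fun x => 1 - cos (comp i x - comp i y))).
  { intros i Hi. apply cper_ext with (fun x => 1 + -1 * trm (cos (comp i y), - sin (comp i y)) (zdot (e3 i) x)).
    - intros x. rewrite cos_comp_trm by auto. ring.
    - apply cper_plus; [apply cper_const|apply cper_scal, cper_trm]. }
  apply cper_plus; [apply cper_plus|]; apply T; lia.
Qed.

Lemma sc_bounds y x : 0 <= sc y x <= 6.
Proof.
  unfold sc. pose proof (COS_bound (comp 0 x - comp 0 y)). pose proof (COS_bound (comp 1 x - comp 1 y)). pose proof (COS_bound (comp 2 x - comp 2 y)). lra.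
Qed.

(* Closeness modulo the period lattice is measured by [sc]. *)
Lemma sc_small_close d : 0 < d -> exists eta, 0 < eta <= 1 /\ forall y x, sc y x < eta -> exists n, dist3 y (tv n x) < d.
Proof.
  intros Hd. pose proof PI_RGT_0 as HP.
  set (r := Rmin (d / 4) 1). assert (Hr : 0 < r <= 1 /\ r <= d / 4).
  { unfold r. split; [split; [apply Rmin_pos; lra|apply Rmin_r]|apply Rmin_l]. }
  assert (Hc : cos r < 1).
  { rewrite <- cos_0. apply cos_decreasing_1; try lra. pose proof PI2_3_2. lra. }
  exists (1 - cos r). split; [pose proof (cos_ge_0 r) as Q; split; [lra|]|].
  { assert (0 <= cos r); [|lra]. apply Q; pose proof PI2_3_2; lra. }
  intros y x H.
  assert (K : forall a, 1 - cos a < 1 - cos r -> exists n, Rabs (a + IZR n * (2 * PI)) < r).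
  { intros a Ha. exists (- (up ((a + PI) / (2 * PI)) - 1))%Z.
    destruct (archimed ((a + PI) / (2 * PI))) as [H1 H2]. rewrite opp_IZR, minus_IZR.
    set (u := IZR (up ((a + PI) / (2 * PI)))) in *. set (b := a + - (u - 1) * (2 * PI)).
    assert (Hb : - PI <= b < PI).
    { assert (E : a + PI = (a + PI) / (2 * PI) * (2 * PI)) by (field; lra). set (q := (a + PI) / (2 * PI)) in *. unfold b. nra. }
    assert (Cb : cos b = cos a).
    { unfold b, u. rewrite <- minus_IZR, <- opp_IZR. apply cos_2pi_Z. }
    assert (Ca : cos (Rabs b) = cos a).
    { unfold Rabs. destruct Rcase_abs; [rewrite cos_neg|]; auto. }
    destruct (Rlt_dec (Rabs b) r) as [L|L]; auto. exfalso.
    assert (Bp : Rabs b <= PI) by (apply Rabs_le; lra).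
    assert (cos (Rabs b) <= cos r); [|lra].
    destruct (Req_dec (Rabs b) r) as [->|Hn]; [lra|]. left. apply cos_decreasing_1; lra. }
  unfold sc in H. pose proof (COS_bound (comp 0 x - comp 0 y)). pose proof (COS_bound (comp 1 x - comp 1 y)). pose proof (COS_bound (comp 2 x - comp 2 y)).
  destruct (K (comp 0 x - comp 0 y) ltac:(lra)) as [n0 K0]. destruct (K (comp 1 x - comp 1 y) ltac:(lra)) as [n1 K1]. destruct (K (comp 2 x - comp 2 y) ltac:(lra)) as [n2 K2].
  exists (n0, n1, n2). rewrite dist3_sym. destruct x as [[x0 x1] x2], y as [[y0 y1] y2]. unfold dist3, tv. simpl in *.
  replace (x0 + IZR n0 * (2 * PI) - y0) with (x0 - y0 + IZR n0 * (2 * PI)) by ring.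
  replace (x1 + IZR n1 * (2 * PI) - y1) with (x1 - y1 + IZR n1 * (2 * PI)) by ring.
  replace (x2 + IZR n2 * (2 * PI) - y2) with (x2 - y2 + IZR n2 * (2 * PI)) by ring. lra.
Qed.

Lemma allzero_nonpos f : allzero f -> forall y, f y <= 0.
Proof.
  intros Hf y. destruct (Rle_dec (f y) 0) as [|Hn]; auto. exfalso.
  destruct Hf as [Cf Hz]. assert (Hf : allzero f) by (split; auto). clear Hz.
  set (c := f y / 2). assert (Hc : 0 < c) by (unfold c; lra).
  destruct (proj1 Cf y c Hc) as (d & Hd & Hu).
  destruct (sc_small_close d Hd) as (eta & Heta & Hcl).
  destruct (cper_bounded f Cf) as (B & HB & HBf).
  assert (Near : forall x, sc y x < eta -> c <= f x).
  { intros x Hx. destruct (Hcl y x Hx) as [n Hn']. specialize (Hu _ Hn'). rewrite per_tv in Hu by apply Cf.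
    apply Rabs_lt_between in Hu. unfold c in *. lra. }
  (* A continuous bump on the smaller neighbourhood [sc y x < eta / 2], against which the
     concentrating part can be integrated. *)
  set (chi := fun x => Rmax 0 (eta / 2 - sc y x)).
  assert (Cchi : cper chi).
  { destruct (cper_sc y) as [S1 S2]. split.
    - intros x eps He. destruct (S1 x eps He) as (dd & Hdd & HH). exists dd. split; auto. intros z Hz. specialize (HH z Hz).
      eapply Rle_lt_trans; [|exact HH]. unfold chi, Rmax. repeat destruct Rle_dec; unfold Rabs; repeat destruct Rcase_abs; lra.
    - intros j x Hj. unfold chi. now rewrite S2. }
  assert (Hyy : sc y y = 0).
  { unfold sc. rewrite !Rminus_diag, cos_0. ring. }
  assert (Ichi : 0 < integral chi).
  { apply (int_pos chi y); auto; unfold chi; [intros; apply Rmax_l|]. rewrite Hyy.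
    eapply Rlt_le_trans; [|apply Rmax_r]. lra. }
  (* Where [chi] is positive the kernel is at least [g > 1]; outside the larger neighbourhood it
     lies between 0 and 1. The integral would thus grow like [g^M], although it is zero for every
     [M]. *)
  set (g := 1 + eta / 12).
  assert (Key : forall M, c * g ^ M * integral chi <= vol * B).
  { intros M.
    assert (Z : integral (fun x => f x * (1 + / 6 * (eta - sc y x)) ^ M) = 0) by now apply allzero_int, allzero_q.
    assert (Cq : cper (fun x => f x * (1 + / 6 * (eta - sc y x)) ^ M)) by apply (allzero_q y eta f M Hf).
    assert (L : integral (fun x => c * g ^ M * chi x + - B) <= integral (fun x => f x * (1 + / 6 * (eta - sc y x)) ^ M)).
    { apply int_le; auto; [apply cper_plus; [now apply cper_scal|apply cper_const]|].
      intros x. pose proof (sc_bounds y x) as Hs. set (q := 1 + / 6 * (eta - sc y x)).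
      assert (Hq : 0 <= q) by (unfold q; lra). pose proof (pow_le q M Hq) as HqM.
      destruct (Rlt_dec (sc y x) eta) as [Hin|Hout].
      - apply Rle_trans with (c * q ^ M).
        + assert (Q : g ^ M * chi x <= q ^ M).
          { unfold chi, Rmax. destruct Rle_dec as [Hle|Hle]; [|rewrite Rmult_0_r; auto].
            assert (g ^ M <= q ^ M) by (apply pow_incr; unfold g, q; lra).
            nra. }
          assert (c * (g ^ M * chi x) <= c * q ^ M) by (apply Rmult_le_compat_l; lra). lra.
        + apply Rmult_le_compat_r; auto.
      - replace (chi x) with 0 by (unfold chi; rewrite Rmax_left; lra).
        assert (q ^ M <= 1). { replace 1 with (1 ^ M) by apply pow1. apply pow_incr. unfold q in *; lra. }
        specialize (HBf x). apply Rabs_le_between in HBf. nra. }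
    rewrite Z, int_plus, int_scal, int_const in L by (try apply cper_scal; try apply cper_const; auto). lra. }
  assert (Hg : 1 < g) by (unfold g; lra).
  destruct (Pow_x_infinity g ltac:(rewrite Rabs_pos_eq; lra) (vol * B / (c * integral chi) + 1)) as [M HM].
  specialize (HM M (le_n _)). rewrite Rabs_pos_eq in HM by (apply pow_le; lra).
  assert (P : 0 < c * integral chi) by (apply Rmult_lt_0_compat; auto).
  apply Rge_le in HM. apply Rmult_le_compat_l with (r := c * integral chi) in HM; [|lra].
  replace (c * integral chi * (vol * B / (c * integral chi) + 1)) with (vol * B + c * integral chi) in HM by (field; lra).
  specialize (Key M). lra.
Qed.

Lemma allzero_zero f : allzero f -> forall y, f y = 0.
Proof.
  intros H y. apply Rle_antisym; [now apply allzero_nonpos|].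
  assert (- 1 * f y <= 0); [|lra]. apply (allzero_nonpos (fun x => -1 * f x)). now apply allzero_scal.
Qed.

Lemma int_mul_trm f a k : cper f -> integral (fun x => f x * trm a (zdot k x)) = vol * (Re a * Re (fc f k) + Im a * Im (fc f k)).
Proof.
  intros Cf. pose proof vol_pos as HV. pose proof (cper_mult _ _ Cf (cper_cosk k)). pose proof (cper_mult _ _ Cf (cper_sink k)).
  rewrite (int_ext _ (fun x => Re a * (f x * cosk k x) + - Im a * (f x * sink k x))) by (intros; rewrite trm_as_trig; ring).
  rewrite int_plus, !int_scal by (try apply cper_scal; auto). unfold fc. simpl. field. lra.
Qed.

Theorem fourier_representation f : smooth3 f -> periodic_s f -> forall x, f x = SF (fc f) x.
Proof.
  intros Hs Hp x. pose proof (smooth_cper f Hs Hp) as Cf. pose proof (RD_fc f Hs Hp) as HR. pose proof (cper_SF _ HR) as CS.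
  apply Rminus_diag_uniq. apply (allzero_zero (fun x => f x - SF (fc f) x)). split.
  - apply cper_ext with (fun x => f x + -1 * SF (fc f) x); [intros; ring|]. apply cper_plus; auto. now apply cper_scal.
  - intros a k. rewrite (int_ext _ (fun x => f x * trm a (zdot k x) - SF (fc f) x * trm a (zdot k x))) by (intros; ring).
    rewrite int_minus, !int_mul_trm, fc_SF by (auto using rls_fc; apply cper_mult; auto; apply cper_trm). ring.
Qed.

(** ** Smooth solutions in physical space and the metric *)

Lemma sob_of_RD (c : coef) : n3 c -> (forall i, RD (fun k => c k i)) -> forall m, exists B, sob m c B.
Proof.
  intros Hn H m. destruct (H 0%nat (m + 6)%nat) as [B0 H0]. destruct (H 1%nat (m + 6)%nat) as [B1 H1]. destruct (H 2%nat (m + 6)%nat) as [B2 H2].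
  set (B := B0 + B1 + B2). exists (12 * B).
  assert (Q : forall k, wt k ^ m * vn (c k) <= B * om k).
  { intros k. specialize (H0 k). specialize (H1 k). specialize (H2 k). rewrite pow_add in *.
    pose proof (wt_ge1 k). pose proof (om_wt k). pose proof (om_pos k). assert (0 <= wt k ^ m) by (apply pow_le; lra).
    pose proof (vn_ge0 (c k)).
    apply Rle_trans with (om k * (wt k ^ m * wt k ^ 6 * vn (c k))).
    - replace (om k * (wt k ^ m * wt k ^ 6 * vn (c k))) with ((om k * wt k ^ 6) * (wt k ^ m * vn (c k))) by ring.
      assert (0 <= wt k ^ m * vn (c k)) by (apply Rmult_le_pos; auto). nra.
    - rewrite (Rmult_comm B). apply Rmult_le_compat_l; [lra|]. pose proof (vn_le_sum (c k)).
      assert (0 <= wt k ^ m * wt k ^ 6) by (apply Rmult_le_pos; auto; apply pow_le; lra). unfold B. nra. }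
  assert (HB : 0 <= B).
  { pose proof (Q z3zero). pose proof (om_pos z3zero). assert (0 <= wt z3zero ^ m * vn (c z3zero)); [|nra].
    apply Rmult_le_pos; [apply pow_le; pose proof (wt_ge1 z3zero); lra|apply vn_ge0]. }
  split; [lra|]. intros M. apply Rle_trans with (lsum (box M) (fun k => B ^ 2 * om k)).
  - apply lsum_le. intros k _. pose proof (om_pos k). pose proof (om_le1 k).
    apply Rle_trans with ((B * om k) ^ 2).
    + apply pow_incr. split; [apply Rmult_le_pos; [apply pow_le; pose proof (wt_ge1 k); lra|apply vn_ge0]|auto].
    + rewrite Rpow_mult_distr. apply Rmult_le_compat_l; [apply pow2_ge_0|]. nra.
  - rewrite lsum_scal. pose proof (om_sum_bound M). nra.
Qed.

Definition cf (u : field) : coef := fun k i => if Nat.ltb i 3 then fc (fcomp i u) k else 0%C.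

Lemma periodic_fcomp u i : periodic u -> periodic_s (fcomp i u).
Proof. intros H j x Hj. unfold fcomp. now rewrite H. Qed.

Lemma field_ext (u v : field) : (forall i x, (i < 3)%nat -> fcomp i u x = fcomp i v x) -> u = v.
Proof.
  intros H. apply functional_extensionality. intros x.
  pose proof (H 0%nat x ltac:(lia)) as H0. pose proof (H 1%nat x ltac:(lia)) as H1. pose proof (H 2%nat x ltac:(lia)) as H2.
  unfold fcomp in *. destruct (u x) as [[a b] c], (v x) as [[a' b'] c']. simpl in *. congruence.
Qed.

Theorem inX_repr u : inX u -> adm (cf u) /\ synth (cf u) = u.
Proof.
  intros (Hp & Hs & Hd & Hi).
  assert (P : forall i, periodic_s (fcomp i u)) by (intros; now apply periodic_fcomp).
  assert (HR : forall i, (i < 3)%nat -> RD (fc (fcomp i u))) by (intros; apply RD_fc; auto).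
  assert (Hc : forall i, (i < 3)%nat -> cper (fcomp i u)) by (intros; apply smooth_cper; auto).
  assert (E : forall i, (i < 3)%nat -> (fun k => cf u k i) = fc (fcomp i u)).
  { intros i H. apply functional_extensionality. intros k. unfold cf. now rewrite (proj2 (Nat.ltb_lt i 3)). }
  assert (S : synth (cf u) = u).
  { apply field_ext. intros i x H. rewrite fcomp_synth, E by auto. symmetry. apply fourier_representation; auto. }
  split; auto.
  assert (Hn : n3 (cf u)).
  { intros k i H. unfold cf. now rewrite (proj2 (Nat.ltb_ge i 3)). }
  assert (Rl : rl (cf u)).
  { intros k i. unfold cf. destruct (Nat.ltb i 3) eqn:L; [|now rewrite Cconj_RtoC].
    apply Nat.ltb_lt in L. now apply rls_fc, Hc. }
  assert (RDc : forall i, RD (fun k => cf u k i)).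
  { intros i. destruct (le_lt_dec 3 i) as [H|H].
    - apply RD_ext with (fun _ => 0%C); [intros; symmetry; now apply Hn|]. intros p. exists 0. intros k. rewrite Cmod_0. lra.
    - rewrite E; auto. }
  repeat split; auto.
  - intros k.
    (* The divergence is the series with the Hermitian, rapidly decaying coefficients [i k . c_k];
       as it vanishes identically, so do they. *)
    set (a := fun k => (Ci * cdot (cf u k) k)%C).
    assert (Ea : forall k, a k = (dk 0 (fun k => cf u k 0%nat) k + dk 1 (fun k => cf u k 1%nat) k + dk 2 (fun k => cf u k 2%nat) k)%C).
    { intros q. unfold a, dk, cdot, s3. ring. }
    assert (RDa : RD a).
    { eapply RD_ext; [intros; symmetry; apply Ea|]. apply RD_plus; [apply RD_plus|]; now apply RD_dk. }
    assert (Ra : rls a).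
    { intros q. unfold a. rewrite cdot_opp, (cdot_rl (cf u)), Cmult_conj by auto.
      replace (Cconj Ci) with (- Ci)%C; [ring|]. apply ceq; simpl; ring. }
    assert (Z : SF a = fun _ => 0).
    { apply functional_extensionality. intros x. rewrite (SF_ext _ _ x Ea).
      rewrite (SF_plus (fun k => dk 0 (fun k0 => cf u k0 0%nat) k + dk 1 (fun k0 => cf u k0 1%nat) k)%C (dk 2 (fun k => cf u k 2%nat))) by (try apply RD_plus; now apply RD_dk).
      rewrite (SF_plus (dk 0 (fun k0 => cf u k0 0%nat)) (dk 1 (fun k => cf u k 1%nat))) by (now apply RD_dk).
      rewrite <- !partial_SF, <- !fcomp_synth by (auto; lia). rewrite S. apply Hd. }
    assert (a k = 0%C) as Ez.
    { rewrite <- (fc_SF a k RDa Ra), Z. unfold fc.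
      rewrite (int_ext _ (fun _ => 0)) by (intros; ring). rewrite (int_ext (fun x => 0 * sink k x) (fun _ => 0)) by (intros; ring).
      rewrite int_const. unfold Rdiv. apply ceq; simpl; ring. }
    unfold a in Ez. apply (f_equal (fun z => (- Ci * z)%C)) in Ez.
    replace (- Ci * (Ci * cdot (cf u k) k))%C with (- (Ci * Ci) * cdot (cf u k) k)%C in Ez by ring.
    replace (Ci * Ci)%C with (- RtoC 1)%C in Ez by (apply ceq; simpl; ring).
    replace (- - RtoC 1 * cdot (cf u k) k)%C with (cdot (cf u k) k) in Ez by ring. rewrite Ez. ring.
  - intros i. destruct (le_lt_dec 3 i) as [H|H]; [now apply Hn|].
    unfold cf. rewrite (proj2 (Nat.ltb_lt i 3)) by auto. unfold fc.
    assert (Z0 : forall x, zdot z3zero x = 0) by (intros x; unfold zdot, z3zero; simpl; ring).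
    rewrite (int_ext (fun x => fcomp i u x * cosk z3zero x) (fcomp i u)) by (intros x; unfold cosk; rewrite Z0, cos_0; ring).
    rewrite (int_ext (fun x => fcomp i u x * sink z3zero x) (fun _ => 0)) by (intros x; unfold sink; rewrite Z0, sin_0; ring).
    rewrite Hi, int_const by auto. unfold Rdiv. apply ceq; simpl; ring.
  - intros m. now apply sob_of_RD.
Qed.

Theorem inX_synth c : adm c -> inX (synth c).
Proof.
  intros Hc. assert (HR : forall i, RD (fun k => c k i)) by (intros; now apply adm_RD).
  destruct Hc as ((Hr & Hd & Hn) & Hz & Hs). split; [|split; [|split]].
  - intros j x Hj. unfold synth. now rewrite !SF_periodic.
  - intros i Hi. rewrite fcomp_synth by auto. now apply SF_smooth.
  - intros x. rewrite !fcomp_synth, !partial_SF by (auto; lia).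
    rewrite <- SF_plus, <- SF_plus by (try apply RD_plus; now apply RD_dk).
    rewrite <- (SF_zero x). apply SF_ext. intros k. unfold dk.
    transitivity (Ci * cdot (c k) k)%C; [unfold cdot, s3; ring|]. rewrite Hd. ring.
  - intros i Hi. rewrite fcomp_synth by auto.
    rewrite (int_ext _ (fun x => SF (fun k => c k i) x * trm 1 (zdot z3zero x))).
    + rewrite SF_int_trig by auto. replace (z3opp z3zero) with z3zero by reflexivity. rewrite Hz. simpl. ring.
    + intros x. unfold trm. replace (zdot z3zero x) with 0 by (unfold zdot, z3zero; simpl; ring). rewrite cos_0. simpl. ring.
Qed.

Lemma synth_csb c d : adm c -> adm d -> fsub (synth c) (synth d) = synth (csb c d).
Proof.
  intros Hc Hd. apply functional_extensionality. intros x.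
  assert (E : forall i, SF (fun k => c k i) x + -1 * SF (fun k => d k i) x = SF (fun k => csb c d k i) x).
  { intros i. rewrite <- SF_scal by now apply adm_RD. rewrite <- SF_plus; [|now apply adm_RD|now apply RD_scal, adm_RD].
    apply SF_ext. intros k. unfold csb. change (RtoC (-1)) with (RtoC (Ropp 1)). rewrite RtoC_opp. ring. }
  unfold fsub, fadd, fscal, synth, v3add, v3scal. now rewrite !E.
Qed.
Lemma synth_cadd c d : adm c -> adm d -> fadd (synth c) (synth d) = synth (cadd c d).
Proof.
  intros Hc Hd. apply functional_extensionality. intros x.
  unfold fadd, synth, v3add. unfold cadd. rewrite !SF_plus by now apply adm_RD. reflexivity.
Qed.
Lemma synth_cscl r c : adm c -> fscal r (synth c) = synth (cscl r c).
Proof.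
  intros Hc. apply functional_extensionality. intros x.
  unfold fscal, synth, v3scal. unfold cscl. rewrite !SF_scal by now apply adm_RD. reflexivity.
Qed.

Lemma adm_cadd c d : adm c -> adm d -> adm (cadd c d).
Proof.
  intros ((R1 & D1 & N1) & Z1 & S1) ((R2 & D2 & N2) & Z2 & S2). repeat split.
  - intros k i. unfold cadd. now rewrite R1, R2, Cplus_conj.
  - intros k. unfold cadd. rewrite cdot_cadd, D1, D2. ring.
  - intros k i Hi. unfold cadd. rewrite N1, N2 by auto. ring.
  - intros i. unfold cadd. rewrite Z1, Z2. ring.
  - intros m. destruct (S1 m) as [A HA], (S2 m) as [B HB]. exists (A + B). now apply sob_add.
Qed.
Lemma adm_cscl r c : adm c -> adm (cscl r c).
Proof.
  intros ((R1 & D1 & N1) & Z1 & S1). repeat split.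
  - intros k i. unfold cscl. now rewrite R1, Cmult_conj, Cconj_RtoC.
  - intros k. unfold cscl. rewrite cdot_cscl, D1. ring.
  - intros k i Hi. unfold cscl. rewrite N1 by auto. ring.
  - intros i. unfold cscl. rewrite Z1. ring.
  - intros m. destruct (S1 m) as [A HA]. eexists. apply sob_scl. eauto.
Qed.
Lemma adm_csb c d : adm c -> adm d -> adm (csb c d).
Proof. intros. rewrite csb_scl. apply adm_cadd; auto. now apply adm_cscl. Qed.
Lemma adm_zero : adm czero.
Proof.
  repeat split.
  - intros k i. unfold czero. now rewrite Cconj_RtoC.
  - intros k. unfold czero, cdot, s3. ring.
  - intros m. exists 0. apply sob_zero.
Qed.

(** * Sobolev norms and the metric *)

Lemma fold_right_lsum {A} (l : list A) f : fold_right Rplus 0 (map f l) = lsum l f.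
Proof. induction l; simpl; auto. now rewrite IHl. Qed.

Lemma in_words n w : In w (words n) -> length w = n /\ forall j, In j w -> (j < 3)%nat.
Proof.
  revert w. induction n as [|n IH]; intros w; simpl.
  - intros [<-|[]]. split; auto. intros j [].
  - intros H. apply in_flat_map in H. destruct H as (v & Hv & Hw). specialize (IH v Hv).
    destruct Hw as [<-|[<-|[<-|[]]]]; (split; [simpl; lia|intros j [<-|Hj]; [lia|now apply IH]]).
Qed.
Lemma in_allwords m w : In w (allwords m) -> (length w <= m)%nat /\ forall j, In j w -> (j < 3)%nat.
Proof.
  intros H. apply in_flat_map in H. destruct H as (n & Hn & Hw). apply in_seq in Hn. apply in_words in Hw. split; [lia|tauto].
Qed.

(** The [L2] norms are bounded crudely by sup norms, at the price of the six derivatives that make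
    Fourier series converge absolutely. A fixed loss is harmless for the topology of smooth
    fields. *)
Lemma Hnorm_bound m c B : adm c -> sob (m + 6) c B ->
  Hnorm m (synth c) <= sqrt (INR (length (allwords m)) * 3 * vol) * (250 * B).
Proof.
  intros Hc HB. pose proof vol_pos as HV. assert (B0 : 0 <= B) by (eapply sob_pos; eauto).
  rewrite <- (sqrt_pow2 (250 * B)) by lra. rewrite <- sqrt_mult_alt.
  2:{ apply Rmult_le_pos; [|lra]. apply Rmult_le_pos; [apply pos_INR|lra]. }
  apply sqrt_le_1_alt. unfold Hm_sq. rewrite fold_right_lsum.
  apply Rle_trans with (lsum (allwords m) (fun _ => 3 * vol * (250 * B) ^ 2)); [|rewrite lsum_const; right; ring].
  apply lsum_le. intros w Hw. apply in_allwords in Hw. destruct Hw as [Lw Jw]. rewrite fold_right_lsum.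
  assert (Q : forall i, (i < 3)%nat -> integral (fun x => dl w (fcomp i (synth c)) x ^ 2) <= vol * (250 * B) ^ 2).
  { intros i Hi. rewrite fcomp_synth, dl_SF by (auto; now apply adm_RD).
    assert (RDa : RD (dks w (fun k => c k i))) by now apply RD_dks, adm_RD.
    rtrans Rle_abs. apply int_abs.
    - apply cper_ext with (fun x => SF (dks w (fun k => c k i)) x * SF (dks w (fun k => c k i)) x); [intros; ring|].
      apply cper_mult; now apply cper_SF.
    - intros x. rewrite <- RPow_abs. apply pow_incr. split; [apply Rabs_pos|]. apply SF_bound. intros k.
      rtrans dks_bound. apply (sob_mono (6 + length w)) in HB; [|lia]. now apply sob_comp. }
  simpl. pose proof (Q 0%nat ltac:(lia)). pose proof (Q 1%nat ltac:(lia)). pose proof (Q 2%nat ltac:(lia)). simpl in *. lra.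
Qed.

Definition dterm (u v : field) (m : nat) : R := (/ 2) ^ m * Rmin 1 (Hnorm m (fsub u v)).

Lemma dterm_bound u v m : 0 <= dterm u v m <= (/ 2) ^ m.
Proof.
  unfold dterm. assert (0 < (/ 2) ^ m) by (apply pow_lt; lra).
  assert (0 <= Rmin 1 (Hnorm m (fsub u v)) <= 1).
  { split; [apply Rmin_glb; [lra|apply sqrt_pos]|apply Rmin_l]. }
  split; [apply Rmult_le_pos; lra|]. nra.
Qed.

(** [dinf] is a chosen value; bounded monotone partial sums show that the choice is made among
    actual sums of the series. *)
Lemma dinf_sum u v : Un_cv (sum_f_R0 (dterm u v)) (dinf u v).
Proof.
  unfold dinf. fold (dterm u v). apply (epsilon_spec (inhabits 0) (fun s => infinite_sum (dterm u v) s)).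
  assert (Hg : Un_growing (sum_f_R0 (dterm u v))).
  { intros n. simpl. pose proof (dterm_bound u v (S n)). lra. }
  assert (Hb : has_ub (sum_f_R0 (dterm u v))).
  { exists 2. intros x [n ->].
    assert (H : sum_f_R0 (dterm u v) n <= 2 - (/ 2) ^ n).
    { induction n as [|n IH].
      - simpl. pose proof (dterm_bound u v 0). simpl in H. lra.
      - rewrite tech5. pose proof (dterm_bound u v (S n)). simpl pow in *. lra. }
    assert (0 < (/ 2) ^ n) by (apply pow_lt; lra). lra. }
  destruct (growing_cv _ Hg Hb) as [l Hl]. exists l. exact Hl.
Qed.

Lemma dinf_lower u v : Rmin 1 (Hnorm 0 (fsub u v)) <= dinf u v.
Proof.
  assert (Hg : Un_growing (sum_f_R0 (dterm u v))).
  { intros n. simpl. pose proof (dterm_bound u v (S n)). lra. }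
  pose proof (growing_ineq _ _ Hg (dinf_sum u v) 0) as H. simpl in H. unfold dterm in H. simpl in H. lra.
Qed.

(** The terms beyond [M] contribute at most [2^(-M) < eps / 4], and those up to [M] are controlled
    by one Sobolev norm of order [M + 6]. *)
Lemma dinf_small eps : 0 < eps -> exists m eta, 0 < eta /\
  forall c d, adm c -> adm d -> sob m (csb c d) eta -> dinf (synth c) (synth d) < eps.
Proof.
  intros He. destruct (half_pow_small 1 (eps / 4)) as [M HM]; [lra|]. rewrite Rmult_1_l, <- pow_inv in HM.
  set (K := fun m => sqrt (INR (length (allwords m)) * 3 * vol) * 250).
  set (KK := sum_f_R0 K M).
  assert (K0 : forall m, 0 <= K m) by (intros; apply Rmult_le_pos; [apply sqrt_pos|lra]).
  assert (HK : forall m, (m <= M)%nat -> K m <= KK).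
  { intros m Hm. unfold KK. rewrite sum_f_R0_lsum. apply (lsum_term_le (seq 0 (S M)) K); [apply in_seq; lia|auto]. }
  assert (KK0 : 0 <= KK) by (eapply Rle_trans; [apply (K0 0%nat)|apply HK; lia]).
  exists (M + 6)%nat, (eps / (8 * (KK + 1))). split; [apply Rdiv_lt_0_compat; lra|].
  intros c d Hc Hd HS. set (u := synth c). set (v := synth d). set (del := eps / 8).
  assert (Hs : forall m, (m <= M)%nat -> dterm u v m <= (/ 2) ^ m * del).
  { intros m Hm. unfold dterm. apply Rmult_le_compat_l; [left; apply pow_lt; lra|].
    rtrans Rmin_r. unfold u, v. rewrite synth_csb by auto.
    eapply Rle_trans; [apply Hnorm_bound|]; [now apply adm_csb| |].
    - eapply sob_mono; [|apply HS]. lia.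
    - replace (sqrt (INR (length (allwords m)) * 3 * vol) * (250 * (eps / (8 * (KK + 1))))) with (K m * (eps / (8 * (KK + 1)))) by (unfold K; ring).
      specialize (HK m Hm). apply Rmult_le_reg_r with (8 * (KK + 1)); [lra|].
      replace (K m * (eps / (8 * (KK + 1))) * (8 * (KK + 1))) with (K m * eps) by (field; lra). unfold del. nra. }
  assert (P : forall n, sum_f_R0 (dterm u v) n <= del * (2 - (/ 2) ^ n) + (if le_lt_dec n M then 0 else (/ 2) ^ M - (/ 2) ^ n)).
  { assert (Hdel : 0 < del) by (unfold del; lra).
    induction n as [|n IH].
    - pose proof (Hs 0%nat ltac:(lia)). destruct (le_lt_dec 0 M); [|lia]. simpl in *. lra.
    - rewrite tech5. destruct (le_lt_dec n M) as [L|L], (le_lt_dec (S n) M) as [L'|L']; try lia.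
      + specialize (Hs (S n) L'). simpl pow in *. lra.
      + assert (n = M) by lia. subst n. pose proof (dterm_bound u v (S M)). simpl pow in *. nra.
      + pose proof (dterm_bound u v (S n)). simpl pow in *. nra. }
  apply Rle_lt_trans with (eps / 2); [|lra].
  apply (Un_cv_le _ _ _ (dinf_sum u v)). exists 0%nat. intros n _. rtrans P.
  assert (0 < (/ 2) ^ n) by (apply pow_lt; lra).
  unfold del. destruct (le_lt_dec n M); nra.
Qed.

(** A solution as a curve of coefficients. The bounds of all orders supply the domination for
    differentiating the Fourier series in time, the Lipschitz bounds the continuity in [dinf]. *)
Record csol (T : R) (f : coef) (e : R -> coef) : Prop := {
  cs_adm : forall s, 0 <= s <= T -> adm (e s);
  cs_bd : forall m, exists B, forall s, 0 <= s <= T -> sob m (e s) B;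
  cs_lip : forall m, exists B, 0 <= B /\ forall s s', 0 <= s <= T -> 0 <= s' <= T -> sob m (csb (e s) (e s')) (B * Rabs (s - s'));
  cs_der : forall s, 0 < s < T -> cder e s (cadd (Binf (e s)) f) }.

Theorem csol_euler T f e : adm f -> csol T f e -> euler_sol T (synth f) (fun s => synth (e s)).
Proof.
  intros Hf He. split; [|split].
  - intros s Hs. apply inX_synth. now apply (cs_adm _ _ _ He).
  - intros s eps Hs Heps. destruct (dinf_small eps Heps) as (m & eta & Heta & H).
    destruct (cs_lip _ _ _ He m) as (B & HB & HL). exists (eta / (B + 1)). split; [apply Rdiv_lt_0_compat; lra|].
    intros s' Hs' Hd. apply H; try now apply (cs_adm _ _ _ He).
    eapply sob_le; [apply HL; auto|]. pose proof (Rabs_pos (s' - s)).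
    apply Rle_trans with ((B + 1) * Rabs (s' - s)); [nra|].
    apply Rmult_lt_compat_l with (r := B + 1) in Hd; [|lra]. replace ((B + 1) * (eta / (B + 1))) with eta in Hd by (field; lra). lra.
  - exists (fun s => SF (phat (e s))). split.
    + intros s Hs. assert (adm (e s)) by (apply (cs_adm _ _ _ He); lra). split; [apply SF_smooth; now apply RD_phat|apply SF_periodic].
    + intros s x i Hs Hi. assert (As : adm (e s)) by (apply (cs_adm _ _ _ He); lra).
      assert (Ei : forall c, comp i (synth c x) = SF (fun k => c k i) x).
      { intros c. rewrite <- (fcomp_synth c i Hi). reflexivity. }
      eapply deriv_ext; [intros r; symmetry; apply Ei|].
      set (d := fun r => cadd (Binf (e r)) f).
      assert (EB : forall k, d s k i = (Dinf (e s) (e s) k i + RtoC (-1) * dk i (phat (e s)) k + f k i)%C).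
      { intros k. unfold d, cadd, Binf, pj. rewrite dk_phat. change (RtoC (-1)) with (RtoC (Ropp 1)). rewrite RtoC_opp. ring. }
      eapply deriv_val with (l := SF (fun k => d s k i) x).
      * rewrite (SF_ext _ _ x EB).
        rewrite (SF_plus (fun k => Dinf (e s) (e s) k i + RtoC (-1) * dk i (phat (e s)) k)%C (fun k => f k i)).
        2:{ apply RD_plus; [now apply RD_Dinf|apply RD_scal, RD_dk, RD_phat; auto]. }
        2:{ now apply adm_RD. }
        rewrite SF_plus; [|now apply RD_Dinf|apply RD_scal, RD_dk, RD_phat; auto].
        rewrite SF_scal by (apply RD_dk, RD_phat; auto).
        rewrite SF_transport by auto. rewrite partial_SF by (auto; now apply RD_phat). rewrite Ei. ring.
      (* Order 15 is [6 + 9]: [Binf_decay] then gives the six powers of decay that make the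
         differentiated series dominated. *)
      * destruct (cs_bd _ _ _ He 15) as [A HA]. pose proof (adm_RD f i Hf 6%nat) as [Bf HBf].
        assert (A0 : 0 <= A) by (apply (sob_pos 15 (e s)), HA; lra).
        assert (Bf0 : 0 <= Bf). { eapply Rle_trans; [|apply (HBf z3zero)]. apply Rmult_le_pos; [apply pow_le; pose proof (wt_ge1 z3zero); lra|apply Cmod_ge_0]. }
        set (B := A + (4 * (250 * (A * A)) + Bf)).
        assert (P : 0 <= 4 * (250 * (A * A))) by nra.
        assert (HR : forall r, Rabs (r - s) < Rmin s (T - s) -> 0 < r < T).
        { intros r Hr. pose proof (Rmin_l s (T - s)). pose proof (Rmin_r s (T - s)). apply Rabs_lt_between in Hr. lra. }
        unfold SF. apply (zsum_derive (2 * B) (fun k r => trm (e r k i) (zdot k x)) (fun k r => trm (d r k i) (zdot k x)) s (Rmin s (T - s))).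
        -- apply Rmin_pos; lra.
        -- intros k r Hr. destruct (cs_der _ _ _ He r (HR r Hr) k i) as [D1 D2]. fold (d r) in D1, D2. unfold trm.
           eapply deriv_val; [|apply derivable_pt_lim_minus; apply derivable_pt_lim_mult; [exact D1|apply derivable_pt_lim_const|exact D2|apply derivable_pt_lim_const]]. cbv beta. ring.
        -- intros r Hr. apply trm_dom. apply domC_of_decay. intros k.
           assert (H : sob 15 (e r) A) by (apply HA; specialize (HR r Hr); lra). apply (sob_mono 6) in H; [|lia].
           eapply Rle_trans; [apply (sob_comp 6 (e r) A); auto|unfold B; lra].
        -- intros r Hr. apply trm_dom. apply domC_of_decay. intros k.
           assert (H : sob 15 (e r) A) by (apply HA; specialize (HR r Hr); lra).
           assert (Ar : adm (e r)) by (apply (cs_adm _ _ _ He); specialize (HR r Hr); lra).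
           unfold d, cadd. eapply Rle_trans; [apply Rmult_le_compat_l; [apply pow_le; pose proof (wt_ge1 k); lra|apply Cmod_triangle]|].
           pose proof (Binf_decay 6 (e r) A k i (proj2 (proj2 (proj1 Ar))) H). specialize (HBf k). unfold B. lra.
Qed.

(** ** Controlled motion of families of states *)

(** Every interaction carries the factor [u_j . k], zero at [k = 0]; this conserves the mean. *)
Lemma Binf_zero_mode u i : Binf u z3zero i = 0%C.
Proof.
  assert (K : forall j, kc j z3zero = 0) by (intros [|[|[|j]]]; reflexivity).
  assert (D : forall a, Dinf u u z3zero a = 0%C).
  { intros a. unfold Dinf. rewrite (zsumC_finite 0).
    - rewrite csum_zero; [ring|]. intros j _. unfold cdot, s3. rewrite !K. ring.
    - intros j _. unfold cdot, s3. rewrite !K. ring. }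
  unfold Binf, pj, cdot, s3. rewrite !D. ring.
Qed.

Lemma clim_unique u v w : clim u v -> clim u w -> v = w.
Proof.
  intros H H'. apply coef_ext; intros k i. destruct (H k i), (H' k i). apply ceq; eapply Un_cv_unique; eauto.
Qed.

Lemma esol_init mu F c0 cN c : esol mu F c0 cN c -> c 0 = c0.
Proof.
  intros H. eapply clim_unique; [apply (es_lim _ _ _ _ _ H); rewrite Rabs_R0; lra|].
  apply clim_ev with (fun N => trunc N c0); [|apply clim_trunc].
  exists 0%nat. intros N _. symmetry. apply (es_gal _ _ _ _ _ H N).
Qed.

Lemma esol_adm mu F c0 cN c s : 0 <= mu <= 1 -> adm F -> adm c0 -> esol mu F c0 cN c -> 0 <= s <= 1 -> adm (c s).
Proof.
  intros Hmu HF H0 H Hs. assert (Hs2 : Rabs s <= 2) by (apply Rabs_le; lra).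
  split; [eapply esol_ok; eauto|split].
  - intros i. rewrite <- (esol_init _ _ _ _ _ H) in H0. destruct H0 as (_ & Hz & _). rewrite <- (Hz i).
    assert (D : forall r, 0 <= r <= s -> derivable_pt_lim (fun r => Re (c r z3zero i)) r 0 /\ derivable_pt_lim (fun r => Im (c r z3zero i)) r 0).
    { intros r Hr. destruct (esol_derive _ _ _ _ _ Hmu H r ltac:(apply Rabs_lt_between; lra) z3zero i) as [D1 D2].
      unfold cadd, cscl in D1, D2. rewrite Binf_zero_mode in D1, D2. destruct HF as (_ & HF & _). rewrite HF in D1, D2.
      split; (eapply deriv_val; [|eassumption]); simpl; ring. }
    apply ceq; apply Rle_antisym.
    + assert (- Re (c 0 z3zero i) <= - Re (c s z3zero i)); [|lra].
      apply (deriv_mono (fun r => - Re (c r z3zero i)) (fun _ => - 0)); [lra| |intros; lra].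
      intros r Hr. apply (derivable_pt_lim_opp (fun r => Re (c r z3zero i))). now apply D.
    + apply (deriv_mono (fun r => Re (c r z3zero i)) (fun _ => 0)); [lra| |intros; lra]. intros r Hr. now apply D.
    + assert (- Im (c 0 z3zero i) <= - Im (c s z3zero i)); [|lra].
      apply (deriv_mono (fun r => - Im (c r z3zero i)) (fun _ => - 0)); [lra| |intros; lra].
      intros r Hr. apply (derivable_pt_lim_opp (fun r => Im (c r z3zero i))). now apply D.
    + apply (deriv_mono (fun r => Im (c r z3zero i)) (fun _ => 0)); [lra| |intros; lra]. intros r Hr. now apply D.
  - intros m. destruct (esol_bd _ _ _ _ _ H m) as [B HB]. exists B. auto.
Qed.

Lemma csb_swap u v : csb u v = cscl (-1) (csb v u).
Proof. coef_ring. Qed.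

Lemma esol_lip mu F c0 cN c : 0 <= mu <= 1 -> adm F -> esol mu F c0 cN c -> forall m, exists B, 0 <= B /\
  forall s s', 0 <= s <= 1 -> 0 <= s' <= 1 -> sob m (csb (c s) (c s')) (B * Rabs (s - s')).
Proof.
  intros Hmu HF H m. destruct (es_bd _ _ _ _ _ H (S (m + 4))) as [A HA]. destruct HF as (_ & _ & HF). destruct (HF (m + 4)%nat) as [Bf HBf].
  assert (A0 : 0 <= A) by (apply (sob_pos (S (m + 4)) (cN 0%nat 0)), HA; rewrite Rabs_R0; lra).
  pose proof (sob_pos _ _ _ HBf) as B0. pose proof (KII_pos (m + 4)) as KP.
  set (B := mu * (KII (m + 4) * A * A) + Bf).
  assert (HB : 0 <= B).
  { unfold B. apply Rplus_le_le_0_compat; auto. apply Rmult_le_pos; [lra|]. apply Rmult_le_pos; [apply Rmult_le_pos|]; auto. }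
  exists (3 * B). split; [lra|].
  assert (Q : forall s s', 0 <= s' <= s -> s <= 1 -> sob m (csb (c s) (c s')) (3 * B * (s - s'))).
  { intros s s' Hs Hs1. apply (sob_lim m (fun N => csb (cN N s) (cN N s'))).
    - exists 0%nat. intros N _. destruct (es_gal _ _ _ _ _ H N) as [[G1 G2] _].
      apply (sob_mono m (m + 4)); [lia|].
      apply (mean_value (m + 4) N (cN N) (fun r => cadd (cscl mu (trunc N (Bn N (cN N r) (cN N r)))) (trunc N F))); try lra.
      + intros r. apply G1.
      + intros r Hr. apply G2, Rabs_le. lra.
      + intros r Hr. assert (Hr2 : Rabs r <= 2) by (apply Rabs_le; lra). apply sob_add; [|now apply sob_trunc].
        replace mu with (Rabs mu) at 2 by (rewrite Rabs_pos_eq; lra). apply sob_scl. apply sob_Bn; [lia|apply G1| |apply HA; auto].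
        eapply sob_mono; [|apply HA; auto]. lia.
    - apply clim_csb; apply (es_lim _ _ _ _ _ H); apply Rabs_le; lra. }
  intros s s' Hs Hs'. destruct (Rle_dec s' s) as [L|L].
  - rewrite Rabs_pos_eq by lra. apply Q; lra.
  - rewrite Rabs_left by lra. rewrite csb_swap.
    replace (3 * B * - (s - s')) with (Rabs (-1) * (3 * B * (s' - s))) by (rewrite Rabs_left by lra; ring).
    apply sob_scl. apply Q; lra.
Qed.

Lemma Dinf_scal a u k i : adm u -> Dinf (cscl a u) (cscl a u) k i = (RtoC (a * a) * Dinf u u k i)%C.
Proof.
  intros ((_ & _ & Hn) & _ & Hs). destruct (Hs 6%nat) as [A HA]. unfold Dinf.
  rewrite (zsumC_ext _ (fun j => RtoC (a * a) * (cdot (u j) k * u (z3sub k j) i))%C).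
  - rewrite (zsumC_scal (A * wt k * A)); [ring|]. apply Dinf_dom; auto. eapply sob_mono; [|eauto]. lia.
  - intros j. unfold cscl. rewrite cdot_cscl, RtoC_mult. ring.
Qed.

(** [a] scales the state and [b] the time, subject to [b mu = a]. Strong controls use [a = 1], the
    drift inside a bracket uses [a = / mu]. *)
Theorem esol_csol mu F c0 cN c a b : 0 < mu <= 1 -> 0 < a -> 0 < b -> b * mu = a -> adm F -> adm c0 -> esol mu F c0 cN c ->
  csol (/ b) (cscl (a * b) F) (fun s => cscl a (c (b * s))).
Proof.
  intros Hmu Ha Hb E HF H0 H.
  assert (R01 : forall s, 0 <= s <= / b -> 0 <= b * s <= 1).
  { intros s Hs. split; [apply Rmult_le_pos; lra|]. rewrite <- (Rinv_r b) by lra. apply Rmult_le_compat_l; lra. }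
  assert (AD : forall s, 0 <= s <= / b -> adm (c (b * s))).
  { intros s Hs. apply (esol_adm mu F c0 cN c); auto. lra. }
  split.
  - intros s Hs. now apply adm_cscl, AD.
  - intros m. destruct (esol_bd _ _ _ _ _ H m) as [B HB]. exists (Rabs a * B). intros s Hs. apply sob_scl, HB.
    specialize (R01 s Hs). apply Rabs_le; lra.
  - intros m. destruct (esol_lip mu F c0 cN c ltac:(lra) HF H m) as (B & HB & HL). exists (a * (B * b)). split.
    { apply Rmult_le_pos; [lra|apply Rmult_le_pos; lra]. }
    intros s s' Hs Hs'. replace (csb (cscl a (c (b * s))) (cscl a (c (b * s')))) with (cscl a (csb (c (b * s)) (c (b * s')))).
    + replace (a * (B * b) * Rabs (s - s')) with (Rabs a * (B * Rabs (b * s - b * s'))).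
      * apply sob_scl, HL; auto.
      * rewrite <- Rmult_minus_distr_l, Rabs_mult, (Rabs_pos_eq a), (Rabs_pos_eq b) by lra. ring.
    + coef_ring.
  - intros s Hs k i. assert (Hs' : 0 <= s <= / b) by lra. pose proof (R01 s Hs') as R1.
    destruct (esol_derive mu F c0 cN c ltac:(lra) H (b * s) ltac:(apply Rabs_lt_between; lra) k i) as [D1 D2].
    assert (EB : cadd (Binf (cscl a (c (b * s)))) (cscl (a * b) F) k i = (RtoC (a * b) * cadd (cscl mu (Binf (c (b * s)%R))) F k i)%C).
    { unfold cadd, cscl at 2 3. unfold Binf. rewrite (pj_ext k _ (fun i => RtoC (a * a) * Dinf (c (b * s)%R) (c (b * s)%R) k i)%C) by (intros; now apply Dinf_scal, AD).
      rewrite pj_scal. rewrite Cmult_plus_distr_l. f_equal. rewrite Cmult_assoc, <- RtoC_mult. do 2 f_equal. rewrite <- E. ring. }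
    rewrite EB. assert (DB : derivable_pt_lim (fun r => b * r) s b).
    { eapply deriv_val; [|apply derivable_pt_lim_scal, derivable_pt_lim_id]. ring. }
    split.
    + rewrite Re_scal. apply deriv_ext with (fun r => a * Re (c (b * r) k i)); [intros; unfold cscl; now rewrite Re_scal|].
      eapply deriv_val; [|apply derivable_pt_lim_scal; apply (derivable_pt_lim_comp (fun r => b * r) (fun r => Re (c r k i))); eauto]. ring.
    + rewrite Im_scal. apply deriv_ext with (fun r => a * Im (c (b * r) k i)); [intros; unfold cscl; now rewrite Im_scal|].
      eapply deriv_val; [|apply derivable_pt_lim_scal; apply (derivable_pt_lim_comp (fun r => b * r) (fun r => Im (c r k i))); eauto]. ring.
Qed.

Section Control.
Variables (Zs : Z3 -> Prop) (gc : coef).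
Hypothesis g_adm : adm gc.

(** Composition of the flows of constant controls, with the total time as last argument; the empty
    composition is allowed so that moves concatenate. *)
Inductive reach : coef -> coef -> R -> Prop :=
| reach_refl u : reach u u 0
| reach_step u w w' tau t' hc e : reach u w tau -> in_X0 Zs (synth hc) -> adm hc -> 0 < t' ->
    csol t' (cadd gc hc) e -> e 0 = w -> e t' = w' -> reach u w' (tau + t').

Lemma reach_trans u v w s t : reach u v s -> reach v w t -> reach u w (s + t).
Proof.
  intros Hr Hs. revert u s Hr. induction Hs as [v|v x w' tau t' hc e H IH]; intros u s Hr.
  - now rewrite Rplus_0_r.
  - rewrite <- Rplus_assoc. eapply reach_step; eauto.
Qed.
Lemma reach_eq u w s t : s = t -> reach u w s -> reach u w t.
Proof. now intros ->. Qed.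
Lemma reach_one hc e t' u w : in_X0 Zs (synth hc) -> adm hc -> 0 < t' -> csol t' (cadd gc hc) e -> e 0 = u -> e t' = w -> reach u w t'.
Proof. intros. apply (reach_eq _ _ (0 + t')); [ring|]. eapply reach_step; eauto. subst u. apply reach_refl. Qed.

Context {P : Type} (dst : P -> P -> R) (dst_pos : forall p q, 0 <= dst p q).
Notation fam := (@fam P dst).
Notation cfam := (@cfam P dst).

Lemma small_mu A B del : 0 <= A -> 0 <= B -> 0 < del -> exists m1, 0 < m1 <= 1 /\ forall mu, 0 < mu <= m1 -> mu <= A + 1 /\ mu <= del /\ mu * B <= del.
Proof.
  intros HA HB Hd. exists (Rmin 1 (Rmin del (del / (B + 1)))).
  assert (0 < del / (B + 1)) by (apply Rdiv_lt_0_compat; lra).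
  pose proof (Rmin_l 1 (Rmin del (del / (B + 1)))). pose proof (Rmin_r 1 (Rmin del (del / (B + 1)))).
  pose proof (Rmin_l del (del / (B + 1))). pose proof (Rmin_r del (del / (B + 1))).
  split; [split; auto; repeat apply Rmin_pos; lra|]. intros mu Hmu. repeat split; try lra.
  assert (mu * (B + 1) <= del / (B + 1) * (B + 1)) by (apply Rmult_le_compat_r; lra).
  replace (del / (B + 1) * (B + 1)) with del in * by (field; lra). nra.
Qed.

Lemma Bn_czero N : Bn N czero czero = czero.
Proof.
  apply coef_ext; intros k i. unfold Bn, pj.
  assert (D : forall a, Dn N czero czero k a = 0%C).
  { intros a. unfold Dn. rewrite csum_zero; [ring|]. intros j _. unfold czero. ring. }
  unfold cdot, s3. rewrite !D. unfold czero. ring.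
Qed.

(** The quadratic term is absorbed into the error: [family_jump] is applied with reference state 0,
    and what remains is of order [mu]. Every duration up to [mu1] is available, so with [h = 0] this
    is also the move that waits. *)
Lemma first_order_jump m h M Cc del : (4 <= m)%nat -> adm h -> (forall r, in_X0 Zs (synth (cscl r h))) ->
  0 <= M -> 0 <= Cc -> 0 < del -> exists mu1, 0 < mu1 /\ forall mu, 0 < mu <= mu1 ->
  forall w c, (forall p, adm (w p)) -> fam (m + 3) w M -> cfam c Cc ->
  exists w', (forall p, adm (w' p)) /\ fam m (fun p => csb (w' p) (cadd (w p) (cscl (c p) h))) del /\ forall p, reach (w p) (w' p) mu.
Proof.
  intros Hm Hh HX HM HC Hd.
  destruct (proj2 (proj2 g_adm) (m + 3)%nat) as [G HG]. destruct (proj2 (proj2 Hh) (m + 3)%nat) as [H HH].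
  pose proof (sob_pos _ _ _ HG) as G0. pose proof (sob_pos _ _ _ HH) as H0.
  assert (CH : 0 <= Cc * H) by (apply Rmult_le_pos; auto).
  set (R0 := M + G + Cc * H).
  destruct (family_jump dst dst_pos m R0 Hm ltac:(unfold R0; lra)) as (mu0 & Cj & Hmu0 & HCj & HJ).
  destruct (small_mu 0 (Cj * (M + 1 + R0) + G) del ltac:(lra) ltac:(apply Rplus_le_le_0_compat; auto; apply Rmult_le_pos; auto; unfold R0; lra) Hd) as (m1 & Hm1 & Hsm).
  exists (Rmin mu0 m1). split; [apply Rmin_pos; lra|]. intros mu Hmu w c Aw Fw Fc.
  pose proof (Rmin_l mu0 m1). pose proof (Rmin_r mu0 m1). destruct (Hsm mu ltac:(lra)) as (_ & Hs1 & Hs2).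
  (* In true time, [/ mu] times faster, this forcing reads [gc + (c / mu) h]: a control of size
     [1 / mu] acting for time [mu]. *)
  set (F := fun p => cadd (cscl mu gc) (cscl (c p) h)).
  assert (AF : forall p, adm (F p)) by (intros p; apply adm_cadd; now apply adm_cscl).
  assert (FF : fam (m + 3) F R0).
  { apply fam_le with (A := mu * G + Cc * H); auto.
    - apply fam_add.
      + apply fam_const; auto. replace (mu * G) with (Rabs mu * G) by (rewrite Rabs_pos_eq; lra). now apply sob_scl.
      + now apply fam_cmul.
    - unfold R0. assert (mu * G <= 1 * G) by (apply Rmult_le_compat_r; lra). lra. }
  destruct (HJ mu w F (fun _ => czero) 0%nat M R0 ltac:(lra) HM ltac:(unfold R0; lra) Aw AF) as (cc & Hcc & Hrem).
  - intros p. split; [intros k i _; reflexivity|apply adm_zero].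
  - apply fam_le with (A := M); auto. unfold R0; lra.
  - exact FF.
  - apply fam_le with (A := 0); auto; [|unfold R0; lra]. apply fam_const; auto. apply sob_zero.
  - apply fam_ext with w; [|apply (fam_mono _ _ (m + 3)); auto; lia]. intros p. coef_ring.
  - exists (fun p => cc p 1). split; [|split].
    + intros p. destruct (Hcc p) as [cN HE]. apply (esol_adm mu (F p) (w p) cN (cc p)); auto; lra.
    + eapply fam_le; auto; [eapply fam_ext; [|apply fam_add; [exact Hrem|apply (fam_const dst dst_pos m (cscl mu gc) (Rabs mu * G)); apply sob_scl; eapply sob_mono; [|exact HG]; lia]]|].
      * intros p. unfold rem. rewrite Bn_czero. apply coef_ext; intros. unfold F, csb, cadd, cscl, czero. ring.
      * rewrite Rabs_pos_eq by lra. assert (Cj * mu * (M + mu + R0) <= Cj * mu * (M + 1 + R0)); [|lra].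
        apply Rmult_le_compat_l; [apply Rmult_le_pos; lra|]. lra.
    + intros p. destruct (Hcc p) as [cN HE].
      pose proof (esol_csol mu (F p) (w p) cN (cc p) 1 (/ mu) ltac:(lra) Rlt_0_1 ltac:(apply Rinv_0_lt_compat; lra) ltac:(field; lra) (AF p) (Aw p) HE) as CS.
      rewrite Rinv_inv in CS.
      apply (reach_one (cscl (/ mu) (cscl (c p) h)) (fun s => cscl 1 (cc p (/ mu * s)))); auto.
      * replace (cscl (/ mu) (cscl (c p) h)) with (cscl (/ mu * c p) h); [apply HX|]. coef_ring.
      * now apply adm_cscl, adm_cscl.
      * lra.
      * replace (cadd gc (cscl (/ mu) (cscl (c p) h))) with (cscl (1 * / mu) (F p)); auto.
        apply coef_ext; intros. unfold F, cadd, cscl. rewrite Rmult_1_l, Cmult_plus_distr_l, Cmult_assoc, <- RtoC_mult, Rinv_l by lra. ring.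
      * rewrite Rmult_0_r, (esol_init _ _ _ _ _ HE). coef_ring.
      * rewrite Rinv_l by lra. coef_ring.
Qed.

(* [Sat h]: every bounded Lipschitz family can be translated by [c(p) h] in arbitrarily small time,
   up to an arbitrarily small Lipschitz error, with a fixed loss of derivatives. *)
Definition Sat (h : coef) : Prop := adm h /\ forall m, (4 <= m)%nat -> exists m', (m <= m')%nat /\
  forall M Cc del, 0 <= M -> 0 <= Cc -> 0 < del ->
  forall w c, (forall p, adm (w p)) -> fam m' w M -> cfam c Cc ->
  exists tau w', 0 < tau <= del /\ (forall p, adm (w' p)) /\
    fam m (fun p => csb (w' p) (cadd (w p) (cscl (c p) h))) del /\ forall p, reach (w p) (w' p) tau.

Lemma Sat_control h : adm h -> (forall r, in_X0 Zs (synth (cscl r h))) -> Sat h.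
Proof.
  intros Hh HX. split; auto. intros m Hm. exists (m + 3)%nat. split; [lia|]. intros M Cc del HM HC Hd w c Aw Fw Fc.
  destruct (first_order_jump m h M Cc del Hm Hh HX HM HC Hd) as (mu1 & Hmu1 & HJ).
  assert (Hmin : 0 < Rmin mu1 del) by (apply Rmin_pos; auto).
  destruct (HJ (Rmin mu1 del)) with (w := w) (c := c) as (w' & H1 & H2 & H3); auto.
  { split; auto. apply Rmin_l. }
  exists (Rmin mu1 del), w'. repeat (split; auto). apply Rmin_r.
Qed.

(** Derivative losses compose: the first move must deliver in the order that the second one
    consumes. *)
Lemma Sat_add h1 h2 : Sat h1 -> Sat h2 -> Sat (cadd h1 h2).
Proof.
  intros [A1 S1] [A2 S2]. split; [now apply adm_cadd|]. intros m Hm.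
  destruct (S2 m Hm) as (m2 & Hm2 & Q2). destruct (S1 m2 ltac:(lia)) as (m1 & Hm1 & Q1).
  exists m1. split; [lia|]. intros M Cc del HM HC Hd w c Aw Fw Fc.
  destruct (proj2 (proj2 A1) m2) as [H1 HH1]. pose proof (sob_pos _ _ _ HH1).
  assert (0 <= Cc * H1) by (apply Rmult_le_pos; auto).
  destruct (Q1 M Cc (del / 2) HM HC ltac:(lra) w c Aw Fw Fc) as (t1 & w1 & T1 & Aw1 & F1 & R1).
  assert (Fw1 : fam m2 w1 (del / 2 + (M + Cc * H1))).
  { eapply fam_ext; [|apply fam_add; [exact F1|apply fam_add; [apply (fam_mono dst m2 m1); [lia|exact Fw]|apply (fam_cmul dst m2 c h1); eauto]]].
    intros p. coef_ring. }
  destruct (Q2 (del / 2 + (M + Cc * H1)) Cc (del / 2) ltac:(lra) HC ltac:(lra) w1 c Aw1 Fw1 Fc) as (t2 & w2 & T2 & Aw2 & F2 & R2).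
  exists (t1 + t2), w2. split; [lra|]. split; [auto|]. split.
  - eapply fam_ext. 2: eapply (fam_le _ dst_pos); [apply fam_add; [exact F2|apply (fam_mono dst m m2); [lia|exact F1]]|lra].
    + intros p. coef_ring.
  - intros p. eapply reach_trans; eauto.
Qed.

Lemma cfam_scal c Cc r : cfam c Cc -> cfam (fun p => r * c p) (Rabs r * Cc).
Proof.
  intros (H0 & H1 & H2). pose proof (Rabs_pos r). split; [now apply Rmult_le_pos|]. split; intros.
  - rewrite Rabs_mult. now apply Rmult_le_compat_l.
  - rewrite <- Rmult_minus_distr_l, Rabs_mult, Rmult_assoc. now apply Rmult_le_compat_l.
Qed.
Lemma cfam_const r : cfam (fun _ => r) (Rabs r).
Proof.
  pose proof (Rabs_pos r). split; auto. split; [intros; lra|]. intros p q. rewrite Rminus_diag, Rabs_R0. now apply Rmult_le_pos.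
Qed.
Lemma cscl_cscl a b u : cscl a (cscl b u) = cscl (a * b) u.
Proof. coef_ring. Qed.

Lemma Sat_scal r h : Sat h -> Sat (cscl r h).
Proof.
  intros [A S]. split; [now apply adm_cscl|]. intros m Hm. destruct (S m Hm) as (m' & Hm' & Q). exists m'. split; auto.
  intros M Cc del HM HC Hd w c Aw Fw Fc.
  destruct (Q M (Rabs r * Cc) del HM) with (w := w) (c := fun p => r * c p) as (t & w' & T & Aw' & F' & R'); auto.
  - apply Rmult_le_pos; auto. apply Rabs_pos.
  - now apply cfam_scal.
  - exists t, w'. split; auto. split; auto. split; auto. eapply fam_ext; [|exact F'].
    intros p. now rewrite cscl_cscl, (Rmult_comm r).
Qed.

(* Go to height [lam (h1 + c h2)], let the flow act for time [1/lam^2], and come back. *)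
Lemma Sat_bracket h1 h2 N0 : Sat h1 -> Sat h2 -> supp N0 h1 -> supp N0 h2 ->
  Bn N0 h1 h1 = czero -> Bn N0 h2 h2 = czero -> adm (cadd (Bn N0 h1 h2) (Bn N0 h2 h1)) ->
  (forall r, in_X0 Zs (synth (cscl r czero))) ->
  Sat (cadd (Bn N0 h1 h2) (Bn N0 h2 h1)).
Proof.
  intros [A1 S1] [A2 S2] Su1 Su2 B1 B2 Aq HX0. set (q := cadd (Bn N0 h1 h2) (Bn N0 h2 h1)) in *.
  split; auto. intros m Hm.
  destruct (S2 m Hm) as (m5 & Hm5 & Q5). destruct (S1 m5 ltac:(lia)) as (m4 & Hm4 & Q4).
  destruct (S2 (m4 + 3)%nat ltac:(lia)) as (m2 & Hm2 & Q2). destruct (S1 m2 ltac:(lia)) as (m1 & Hm1 & Q1).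
  exists m1. split; [lia|]. intros M Cc del HM HC Hd w c Aw Fw Fc.
  destruct (proj2 (proj2 A1) (m1 + 3)%nat) as [H1 HH1]. destruct (proj2 (proj2 A2) (m1 + 3)%nat) as [H2 HH2].
  destruct (proj2 (proj2 g_adm) (m1 + 3)%nat) as [G HG]. destruct (proj2 (proj2 Aq) m4) as [Hq HHq].
  pose proof (sob_pos _ _ _ HH1) as P1. pose proof (sob_pos _ _ _ HH2) as P2. pose proof (sob_pos _ _ _ HG) as PG. pose proof (sob_pos _ _ _ HHq) as Pq.
  assert (PC2 : 0 <= Cc * H2) by (apply Rmult_le_pos; auto).
  set (R0 := (M + 1) + H1 + Cc * H2 + G).
  destruct (family_jump dst dst_pos m4 R0 ltac:(lia) ltac:(unfold R0; lra)) as (mu0 & Cj & Hmu0 & HCj & HJ).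
  assert (PB : 0 <= Cj * (M + 1 + 1 + G) + G) by (apply Rplus_le_le_0_compat; auto; apply Rmult_le_pos; auto; lra).
  destruct (small_mu 0 (Cj * (M + 1 + 1 + G) + G) (del / 8) ltac:(lra) PB ltac:(lra)) as (mm & Hmm & Hsm).
  set (mu := Rmin mu0 mm). assert (Hmu : 0 < mu <= mu0 /\ mu <= mm).
  { unfold mu. repeat split; [apply Rmin_pos; lra|apply Rmin_l|apply Rmin_r]. }
  destruct (Hsm mu ltac:(lra)) as (_ & Hs1 & Hs2). set (lam := / mu).
  assert (Hlam : 0 < lam) by (apply Rinv_0_lt_compat; lra).
  assert (Elm : mu * lam = 1) by (unfold lam; field; lra).
  set (d1 := Rmin 1 (del / 8)). assert (Hd1 : 0 < d1 /\ d1 <= 1 /\ d1 <= del / 8).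
  { unfold d1. repeat split; [apply Rmin_pos; lra|apply Rmin_l|apply Rmin_r]. }
  destruct (Q1 M (Rabs lam) (d1 / 2) HM (Rabs_pos _) ltac:(lra) w (fun _ => lam) Aw Fw (cfam_const lam)) as (t1 & w1 & T1 & Aw1 & F1 & R1).
  assert (Fl1 : fam m2 (fun _ : P => cscl lam h1) (Rabs lam * H1)).
  { apply fam_const; auto. apply sob_scl. eapply sob_mono; [|exact HH1]. lia. }
  assert (Fw1 : fam m2 w1 (d1 / 2 + (M + Rabs lam * H1))).
  { eapply fam_ext; [|apply fam_add; [exact F1|apply fam_add; [apply (fam_mono dst m2 m1); [lia|exact Fw]|exact Fl1]]].
    intros p. coef_ring. }
  assert (PL : 0 <= Rabs lam * H1) by (apply Rmult_le_pos; auto; apply Rabs_pos).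
  assert (PLC : 0 <= Rabs lam * Cc) by (apply Rmult_le_pos; auto; apply Rabs_pos).
  destruct (Q2 (d1 / 2 + (M + Rabs lam * H1)) (Rabs lam * Cc) (d1 / 2) ltac:(lra) PLC ltac:(lra) w1 (fun p => lam * c p) Aw1 Fw1 (cfam_scal c Cc lam Fc)) as (t2 & w2 & T2 & Aw2 & F2 & R2).
  set (e := fun p => csb (w2 p) (cadd (w p) (cscl lam (cadd h1 (cscl (c p) h2))))).
  assert (Fe : fam (m4 + 3) e d1).
  { eapply fam_ext. 2: eapply (fam_le _ dst_pos); [apply fam_add; [exact F2|apply (fam_mono dst (m4 + 3) m2); [lia|exact F1]]|lra].
    intros p. unfold e. coef_ring. }
  set (hh := fun p => cadd h1 (cscl (c p) h2)).
  (* In units of [lam] the state after the two jumps is [hh p] up to order [mu], which is the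
     situation of [family_jump] with [X] of order [mu]. *)
  set (c0 := fun p => cscl mu (w2 p)).
  assert (Ec0 : forall p, c0 p = cadd (hh p) (cscl mu (cadd (w p) (e p)))).
  { intros p. unfold c0, hh, e. apply coef_ext; intros. unfold cadd, csb, cscl.
    transitivity (mu * w2 p k i + (1 - RtoC (mu * lam)) * (h1 k i + c p * h2 k i))%C; [rewrite Elm; ring|rewrite RtoC_mult; ring]. }
  assert (Fhh : fam (m4 + 3) hh (H1 + Cc * H2)).
  { apply fam_add; [apply fam_const; auto; eapply sob_mono; [|exact HH1]; lia|]. apply fam_cmul; auto. eapply sob_mono; [|exact HH2]; lia. }
  assert (Fx : fam (m4 + 3) (fun p => cscl mu (cadd (w p) (e p))) (mu * (M + 1))).
  { apply fam_le with (A := Rabs mu * (M + d1)); auto.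
    - apply fam_scl. apply fam_add; auto. apply (fam_mono dst (m4 + 3) m1); [lia|exact Fw].
    - rewrite Rabs_pos_eq by lra. apply Rmult_le_compat_l; lra. }
  assert (mu2 : mu * mu <= mu) by nra. assert (mu3 : 0 <= mu * mu) by nra.
  (* Undoing the scaling with [a = lam] and [b = lam^2] multiplies the forcing by [lam^3], so this
     is the uncontrolled forcing [gc]. *)
  set (F := fun _ : P => cscl (mu * mu * mu) gc).
  assert (FFb : fam (m4 + 3) F (mu * G)).
  { apply fam_le with (A := Rabs (mu * mu * mu) * G); auto.
    - apply fam_const; auto. apply sob_scl. eapply sob_mono; [|exact HG]. lia.
    - apply Rmult_le_compat_r; auto. rewrite Rabs_pos_eq by nra. nra. }
  assert (mM : mu * (M + 1) <= 1 * (M + 1)) by (apply Rmult_le_compat_r; lra).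
  assert (mG : mu * G <= 1 * G) by (apply Rmult_le_compat_r; lra).
  assert (mG0 : 0 <= mu * G) by (apply Rmult_le_pos; lra).
  assert (mM0 : 0 <= mu * (M + 1)) by (apply Rmult_le_pos; lra).
  destruct (HJ mu c0 F hh N0 (mu * (M + 1)) (mu * G)) as (cc & Hcc & Hrem); auto; try lra.
  - unfold R0; lra.
  - intros p. now apply adm_cscl.
  - intros p. now apply adm_cscl.
  - intros p. split; [apply supp_cadd; auto; now apply supp_cscl|]. apply adm_cadd; auto. now apply adm_cscl.
  - eapply fam_ext; [intros p; symmetry; apply Ec0|]. eapply (fam_le _ dst_pos); [apply fam_add; [exact Fhh|exact Fx]|unfold R0; lra].
  - apply (fam_mono _ _ (m4 + 3)); [lia|]. eapply (fam_le _ dst_pos); [exact Fhh|unfold R0; lra].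
  - apply (fam_mono _ _ (m4 + 3)); [lia|]. eapply fam_ext; [|exact Fx]. intros p. rewrite Ec0. coef_ring.
  - set (w3 := fun p => cscl lam (cc p 1)).
    assert (AF : forall p, adm (F p)) by (intros p; now apply adm_cscl).
    assert (Ac0 : forall p, adm (c0 p)) by (intros p; now apply adm_cscl).
    assert (Aw3 : forall p, adm (w3 p)).
    { intros p. apply adm_cscl. destruct (Hcc p) as [cN HE]. apply (esol_adm mu (F p) (c0 p) cN (cc p)); auto; lra. }
    (* The squares vanish by hypothesis; only the cross terms remain, linear in [c p], and hence of
       either sign. *)
    assert (Ehh : forall p, Bn N0 (hh p) (hh p) = cscl (c p) q).
    { intros p. unfold hh. rewrite !Bn_addl, !Bn_addr, !Bn_scall, !Bn_scalr, B1, B2. apply coef_ext; intros. unfold q, cadd, cscl, czero. ring. }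
    set (r3 := fun p => csb (w3 p) (cadd (cadd (w p) (cscl (c p) q)) (cscl lam (hh p)))).
    assert (FlF : fam m4 (fun p => cscl lam (F p)) (mu * G)).
    { apply fam_ext with (fun _ => cscl (mu * mu) gc).
      - intros p. unfold F. rewrite cscl_cscl. f_equal. transitivity (mu * mu * (mu * lam)); [rewrite Elm; ring|ring].
      - apply fam_le with (A := Rabs (mu * mu) * G); auto.
        + apply fam_const; auto. apply sob_scl. eapply sob_mono; [|exact HG]. lia.
        + apply Rmult_le_compat_r; auto. rewrite Rabs_pos_eq; auto. }
    (* The remainder of order [mu^2] in scaled units is of order [mu] after multiplication by [lam];
       [d1] comes from the two jumps and [mu * G] from the free forcing. *)
    assert (Fr3 : fam m4 r3 (3 * (del / 8))).
    { apply fam_le with (A := Rabs lam * (Cj * mu * (mu * (M + 1) + mu + mu * G)) + d1 + mu * G); auto.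
      - eapply fam_ext; [|apply fam_add; [apply fam_add; [apply (fam_scl dst m4 lam _ _ Hrem)|apply (fam_mono dst m4 (m4 + 3)); [lia|exact Fe]]|exact FlF]].
        intros p. cbv beta. unfold rem. rewrite Ehh. apply coef_ext; intros. unfold r3, w3, c0, e, hh, cadd, csb, cscl.
        assert (EC : (RtoC mu * RtoC lam = 1)%C) by now rewrite <- RtoC_mult, Elm.
        transitivity (RtoC lam * cc p 1 k i - (RtoC mu * RtoC lam) * (w2 p k i) - (RtoC mu * RtoC lam) * (c p * q k i) + (w2 p k i - (w p k i + RtoC lam * (h1 k i + c p * h2 k i))))%C; [ring|]. rewrite EC. ring.
      - rewrite Rabs_pos_eq by lra.
        replace (lam * (Cj * mu * (mu * (M + 1) + mu + mu * G))) with ((mu * lam) * (mu * (Cj * (M + 1 + 1 + G)))) by ring. rewrite Elm. lra. }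
    set (M4 := 3 * (del / 8) + ((M + Cc * Hq) + Rabs lam * (H1 + Cc * H2))).
    assert (Fw3 : fam m4 w3 M4).
    { eapply fam_ext; [|apply fam_add; [exact Fr3|apply fam_add; [apply fam_add; [apply (fam_mono dst m4 m1); [lia|exact Fw]|apply (fam_cmul dst m4 c q Cc Hq Fc HHq)]|apply (fam_scl dst m4 lam hh); apply (fam_mono dst m4 (m4 + 3)); [lia|exact Fhh]]]].
      intros p. apply coef_ext; intros. unfold r3, cadd, csb, cscl. ring. }
    assert (PM4 : 0 <= M4).
    { unfold M4. assert (0 <= Cc * Hq) by (apply Rmult_le_pos; auto). assert (0 <= Rabs lam * (H1 + Cc * H2)); [|lra]. apply Rmult_le_pos; [apply Rabs_pos|lra]. }
    destruct (Q4 M4 (Rabs (- lam)) (del / 8) PM4 (Rabs_pos _) ltac:(lra) w3 (fun _ => - lam) Aw3 Fw3 (cfam_const (- lam))) as (t4 & w4 & T4 & Aw4 & F4 & R4).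
    assert (Fl4 : fam m5 (fun _ : P => cscl (- lam) h1) (Rabs (- lam) * H1)).
    { apply fam_const; auto. apply sob_scl. eapply sob_mono; [|exact HH1]. lia. }
    assert (Fw4 : fam m5 w4 (del / 8 + (M4 + Rabs (- lam) * H1))).
    { eapply fam_ext; [|apply fam_add; [exact F4|apply fam_add; [apply (fam_mono dst m5 m4); [lia|exact Fw3]|exact Fl4]]].
      intros p. coef_ring. }
    assert (PL4 : 0 <= Rabs (- lam) * H1) by (apply Rmult_le_pos; auto; apply Rabs_pos).
    assert (PLC4 : 0 <= Rabs (- lam) * Cc) by (apply Rmult_le_pos; auto; apply Rabs_pos).
    destruct (Q5 (del / 8 + (M4 + Rabs (- lam) * H1)) (Rabs (- lam) * Cc) (del / 8) ltac:(lra) PLC4 ltac:(lra) w4 (fun p => - lam * c p) Aw4 Fw4 (cfam_scal c Cc (- lam) Fc)) as (t5 & w5 & T5 & Aw5 & F5 & R5).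
    assert (R3 : forall p, reach (w2 p) (w3 p) (mu * mu)).
    { intros p. destruct (Hcc p) as [cN HE].
      assert (Ll : 0 < lam * lam) by (apply Rmult_lt_0_compat; auto).
      pose proof (esol_csol mu (F p) (c0 p) cN (cc p) lam (lam * lam) ltac:(lra) Hlam Ll ltac:(transitivity (lam * (mu * lam)); [ring|rewrite Elm; ring]) (AF p) (Ac0 p) HE) as CS.
      replace (/ (lam * lam)) with (mu * mu) in CS by (unfold lam; field; lra).
      apply (reach_one czero (fun s => cscl lam (cc p (lam * lam * s)))); auto.
      - replace czero with (cscl 0 czero) by (coef_ring). apply HX0.
      - apply adm_zero.
      - apply Rmult_lt_0_compat; lra.
      - replace (cadd gc czero) with (cscl (lam * (lam * lam)) (F p)); auto. unfold F. rewrite cscl_cscl.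
        replace (lam * (lam * lam) * (mu * mu * mu)) with ((mu * lam) * (mu * lam) * (mu * lam)) by ring. rewrite Elm.
        apply coef_ext; intros. unfold cscl, cadd, czero. rewrite !Rmult_1_l. ring.
      - rewrite Rmult_0_r, (esol_init _ _ _ _ _ HE). unfold c0. rewrite cscl_cscl, (Rmult_comm lam), Elm.
        coef_ring.
      - unfold w3. do 2 f_equal. replace (lam * lam * (mu * mu)) with ((mu * lam) * (mu * lam)) by ring. rewrite Elm. ring. }
    exists (t1 + t2 + mu * mu + t4 + t5), w5. split; [lra|]. split; [exact Aw5|]. split.
    + eapply fam_ext. 2: eapply (fam_le _ dst_pos); [apply fam_add; [apply fam_add; [exact F5|apply (fam_mono dst m m5); [lia|exact F4]]|apply (fam_mono dst m m4); [lia|exact Fr3]]|lra].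
      intros p. unfold r3, hh. coef_ring.
    + intros p. apply reach_trans with (w4 p); auto. apply reach_trans with (w3 p); auto. apply reach_trans with (w2 p); auto. apply reach_trans with (w1 p); auto.
Qed.
End Control.

(** ** Fourier modes *)

Definition one (k : Z3) (z : nat -> C) : coef := fun l i => if classic_dec (l = k) then z i else 0%C.
Definition cjv (z : nat -> C) : nat -> C := fun i => Cconj (z i).
(** A real field of a single frequency; Hermitian symmetry forces the coefficient at [- k]. *)
Definition mode (k : Z3) (z : nat -> C) : coef := cadd (one k z) (one (z3opp k) (cjv z)).
Definition cvec (x y z : C) : nat -> C := fun i => match i with 0%nat => x | 1%nat => y | 2%nat => z | _ => 0%C end.

Lemma one_in k z i : one k z k i = z i.
Proof. unfold one. destruct (classic_dec _); tauto. Qed.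
Lemma one_out k z l i : l <> k -> one k z l i = 0%C.
Proof. unfold one. destruct (classic_dec _); tauto. Qed.
Lemma one_add k z w : cadd (one k z) (one k w) = one k (fun i => z i + w i)%C.
Proof. apply coef_ext; intros. unfold one, cadd. destruct (classic_dec _); ring. Qed.
Lemma one_ext k z w : (forall i, z i = w i) -> one k z = one k w.
Proof. intros H. apply coef_ext; intros. unfold one. now rewrite H. Qed.
Lemma mode_ext k z w : (forall i, z i = w i) -> mode k z = mode k w.
Proof. intros H. unfold mode, cjv. f_equal; apply one_ext; auto. intros; now rewrite H. Qed.
Lemma mode_add k z w : mode k (fun i => z i + w i)%C = cadd (mode k z) (mode k w).
Proof. apply coef_ext; intros. unfold mode, one, cjv, cadd. destruct (classic_dec _), (classic_dec _); rewrite ?Cplus_conj; ring. Qed.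
Lemma mode_scl k r z : mode k (fun i => RtoC r * z i)%C = cscl r (mode k z).
Proof. apply coef_ext; intros. unfold mode, one, cjv, cadd, cscl. destruct (classic_dec _), (classic_dec _); rewrite ?Cmult_conj, ?Cconj_RtoC; ring. Qed.
Lemma mode_opp k z : mode (z3opp k) z = mode k (cjv z).
Proof.
  unfold mode. rewrite z3oppK. apply coef_ext; intros. unfold cadd. rewrite Cplus_comm. f_equal.
  unfold one, cjv. destruct (classic_dec _); auto. now rewrite Cconj_conj.
Qed.

Lemma supp_one N k z : In k (box N) -> supp N (one k z).
Proof. intros H l i Hl. apply one_out. congruence. Qed.
Lemma supp_mode N k z : In k (box N) -> supp N (mode k z).
Proof. intros H. apply supp_cadd; apply supp_one; auto. now apply box_opp. Qed.

Lemma cdot_cjv z k : cdot z k = 0%C -> cdot (cjv z) (z3opp k) = 0%C.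
Proof. intros H. unfold cjv. rewrite cdot_opp, <- cdot_conj, H, Cconj_RtoC. ring. Qed.

Lemma adm_mode k z : k <> z3zero -> cdot z k = 0%C -> (forall i, (3 <= i)%nat -> z i = 0%C) -> adm (mode k z).
Proof.
  intros Hk Hz Hn. assert (Hk' : z3opp k <> z3zero) by (intros H; apply Hk; rewrite <- (z3oppK k), H; reflexivity).
  destruct (box_ex k) as [N HN].
  split; [split; [|split]|split].
  - intros l i. unfold mode, cadd. rewrite Cplus_conj. rewrite Cplus_comm. unfold one, cjv. f_equal.
    + destruct (classic_dec (z3opp l = z3opp k)) as [e|e], (classic_dec (l = k)) as [e'|e']; auto.
      * elim e'. now rewrite <- (z3oppK l), e, z3oppK.
      * now subst.
      * now rewrite Cconj_RtoC.
    + destruct (classic_dec (z3opp l = k)) as [e|e], (classic_dec (l = z3opp k)) as [e'|e']; rewrite ?Cconj_conj, ?Cconj_RtoC; auto.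
      * elim e'. now rewrite <- e, z3oppK.
      * elim e. now rewrite e', z3oppK.
  - intros l. unfold mode, cadd, one.
    assert (Hc : cdot (fun i => cjv z i) (z3opp k) = 0%C) by exact (cdot_cjv _ _ Hz). assert (Hz' : cdot (fun i => z i) k = 0%C) by exact Hz.
    rewrite cdot_cadd. destruct (classic_dec (l = k)) as [->|_]; [rewrite Hz'|]; (destruct (classic_dec _) as [->|_] || destruct (classic_dec _) as [e|_]; [rewrite ?e; rewrite ?Hc|]); unfold cdot, s3; ring.
  - intros l i Hi. unfold mode, cadd, one, cjv. destruct (classic_dec _), (classic_dec _); rewrite ?Hn, ?Cconj_RtoC by auto; ring.
  - intros i. unfold mode, cadd. rewrite !one_out by congruence. ring.
  - intros m. eexists. apply supp_sob_sqrt with (N := N). now apply supp_mode.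
Qed.

Lemma pj_zero k (z : nat -> C) i : (forall i, z i = 0%C) -> pj k z i = 0%C.
Proof. intros H. unfold pj, cdot, s3. rewrite !H. ring. Qed.
Lemma pj_id k z i : cdot z k = 0%C -> pj k z i = z i.
Proof. intros H. unfold pj. rewrite H. ring. Qed.
Lemma pj_opp k z i : pj (z3opp k) z i = pj k z i.
Proof. unfold pj. rewrite cdot_opp, kc_opp. unfold ksq, Rdiv. rewrite !kc_opp, Ropp_mult_distr_l_reverse, RtoC_opp.
  replace ((- kc 0 k) ^ 2 + (- kc 1 k) ^ 2 + (- kc 2 k) ^ 2) with (kc 0 k ^ 2 + kc 1 k ^ 2 + kc 2 k ^ 2) by ring. ring. Qed.
Lemma pj_cjv k z i : pj k (cjv z) i = Cconj (pj k z i).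
Proof. unfold pj, cjv, Cminus. rewrite Cplus_conj, Copp_conj, Cmult_conj, cdot_conj, Cconj_RtoC. reflexivity. Qed.
Lemma pj_n3 k (z : nat -> C) i : (forall i, (3 <= i)%nat -> z i = 0%C) -> (3 <= i)%nat -> pj k z i = 0%C.
Proof.
  intros H Hi. unfold pj. rewrite H by auto. replace (kc i k) with 0; [unfold Rdiv; rewrite Rmult_0_l; ring|].
  destruct i as [|[|[|i]]]; try lia. unfold kc, zc. now destruct k as [[? ?] ?].
Qed.

(** Two exponentials interact only at the frequency [j + k]; the brackets of modes are computed from
    this case. *)
Lemma Bn_one N j z k w : In j (box N) ->
  Bn N (one j z) (one k w) = one (z3add j k) (pj (z3add j k) (fun i => - Ci * (cdot z (z3add j k) * w i))%C).
Proof.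
  intros Hj. assert (D : forall l i, Dn N (one j z) (one k w) l i = one (z3add j k) (fun i => - Ci * (cdot z (z3add j k) * w i))%C l i).
  { intros l i. unfold Dn. rewrite (csum_support (box N) [j]); auto.
    - unfold csum, lsum. cbn [fold_right map fst snd]. change (0, 0) with (RtoC 0).
      destruct (classic_dec (l = z3add j k)) as [->|e].
      + replace (z3sub (z3add j k) j) with k by (rewrite z3add_comm, z3addK; reflexivity). rewrite !one_in.
        rewrite (cdot_ext (one j z j) z) by (intros; apply one_in). apply ceq; simpl; ring.
      + rewrite (one_out (z3add j k)) by auto. rewrite (one_out k); [apply ceq; simpl; ring|]. intros H. apply e. rewrite <- H. now rewrite z3add_sub.
    - repeat constructor; auto.
    - intros a _ Ha. rewrite (cdot_ext _ (fun _ => 0%C)); [unfold cdot, s3; ring|]. intros. apply one_out. intros ->. apply Ha. now left.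
    - intros a [->|[]] Ha. tauto. }
  apply coef_ext; intros l i. unfold Bn. rewrite (pj_ext l _ _ i (D l)). unfold one. destruct (classic_dec (l = z3add j k)) as [->|e]; auto.
  now apply pj_zero.
Qed.

Definition bs (N : nat) (u v : coef) : coef := cadd (Bn N u v) (Bn N v u).
(** The symmetrised interaction coefficient at [j + k], simplified by [z . j = w . k = 0]. *)
Definition bet (j : Z3) (z : nat -> C) (k : Z3) (w : nat -> C) : nat -> C :=
  pj (z3add j k) (fun i => - Ci * (cdot z k * w i + cdot w j * z i))%C.

Lemma bs_addl N u u' v : bs N (cadd u u') v = cadd (bs N u v) (bs N u' v).
Proof. unfold bs. rewrite Bn_addl, Bn_addr. coef_ring. Qed.
Lemma bs_addr N u v v' : bs N u (cadd v v') = cadd (bs N u v) (bs N u v').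
Proof. unfold bs. rewrite Bn_addl, Bn_addr. coef_ring. Qed.

Lemma cdot_addk z j k : cdot z (z3add j k) = (cdot z j + cdot z k)%C.
Proof. unfold cdot, s3. rewrite !kc_add, !RtoC_plus. ring. Qed.

Lemma bs_one N j z k w : In j (box N) -> In k (box N) -> cdot z j = 0%C -> cdot w k = 0%C ->
  bs N (one j z) (one k w) = one (z3add j k) (bet j z k w).
Proof.
  intros Hj Hk Hz Hw. unfold bs. rewrite !Bn_one, (z3add_comm k j), one_add by auto. apply one_ext. intros i.
  rewrite <- pj_add. apply pj_ext. intros a. rewrite !cdot_addk, Hz, Hw. ring.
Qed.

Lemma bet_cjv j z k w i : bet (z3opp j) (cjv z) (z3opp k) (cjv w) i = Cconj (bet j z k w i).
Proof.
  unfold bet. replace (z3add (z3opp j) (z3opp k)) with (z3opp (z3add j k)) by z3.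
  rewrite pj_opp, <- pj_cjv. apply pj_ext. intros a. unfold cjv. rewrite !cdot_opp, <- !cdot_conj.
  rewrite Cmult_conj, Cplus_conj, !Cmult_conj, Copp_conj. replace (Cconj Ci) with (- Ci)%C by (unfold Ci, Cconj, Copp; simpl; f_equal; ring). ring.
Qed.

Lemma bs_mode N j z k w : In j (box N) -> In k (box N) -> cdot z j = 0%C -> cdot w k = 0%C ->
  bs N (mode j z) (mode k w) = cadd (mode (z3add j k) (bet j z k w)) (mode (z3add j (z3opp k)) (bet j z (z3opp k) (cjv w))).
Proof.
  intros Hj Hk Hz Hw. unfold mode at 1 2. pose proof (box_opp _ _ Hj). pose proof (box_opp _ _ Hk).
  pose proof (cdot_cjv _ _ Hz). pose proof (cdot_cjv _ _ Hw).
  rewrite bs_addl, !bs_addr, !bs_one by auto. unfold mode.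
  replace (z3opp (z3add j k)) with (z3add (z3opp j) (z3opp k)) by z3.
  replace (z3opp (z3add j (z3opp k))) with (z3add (z3opp j) k) by z3.
  rewrite (one_ext _ (cjv (bet j z k w)) (bet (z3opp j) (cjv z) (z3opp k) (cjv w))) by (intros; symmetry; apply bet_cjv).
  rewrite (one_ext _ (cjv (bet j z (z3opp k) (cjv w))) (bet (z3opp j) (cjv z) k w)).
  - coef_ring.
  - intros i. unfold cjv at 1. rewrite <- bet_cjv, z3oppK. f_equal. apply functional_extensionality. intros. unfold cjv. now rewrite Cconj_conj.
Qed.

(** Every interaction among [k] and [- k] carries the factor [z . k = 0] or its conjugate: a single
    mode is a steady flow. *)
Lemma Bn_mode_self N k z : In k (box N) -> cdot z k = 0%C -> Bn N (mode k z) (mode k z) = czero.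
Proof.
  intros Hk Hz. pose proof (box_opp _ _ Hk). pose proof (cdot_cjv _ _ Hz) as Hc.
  assert (Z : forall j w j' w', In j (box N) -> cdot w j = 0%C -> cdot w j' = 0%C -> Bn N (one j w) (one j' w') = czero).
  { intros j w j' w' Hj H1 H2. rewrite Bn_one by auto. apply coef_ext; intros l i. unfold one. destruct (classic_dec _); auto.
    apply pj_zero. intros. rewrite cdot_addk, H1, H2. unfold czero. ring. }
  unfold mode. rewrite Bn_addl, !Bn_addr, !Z; auto.
  - coef_ring.
  - rewrite cdot_opp in Hc. transitivity (- - cdot (cjv z) k)%C; [ring|rewrite Hc; ring].
  - rewrite cdot_opp, Hz. ring.
Qed.

(* Replacing [(z, w)] by [(i z, - i w)] keeps the interaction at [j + k] and reverses the one at [j - k]. *)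
Lemma bs_mode_sum N j z k w : In j (box N) -> In k (box N) -> cdot z j = 0%C -> cdot w k = 0%C ->
  cadd (bs N (mode j z) (mode k w)) (bs N (mode j (fun i => Ci * z i)%C) (mode k (fun i => - Ci * w i)%C)) = cscl 2 (mode (z3add j k) (bet j z k w)).
Proof.
  intros Hj Hk Hz Hw. rewrite !bs_mode; auto.
  2: rewrite cdot_cscl, Hz; ring. 2: rewrite cdot_cscl, Hw; ring.
  assert (I2 : (Ci * Ci = - (1))%C) by (apply ceq; simpl; ring).
  rewrite (mode_ext (z3add j k) (bet j (fun i => Ci * z i)%C k (fun i => - Ci * w i)%C) (bet j z k w)).
  - rewrite (mode_ext (z3add j (z3opp k)) (bet j (fun i => Ci * z i)%C (z3opp k) (cjv (fun i => - Ci * w i)%C)) (fun i => RtoC (-1) * bet j z (z3opp k) (cjv w) i)%C).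
    + rewrite mode_scl. apply coef_ext; intros. unfold cadd, cscl. change (RtoC (-1)) with (RtoC (Ropp 1)). rewrite RtoC_opp.
      change (RtoC 2) with (RtoC (1 + 1)). rewrite RtoC_plus. ring.
    + intros i. unfold bet. rewrite <- pj_scal. apply pj_ext. intros a.
      rewrite (cdot_ext (cjv (fun i => - Ci * w i)%C) (fun i => Ci * cjv w i)%C), !cdot_cscl.
      * unfold cjv. rewrite Cmult_conj, Copp_conj. replace (Cconj Ci) with (- Ci)%C by (unfold Ci, Cconj, Copp; simpl; f_equal; ring).
        change (RtoC (-1)) with (RtoC (Ropp 1)); rewrite RtoC_opp.
        transitivity (- Ci * (Ci * Ci) * (cdot z (z3opp k) * Cconj (w a) + cdot (fun i => Cconj (w i)) j * z a))%C; [ring|]. rewrite I2. unfold cjv; ring.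
      * intros b. unfold cjv. rewrite Cmult_conj, Copp_conj. replace (Cconj Ci) with (- Ci)%C by (unfold Ci, Cconj, Copp; simpl; f_equal; ring). ring.
  - intros i. unfold bet. apply pj_ext. intros a. rewrite !cdot_cscl.
    transitivity (- Ci * (- (Ci * Ci)) * (cdot z k * w a + cdot w j * z a))%C; [ring|]. rewrite I2. ring.
Qed.

Lemma synth_mode k z x : k <> z3zero -> cdot z k = 0%C -> (forall i, (3 <= i)%nat -> z i = 0%C) -> synth (mode k z) x =
  v3add (v3scal (cos (zdot k x)) (v3scal 2 (Re (z 0%nat), Re (z 1%nat), Re (z 2%nat))))
        (v3scal (sin (zdot k x)) (v3scal (-2) (Im (z 0%nat), Im (z 1%nat), Im (z 2%nat)))).
Proof.
  intros Hk Hz Hn. destruct (box_ex k) as [N HN]. pose proof (box_opp _ _ HN) as HN'.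
  assert (E1 : forall i k z, In k (box N) -> zsum (fun l => trm (one k z l i) (zdot l x)) = trm (z i) (zdot k x)).
  { intros i k' z' H'. rewrite (zsum_finite N).
    - rewrite (lsum_support (box N) [k']); auto.
      + unfold lsum. cbn [map fold_right]. rewrite one_in. ring.
      + repeat constructor; auto.
      + intros a _ Ha. rewrite one_out; [unfold trm; simpl; ring|]. intros ->. apply Ha. now left.
      + intros a [->|[]] Ha. tauto.
    - intros a Ha. rewrite one_out; [unfold trm; simpl; ring|congruence]. }
  assert (S : forall i, SF (fun l => mode k z l i) x = 2 * trm (z i) (zdot k x)).
  { intros i. destruct (adm_mode k z Hk Hz Hn) as (_ & _ & Hs). unfold SF.
    assert (D : forall l, trm (mode k z l i) (zdot l x) = trm (one k z l i) (zdot l x) + trm (one (z3opp k) (cjv z) l i) (zdot l x)).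
    { intros l. unfold mode, cadd, trm. rewrite Re_plus, Im_plus. ring. }
    rewrite (zsum_ext _ _ D), (zsum_finite N).
    - rewrite lsum_plus, <- !(zsum_finite N), !E1; auto.
      + rewrite zdot_opp. unfold trm, cjv. rewrite cos_neg, sin_neg. destruct (z i); simpl. ring.
      + intros a Ha. rewrite one_out; [unfold trm; simpl; ring|congruence].
      + intros a Ha. rewrite one_out; [unfold trm; simpl; ring|congruence].
    - intros a Ha. rewrite !one_out by congruence. unfold trm; simpl; ring. }
  unfold synth. rewrite !S. unfold v3add, v3scal, trm. apply f_equal2; [apply f_equal2|]; ring.
Qed.

Lemma adm_mode_bet j z k w : cdot z j = 0%C -> cdot w k = 0%C ->
  (forall i, (3 <= i)%nat -> z i = 0%C) -> (forall i, (3 <= i)%nat -> w i = 0%C) -> adm (mode (z3add j k) (bet j z k w)).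
Proof.
  (* At total frequency zero both transport factors vanish, so the result is the zero field, which
     is admissible although [adm_mode] excludes this frequency. *)
  intros Hz Hw Nz Nw. destruct (classic (z3add j k = z3zero)) as [e|e].
  - assert (Ek : k = z3opp j) by (rewrite <- (z3addK j k), e; z3). subst k.
    assert (B : forall i, bet j z (z3opp j) w i = 0%C).
    { intros i. apply pj_zero. intros a. rewrite cdot_opp in *. rewrite Hz.
      replace (cdot w j) with (- - cdot w j)%C by ring. rewrite Hw. ring. }
    replace (mode _ _) with czero; [apply adm_zero|]. rewrite (mode_ext _ _ _ B). apply coef_ext; intros. unfold mode, cadd, one, cjv, czero.
    destruct (classic_dec _), (classic_dec _); rewrite ?Cconj_RtoC; ring.
  - apply adm_mode; auto; [apply cdot_pj|]. intros i Hi. unfold bet. apply pj_n3; auto. intros a Ha. rewrite Nz, Nw by auto. ring.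
Qed.

(** * Polarisations that can be steered at a given frequency *)

Section Modes.
Variables (Zs : Z3 -> Prop) (gc : coef).
Hypothesis g_adm : adm gc.
Hypothesis Zs_nz : forall k, Zs k -> k <> z3zero.
Context {P : Type} (dst : P -> P -> R) (dst_pos : forall p q, 0 <= dst p q).
Notation Sat := (Sat Zs gc dst).

Lemma in_X0_zero r : in_X0 Zs (synth (cscl r czero)).
Proof.
  exists nil. split; [intros k a b []|]. intros x. cbn [map fold_right].
  assert (Z : forall i, SF (fun k => cscl r czero k i) x = 0).
  { intros i. rewrite <- (SF_zero x). apply SF_ext. intros. unfold cscl, czero. ring. }
  unfold synth. rewrite !Z. reflexivity.
Qed.

Lemma in_X0_mode k z : Zs k -> cdot z k = 0%C -> (forall i, (3 <= i)%nat -> z i = 0%C) -> in_X0 Zs (synth (mode k z)).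
Proof.
  intros Hk Hz Hn. exists [(k, v3scal 2 (Re (z 0%nat), Re (z 1%nat), Re (z 2%nat)), v3scal (-2) (Im (z 0%nat), Im (z 1%nat), Im (z 2%nat)))].
  assert (HR : Re (z 0%nat) * kc 0 k + Re (z 1%nat) * kc 1 k + Re (z 2%nat) * kc 2 k = 0).
  { transitivity (Re (cdot z k)); [unfold cdot, s3; rewrite !Re_plus, !(Cmult_comm (z _)), !Re_scal; ring|now rewrite Hz]. }
  assert (HI : Im (z 0%nat) * kc 0 k + Im (z 1%nat) * kc 1 k + Im (z 2%nat) * kc 2 k = 0).
  { transitivity (Im (cdot z k)); [unfold cdot, s3; rewrite !Im_plus, !(Cmult_comm (z _)), !Im_scal; ring|now rewrite Hz]. }
  split.
  - intros k' a b [H|[]]. inversion H; subst. split; auto. unfold kc in HR, HI. unfold zdot, v3scal, comp.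
    split; [rewrite <- (Rmult_0_r 2), <- HR|rewrite <- (Rmult_0_r (-2)), <- HI]; ring.
  - intros x. rewrite synth_mode by auto. cbn [map fold_right]. unfold v3add, v3scal, v3zero. apply f_equal2; [apply f_equal2|]; ring.
Qed.

Lemma Sat_zero : Sat czero.
Proof. apply Sat_control; auto using adm_zero, in_X0_zero. Qed.

(** The direction is real, and the complex factor [c] covers both phases, cosine and sine. The
    projection [pj] lets any vector name a polarisation, modulo multiples of [k]. *)
Definition Steer (k : Z3) (x y z : R) : Prop := forall c : C, Sat (mode k (pj k (cvec (c * x) (c * y) (c * z)))).
Definition Full (k : Z3) : Prop := forall x y z, Steer k x y z.

Lemma cvec_n3 x y z i : (3 <= i)%nat -> cvec x y z i = 0%C.
Proof. intros H. destruct i as [|[|[|i]]]; try lia. reflexivity. Qed.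

Lemma Steer_control k x y z : Zs k -> Steer k x y z.
Proof.
  intros Hk c. assert (K := Zs_nz k Hk). pose proof (cdot_pj k (cvec (c * x) (c * y) (c * z))) as H.
  pose proof (fun i => pj_n3 k _ i (cvec_n3 (c * x) (c * y) (c * z))) as Hn.
  apply Sat_control; auto.
  - now apply adm_mode.
  - intros r. rewrite <- mode_scl. apply in_X0_mode; auto.
    + rewrite cdot_cscl, H. ring.
    + intros i Hi. rewrite Hn by auto. ring.
Qed.

Lemma Steer_lin k x y z x' y' z' p q : Steer k x y z -> Steer k x' y' z' -> Steer k (p * x + q * x') (p * y + q * y') (p * z + q * z').
Proof.
  intros H H' c. pose proof (Sat_add Zs gc dst dst_pos _ _ (H (RtoC p * c)%C) (H' (RtoC q * c)%C)) as S.
  rewrite <- mode_add in S. erewrite mode_ext; [exact S|]. intros i. cbv beta. rewrite <- pj_add. apply pj_ext.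
  intros [|[|[|a]]]; cbn [cvec]; rewrite ?RtoC_plus, ?RtoC_mult; ring.
Qed.

Lemma Steer_eq k x y z x' y' z' : Steer k x y z -> x = x' -> y = y' -> z = z' -> Steer k x' y' z'.
Proof. now intros H -> -> ->. Qed.

Lemma Steer_opp k x y z : Steer k x y z -> Steer (z3opp k) x y z.
Proof.
  intros H c. rewrite mode_opp. erewrite mode_ext; [exact (H (Cconj c))|]. intros i. unfold cjv at 1.
  rewrite pj_opp. rewrite <- pj_cjv. apply pj_ext. intros [|[|[|a]]]; unfold cjv; cbn [cvec]; rewrite ?Cmult_conj, ?Cconj_RtoC; reflexivity.
Qed.

(** A bracket excites [j - k] as well as [j + k]; averaging with the phases turned by [i] and [- i]
    removes the former. What is left is the real formula [(k . p) q + (j . q) p] for directions [p]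
    at [j] and [q] at [k]. *)
Lemma Steer_bracket j k x y z x' y' z' : j <> z3zero -> k <> z3zero -> z3add j k <> z3zero -> Steer j x y z -> Steer k x' y' z' ->
  kc 0 j * x + kc 1 j * y + kc 2 j * z = 0 -> kc 0 k * x' + kc 1 k * y' + kc 2 k * z' = 0 ->
  let al := kc 0 k * x + kc 1 k * y + kc 2 k * z in let be := kc 0 j * x' + kc 1 j * y' + kc 2 j * z' in
  Steer (z3add j k) (al * x' + be * x) (al * y' + be * y) (al * z' + be * z).
Proof.
  intros Hj Hk Hjk Aj Ak Ej Ek al be c.
  destruct (box_ex_list [j; k]) as [N HN]. assert (In j (box N) /\ In k (box N)) as [Ij Ik] by (split; apply HN; simpl; auto).
  assert (I2 : (Ci * Ci = - (1))%C) by (apply ceq; simpl; ring).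
  assert (Zj : forall d : C, cdot (cvec (d * x) (d * y) (d * z)) j = 0%C).
  { intros d. transitivity (d * RtoC (kc 0 j * x + kc 1 j * y + kc 2 j * z))%C; [|rewrite Ej; ring]. unfold cdot, s3, cvec. rewrite !RtoC_plus, !RtoC_mult. ring. }
  assert (Zk : forall d : C, cdot (cvec (d * x') (d * y') (d * z')) k = 0%C).
  { intros d. transitivity (d * RtoC (kc 0 k * x' + kc 1 k * y' + kc 2 k * z'))%C; [|rewrite Ek; ring]. unfold cdot, s3, cvec. rewrite !RtoC_plus, !RtoC_mult. ring. }
  assert (Sj : forall d, Sat (mode j (cvec (d * x) (d * y) (d * z)))).
  { intros d. erewrite mode_ext; [apply (Aj d)|]. intros i. symmetry. now apply pj_id. }
  assert (Sk : forall d, Sat (mode k (cvec (d * x') (d * y') (d * z')))).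
  { intros d. erewrite mode_ext; [apply (Ak d)|]. intros i. symmetry. now apply pj_id. }
  assert (B : forall d d', Sat (bs N (mode j (cvec (d * x) (d * y) (d * z))) (mode k (cvec (d' * x') (d' * y') (d' * z'))))).
  { intros d d'. apply Sat_bracket; auto using supp_mode, Bn_mode_self, in_X0_zero.
    change (adm (bs N (mode j (cvec (d * x) (d * y) (d * z))) (mode k (cvec (d' * x') (d' * y') (d' * z'))))).
    rewrite bs_mode by auto. apply adm_cadd; apply adm_mode_bet; auto using cvec_n3; [now apply cdot_cjv|].
    intros i Hi. unfold cjv. now rewrite cvec_n3, Cconj_RtoC. }
  (* The phase [Ci * c] cancels the [- Ci] of the convection term, so that [c] comes out unchanged;
     [/ 2] undoes the doubling in [bs_mode_sum]. *)
  pose proof (Sat_scal Zs gc dst (/ 2) _ (Sat_add Zs gc dst dst_pos _ _ (B (Ci * c)%C 1%C) (B (Ci * (Ci * c))%C (- Ci * 1)%C))) as S.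
  set (z0 := cvec (Ci * c * x) (Ci * c * y) (Ci * c * z)) in S. set (w0 := cvec (1 * x') (1 * y') (1 * z')) in S.
  assert (Q1 : cvec (Ci * (Ci * c) * x) (Ci * (Ci * c) * y) (Ci * (Ci * c) * z) = fun i => (Ci * z0 i)%C).
  { apply functional_extensionality. intros [|[|[|i]]]; cbn [z0 cvec]; ring. }
  assert (Q2 : cvec (- Ci * 1 * x') (- Ci * 1 * y') (- Ci * 1 * z') = fun i => (- Ci * w0 i)%C).
  { apply functional_extensionality. intros [|[|[|i]]]; cbn [w0 cvec]; ring. }
  rewrite Q1, Q2 in S. rewrite bs_mode_sum in S; auto; [|apply Zj|apply Zk].
  rewrite cscl_cscl in S. replace (/ 2 * 2) with 1 in S by lra.
  replace (mode (z3add j k) (pj (z3add j k) (cvec (c * (al * x' + be * x)%R) (c * (al * y' + be * y)%R) (c * (al * z' + be * z)%R)))) with (cscl 1 (mode (z3add j k) (bet j z0 k w0))); auto.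
  rewrite <- mode_scl. apply mode_ext. intros i. rewrite Cmult_1_l. unfold bet. apply pj_ext. intros a.
  assert (D1 : cdot z0 k = (Ci * c * al)%C) by (unfold al, cdot, s3, z0, cvec; rewrite !RtoC_plus, !RtoC_mult; ring).
  assert (D2 : cdot w0 j = RtoC be) by (unfold be, cdot, s3, w0, cvec; rewrite !RtoC_plus, !RtoC_mult; ring).
  rewrite D1, D2. destruct a as [|[|[|a]]]; cbn [cvec z0 w0]; rewrite ?RtoC_plus, ?RtoC_mult; try ring.
  all: match goal with |- _ = ?r => transitivity ((- (Ci * Ci)) * r)%C; [ring|rewrite I2; ring] end.
Qed.
Lemma Full_opp k : Full k -> Full (z3opp k).
Proof. intros H x y z. now apply Steer_opp. Qed.

Lemma Steer_shift k x y z r : k <> z3zero -> Steer k x y z -> Steer k (x + r * kc 0 k) (y + r * kc 1 k) (z + r * kc 2 k).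
Proof.
  intros Hk H c. erewrite mode_ext; [exact (H c)|]. intros i.
  assert (K : ksq k <> 0).
  { intros K. apply Hk. unfold ksq in K.
    assert (Q : forall i, (i < 3)%nat -> zc i k = 0%Z).
    { intros j Hj. apply eq_IZR. change (kc j k = 0). assert (kc j k * kc j k = 0); [|nra].
      destruct j as [|[|[|j]]]; try lia; nra. }
    destruct k as [[a b] d]. apply f_equal2; [apply f_equal2|]; [apply (Q 0%nat)|apply (Q 1%nat)|apply (Q 2%nat)]; lia. }
  assert (C1 : cdot (cvec (c * kc 0 k) (c * kc 1 k) (c * kc 2 k)) k = (c * RtoC (ksq k))%C).
  { unfold cdot, s3, ksq. cbn [cvec]. rewrite !RtoC_plus, !RtoC_pow. simpl. ring. }
  rewrite (pj_ext k _ (fun i => cvec (c * x) (c * y) (c * z) i + RtoC r * cvec (c * kc 0 k) (c * kc 1 k) (c * kc 2 k) i)%C).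
  - rewrite pj_add, pj_scal. unfold pj at 2. rewrite C1.
    replace (cvec (c * kc 0 k) (c * kc 1 k) (c * kc 2 k) i) with (c * RtoC (kc i k))%C.
    + unfold Rdiv. rewrite RtoC_mult. transitivity (pj k (cvec (c * x) (c * y) (c * z)) i + RtoC r * (c * RtoC (kc i k) * (1 - RtoC (/ ksq k * ksq k))))%C; [rewrite RtoC_mult; ring|].
      rewrite Rinv_l by auto. ring.
    + destruct i as [|[|[|i]]]; auto. unfold kc. destruct k as [[? ?] ?]. cbn [cvec zc]. ring.
  - intros [|[|[|a]]]; cbn [cvec]; rewrite ?RtoC_plus, ?RtoC_mult; ring.
Qed.

(** Cramer's rule in the basis formed by [p], [q] and the frequency [l]; the component along [l] is
    free by [Steer_shift]. *)
Lemma Full_of_two l p1 p2 p3 q1 q2 q3 : l <> z3zero -> Steer l p1 p2 p3 -> Steer l q1 q2 q3 ->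
  kc 0 l * (p2 * q3 - p3 * q2) + kc 1 l * (p3 * q1 - p1 * q3) + kc 2 l * (p1 * q2 - p2 * q1) <> 0 -> Full l.
Proof.
  intros Hl Hp Hq HD x y z. set (a := kc 0 l) in *. set (b := kc 1 l) in *. set (c := kc 2 l) in *.
  set (D := a * (p2 * q3 - p3 * q2) + b * (p3 * q1 - p1 * q3) + c * (p1 * q2 - p2 * q1)) in *.
  set (al := (a * (y * q3 - z * q2) + b * (z * q1 - x * q3) + c * (x * q2 - y * q1)) / D).
  set (be := (a * (p2 * z - p3 * y) + b * (p3 * x - p1 * z) + c * (p1 * y - p2 * x)) / D).
  set (ga := (x * (p2 * q3 - p3 * q2) + y * (p3 * q1 - p1 * q3) + z * (p1 * q2 - p2 * q1)) / D).
  pose proof (Steer_shift l _ _ _ ga Hl (Steer_lin l _ _ _ _ _ _ al be Hp Hq)) as H. fold a b c in H.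
  replace x with (al * p1 + be * q1 + ga * a) by (unfold al, be, ga; field_simplify_eq; auto; unfold D; ring).
  replace y with (al * p2 + be * q2 + ga * b) by (unfold al, be, ga; field_simplify_eq; auto; unfold D; ring).
  replace z with (al * p3 + be * q3 + ga * c) by (unfold al, be, ga; field_simplify_eq; auto; unfold D; ring).
  exact H.
Qed.

Lemma ksq_IZR k : ksq k = IZR (z3normsq k).
Proof. unfold ksq, z3normsq, kc. rewrite !plus_IZR, !mult_IZR. ring. Qed.

(* With [n = j x k], the pairs [(n, n x k)] and [(n x j, n x k)] produce the directions [n] and [n x (k - j)] at [j + k];
   the component of the latter orthogonal to [j + k] is nonzero because [|j| <> |k|]. *)
Lemma Full_admissible j k : j <> z3zero -> k <> z3zero -> Full j -> Full k -> admissible j k -> Full (z3add j k).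
Proof.
  intros Hj Hk Fj Fk [HL Hn].
  assert (Hl : z3add j k <> z3zero).
  { intros e. apply Hn. assert (k = z3opp j) by (rewrite <- (z3addK k j), z3add_comm, e; z3). subst k.
    apply eq_IZR. rewrite <- !ksq_IZR. unfold ksq. rewrite !kc_opp. ring. }
  assert (Hq : ksq k - ksq j <> 0) by (rewrite !ksq_IZR; intros e; apply Hn, eq_IZR; lra).
  set (j0 := kc 0 j) in *. set (j1 := kc 1 j). set (j2 := kc 2 j). set (k0 := kc 0 k). set (k1 := kc 1 k). set (k2 := kc 2 k).
  set (n0 := j1 * k2 - j2 * k1). set (n1 := j2 * k0 - j0 * k2). set (n2 := j0 * k1 - j1 * k0).
  set (N := n0 * n0 + n1 * n1 + n2 * n2).
  assert (HN : N <> 0).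
  { intros e. assert (n0 = 0 /\ n1 = 0 /\ n2 = 0) as (e0 & e1 & e2) by (unfold N in e; repeat split; nra).
    assert (Q : forall i, (i < 3)%nat -> kc i k = 0 /\ - kc i j = 0).
    { intros i Hi. apply HL. intros m Hm. change (IZR (zc m j)) with (kc m j). change (IZR (zc m k)) with (kc m k). unfold n0, n1, n2, j0, j1, j2, k0, k1, k2 in *.
      destruct i as [|[|[|i]]]; try lia; destruct m as [|[|[|m]]]; try lia; lra. }
    destruct (HL 1 1); [|lra]. intros m Hm. change (1 * kc m j + 1 * kc m k = 0). destruct (Q m Hm). lra. }
  assert (Nj : j0 * n0 + j1 * n1 + j2 * n2 = 0) by (unfold n0, n1, n2; ring).
  assert (Nk : k0 * n0 + k1 * n1 + k2 * n2 = 0) by (unfold n0, n1, n2; ring).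
  assert (Q1 : k0 * (n1 * j2 - n2 * j1) + k1 * (n2 * j0 - n0 * j2) + k2 * (n0 * j1 - n1 * j0) = N) by (unfold N, n0, n1, n2; ring).
  assert (Q2 : j0 * (n1 * k2 - n2 * k1) + j1 * (n2 * k0 - n0 * k2) + j2 * (n0 * k1 - n1 * k0) = - N) by (unfold N, n0, n1, n2; ring).
  pose proof (Steer_bracket j k n0 n1 n2 (n1 * k2 - n2 * k1) (n2 * k0 - n0 * k2) (n0 * k1 - n1 * k0) Hj Hk Hl (Fj _ _ _) (Fk _ _ _)) as H1.
  pose proof (Steer_bracket j k (n1 * j2 - n2 * j1) (n2 * j0 - n0 * j2) (n0 * j1 - n1 * j0) (n1 * k2 - n2 * k1) (n2 * k0 - n0 * k2) (n0 * k1 - n1 * k0) Hj Hk Hl (Fj _ _ _) (Fk _ _ _)) as H2.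
  cbv zeta in H1, H2. fold j0 j1 j2 k0 k1 k2 in H1, H2. rewrite Nk, Q2 in H1. rewrite Q1, Q2 in H2.
  specialize (H1 Nj ltac:(ring)). specialize (H2 ltac:(ring) ltac:(ring)).
  eapply Full_of_two; [exact Hl|exact H1|exact H2|]. rewrite !kc_add. fold j0 j1 j2 k0 k1 k2.
  unfold ksq in Hq. fold j0 j1 j2 k0 k1 k2 in Hq. clearbody n0 n1 n2 j0 j1 j2 k0 k1 k2.
  match goal with |- ?x <> 0 => replace x with (N * N * N * ((k0 ^ 2 + k1 ^ 2 + k2 ^ 2) - (j0 ^ 2 + j1 ^ 2 + j2 ^ 2))) end.
  - repeat apply Rmult_integral_contrapositive_currified; auto.
  - set (D0 := k0 - j0). set (D1 := k1 - j1). set (D2 := k2 - j2).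
    assert (ND : n0 * D0 + n1 * D1 + n2 * D2 = 0) by (unfold D0, D1, D2; lra).
    assert (NL : n0 * (j0 + k0) + n1 * (j1 + k1) + n2 * (j2 + k2) = 0) by lra.
    transitivity (N * N * ((n0 * n0 + n1 * n1 + n2 * n2) * (D0 * (j0 + k0) + D1 * (j1 + k1) + D2 * (j2 + k2)) - (n0 * D0 + n1 * D1 + n2 * D2) * (n0 * (j0 + k0) + n1 * (j1 + k1) + n2 * (j2 + k2)))).
    + rewrite ND, NL. fold N. unfold D0, D1, D2. ring.
    + unfold D0, D1, D2. clearbody N. ring.
Qed.

Lemma Full_Zn n k : Zn Zs n k -> k <> z3zero /\ Full k.
Proof.
  revert k. induction n as [|n IH]; intros l; simpl.
  - intros H. split; auto. intros x y z. now apply Steer_control.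
  - intros [H|[Hl (j & k & Hj & Hk & Ha & ->)]]; auto. destruct (IH j Hj), (IH k Hk). split; auto. now apply Full_admissible.
Qed.

(** Equal lengths put two axes outside [Full_admissible]: their bracket gives only the vertical
    polarisation at [(s1, s2, 0)]. Bracketing that with two horizontal polarisations at [(0, 0, s3)]
    gives two directions which, with the corner itself, are independent. *)
Lemma Full_corner s1 s2 s3 : (Z.abs s1 = 1)%Z -> (Z.abs s2 = 1)%Z -> (Z.abs s3 = 1)%Z ->
  Full (s1, 0, 0)%Z -> Full (0, s2, 0)%Z -> Full (0, 0, s3)%Z -> Full (s1, s2, s3).
Proof.
  intros A1 A2 A3 F1 F2 F3.
  assert (N1 : ((s1, 0, 0)%Z : Z3) <> z3zero) by (intros e; injection e; lia).
  assert (N2 : ((0, s2, 0)%Z : Z3) <> z3zero) by (intros e; injection e; lia).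
  assert (N3 : ((0, 0, s3)%Z : Z3) <> z3zero) by (intros e; injection e; lia).
  assert (N12 : ((s1, s2, 0)%Z : Z3) <> z3zero) by (intros e; injection e; lia).
  assert (N123 : ((s1, s2, s3) : Z3) <> z3zero) by (intros e; injection e; lia).
  assert (E12 : z3add (s1, 0, 0)%Z (0, s2, 0)%Z = (s1, s2, 0)%Z) by (unfold z3add; apply f_equal2; [apply f_equal2|]; lia).
  assert (E123 : z3add (s1, s2, 0)%Z (0, 0, s3)%Z = (s1, s2, s3)) by (unfold z3add; apply f_equal2; [apply f_equal2|]; lia).
  assert (B : Steer (s1, s2, 0)%Z 0 0 (IZR s2)).
  { pose proof (Steer_bracket (s1, 0, 0)%Z (0, s2, 0)%Z 0 1 0 0 0 1 N1 N2 ltac:(now rewrite E12) (F1 _ _ _) (F2 _ _ _)) as H.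
    rewrite E12 in H. unfold kc, zc in H. specialize (H ltac:(ring) ltac:(ring)). cbv zeta in H.
    eapply Steer_eq; [exact H|ring|ring|ring]. }
  pose proof (fun x y => Steer_bracket (s1, s2, 0)%Z (0, 0, s3)%Z 0 0 (IZR s2) x y 0 N12 N3 ltac:(now rewrite E123) B (F3 _ _ _)) as H.
  rewrite E123 in H. unfold kc, zc in H. cbv zeta in H.
  pose proof (H 1 0 ltac:(ring) ltac:(ring)) as H1. pose proof (H 0 1 ltac:(ring) ltac:(ring)) as H2.
  eapply Full_of_two; [exact N123|exact H1|exact H2|]. unfold kc, zc.
  assert (C : forall s, (Z.abs s = 1)%Z -> s = 1%Z \/ s = (-1)%Z) by lia.
  destruct (C s1 A1), (C s2 A2), (C s3 A3); subst; lra.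
Qed.

Ltac axis_step F1 F2 :=
  match goal with |- Full ?l => match type of F1 with Full ?j => match type of F2 with Full ?k =>
    replace l with (z3add j k) by (unfold z3add; apply f_equal2; [apply f_equal2|]; lia); apply Full_admissible; auto;
    [intros e; injection e; lia|intros e; injection e; lia|split; [|unfold z3normsq, zc; nia]]
  end end end;
  let a := fresh "a" in let b := fresh "b" in let H := fresh "H" in
  intros a b H; pose proof (H 0%nat ltac:(lia)); pose proof (H 1%nat ltac:(lia)); pose proof (H 2%nat ltac:(lia)); unfold zc in *.

(** * Frequencies generated by the coordinate axes *)

Section Axes.
Hypothesis (Fx : forall s, (Z.abs s = 1)%Z -> Full (s, 0, 0)%Z) (Fy : forall s, (Z.abs s = 1)%Z -> Full (0, s, 0)%Z)
  (Fz : forall s, (Z.abs s = 1)%Z -> Full (0, 0, s)%Z).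

Lemma lin_indep_axis (x y z s : R) : s <> 0 -> y <> 0 \/ z <> 0 -> forall a b, a * x + b * s = 0 -> a * y = 0 -> a * z = 0 -> a = 0 /\ b = 0.
Proof.
  intros Hs Hyz a b H1 H2 H3. assert (a = 0) by (destruct Hyz; [apply (Rmult_eq_reg_r y)|apply (Rmult_eq_reg_r z)]; lra).
  split; auto. subst a. apply (Rmult_eq_reg_r s); lra.
Qed.

(** A unit step is admissible as soon as the point is neither on the axis of the step nor on the
    unit sphere, the two cases that the side conditions exclude. *)
Lemma step_x a b c s : Full (a, b, c) -> (Z.abs s = 1)%Z -> b <> 0%Z \/ c <> 0%Z -> (a * a + b * b + c * c <> 1)%Z -> Full ((a + s)%Z, b, c).
Proof.
  intros F Hs Hbc Hn. pose proof (Fx s Hs) as F'. axis_step F F'.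
  apply (lin_indep_axis (IZR a) (IZR b) (IZR c) (IZR s)); try lra; [intros e; apply eq_IZR in e; lia|].
  destruct Hbc; [left|right]; intros e; apply eq_IZR in e; lia.
Qed.
Lemma step_y a b c s : Full (a, b, c) -> (Z.abs s = 1)%Z -> a <> 0%Z \/ c <> 0%Z -> (a * a + b * b + c * c <> 1)%Z -> Full (a, (b + s)%Z, c).
Proof.
  intros F Hs Hbc Hn. pose proof (Fy s Hs) as F'. axis_step F F'.
  apply (lin_indep_axis (IZR b) (IZR a) (IZR c) (IZR s)); try lra; [intros e; apply eq_IZR in e; lia|].
  destruct Hbc; [left|right]; intros e; apply eq_IZR in e; lia.
Qed.
Lemma step_z a b c s : Full (a, b, c) -> (Z.abs s = 1)%Z -> a <> 0%Z \/ b <> 0%Z -> (a * a + b * b + c * c <> 1)%Z -> Full (a, b, (c + s)%Z).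
Proof.
  intros F Hs Hbc Hn. pose proof (Fz s Hs) as F'. axis_step F F'.
  apply (lin_indep_axis (IZR c) (IZR a) (IZR b) (IZR s)); try lra; [intros e; apply eq_IZR in e; lia|].
  destruct Hbc; [left|right]; intros e; apply eq_IZR in e; lia.
Qed.

Lemma away_from_zero (Q : Z -> Prop) : (forall s, (Z.abs s = 1)%Z -> Q s) -> (forall a s, (Z.abs s = 1)%Z -> a <> 0%Z -> Q a -> Q (a + s)%Z) ->
  forall a, a <> 0%Z -> Q a.
Proof.
  intros H1 H2. assert (W : forall s, (Z.abs s = 1)%Z -> forall n, Q (s * (1 + Z.of_nat n))%Z).
  { intros s Hs n. induction n as [|n IH].
    - replace (s * _)%Z with s by lia. auto.
    - replace (s * (1 + Z.of_nat (S n)))%Z with (s * (1 + Z.of_nat n) + s)%Z by lia. apply H2; auto. nia. }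
  intros a Ha. replace a with (Z.sgn a * (1 + Z.of_nat (Z.to_nat (Z.abs a - 1))))%Z; [apply W; lia|].
  rewrite Z2Nat.id by lia. transitivity (Z.abs a * Z.sgn a)%Z; [ring|apply Z.abs_sgn].
Qed.

(** The walk starts at a corner and moves away from zero in one coordinate at a time; all
    coordinates stay nonzero, so every step is admissible. *)
Lemma Full_interior a b c : a <> 0%Z -> b <> 0%Z -> c <> 0%Z -> Full (a, b, c).
Proof.
  intros Ha Hb Hc. revert c Hc. apply away_from_zero; [intros s3 H3|intros; apply step_z; auto; nia].
  revert b Hb. apply away_from_zero; [intros s2 H2|intros; apply step_y; auto; nia].
  revert a Ha. apply away_from_zero; [intros s1 H1|intros; apply step_x; auto; nia].
  apply Full_corner; auto.
Qed.

Lemma Full_from_axes k : k <> z3zero -> Full k.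
Proof.
  destruct k as [[a b] c]. intros Hk.
  (* Coordinates that vanish are reached last, by a step from 1 to 0; the point before the step has
     length greater than 1. *)
  assert (P1 : forall b c, b <> 0%Z -> c <> 0%Z -> Full (0%Z, b, c)).
  { intros b' c' Hb Hc. change 0%Z with (1 + -1)%Z. apply step_x; auto; [now apply Full_interior|nia]. }
  assert (P2 : forall a c, a <> 0%Z -> c <> 0%Z -> Full (a, 0%Z, c)).
  { intros a' c' Ha Hc. change 0%Z with (1 + -1)%Z. apply step_y; auto; [now apply Full_interior|nia]. }
  assert (P3 : forall a b, a <> 0%Z -> b <> 0%Z -> Full (a, b, 0%Z)).
  { intros a' b' Ha Hb. change 0%Z with (1 + -1)%Z. apply step_z; auto; [now apply Full_interior|nia]. }
  destruct (Z.eq_dec a 0) as [->|Ha], (Z.eq_dec b 0) as [->|Hb], (Z.eq_dec c 0) as [->|Hc]; auto.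
  - change (Full (0, 1 + -1, c)%Z). apply step_y; auto; [now apply P1|nia].
  - change (Full (1 + -1, b, 0)%Z). apply step_x; auto; [now apply P3|nia].
  - change (Full (a, 1 + -1, 0)%Z). apply step_y; auto; [now apply P3|nia].
  - now apply Full_interior.
Qed.
End Axes.

Lemma Full_all : determining Zs \/ (Zs (1, 0, 0)%Z /\ Zs (0, 1, 0)%Z /\ Zs (0, 0, 1)%Z) -> forall k, k <> z3zero -> Full k.
Proof.
  intros [H|(H1 & H2 & H3)] k Hk.
  - destruct (H k Hk) as [n Hn]. now apply (Full_Zn n).
  - assert (C : forall s, (Z.abs s = 1)%Z -> s = 1%Z \/ s = (-1)%Z) by lia.
    apply Full_from_axes; auto; intros s Hs; destruct (C s Hs); subst; try (intros x y z; now apply Steer_control).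
    + change (Full (z3opp (1, 0, 0)%Z)). apply Full_opp. intros x y z; now apply Steer_control.
    + change (Full (z3opp (0, 1, 0)%Z)). apply Full_opp. intros x y z; now apply Steer_control.
    + change (Full (z3opp (0, 0, 1)%Z)). apply Full_opp. intros x y z; now apply Steer_control.
Qed.

(** Each coefficient splits into a real and an imaginary direction, with phases 1 and [Ci]. Summing
    modes over the cube counts [k] and [- k] twice, whence the factor [/ 2]. *)
Lemma Sat_trunc : (forall k, k <> z3zero -> Full k) -> forall N u, adm u -> Sat (trunc N u).
Proof.
  intros HF N u ((Hr & Hd & Hn) & Hz & _).
  assert (S1 : forall k, Sat (mode k (u k))).
  { intros k. destruct (classic (k = z3zero)) as [->|Hk].
    - rewrite (mode_ext _ _ (fun i => RtoC 0 * 0)%C) by (intros; rewrite Hz; ring). rewrite mode_scl.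
      replace (cscl 0 _) with czero; [apply Sat_zero|]. coef_ring.
    - pose proof (Sat_add Zs gc dst dst_pos _ _ (HF k Hk (Re (u k 0%nat)) (Re (u k 1%nat)) (Re (u k 2%nat)) 1%C) (HF k Hk (Im (u k 0%nat)) (Im (u k 1%nat)) (Im (u k 2%nat)) Ci)) as S.
      rewrite <- mode_add in S. erewrite mode_ext; [exact S|]. intros i. cbv beta. rewrite <- pj_add, <- (pj_id k (u k)) by apply Hd. apply pj_ext.
      intros [|[|[|a]]]; cbn [cvec]; try (apply ceq; simpl; ring). rewrite Hn by lia. ring. }
  assert (S2 : forall L, Sat (fun l i => csum L (fun k => RtoC (/ 2) * mode k (u k) l i)%C)).
  { induction L as [|k L IH].
    - apply Sat_zero.
    - replace (fun l i => csum (k :: L) _) with (cadd (cscl (/ 2) (mode k (u k))) (fun l i => csum L (fun k => RtoC (/ 2) * mode k (u k) l i)%C)).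
      + apply Sat_add; auto. now apply Sat_scal.
      + apply coef_ext; intros. now rewrite csum_cons. }
  replace (trunc N u) with (fun l i => csum (box N) (fun k => RtoC (/ 2) * mode k (u k) l i)%C); auto.
  apply coef_ext; intros l i.
  assert (D : forall l (z : Z3 -> C), (forall k, k <> l -> z k = 0%C) -> csum (box N) z = if inb (box N) l then z l else 0%C).
  { clear l. intros l z Hzz. destruct (inb (box N) l) eqn:El.
    - apply inb_true in El. rewrite (csum_support (box N) [l]); auto.
      + unfold csum, lsum; simpl. apply ceq; simpl; ring.
      + repeat constructor; auto.
      + intros a _ Ha. apply Hzz. intros ->. apply Ha. now left.
      + intros a [->|[]] Ha. tauto.
    - apply csum_zero. intros k Hk. apply Hzz. intros ->. apply inb_true in Hk. congruence. }
  rewrite (csum_ext _ _ (fun k => RtoC (/ 2) * one k (u k) l i + RtoC (/ 2) * one (z3opp k) (cjv (u k)) l i)%C) by (intros; unfold mode, cadd; ring).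
  rewrite csum_plus, (D l), (D (z3opp l)).
  - rewrite z3oppK, !one_in. unfold cjv. rewrite Hr, Cconj_conj. unfold trunc.
    replace (inb (box N) (z3opp l)) with (inb (box N) l).
    + destruct (inb (box N) l); [|ring]. transitivity (RtoC (/ 2 + / 2) * u l i)%C; [rewrite RtoC_plus; ring|].
      replace (/ 2 + / 2) with 1 by lra. ring.
    + apply Bool.eq_iff_eq_true. now rewrite !inb_true, box_opp_iff.
  - intros k Hk. rewrite one_out; [ring|]. intros ->. apply Hk. now rewrite z3oppK.
  - intros k Hk. rewrite one_out by congruence. ring.
Qed.
End Modes.

(** ** Coordinates on the range of the projection *)

(** The real or imaginary part of one Fourier coefficient; these functionals separate states. *)
Definition ell (l : Z3 * nat * bool) (c : coef) : R := let '(k, i, b) := l in if b then Re (c k i) else Im (c k i).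
Definition comb (L : list nat) (p : nat -> R) (b : nat -> coef) : coef := fold_right (fun j acc => cadd (cscl (p j) (b j)) acc) czero L.

Lemma ell_add l u v : ell l (cadd u v) = ell l u + ell l v.
Proof. destruct l as [[k i] [|]]; unfold ell, cadd; [apply Re_plus|apply Im_plus]. Qed.
Lemma ell_scl l r u : ell l (cscl r u) = r * ell l u.
Proof. destruct l as [[k i] [|]]; unfold ell, cscl; [apply Re_scal|apply Im_scal]. Qed.
Lemma ell_zero l : ell l czero = 0.
Proof. destruct l as [[k i] [|]]; reflexivity. Qed.
Lemma ell_csb l u v : ell l (csb u v) = ell l u - ell l v.
Proof. rewrite csb_scl, ell_add, ell_scl. ring. Qed.
Lemma ell_nonzero u : u <> czero -> exists l, ell l u <> 0.
Proof.
  intros H. apply NNPP. intros Hn. apply H. apply coef_ext; intros k i. unfold czero.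
  apply ceq; apply NNPP; intros e; apply Hn; [exists (k, i, true)|exists (k, i, false)]; exact e.
Qed.

Lemma comb_cons j L p b : comb (j :: L) p b = cadd (cscl (p j) (b j)) (comb L p b). Proof. reflexivity. Qed.
Lemma comb_snoc L d p b : comb (L ++ [d]) p b = cadd (comb L p b) (cscl (p d) (b d)).
Proof. induction L as [|j L IH]; cbn [app]; rewrite !comb_cons; [|rewrite IH]; apply coef_ext; intros; unfold cadd, comb, czero; simpl; unfold czero; ring. Qed.
Lemma comb_ext L p q b b' : (forall j, In j L -> p j = q j /\ b j = b' j) -> comb L p b = comb L q b'.
Proof.
  induction L as [|j L IH]; intros H; auto. rewrite !comb_cons. rewrite IH by (intros; apply H; simpl; auto).
  destruct (H j (or_introl eq_refl)) as [-> ->]. reflexivity.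
Qed.
Lemma comb_lin L p q r b : comb L (fun j => r * p j + q j) b = cadd (cscl r (comb L p b)) (comb L q b).
Proof.
  induction L as [|j L IH]; [|rewrite !comb_cons, IH]; apply coef_ext; intros; unfold cadd, cscl; rewrite ?RtoC_plus, ?RtoC_mult; simpl; unfold czero; ring.
Qed.
Lemma comb_zero L p b : (forall j, p j = 0) -> comb L p b = czero.
Proof.
  intros H. induction L as [|j L IH]; auto. rewrite comb_cons, IH, H. coef_ring.
Qed.
Lemma ell_comb l L p b : ell l (comb L p b) = lsum L (fun j => p j * ell l (b j)).
Proof. induction L as [|j L IH]; [apply ell_zero|]. rewrite comb_cons, ell_add, ell_scl, IH. reflexivity. Qed.
Lemma comb_move L p b r u : comb L p (fun j => cadd (b j) (cscl (- r j) u)) = cadd (comb L p b) (cscl (- lsum L (fun j => p j * r j)) u).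
Proof.
  induction L as [|j L IH].
  - apply coef_ext; intros. unfold comb, cadd, cscl, czero, lsum. simpl. rewrite RtoC_opp. ring.
  - rewrite !comb_cons, IH. apply coef_ext; intros. unfold cadd, cscl.
    change (lsum (j :: L) (fun j => p j * r j)) with (p j * r j + lsum L (fun j => p j * r j)).
    rewrite !RtoC_opp, !RtoC_plus, !RtoC_mult. ring.
Qed.
Lemma adm_comb L p b : (forall j, In j L -> adm (b j)) -> adm (comb L p b).
Proof.
  induction L as [|j L IH]; intros H; [apply adm_zero|]. rewrite comb_cons. apply adm_cadd; [apply adm_cscl, H|apply IH; intros; apply H]; simpl; auto.
Qed.

Lemma lsum_delta d i (x : nat -> R) : (i < d)%nat -> lsum (seq 0 d) (fun j => x j * (if Nat.eqb i j then 1 else 0)) = x i.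
Proof.
  intros Hi. rewrite (lsum_support _ [i]); [| apply seq_NoDup |repeat constructor; auto| |].
  - unfold lsum. cbn [map fold_right]. rewrite Nat.eqb_refl. ring.
  - intros a _ Ha. destruct (Nat.eqb_spec i a) as [->|]; [|ring]. elim Ha. now left.
  - intros a [->|[]] Ha. elim Ha. apply in_seq. lia.
Qed.

(* Gaussian elimination: a finite-dimensional space of fields has a basis dual to finitely many Fourier coordinates. *)
Lemma echelon (f : nat -> coef) (S : coef -> Prop) : (forall a u v, S u -> S v -> S (cadd u (cscl a v))) -> (forall n, S (f n)) ->
  forall N, exists d b l, (forall i, (i < d)%nat -> S (b i)) /\
  (forall i j, (i < d)%nat -> (j < d)%nat -> ell (l i) (b j) = if Nat.eqb i j then 1 else 0) /\
  forall n, (n < N)%nat -> f n = comb (seq 0 d) (fun i => ell (l i) (f n)) b.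
Proof.
  intros HS Hf. induction N as [|N (d & b & l & Sb & Db & Cb)].
  - exists 0%nat, (fun _ => czero), (fun _ => (z3zero, 0%nat, true)). repeat split; intros; lia.
  (* The residue modulo the basis found so far. If it is nonzero, some coordinate [l0] detects it;
     the normalised residue joins the basis and the old vectors are cleared of that coordinate. *)
  - set (r := csb (f N) (comb (seq 0 d) (fun i => ell (l i) (f N)) b)).
    assert (Er : f N = cadd (comb (seq 0 d) (fun i => ell (l i) (f N)) b) r) by (apply coef_ext; intros; unfold r, csb, cadd; ring).
    destruct (classic (r = czero)) as [E0|E0].
    { exists d, b, l. repeat split; auto. intros n Hn. destruct (Nat.eq_dec n N) as [->|]; [|apply Cb; lia].
      rewrite Er at 1. rewrite E0. coef_ring. }
    destruct (ell_nonzero r E0) as [l0 Hl0]. set (bn := cscl (/ ell l0 r) r).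
    assert (SL : forall L p u, (forall i, In i L -> (i < d)%nat) -> S u -> S (csb u (comb L p b))).
    { induction L as [|j L IH]; intros p u HL Su.
      - replace (csb u (comb [] p b)) with u; auto. apply coef_ext; intros; unfold csb, comb; simpl; unfold czero; ring.
      - rewrite comb_cons. replace (csb u (cadd (cscl (p j) (b j)) (comb L p b))) with (cadd (csb u (comb L p b)) (cscl (- p j) (b j))).
        + apply HS; [apply IH; auto; intros; apply HL; simpl; auto|apply Sb, HL; simpl; auto].
        + coef_ring. }
    assert (Sr : S r) by (apply SL; auto; intros i Hi; apply in_seq in Hi; lia).
    assert (Sn : S bn).
    { replace bn with (cadd r (cscl (/ ell l0 r - 1) r)); [now apply HS|]. apply coef_ext; intros; unfold bn, cadd, cscl; rewrite RtoC_minus; ring. }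
    assert (B0 : forall i, (i < d)%nat -> ell (l i) bn = 0).
    { intros i Hi. unfold bn. rewrite ell_scl. replace (ell (l i) r) with 0; [ring|]. unfold r. rewrite ell_csb, ell_comb.
      rewrite (lsum_ext _ _ (fun j => ell (l j) (f N) * (if Nat.eqb i j then 1 else 0))).
      - rewrite lsum_delta by auto. ring.
      - intros j Hj. apply in_seq in Hj. now rewrite Db by lia. }
    assert (B1 : ell l0 bn = 1) by (unfold bn; rewrite ell_scl; now field).
    set (b' := fun i => if Nat.ltb i d then cadd (b i) (cscl (- ell l0 (b i)) bn) else bn).
    set (l' := fun i => if Nat.ltb i d then l i else l0).
    assert (Lt : forall i, (i < d)%nat -> b' i = cadd (b i) (cscl (- ell l0 (b i)) bn) /\ l' i = l i).
    { intros i Hi. unfold b', l'. apply Nat.ltb_lt in Hi. now rewrite Hi. }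
    assert (Ld : b' d = bn /\ l' d = l0) by (unfold b', l'; now rewrite Nat.ltb_irrefl).
    assert (CB : forall g, comb (seq 0 (Datatypes.S d)) (fun i => ell (l' i) g) b' =
      cadd (comb (seq 0 d) (fun i => ell (l i) g) b) (cscl (ell l0 (csb g (comb (seq 0 d) (fun i => ell (l i) g) b))) bn)).
    { intros g. rewrite seq_S. cbn [Nat.add]. rewrite comb_snoc. destruct Ld as [-> ->].
      rewrite (comb_ext _ _ (fun i => ell (l i) g) _ (fun i => cadd (b i) (cscl (- ell l0 (b i)) bn))).
      - rewrite comb_move, ell_csb, ell_comb. coef_ring.
      - intros j Hj. apply in_seq in Hj. destruct (Lt j ltac:(lia)) as [-> ->]. auto. }
    exists (Datatypes.S d), b', l'. split; [|split].
    + intros i Hi. destruct (Nat.eq_dec i d) as [->|]; [now rewrite (proj1 Ld)|]. rewrite (proj1 (Lt i ltac:(lia))). apply HS; auto. apply Sb; lia.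
    + intros i j Hi Hj. destruct (Nat.eq_dec i d) as [->|ni], (Nat.eq_dec j d) as [->|nj].
      * destruct Ld as [-> ->]. now rewrite Nat.eqb_refl.
      * destruct Ld as [_ ->]. rewrite (proj1 (Lt j ltac:(lia))), ell_add, ell_scl, B1. destruct (Nat.eqb_spec d j); [lia|ring].
      * destruct Ld as [-> _]. rewrite (proj2 (Lt i ltac:(lia))), B0 by lia. destruct (Nat.eqb_spec i d); [lia|ring].
      * rewrite (proj2 (Lt i ltac:(lia))), (proj1 (Lt j ltac:(lia))), ell_add, ell_scl, B0, Db by lia. ring.
    + intros n Hn. rewrite CB. destruct (Nat.eq_dec n N) as [->|].
      * fold r. rewrite Er at 1. f_equal. unfold bn. rewrite cscl_cscl, Rinv_r by auto. coef_ring.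
      * rewrite <- Cb by lia. rewrite csb_self, ell_zero. coef_ring.
Qed.

Lemma cf_synth c : adm c -> cf (synth c) = c.
Proof.
  intros Hc. apply coef_ext; intros k i. unfold cf. destruct (Nat.ltb_spec i 3) as [Hi|Hi].
  - replace (fcomp i (synth c)) with (SF (fun k => c k i)); [rewrite fc_SF; auto; [now apply adm_RD|]|].
    + intros l. apply Hc.
    + symmetry. now apply fcomp_synth.
  - symmetry. now apply Hc.
Qed.

(* [f g <= (f^2 + 1)/2] when [|g| <= 1]: a bound on the L2 norm bounds the Fourier coefficients. *)
Lemma int_mul_bound f g : cper f -> cper g -> (forall x, Rabs (g x) <= 1) -> integral (fun x => f x ^ 2) <= 1 ->
  Rabs (integral (fun x => f x * g x)) <= 1 + vol.
Proof.
  intros Hf Hg Hb HI.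
  assert (C2 : cper (fun x => f x ^ 2)) by (apply (cper_ext (fun x => f x * f x)); [intros; ring|now apply cper_mult]).
  assert (C3 : cper (fun x => f x ^ 2 + 1)) by (apply cper_plus; auto; apply cper_const).
  assert (E3 : integral (fun x => f x ^ 2 + 1) <= 1 + vol).
  { rewrite (int_plus (fun x => f x ^ 2) (fun _ => 1)); auto; [|apply cper_const]. rewrite int_const. lra. }
  assert (G : forall x, -1 <= g x <= 1) by (intros x; apply Rabs_le_between, Hb).
  apply Rabs_le. split.
  - assert (integral (fun x => -1 * (f x * g x)) <= 1 + vol); [|rewrite int_scal in H by (now apply cper_mult); lra].
    eapply Rle_trans; [|exact E3]. apply int_le; auto; [now apply cper_scal, cper_mult|]. intros x. specialize (G x). pose proof (pow2_ge_0 (f x + g x / 2)). assert (0 <= (1 - g x) * (1 + g x)) by (apply Rmult_le_pos; lra). lra.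
  - eapply Rle_trans; [|exact E3]. apply int_le; auto; [now apply cper_mult|]. intros x. specialize (G x). pose proof (pow2_ge_0 (f x - g x / 2)). assert (0 <= (1 - g x) * (1 + g x)) by (apply Rmult_le_pos; lra). lra.
Qed.

Lemma ell_Hnorm c l : adm c -> Hnorm 0 (synth c) <= 1 -> Rabs (ell l c) <= (1 + vol) / vol.
Proof.
  intros Hc H. pose proof vol_pos as HV. assert (HC : 0 <= (1 + vol) / vol) by (apply Rlt_le, Rdiv_lt_0_compat; lra).
  destruct l as [[k i] b]. destruct (Nat.ltb_spec i 3) as [Hi|Hi].
  2:{ destruct Hc as ((_ & _ & Hn) & _). unfold ell. rewrite Hn by auto. destruct b; simpl; now rewrite Rabs_R0. }
  assert (CS : cper (SF (fun k => c k i))) by (apply cper_SF; now apply adm_RD).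
  assert (I1 : integral (fun x => SF (fun k => c k i) x ^ 2) <= 1).
  { assert (Q : forall j, (j < 3)%nat -> 0 <= integral (fun x => SF (fun k => c k j) x ^ 2)).
    { intros j Hj. replace 0 with (integral (fun _ => 0)) by (rewrite int_const; ring). apply int_le; [apply cper_const| |intros; apply pow2_ge_0].
      apply (cper_ext (fun x => SF (fun k => c k j) x * SF (fun k => c k j) x)); [intros; ring|].
      apply cper_mult; apply cper_SF; now apply adm_RD. }
    assert (Hm_sq 0 (synth c) <= 1).
    { unfold Hnorm in H. destruct (Rle_dec 0 (Hm_sq 0 (synth c))) as [L|L]; [|lra].
      rewrite <- (sqrt_sqrt _ L). pose proof (sqrt_pos (Hm_sq 0 (synth c))). nra. }
    unfold Hm_sq in H0. cbn in H0. pose proof (Q 0%nat ltac:(lia)). pose proof (Q 1%nat ltac:(lia)). pose proof (Q 2%nat ltac:(lia)).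
    cbn [pow] in *. destruct i as [|[|[|i]]]; try lia; lra. }
  assert (F : c k i = fc (SF (fun k => c k i)) k) by (rewrite fc_SF; auto; [now apply adm_RD|intros l'; apply Hc]).
  assert (Cc : cper (cosk k)) by apply cper_cosk. assert (Cs : cper (sink k)) by apply cper_sink.
  unfold ell. rewrite F. unfold fc, Re, Im. cbn [fst snd].
  destruct b; [|rewrite Rabs_Ropp]; unfold Rdiv; rewrite Rabs_mult, (Rabs_pos_eq (/ vol)) by (left; apply Rinv_0_lt_compat; lra);
    (apply Rmult_le_compat_r; [left; apply Rinv_0_lt_compat; lra|]); apply int_mul_bound; auto; intros x; apply Rabs_le; [apply COS_bound|apply SIN_bound].
Qed.

(** A basis of the range dual to Fourier coordinates turns equality of projections into [d] scalar
    equations, each linear in the state and bounded in one Sobolev norm. *)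
Theorem projection_coordinates pi : fd_cont_proj pi -> exists d b l m C, 0 <= C /\ (forall i, (i < d)%nat -> adm (b i)) /\
  (forall c, adm c -> adm (cf (pi (synth c)))) /\
  (forall c, adm c -> pi (synth c) = synth (comb (seq 0 d) (fun i => ell (l i) (cf (pi (synth c)))) b)) /\
  (forall c e r, adm c -> adm e -> cf (pi (synth (cadd c (cscl r e)))) = cadd (cf (pi (synth c))) (cscl r (cf (pi (synth e))))) /\
  (forall i j, (i < d)%nat -> (j < d)%nat -> ell (l i) (cf (pi (synth (b j)))) = if Nat.eqb i j then 1 else 0) /\
  forall c B i, adm c -> sob m c B -> Rabs (ell (l i) (cf (pi (synth c)))) <= C * B.
Proof.
  intros (Hin & Hlin & Hid & (N & e & He & Hspan) & Hcont). set (Pi := fun c => cf (pi (synth c))).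
  assert (PA : forall c, adm c -> adm (Pi c) /\ synth (Pi c) = pi (synth c)) by (intros c Hc; apply inX_repr, Hin, inX_synth, Hc).
  assert (PL : forall c u r, adm c -> adm u -> Pi (cadd c (cscl r u)) = cadd (Pi c) (cscl r (Pi u))).
  { intros c u r Hc Hu. unfold Pi at 1.
    replace (pi (synth (cadd c (cscl r u)))) with (synth (cadd (Pi c) (cscl r (Pi u)))).
    - apply cf_synth. apply adm_cadd; [|apply adm_cscl]; now apply PA.
    - replace (synth (cadd c (cscl r u))) with (fadd (fscal 1 (synth c)) (fscal r (synth u))).
      + apply functional_extensionality. intros x. rewrite Hlin by (now apply inX_synth). destruct (PA c Hc) as [A1 <-]. destruct (PA u Hu) as [A2 <-].
        rewrite <- synth_cadd, <- synth_cscl by (auto using adm_cscl). unfold fadd, fscal. f_equal. destruct (synth (Pi c) x) as [[? ?] ?]. unfold v3scal. apply f_equal2; [apply f_equal2|]; ring.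
      + rewrite !synth_cscl, synth_cadd by (auto using adm_cscl). f_equal. coef_ring. }
  assert (PI2 : forall c, adm c -> Pi (Pi c) = Pi c).
  { intros c Hc. destruct (PA c Hc) as [A1 E1]. unfold Pi at 1. rewrite E1. replace (pi (pi (synth c))) with (pi (synth c)); auto.
    symmetry. apply functional_extensionality. apply Hid. now apply inX_synth. }
  assert (PZ : Pi czero = czero).
  { replace czero with (cadd czero (cscl (-1) czero)) at 1 by (coef_ring).
    rewrite PL by apply adm_zero. rewrite <- csb_scl. apply csb_self. }
  set (E' := fun i => cf (e i)).
  assert (AE : forall i, adm (E' i) /\ synth (E' i) = e i) by (intros; now apply inX_repr).
  assert (SC : forall L p x, synth (comb L p E') x = fold_right v3add v3zero (map (fun i => v3scal (p i) (e i x)) L)).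
  { induction L as [|j L IH]; intros p x.
    - unfold synth, comb. cbn [fold_right map]. unfold czero. now rewrite SF_zero.
    - rewrite comb_cons. cbn [map fold_right]. rewrite <- IH, <- synth_cadd, <- synth_cscl, (proj2 (AE j)).
      + reflexivity.
      + apply AE.
      + apply adm_cscl, AE.
      + apply adm_comb. intros; apply AE. }
  assert (PC : forall L p, Pi (comb L p E') = comb L p (fun i => Pi (E' i))).
  { induction L as [|j L IH]; intros p; auto. rewrite !comb_cons.
    replace (cadd (cscl (p j) (E' j)) (comb L p E')) with (cadd (comb L p E') (cscl (p j) (E' j))) by (coef_ring).
    rewrite PL, IH; [coef_ring|apply adm_comb; intros; apply AE|apply AE]. }
  destruct (echelon (fun n => Pi (E' n)) (fun c => adm c /\ Pi c = c)) with (N := N) as (d & b & l & Sb & Db & Cb).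
  { intros a u v [A1 E1] [A2 E2]. split; [apply adm_cadd; auto; now apply adm_cscl|]. rewrite PL by auto. now rewrite E1, E2. }
  { intros n. split; [apply PA, AE|apply PI2, AE]. }
  assert (Rep : forall c, adm c -> Pi c = comb (seq 0 d) (fun i => ell (l i) (Pi c)) b).
  { intros c Hc. destruct (Hspan (synth c) (inX_synth c Hc)) as [p Hp].
    assert (E1 : Pi c = comb (seq 0 N) p (fun i => Pi (E' i))).
    { rewrite <- (PI2 c Hc). rewrite <- PC. f_equal. unfold Pi. rewrite <- (cf_synth (comb (seq 0 N) p E')) by (apply adm_comb; intros; apply AE).
      f_equal. apply functional_extensionality. intros x. now rewrite Hp, SC. }
    rewrite E1. clear - Cb. assert (HL : forall n, In n (seq 0 N) -> (n < N)%nat) by (intros n Hn; apply in_seq in Hn; lia).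
    induction (seq 0 N) as [|j L IH].
    - symmetry. apply comb_zero. intros. apply ell_zero.
    - rewrite comb_cons at 1. rewrite IH by (intros; apply HL; simpl; auto). rewrite (Cb j) at 1 by (apply HL; simpl; auto).
      rewrite <- comb_lin. apply comb_ext. intros i _. split; auto. now rewrite comb_cons, ell_add, ell_scl. }
  (* Continuity is used at 0 only: a distance below [/ 2] forces the [L2] norm below 1, through the
     minimum in the metric, and homogeneity turns this into a linear bound. *)
  destruct (Hcont (synth czero) (/ 2) (inX_synth _ adm_zero) ltac:(lra)) as (del & Hdel & HD).
  destruct (dinf_small del Hdel) as (m & eta & Heta & HS). pose proof vol_pos as HV.
  assert (HCv : 0 < (1 + vol) / vol) by (apply Rdiv_lt_0_compat; lra).
  assert (Bd : forall c l, adm c -> sob m c eta -> Rabs (ell l (Pi c)) <= (1 + vol) / vol).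
  { intros c l0 Hc Hs. destruct (PA c Hc) as [Ac Ec]. destruct (PA czero adm_zero) as [_ Ez]. rewrite PZ in Ez.
    assert (D : dinf (pi (synth czero)) (pi (synth c)) < / 2).
    { apply HD; [now apply inX_synth|]. apply HS; auto using adm_zero. rewrite csb_swap.
      replace eta with (Rabs (-1) * eta) by (rewrite Rabs_left by lra; ring). apply sob_scl.
      replace (csb c czero) with c by (coef_ring). exact Hs. }
    rewrite <- Ec, <- Ez in D. pose proof (dinf_lower (synth czero) (synth (Pi c))) as Lw. rewrite synth_csb in Lw by (auto using adm_zero).
    replace (ell l0 (Pi c)) with (- ell l0 (csb czero (Pi c))) by (rewrite ell_csb, ell_zero; ring). rewrite Rabs_Ropp.
    apply ell_Hnorm; [apply adm_csb; auto using adm_zero|]. unfold Rmin in Lw. destruct (Rle_dec _ _); lra. }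
  exists d, b, l, m, ((1 + vol) / vol / eta). split; [apply Rlt_le, Rdiv_lt_0_compat; lra|]. split; [intros; now apply Sb|].
  split; [intros; now apply PA|]. split; [|split; [exact PL|split]].
  - intros c Hc. fold (Pi c). rewrite <- Rep by auto. symmetry. now apply PA.
  - intros i j Hi Hj. change (cf (pi (synth (b j)))) with (Pi (b j)). rewrite (proj2 (Sb j Hj)). auto.
  - intros c B i Hc Hs. change (cf (pi (synth c))) with (Pi c). pose proof (sob_pos _ _ _ Hs) as PB.
    apply le_epsilon. intros ep Hep. set (x := ep / ((1 + vol) / vol / eta)).
    assert (PX : 0 < (1 + vol) / vol / eta) by (apply Rdiv_lt_0_compat; lra).
    assert (Hx : 0 < x) by (apply Rdiv_lt_0_compat; lra).
    replace ((1 + vol) / vol / eta * B + ep) with ((1 + vol) / vol * ((B + x) / eta)) by (unfold x; field; lra).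
    (* The state is rescaled to size [eta]; [x] avoids division by zero when [B = 0] and costs
       exactly [ep]. *)
    set (r := eta / (B + x)). assert (Hr : 0 < r) by (apply Rdiv_lt_0_compat; lra).
    assert (Es : sob m (cscl r c) eta).
    { apply (sob_le _ _ (Rabs r * (B + x))); [apply sob_scl; eapply sob_le; eauto; lra|]. rewrite Rabs_pos_eq by lra. unfold r. right. field. lra. }
    pose proof (Bd _ (l i) (adm_cscl r c Hc) Es) as Q.
    replace (cscl r c) with (cadd czero (cscl r c)) in Q by (coef_ring).
    rewrite PL, PZ, ell_add, ell_zero, ell_scl, Rplus_0_l, Rabs_mult, (Rabs_pos_eq r) in Q by (auto using adm_zero; lra).
    apply (Rmult_le_reg_l r); auto. eapply Rle_trans; [exact Q|]. unfold r. right. field. lra.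
Qed.

(** ** Approximate controllability with exact projection *)

(** Parameters are sequences, so one type serves every [d]; [cdst] compares the first [d]
    entries. *)
Definition cube : Type := {p : nat -> R | forall i, Rabs (p i) <= 1}.
Definition pr (p : cube) : nat -> R := proj1_sig p.
Definition cdst (d : nat) (p q : cube) : R := lsum (seq 0 d) (fun i => Rabs (pr p i - pr q i)).

Lemma cdst_pos d p q : 0 <= cdst d p q.
Proof. apply lsum_nonneg. intros; apply Rabs_pos. Qed.
Lemma cdst_term d p q i : (i < d)%nat -> Rabs (pr p i - pr q i) <= cdst d p q.
Proof. intros Hi. apply (lsum_term_le (seq 0 d) (fun i => Rabs (pr p i - pr q i))); [apply in_seq; lia|intros; apply Rabs_pos]. Qed.

(** The iterates converge coordinatewise by comparison with a geometric series. The limit is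
    completed by 0 beyond [d], so the fixed point equation is asserted for the first [d] entries. *)
Lemma cube_contraction d (T : cube -> cube) : (forall p q, cdst d (T p) (T q) <= / 2 * cdst d p q) ->
  exists p, forall i, (i < d)%nat -> pr (T p) i = pr p i.
Proof.
  intros HT. assert (H0 : forall i : nat, Rabs ((fun _ => 0) i) <= 1) by (intros; rewrite Rabs_R0; lra).
  set (q := fix q n := match n with O => exist _ (fun _ : nat => 0) H0 : cube | S n => T (q n) end).
  set (D := cdst d (q 1%nat) (q 0%nat)).
  assert (G : forall n, cdst d (q (S n)) (q n) <= D * (/ 2) ^ n).
  { induction n as [|n IH]; [unfold D; rewrite Rmult_1_r; apply Rle_refl|].
    change (cdst d (T (q (S n))) (T (q n)) <= D * (/ 2) ^ S n). replace (D * (/ 2) ^ S n) with (/ 2 * (D * (/ 2) ^ n)) by (simpl; ring).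
    rtrans HT. apply Rmult_le_compat_l; [lra|exact IH]. }
  assert (L : forall i, (i < d)%nat -> exists l : R, is_lim_seq (fun n => pr (q n) i) l).
  { intros i Hi. set (a := fun n => pr (q (S n)) i - pr (q n) i).
    assert (Ex : ex_series a).
    { apply (ex_series_le a (fun n => D * (/ 2) ^ n)).
      - intros n. change (Rabs (a n) <= D * (/ 2) ^ n). eapply Rle_trans; [now apply (cdst_term d (q (S n)) (q n))|apply G].
      - apply (ex_series_scal D (fun n => (/ 2) ^ n)). apply ex_series_geom. rewrite Rabs_pos_eq; lra. }
    destruct Ex as [l Hl]. exists (l + pr (q 0%nat) i). apply is_lim_seq_incr_1.
    apply is_lim_seq_ext with (fun n => sum_n a n + pr (q 0%nat) i).
    - intros n. induction n as [|n IH]; [rewrite sum_O; unfold a; ring|]. rewrite sum_Sn. unfold plus; simpl.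
      replace (sum_n a n + a (S n) + 0) with (sum_n a n + 0 + a (S n)) by ring. unfold pr in *. simpl in IH. rewrite IH. unfold a, pr. simpl. ring.
    - apply is_lim_seq_plus'; [exact Hl|apply is_lim_seq_const]. }
  set (lim := fun i => if Nat.ltb i d then real (Lim_seq (fun n => pr (q n) i)) else 0).
  assert (Hlim : forall i, (i < d)%nat -> is_lim_seq (fun n => pr (q n) i) (lim i)).
  { intros i Hi. destruct (L i Hi) as [l Hl]. unfold lim. apply Nat.ltb_lt in Hi. rewrite Hi. now rewrite (is_lim_seq_unique _ _ Hl). }
  assert (Hb : forall i, Rabs (lim i) <= 1).
  { intros i. destruct (Nat.lt_ge_cases i d) as [Hi|Hi].
    - specialize (Hlim i Hi). apply (is_lim_seq_le (fun n => Rabs (pr (q n) i)) (fun _ => 1) (Rabs (lim i)) 1); [intros n; apply (proj2_sig (q n))| |apply is_lim_seq_const].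
      now apply (is_lim_seq_abs _ (Finite (lim i))).
    - unfold lim. apply Nat.ltb_ge in Hi. rewrite Hi, Rabs_R0. lra. }
  exists (exist _ lim Hb). set (p := exist _ lim Hb : cube). intros i Hi. apply cond_eq. intros ep Hep.
  apply Rle_lt_trans with 0; auto.
  apply (is_lim_seq_le (fun _ => Rabs (pr (T p) i - pr p i)) (fun n => / 2 * cdst d p (q n) + Rabs (pr (q (S n)) i - lim i)) (Rabs (pr (T p) i - pr p i)) 0).
  - intros n. replace (pr (T p) i - pr p i) with ((pr (T p) i - pr (T (q n)) i) + (pr (q (S n)) i - lim i)) by (unfold p, pr; simpl; ring).
    rtrans Rabs_triang. apply Rplus_le_compat_r. eapply Rle_trans; [now apply (cdst_term d)|apply HT].
  - apply is_lim_seq_const.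
  - replace (Finite 0) with (Finite (/ 2 * lsum (seq 0 d) (fun _ => 0) + 0)).
    + apply is_lim_seq_plus'.
      * apply (is_lim_seq_scal_l _ (/ 2) (Finite (lsum (seq 0 d) (fun _ => 0)))). apply is_lim_seq_lsum. intros j Hj. apply in_seq in Hj.
        rewrite <- Rabs_R0. apply (is_lim_seq_abs _ (Finite 0)). rewrite <- (Rminus_diag (lim j)). apply is_lim_seq_minus'; [apply is_lim_seq_const|apply Hlim; lia].
      * rewrite <- Rabs_R0. apply (is_lim_seq_abs _ (Finite 0)). rewrite <- (Rminus_diag (lim i)). apply is_lim_seq_minus'; [|apply is_lim_seq_const].
        apply (is_lim_seq_incr_1 (fun n => pr (q n) i)). now apply Hlim.
    + rewrite (lsum_zero _ (fun _ => 0)) by auto. f_equal. ring.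
Qed.

Lemma trunc_tail u m e : adm u -> 0 < e -> exists N0, forall N, (N0 <= N)%nat -> sob m (csb (trunc N u) u) e.
Proof.
  intros (_ & _ & Hs) He. destruct (Hs (S m)) as [B HB]. pose proof (sob_pos _ _ _ HB) as B0.
  destruct (INR_unbounded (B / e)) as [N0 HN0]. exists (S N0). intros N HN.
  assert (HI : INR N0 < INR N) by (apply lt_INR; lia). assert (0 <= B / e) by (apply Rdiv_le_0_compat; lra).
  rewrite csb_swap. replace e with (Rabs (-1) * e) by (rewrite Rabs_left by lra; ring). apply sob_scl.
  apply (sob_le _ _ (B / INR N)).
  - apply (sob_lim m (fun n => csb (trunc n u) (trunc N u))).
    + exists N. intros n Hn. apply tail_norm; [lia|auto|]. now apply sob_trunc.
    + apply clim_csb; [apply clim_trunc|apply clim_const].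
  - apply (Rmult_le_reg_r (INR N / e)); [apply Rdiv_lt_0_compat; lra|].
    replace (B / INR N * (INR N / e)) with (B / e) by (field; lra). replace (e * (INR N / e)) with (INR N) by (field; lra). lra.
Qed.

Lemma trunc_tail_list d (b : nat -> coef) m e : (forall j, (j < d)%nat -> adm (b j)) -> 0 < e ->
  exists N0, forall N, (N0 <= N)%nat -> forall j, (j < d)%nat -> sob m (csb (trunc N (b j)) (b j)) e.
Proof.
  intros Hb He. induction d as [|d IH]; [exists 0%nat; intros; lia|].
  destruct IH as [N1 H1]; [intros; apply Hb; lia|]. destruct (trunc_tail (b d) m e (Hb d ltac:(lia)) He) as [N2 H2].
  exists (Nat.max N1 N2). intros N HN j Hj. destruct (Nat.eq_dec j d) as [->|]; [apply H2|apply H1]; lia.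
Qed.

Lemma sob_comb m L p b M B : 0 <= M -> (forall j, In j L -> Rabs (p j) <= M /\ sob m (b j) B) -> sob m (comb L p b) (INR (length L) * (M * B)).
Proof.
  intros HM. induction L as [|j L IH]; intros H.
  - simpl. rewrite Rmult_0_l. apply sob_zero.
  - rewrite comb_cons. cbn [length]. rewrite S_INR. replace ((INR (length L) + 1) * (M * B)) with (M * B + INR (length L) * (M * B)) by ring.
    destruct (H j (or_introl eq_refl)) as [H1 H2]. apply sob_add; [|apply IH; intros; apply H; simpl; auto].
    eapply sob_le; [apply sob_scl; exact H2|]. apply Rmult_le_compat_r; auto. eapply sob_pos; eauto.
Qed.

(** Passage from the inductive relation to indexed pieces. The empty composition has no piece,
    whence the conditions [0 < n] and the separate clause for [n = 0]. *)
Lemma reach_segments Zs gc u w t : adm gc -> reach Zs gc u w t -> exists n h tau U,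
  (forall i, (i < n)%nat -> in_X0 Zs (h i) /\ 0 < tau i /\ euler_sol (tau i) (fadd (synth gc) (h i)) (U i)) /\
  ((0 < n)%nat -> U 0%nat 0 = synth u) /\ (forall i, (S i < n)%nat -> U (S i) 0 = U i (tau i)) /\ lsum (seq 0 n) tau = t /\
  (n = 0%nat -> w = u) /\ ((0 < n)%nat -> U (n - 1)%nat (tau (n - 1)%nat) = synth w).
Proof.
  intros Hg H. induction H as [u|u w w' s t hc e H (n & h & tau & U & H1 & H2 & H3 & H4 & H5 & H6) HX Hh Ht He E0 E1].
  - exists 0%nat, (fun _ _ => v3zero), (fun _ => 0), (fun _ _ _ => v3zero). repeat split; intros; try lia; auto.
  - exists (S n), (fun i => if Nat.ltb i n then h i else synth hc), (fun i => if Nat.ltb i n then tau i else t),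
      (fun i => if Nat.ltb i n then U i else fun r => synth (e r)).
    assert (Q : Nat.ltb n n = false) by (apply Nat.ltb_irrefl).
    split; [|split; [|split; [|split; [|split]]]].
    + intros i Hi. destruct (Nat.ltb_spec i n); [auto|]. split; [auto|]. split; auto. rewrite synth_cadd by auto. apply csol_euler; auto. now apply adm_cadd.
    + intros _. destruct (Nat.ltb_spec 0 n); [auto|]. rewrite E0, H5 by lia. reflexivity.
    + intros i Hi. destruct (Nat.ltb_spec i n); [|lia]. destruct (Nat.ltb_spec (S i) n); [auto|].
      rewrite E0. replace i with (n - 1)%nat by lia. rewrite H6 by lia. reflexivity.
    + rewrite seq_S, lsum_app. cbn [Nat.add]. unfold lsum at 2. cbn [map fold_right]. rewrite Q, <- H4, Rplus_0_r. f_equal.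
      apply lsum_ext. intros i Hi. apply in_seq in Hi. destruct (Nat.ltb_spec i n); [auto|lia].
    + lia.
    + intros _. replace (S n - 1)%nat with n by lia. rewrite Q. now rewrite E1.
Qed.

(** * One round of steering towards a family of targets *)

Section Round.
Variables (Zs : Z3 -> Prop) (gc : coef).
Hypothesis g_adm : adm gc.
Variables (d : nat) (v : coef) (b : nat -> coef).
Hypothesis v_adm : adm v.
Hypothesis b_adm : forall j, (j < d)%nat -> adm (b j).
Hypothesis HS : forall N u, adm u -> Sat Zs gc (cdst d) (trunc N u).
Notation fam := (@fam cube (cdst d)).
Notation reach := (reach Zs gc).

Lemma cfam_coord j : (j < d)%nat -> cfam (cdst d) (fun p => pr p j) 1.
Proof.
  intros Hj. split; [lra|]. split; [intros p; apply (proj2_sig p)|]. intros p q. rewrite Rmult_1_l. now apply cdst_term.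
Qed.

Lemma fam_comb m L (u : nat -> coef) B : (forall j, In j L -> (j < d)%nat /\ sob m (u j) B) -> fam m (fun p => comb L (pr p) u) (INR (length L) * B).
Proof.
  induction L as [|j L IH]; intros H.
  - simpl. rewrite Rmult_0_l. apply fam_const; [apply cdst_pos|apply sob_zero].
  - cbn [length]. rewrite S_INR. replace ((INR (length L) + 1) * B) with (1 * B + INR (length L) * B) by ring.
    destruct (H j (or_introl eq_refl)) as [H1 H2].
    apply (fam_add (cdst d) m (fun p => cscl (pr p j) (u j))); [|apply IH; intros; apply H; simpl; auto].
    apply fam_cmul; auto. now apply cfam_coord.
Qed.

(** The analogue of [Sat] for translation by a whole family [f p], needed because the target
    combines several fields with independent weights. *)
Definition Jump (f : cube -> coef) : Prop := forall m, (4 <= m)%nat -> exists m', (m <= m')%nat /\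
  forall M del, 0 <= M -> 0 < del -> forall w, (forall p, adm (w p)) -> fam m' w M ->
  exists tau w', 0 < tau <= del /\ (forall p, adm (w' p)) /\ fam m (fun p => csb (w' p) (cadd (w p) (f p))) del /\ forall p, reach (w p) (w' p) tau.

Lemma Jump_cons c Cc h f : Sat Zs gc (cdst d) h -> cfam (cdst d) c Cc -> (forall m, exists B, fam m f B) -> Jump f -> Jump (fun p => cadd (cscl (c p) h) (f p)).
Proof.
  intros [Ah Sh] Hc Hf Jf m Hm. destruct (Sh m Hm) as (m2 & Hm2 & Q2). destruct (Jf m2 ltac:(lia)) as (m1 & Hm1 & Q1).
  exists m1. split; [lia|]. intros M del HM Hd w Aw Fw. destruct (Hf m2) as [Bf HBf].
  assert (PB : 0 <= Bf) by (apply (fam_pos _ _ _ _ HBf); constructor; exists (fun _ => 0); intros; rewrite Rabs_R0; lra).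
  destruct (Q1 M (del / 2) HM ltac:(lra) w Aw Fw) as (t1 & w1 & T1 & Aw1 & F1 & R1).
  assert (Fw1 : fam m2 w1 (del / 2 + (M + Bf))).
  { eapply fam_ext; [|apply fam_add; [exact F1|apply fam_add; [apply (fam_mono _ m2 m1); [lia|exact Fw]|exact HBf]]].
    intros p. coef_ring. }
  destruct (Q2 (del / 2 + (M + Bf)) Cc (del / 2) ltac:(lra) (proj1 Hc) ltac:(lra) w1 c Aw1 Fw1 Hc) as (t2 & w2 & T2 & Aw2 & F2 & R2).
  exists (t1 + t2), w2. split; [lra|]. split; auto. split.
  - eapply fam_ext. 2: eapply (fam_le _ (cdst_pos d)); [apply fam_add; [exact F2|apply (fam_mono _ m m2); [lia|exact F1]]|lra].
    intros p. coef_ring.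
  - intros p. eapply reach_trans; eauto.
Qed.

Lemma Jump_Sat h : Sat Zs gc (cdst d) h -> Jump (fun _ => h).
Proof.
  intros [Ah Sh] m Hm. destruct (Sh m Hm) as (m' & Hm' & Q). exists m'. split; auto. intros M del HM Hd w Aw Fw.
  destruct (Q M (Rabs 1) del HM (Rabs_pos _) Hd w (fun _ => 1) Aw Fw (cfam_const _ (cdst_pos d) 1)) as (t & w' & T & Aw' & F & Rr).
  exists t, w'. split; auto. split; auto. split; auto. eapply fam_ext; [|exact F]. intros p. coef_ring.
Qed.

Lemma Jump_comb h0 N L : Sat Zs gc (cdst d) h0 -> (forall j, In j L -> (j < d)%nat) -> Jump (fun p => cadd (comb L (pr p) (fun j => trunc N (b j))) h0).
Proof.
  intros S0 HL. induction L as [|j L IH].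
  - replace (fun p => _) with (fun _ : cube => h0); [now apply Jump_Sat|]. apply functional_extensionality. intros p.
    apply coef_ext; intros. unfold cadd, comb; simpl; unfold czero. ring.
  - assert (Hj : (j < d)%nat) by (apply HL; simpl; auto).
    replace (fun p => _) with (fun p => cadd (cscl (pr p j) (trunc N (b j))) (cadd (comb L (pr p) (fun j => trunc N (b j))) h0)).
    + apply Jump_cons with 1; [apply HS, b_adm, Hj|now apply cfam_coord| |apply IH; intros; apply HL; simpl; auto].
      intros m. destruct (proj2 (proj2 (proj1 S0)) m) as [B0 HB0].
      assert (HB : exists B, forall j, In j L -> (j < d)%nat /\ sob m (trunc N (b j)) B).
      { clear - HL b_adm. induction L as [|i L IH]; [exists 0; intros ? []|]. destruct IH as [B HB]; [intros a Ha; apply HL; simpl in *; tauto|].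
        assert (Hi : (i < d)%nat) by (apply HL; simpl; auto). destruct (proj2 (proj2 (b_adm i Hi)) m) as [B' HB'].
        exists (Rmax B B'). intros a [<-|Ha]; [split; auto; eapply sob_le; [apply sob_trunc; eauto|apply Rmax_r]|].
        destruct (HB a Ha). split; auto. eapply sob_le; [eauto|apply Rmax_l]. }
      destruct HB as [B HB]. eexists. apply fam_add; [apply fam_comb; exact HB|apply fam_const; [apply cdst_pos|exact HB0]].
    + apply functional_extensionality. intros p. apply coef_ext; intros. rewrite comb_cons. unfold cadd. ring.
Qed.

Definition target (p : cube) : coef := cadd v (comb (seq 0 d) (pr p) b).

Lemma adm_target p : adm (target p).
Proof. apply adm_cadd; auto. apply adm_comb. intros j Hj. apply in_seq in Hj. apply b_adm. lia. Qed.

(** The threshold [s1] is independent of the start [x]: the translation to the target takes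
    negligible time, and the flow then runs freely near the target, whose size alone decides how
    long it stays close. *)
Lemma steer m del : (4 <= m)%nat -> 0 < del -> exists s1, 0 < s1 /\ forall s, 0 < s <= s1 -> forall x, adm x ->
  exists w, (forall p, adm (w p)) /\ fam m (fun p => csb (w p) (target p)) del /\ forall p, reach x (w p) s.
Proof.
  intros Hm Hd.
  assert (HB : exists B, forall j, (j < d)%nat -> sob (m + 3) (b j) B).
  { assert (Q : forall n, (n <= d)%nat -> exists B, forall j, (j < n)%nat -> sob (m + 3) (b j) B).
    { induction n as [|n IH]; intros Hn; [exists 0; intros; lia|]. destruct IH as [B HB]; [lia|]. destruct (proj2 (proj2 (b_adm n ltac:(lia))) (m + 3)%nat) as [B' HB'].
      exists (Rmax B B'). intros j Hj. destruct (Nat.eq_dec j n) as [->|]; [eapply sob_le; [eauto|apply Rmax_r]|]. eapply sob_le; [apply HB; lia|apply Rmax_l]. }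
    now apply Q. }
  destruct HB as [B HB]. destruct (proj2 (proj2 v_adm) (m + 3)%nat) as [Bv HBv].
  set (BY := Bv + INR (length (seq 0 d)) * B).
  assert (FY : fam (m + 3) target BY).
  { apply fam_add; [apply fam_const; auto; apply cdst_pos|]. apply fam_comb. intros j Hj. apply in_seq in Hj. split; [lia|apply HB; lia]. }
  assert (PY : 0 <= BY) by (apply (fam_pos _ _ _ _ FY); constructor; exists (fun _ => 0); intros; rewrite Rabs_R0; lra).
  (* The waiting move starts within distance 1 of the target family, whence the radius [BY + 1]. *)
  destruct (first_order_jump Zs gc g_adm (cdst d) (cdst_pos d) m czero (BY + 1) 0 (del / 2) Hm adm_zero (in_X0_zero Zs) ltac:(lra) ltac:(lra) ltac:(lra)) as (mu1 & Hmu1 & Wait).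
  exists mu1. split; auto. intros s Hs x Ax.
  set (e := Rmin (/ 2) (Rmin (del / 4) (s / 2))).
  assert (He : 0 < e /\ e <= / 2 /\ e <= del / 4 /\ e <= s / 2).
  { unfold e. pose proof (Rmin_l (/ 2) (Rmin (del / 4) (s / 2))). pose proof (Rmin_r (/ 2) (Rmin (del / 4) (s / 2))).
    pose proof (Rmin_l (del / 4) (s / 2)). pose proof (Rmin_r (del / 4) (s / 2)). repeat split; try lra. repeat apply Rmin_pos; lra. }
  (* The [d + 1] truncation errors of size [e1], for the [d] basis fields and for [csb v x], add up
     to [e]. *)
  set (e1 := e / (INR d + 1)). pose proof (pos_INR d) as Pd. assert (He1 : 0 < e1) by (apply Rdiv_lt_0_compat; lra).
  destruct (trunc_tail (csb v x) (m + 3) e1 (adm_csb _ _ v_adm Ax) He1) as [N1 H1].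
  destruct (trunc_tail_list d b (m + 3) e1 b_adm He1) as [N2 H2].
  set (N := Nat.max N1 N2).
  assert (J : Jump (fun p => cadd (comb (seq 0 d) (pr p) (fun j => trunc N (b j))) (trunc N (csb v x)))).
  { apply Jump_comb; [apply HS; now apply adm_csb|]. intros j Hj. apply in_seq in Hj. lia. }
  destruct (J (m + 3)%nat ltac:(lia)) as (m' & Hm' & Q). destruct (proj2 (proj2 Ax) m') as [Bx HBx].
  destruct (Q Bx e (sob_pos _ _ _ HBx) (proj1 He) (fun _ => x) (fun _ => Ax) (fam_const _ (cdst_pos d) m' x Bx HBx)) as (tau & w1 & T1 & Aw1 & F1 & R1).
  assert (F1' : fam (m + 3) (fun p => csb (w1 p) (target p)) (2 * e)).
  { eapply fam_ext. 2: eapply (fam_le _ (cdst_pos d)); [apply fam_add; [exact F1|apply fam_add; [apply (fam_comb (m + 3) (seq 0 d) (fun j => csb (trunc N (b j)) (b j)) e1)|apply (fam_const _ (cdst_pos d) (m + 3)); apply (H1 N); lia]]|].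
    - intros p. unfold target.
      assert (EC : forall L, comb L (pr p) (fun j => csb (trunc N (b j)) (b j)) = csb (comb L (pr p) (fun j => trunc N (b j))) (comb L (pr p) b)).
      { induction L as [|j L IH]; [symmetry; apply csb_self|]. rewrite !comb_cons, IH. coef_ring. }
      rewrite EC. coef_ring.
    - intros j Hj. apply in_seq in Hj. split; [lia|]. apply H2; lia.
    - rewrite length_seq. unfold e1. right. field. lra. }
  assert (Fw1 : fam (m + 3) w1 (BY + 1)).
  { eapply fam_ext. 2: eapply (fam_le _ (cdst_pos d)); [apply fam_add; [exact F1'|exact FY]|lra]. intros p. coef_ring. }
  destruct (Wait (s - tau) ltac:(lra) w1 (fun _ => 0) Aw1 Fw1) as (w2 & Aw2 & F2 & R2).
  { split; [lra|]. split; intros; rewrite ?Rminus_diag, Rabs_R0; lra. }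
  exists w2. split; auto. split.
  - eapply fam_ext. 2: eapply (fam_le _ (cdst_pos d)); [apply fam_add; [exact F2|apply (fam_mono _ m (m + 3)); [lia|exact F1']]|lra].
    intros p. coef_ring.
  - intros p. apply (reach_eq _ _ _ _ (tau + (s - tau))); [ring|]. eapply reach_trans; eauto.
Qed.
End Round.

Theorem theorem5p20 (Zs : Z3 -> Prop) (g : field) (pi : field -> field)
  (u0 v : field) (t eps : R) :
  (forall k, Zs k -> k <> z3zero) ->
  inX g ->
  fd_cont_proj pi ->
  (determining Zs \/
   (Zs (1%Z, 0%Z, 0%Z) /\ Zs (0%Z, 1%Z, 0%Z) /\ Zs (0%Z, 0%Z, 1%Z))) ->
  inX u0 -> inX v -> 0 < t -> 0 < eps ->
  exists (n : nat) (h : nat -> field) (tau : nat -> R) (U : nat -> R -> field),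
    (1 <= n)%nat /\
    (forall i, (i < n)%nat ->
       in_X0 Zs (h i) /\ 0 < tau i /\ euler_sol (tau i) (fadd g (h i)) (U i)) /\
    (forall x, U 0%nat 0 x = u0 x) /\
    (forall i x, (S i < n)%nat -> U (S i) 0 x = U i (tau i) x) /\
    sum_f_R0 tau (n - 1) = t /\
    dinf (U (n - 1)%nat (tau (n - 1)%nat)) v < eps /\
    (forall x, pi (U (n - 1)%nat (tau (n - 1)%nat)) x = pi v x).
Proof.
  intros HZ Hg Hpi Hmodes Hu0 Hv Ht He.
  destruct (inX_repr g Hg) as [Ag Eg]. destruct (inX_repr u0 Hu0) as [A0 E0]. destruct (inX_repr v Hv) as [Av Ev].
  set (gc := cf g) in *. set (c0 := cf u0) in *. set (cv := cf v) in *.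
  destruct (projection_coordinates pi Hpi) as (d & b & l & m0 & C & HC & Ab & APi & RPi & LPi & DPi & BPi).
  set (phi := fun i c => ell (l i) (cf (pi (synth c)))).
  assert (Lphi : forall i c u r, adm c -> adm u -> phi i (cadd c (cscl r u)) = phi i c + r * phi i u).
  { intros i c u r Hc Hu. unfold phi. now rewrite LPi, ell_add, ell_scl. }
  destruct (dinf_small eps He) as (m1 & eta & Heta & HS).
  set (m := (m0 + m1 + 4)%nat).
  assert (HB : exists B, 0 <= B /\ forall j, (j < d)%nat -> sob m (b j) B).
  { assert (Q : forall n, (n <= d)%nat -> exists B, 0 <= B /\ forall j, (j < n)%nat -> sob m (b j) B).
    { induction n as [|n IH]; intros Hn; [exists 0; split; [lra|intros; lia]|]. destruct IH as (B & PB & HB); [lia|]. destruct (proj2 (proj2 (Ab n ltac:(lia))) m) as [B' HB'].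
      exists (Rmax B B'). pose proof (Rmax_l B B'). split; [lra|]. intros j Hj. destruct (Nat.eq_dec j n) as [->|]; [eapply sob_le; [eauto|apply Rmax_r]|]. eapply sob_le; [apply HB; lia|auto]. }
    now apply Q. }
  destruct HB as (B & PB & HB). pose proof (pos_INR d) as Pd.
  assert (PdC : 0 <= INR d * C) by (apply Rmult_le_pos; auto).
  assert (PdCB : 0 <= INR d * C * B) by (apply Rmult_le_pos; auto).
  (* [K] collects the multiples of [del] met below: [C * del <= 1] keeps corrections in the cube,
     [2 * d * C * del <= 1] makes the correction map contract by one half, and
     [del + d * C * B * del <= eta] bounds the final deviation. *)
  set (K := 1 + C + 2 * (INR d * C) + INR d * C * B). assert (PK : 1 <= K) by (unfold K; lra).
  set (del := Rmin 1 eta / K). assert (Pm : 0 < Rmin 1 eta) by (apply Rmin_pos; lra).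
  assert (Hdel : 0 < del) by (apply Rdiv_lt_0_compat; lra).
  assert (EK : K * del = Rmin 1 eta) by (unfold del; field; lra).
  pose proof (Rmin_l 1 eta) as M1. pose proof (Rmin_r 1 eta) as M2.
  assert (KE : del + C * del + 2 * (INR d * C * del) + INR d * C * B * del = Rmin 1 eta) by (rewrite <- EK; unfold K; ring).
  assert (Q1 : 0 <= C * del) by (apply Rmult_le_pos; lra). assert (Q2 : 0 <= INR d * C * del) by (apply Rmult_le_pos; lra).
  assert (Q3 : 0 <= INR d * C * B * del) by (apply Rmult_le_pos; lra).
  destruct (steer Zs gc Ag d cv b Av Ab) with (m := m) (del := del) as (s1 & Hs1 & Hst); auto.
  { intros N u Au. apply Sat_trunc; auto using cdst_pos. apply Full_all; auto using cdst_pos. }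
  { unfold m; lia. }
  (* As [s1] is independent of the starting state, [t] may be cut into [n + 1] equal rounds, each
     shorter than [s1]. *)
  destruct (INR_unbounded (t / s1)) as [n Hn]. set (s := t / INR (S n)).
  assert (PS : 0 < INR (S n)) by (apply lt_0_INR; lia).
  assert (Hs : 0 < s <= s1).
  { split; [apply Rdiv_lt_0_compat; lra|]. apply (Rmult_le_reg_r (INR (S n) / s1)); [apply Rdiv_lt_0_compat; lra|].
    unfold s. replace (t / INR (S n) * (INR (S n) / s1)) with (t / s1) by (field; lra).
    replace (s1 * (INR (S n) / s1)) with (INR (S n)) by (field; lra). rewrite S_INR. lra. }
  (* The first [n] rounds use the parameter 0; only the last one is used as a family. *)
  assert (HR : forall k, exists x, adm x /\ reach Zs gc c0 x (INR k * s)).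
  { induction k as [|k (x & Ax & Rx)].
    - exists c0. split; auto. apply (reach_eq _ _ _ _ 0); [simpl; ring|constructor].
    - destruct (Hst s Hs x Ax) as (w & Aw & _ & Rw).
      assert (H0 : forall i : nat, Rabs ((fun _ => 0) i) <= 1) by (intros; rewrite Rabs_R0; lra).
      exists (w (exist _ _ H0)). split; auto. apply (reach_eq _ _ _ _ (INR k * s + s)); [rewrite S_INR; ring|]. eapply reach_trans; eauto. }
  destruct (HR n) as (x & Ax & Rx). destruct (Hst s Hs x Ax) as (w & Aw & [Fw1 Fw2] & Rw).
  set (r := fun p => csb (w p) (target d cv b p)).
  assert (At : forall p, adm (target d cv b p)) by (intros; now apply adm_target).
  assert (Ar : forall p, adm (r p)) by (intros; now apply adm_csb).
  assert (Br : forall i p, Rabs (phi i (r p)) <= C * del).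
  { intros i p. apply BPi; auto. apply (sob_mono m0 m); [unfold m; lia|apply Fw1]. }
  assert (BT : forall p i, Rabs (- phi i (r p)) <= 1) by (intros p i; rewrite Rabs_Ropp; specialize (Br i p); lra).
  (* A fixed point satisfies [p_i = - phi i (r p)]: the offset built into the target cancels the
     projected steering error. *)
  set (T := fun p => exist (fun q : nat -> R => forall i, Rabs (q i) <= 1) (fun i => - phi i (r p)) (BT p) : cube).
  destruct (cube_contraction d T) as [p Hp].
  { intros p q. unfold cdst at 1. apply Rle_trans with (lsum (seq 0 d) (fun _ => C * (del * cdst d p q))).
    - apply lsum_le. intros i _. unfold T, pr. cbn [proj1_sig].
      replace (- phi i (r p) - - phi i (r q)) with (- (phi i (r p) + -1 * phi i (r q))) by ring. rewrite Rabs_Ropp, <- Lphi, <- csb_scl by auto.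
      apply BPi; [now apply adm_csb|]. apply (sob_mono m0 m); [unfold m; lia|apply Fw2].
    - rewrite lsum_const, length_seq. pose proof (cdst_pos d p q). replace (INR d * (C * (del * cdst d p q))) with (INR d * C * del * cdst d p q) by ring.
      apply Rmult_le_compat_r; lra. }
  assert (Ep : forall i, (i < d)%nat -> pr p i = - phi i (r p)) by (intros i Hi; rewrite <- Hp by auto; reflexivity).
  assert (Pt : forall i, (i < d)%nat -> phi i (target d cv b p) = phi i cv + pr p i).
  { intros i Hi. unfold target. rewrite <- (lsum_delta d i (pr p) Hi).
    assert (HL : forall j, In j (seq 0 d) -> (j < d)%nat) by (intros j Hj; apply in_seq in Hj; lia). revert HL.
    generalize (seq 0 d). intros L. induction L as [|j L IH]; intros HL.
    - replace (cadd cv (comb [] (pr p) b)) with cv by (apply coef_ext; intros; unfold cadd, comb; simpl; unfold czero; ring). unfold lsum. simpl. ring.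
    - assert (Hj : (j < d)%nat) by (apply HL; simpl; auto). assert (HL' : forall a, In a L -> (a < d)%nat) by (intros; apply HL; simpl; auto).
      replace (cadd cv (comb (j :: L) (pr p) b)) with (cadd (cadd cv (comb L (pr p) b)) (cscl (pr p j) (b j))) by (rewrite comb_cons; coef_ring).
      rewrite Lphi, IH; auto.
      + unfold phi at 2. rewrite DPi by auto. unfold lsum. cbn [map fold_right]. ring.
      + apply adm_cadd; auto. apply adm_comb. auto. }
  assert (Ew : forall i, (i < d)%nat -> phi i (w p) = phi i cv).
  { intros i Hi. replace (w p) with (cadd (target d cv b p) (cscl 1 (r p))) by (apply coef_ext; intros; unfold r, cadd, csb, cscl; ring).
    rewrite Lphi, Pt, Ep by auto. ring. }
  assert (Ppi : pi (synth (w p)) = pi v).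
  { rewrite <- Ev. rewrite (RPi (w p)), (RPi cv) by auto. f_equal. apply comb_ext. intros i Hi. apply in_seq in Hi. split; auto. apply Ew. lia. }
  assert (Dw : dinf (synth (w p)) v < eps).
  { rewrite <- Ev. apply HS; auto. apply (sob_mono m1 m); [unfold m; lia|].
    replace (csb (w p) cv) with (cadd (r p) (comb (seq 0 d) (pr p) b)) by (apply coef_ext; intros; unfold r, target, cadd, csb; ring).
    apply (sob_le _ _ (del + INR (length (seq 0 d)) * (C * del * B))).
    - apply sob_add; [apply Fw1|]. apply sob_comb; auto. intros j Hj. apply in_seq in Hj. split; [|apply HB; lia]. rewrite Ep, Rabs_Ropp by lia. apply Br.
    - rewrite length_seq. replace (INR d * (C * del * B)) with (INR d * C * B * del) by ring. lra. }
  assert (Rt : reach Zs gc c0 (w p) t).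
  { apply (reach_eq _ _ _ _ (INR n * s + s)); [|eapply reach_trans; eauto]. unfold s. rewrite S_INR in *. field. lra. }
  destruct (reach_segments Zs gc c0 (w p) t Ag Rt) as (k & h & tau & U & H1 & H2 & H3 & H4 & H5 & H6).
  assert (Hk : (1 <= k)%nat).
  { destruct k; [|lia]. unfold lsum in H4. simpl in H4. lra. }
  exists k, h, tau, U. split; auto. rewrite Eg in H1. rewrite E0 in H2. split; [exact H1|].
  split; [intros y; now rewrite H2 by lia|]. split; [intros i y Hi; now rewrite H3|]. split.
  - rewrite <- H4. destruct k as [|k]; [lia|]. replace (S k - 1)%nat with k by lia. clear.
    induction k as [|k IH]; [unfold lsum; simpl; ring|]. cbn [sum_f_R0]. rewrite IH, (seq_S (S k)), lsum_app. cbn [Nat.add]. unfold lsum at 3. cbn [map fold_right]. ring.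
  - rewrite H6 by lia. split; auto. intros y. now rewrite Ppi.
Qed.
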